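(* Let $(X,\{g,J\})$ be a connected Kähler manifold with $\dim_{\mathbb{R}}X=2n\geq 4$. Then either one of the following holds: (i) There exists a Hermitian manifold $(X,\{h,J\})$ with the Hermitian metric $h$ conformal to the Kähler metric $g$ and $\mathrm{Conf}(X,\{g,J\})=\mathrm{Iso}(X,\{h,J\})$. (ii) $X$ is holomorphically isometric to $\mathbb{C}^n$. In this case, $$\left(\mathrm{Iso}(X,\{g,J\}),\mathrm{Conf}(X,\{g,J\})\right)=\left(\mathbb{C}^n\rtimes\mathrm{U}(n),\ \mathbb{C}^n\rtimes(\mathrm{U}(n)\times\mathbb{R}^{>0})\right).$$
   Context: $J$ is the complex structure of $X$ and $g$ the Kähler metric. For a Hermitian metric $h$ on $(X,J)$, $\mathrm{Iso}(X,\{h,J\})$ denotes the group of holomorphic isometries of $h$, and $\mathrm{Conf}(X,\{h,J\})$ the holomorphic conformal group, i.e. the group of biholomorphic diffeomorphisms $\alpha$ of $(X,J)$ with $\alpha^*h=f\cdot h$ for some $f\in C^\infty(X,\mathbb{R}^{>0})$. $\mathbb{C}^n$ carries its standard flat Kähler metric. $h$ is conformal to $g$ if $h=v\cdot g$ for some $v\in C^\infty(X,\mathbb{R}^{>0})$. *)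

(* Defs.v *)
From HB Require Import structures.
From mathcomp Require Import all_boot all_order all_algebra.
From mathcomp Require Import complex ring.
From mathcomp Require Import all_classical all_reals all_analysis.
Set Implicit Arguments.
Unset Strict Implicit.
Unset Printing Implicit Defensive.
Import Order.TTheory GRing.Theory Num.Theory numFieldNormedType.Exports.
Local Open Scope classical_set_scope.
Local Open Scope ring_scope.
Local Open Scope complex_scope.

(** [R[i]^o] is [R[i]] seen as a normed module over itself, so that ['d f z]
    and [differentiable f z] on [Cn R n] are complex differentials. *)
Notation Cn R n := ('cV[R[i]^o]_n).

Section smooth.
Context {R : realType} {n : nat}.
Implicit Types (f : Cn R n -> R) (v z : Cn R n) (U : set (Cn R n)).

Definition line f z v (t : R) : R := f (z + t%:C *: v).

(** The derivative of [f] at [z] in the real direction [v]. *)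
Definition dirder f v z : R := derive1 (line f z v) 0.

Fixpoint Ck k U f : Prop :=
  (forall z, U z -> {for z, continuous f}) /\
  if k is k'.+1 then
    forall v, (forall z, U z -> derivable (line f z v) 0 1) /\
              Ck k' U (dirder f v)
  else True.

(** Real smoothness on an open set [U] of C^n = R^2n. *)
Definition smooth_on U f := forall k, Ck k U f.

End smooth.

(** A complex manifold of complex dimension [n]: charts [chart c] with values
    in C^n, defined on [dom c], and holomorphic transition maps.  Charts and
    their inverses are total functions, only meaningful on [dom c] and on
    [chart c @` dom c].  The tangent space at [x] is C^n in each chart, vectors
    being related by the differentials of the transition maps, and the complex
    structure [J] is the multiplication by ['i] in any chart. *)
Record complexManifold (R : realType) (n : nat) := ComplexManifold {
  cm_space :> topologicalType;
  cm_index : Type;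
  dom : cm_index -> set cm_space;
  chart : cm_index -> cm_space -> Cn R n;
  chart_inv : cm_index -> Cn R n -> cm_space;
  cm_hausdorff : hausdorff_space cm_space;
  cm_second_countable : @second_countable cm_space;
  cm_cover : forall x, exists c, dom c x;
  cm_dom_open : forall c, open (dom c);
  cm_image_open : forall c, open (chart c @` dom c);
  cm_chartK : forall c x, dom c x -> chart_inv c (chart c x) = x;
  cm_chart_continuous : forall c x, dom c x -> {for x, continuous (chart c)};
  cm_inv_continuous : forall c z, (chart c @` dom c) z ->
    {for z, continuous (chart_inv c)};
  cm_holomorphic : forall c d x, dom c x -> dom d x ->
    differentiable (chart d \o chart_inv c) (chart c x)
}.
Arguments cm_index {R n} _.
Arguments dom {R n c0} c _ : rename.
Arguments chart {R n c0} c _ : rename.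
Arguments chart_inv {R n c0} c _ : rename.

Section maps.
Context {R : realType} {n : nat}.
Implicit Types X Y : complexManifold R n.

Definition smooth_fun X (u : X -> R) :=
  forall c : cm_index X, smooth_on (chart c @` dom c) (u \o chart_inv c).

Definition local_rep X Y (f : X -> Y) (c : cm_index X) (d : cm_index Y) :
    Cn R n -> Cn R n :=
  chart d \o f \o chart_inv c.

Definition holomorphic X Y (f : X -> Y) :=
  continuous f /\
  forall c d x, dom c x -> dom d (f x) ->
    differentiable (local_rep f c d) (chart c x).

Definition biholomorphic X Y (f : X -> Y) :=
  holomorphic f /\
  exists f' : Y -> X, [/\ cancel f f', cancel f' f & holomorphic f'].

End maps.

(** A Hermitian metric, i.e. a [J]-invariant Riemannian metric, given by its
    expression [hm c x] at [x] in each chart [c] around [x]. *)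
Record hermitianMetric (R : realType) (n : nat) (X : complexManifold R n) :=
HermitianMetric {
  hm :> cm_index X -> X -> Cn R n -> Cn R n -> R;
  hm_compat : forall c d x, dom c x -> dom d x -> forall v w,
    hm d x ('d (chart d \o chart_inv c) (chart c x) v)
           ('d (chart d \o chart_inv c) (chart c x) w) = hm c x v w;
  hm_linear : forall c x, dom c x -> forall (t : R) u v w,
    hm c x (t%:C *: u + v) w = t * hm c x u w + hm c x v w;
  hm_sym : forall c x, dom c x -> forall v w, hm c x v w = hm c x w v;
  hm_pos : forall c x, dom c x -> forall v, v != 0 -> 0 < hm c x v v;
  hm_J : forall c x, dom c x -> forall v w,
    hm c x ('i *: v) ('i *: w) = hm c x v w;
  hm_smooth : forall c v w,
    smooth_on (chart c @` dom c) (fun z => hm c (chart_inv c z) v w)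
}.

Section metrics.
Context {R : realType} {n : nat}.
Implicit Types X Y : complexManifold R n.

(** The fundamental 2-form, at the point of coordinates [z] in the chart [c]. *)
Definition fund_form X (g : hermitianMetric X) c (v w z : Cn R n) : R :=
  g c (chart_inv c z) ('i *: v) w.

(** The exterior derivative of a 2-form on an open set of C^n, evaluated on
    the constant vector fields [u], [v] and [w], whose brackets vanish. *)
Definition ext_der (omega : Cn R n -> Cn R n -> Cn R n -> R)
    (u v w z : Cn R n) : R :=
  dirder (omega v w) u z - dirder (omega u w) v z + dirder (omega u v) w z.

Definition kaehler X (g : hermitianMetric X) :=
  forall (c : cm_index X) z, (chart c @` dom c) z ->
    forall u v w, ext_der (fund_form g c) u v w z = 0.

(** [f^* h = u . g] for a map [f] and a function [u]. *)
Definition pullback_eq X Y (f : X -> Y) (h : hermitianMetric Y)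
    (u : X -> R) (g : hermitianMetric X) :=
  forall c d x, dom c x -> dom d (f x) -> forall v w,
    h d (f x) ('d (local_rep f c d) (chart c x) v)
              ('d (local_rep f c d) (chart c x) w) = u x * g c x v w.

Definition holo_isometry X Y (g : hermitianMetric X) (h : hermitianMetric Y)
    (f : X -> Y) :=
  biholomorphic f /\ pullback_eq f h (fun=> 1) g.

Definition Iso X (h : hermitianMetric X) : set (X -> X) :=
  [set a | holo_isometry h h a].

Definition Conf X (h : hermitianMetric X) : set (X -> X) :=
  [set a | biholomorphic a /\
     exists u : X -> R,
       [/\ smooth_fun u, forall x, 0 < u x & pullback_eq a h u h]].

Definition conformal_to X (h g : hermitianMetric X) :=
  exists u : X -> R, [/\ smooth_fun u, forall x, 0 < u x &
    forall c x, dom c x -> forall v w, h c x v w = u x * g c x v w].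

End metrics.

Section flat.
Context (R : realType) (n : nat).

Let Q2C (p : rat * rat) : R[i]^o := ratr p.1 +i* ratr p.2.

Let Q2C_dense (z : R[i]^o) (e : R) : 0 < e -> exists p, ball (Q2C p) e%:C z.
Proof.
move=> e0; case: z => a b.
have e2 : 0 < e / 2 by rewrite divr_gt0.
have near_rat (x : R) : exists q : rat, `|x - ratr q| < e / 2.
  have [|q] := @rat_in_itvoo R (x - e / 2) (x + e / 2).
    by rewrite (lt_trans (y := x)) ?ltrDl// gtrBl.
  rewrite in_itv/= => /andP[q1 q2]; exists q.
  by rewrite distrC ltr_distl q1 q2.
have [p Hp] := near_rat a; have [q Hq] := near_rat b.
exists (p, q); rewrite -ball_normE/= distrC.
rewrite [X in `|X|](_ : _ = (a - ratr p)%:C + (b - ratr q)%:C * 'i); last first.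
  by rewrite -[LHS]/((a - ratr p) +i* (b - ratr q)) [LHS]complexE/= mulrC.
apply: le_lt_trans (ler_normD _ _) _.
rewrite normrM !normc_def/= !expr0n/= !add0r !addr0 expr1n sqrtr1 mulr1.
by rewrite !sqrtr_sqr -rmorphD/= ltcR (splitr e) ltrD.
Qed.

Lemma Cn_second_countable : @second_countable (Cn R n).
Proof.
pose B (p : 'cV[rat * rat]_n * nat) : set (Cn R n) :=
  ball (map_mx Q2C p.1 : Cn R n) ((p.2.+1%:R^-1 : R)%:C).
exists (range B).
  exact: card_le_trans (card_image_le _ _) (countableP _).
split=> [_ [p _ <-]|x A]; first exact: ball_open.
rewrite nbhs_ballP => -[[e e'] /=]; rewrite ltcE/= => /andP[/eqP -> e0 eA].
have [k] := ltr_add_invr (divr_gt0 e0 (ltr0n _ 2)); rewrite add0r => ke.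
have k0 : 0 < k.+1%:R^-1 :> R by rewrite invr_gt0 ltr0n.
have /(_ _)/cid := fun i => Q2C_dense (x i 0) k0.
move=> /all_sig[q xq]; pose p : 'cV[rat * rat]_n := \col_i q i.
have Bx : B (p, k) x.
  by split=> [|i j]; [rewrite ltcR|rewrite ord1 !mxE; exact: xq].
exists (B (p, k)); first by split; [exists (p, k)|].
move=> y By; apply: eA.
have : ball x (k.+1%:R^-1%:C + k.+1%:R^-1%:C) y.
  by apply: ball_triangle By; exact: ball_sym.
by apply: le_ball; rewrite -rmorphD/= lecR (splitr e) lerD// ltW.
Qed.

Let image_id_open : open (@id (Cn R n) @` setT).
Proof. by rewrite image_id; exact: openT. Qed.

Let id_continuous (z : Cn R n) : {for z, continuous (@id (Cn R n))}.
Proof. exact: cvg_id. Qed.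

Let id_comp_differentiable (z : Cn R n) : differentiable (@id (Cn R n) \o id) z.
Proof. exact: (@ex_diff _ _ _ _ _ _ _ (is_diff_id z)). Qed.

Definition Cn_manifold : complexManifold R n :=
  @ComplexManifold R n (Cn R n) unit (fun=> setT) (fun=> id) (fun=> id)
    (@norm_hausdorff _ _) Cn_second_countable (fun=> ex_intro _ tt I)
    (fun=> openT) (fun=> image_id_open) (fun _ _ _ => erefl)
    (fun _ x _ => @id_continuous x) (fun _ z _ => @id_continuous z)
    (fun _ _ z _ _ => id_comp_differentiable z).

Definition flat_form (v w : Cn R n) : R :=
  complex.Re (\sum_(j < n) v j 0 * (w j 0)^*%C).

Lemma smooth_cst U (a : R) : smooth_on U (fun _ : Cn R n => a).
Proof.
move=> k; elim: k a => [|k IH] a /=; split=> //;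
  try by move=> z _; exact: (@cst_continuous _ _ a).
move=> v; split=> [z _|]; first exact: (@derivable_cst _ _ _ a).
rewrite (_ : dirder _ v = fun=> 0) //.
by apply/funext => z; rewrite /dirder; exact: (@derive1_cst _ _ a).
Qed.

Let flat_compat (z v w : Cn R n) :
  flat_form ('d (@id (Cn R n) \o id) z v) ('d (@id (Cn R n) \o id) z w) =
  flat_form v w.
Proof. by rewrite (@diff_val _ _ _ _ _ _ _ (is_diff_id z)). Qed.

Let flat_linear (t : R) (u v w : Cn R n) :
  flat_form (t%:C *: u + v) w = t * flat_form u w + flat_form v w.
Proof.
rewrite /flat_form !raddf_sum/= mulr_sumr -big_split/=; apply: eq_bigr => j _.
rewrite !mxE; case: (u j 0) (v j 0) (w j 0) => [a b] [c d] [e f] /=.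
ring.
Qed.

Let flat_sym (v w : Cn R n) : flat_form v w = flat_form w v.
Proof.
rewrite /flat_form !raddf_sum/=; apply: eq_bigr => j _.
case: (v j 0) (w j 0) => [c d] [e f] /=.
ring.
Qed.

Let flat_pos (v : Cn R n) : v != 0 -> 0 < flat_form v v.
Proof.
move=> v0; have /existsP[j vj] : [exists j, v j 0 != 0].
  apply: contraNT v0; rewrite negb_exists => /forallP v0.
  by apply/eqP/colP => j; apply/eqP; rewrite mxE -[_ == _]negbK v0.
rewrite /flat_form raddf_sum/= (bigD1 j)//= ltr_wpDr ?sumr_ge0// => [k _|].
  by case: (v k 0) => a b /=; rewrite mulrN opprK addr_ge0// -expr2 sqr_ge0.
case: (v j 0) vj => a b; rewrite eq_complex/= negb_and mulrN opprK -!expr2.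
by move=> /orP[?|?]; [rewrite ltr_wpDr|rewrite ltr_wpDl];
  rewrite ?sqr_ge0// lt_neqAle sqr_ge0 eq_sym sqrf_eq0 andbT.
Qed.

Let flat_J (v w : Cn R n) : flat_form ('i *: v) ('i *: w) = flat_form v w.
Proof.
rewrite /flat_form !raddf_sum/=; apply: eq_bigr => j _.
rewrite !mxE; case: (v j 0) (w j 0) => [c d] [e f] /=.
ring.
Qed.

Definition Cn_flat : hermitianMetric Cn_manifold :=
  @HermitianMetric R n Cn_manifold (fun _ _ => flat_form)
    (fun _ _ z _ _ => flat_compat z) (fun _ _ _ => flat_linear)
    (fun _ _ _ => flat_sym) (fun _ _ _ => flat_pos) (fun _ _ _ => flat_J)
    (fun _ v w => @smooth_cst _ (flat_form v w)).

End flat.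

(** The semidirect product [V ⋊ H] for an additive action [act] of [H] on [V],
    and its action on [V] by affine maps. *)
Definition sdp_mul (V : zmodType) (H : Type) (mul : H -> H -> H)
    (act : H -> V -> V) (s t : V * H) : V * H :=
  (s.1 + act s.2 t.1, mul s.2 t.2).

Definition sdp_act (V : zmodType) (H : Type) (act : H -> V -> V)
    (s : V * H) (z : V) : V := act s.2 z + s.1.

Section groups.
Context (R : realType) (n : nat).

(** C^n ⋊ U(n) *)
Definition linU (A : 'M[R[i]]_n) (z : Cn R n) : Cn R n := A *m z.

Definition CnU : set (Cn R n * 'M[R[i]]_n) := [set s | s.2 \is unitarymx].

Definition CnU_mul := sdp_mul (@mulmx R[i] n n n) linU.

(** C^n ⋊ (U(n) × R^{>0}) *)
Definition linUR (h : 'M[R[i]]_n * R) (z : Cn R n) : Cn R n :=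
  h.2%:C *: (h.1 *m z).

Definition CnUR : set (Cn R n * ('M[R[i]]_n * R)) :=
  [set s | s.2.1 \is unitarymx /\ 0 < s.2.2].

Definition CnUR_mul :=
  sdp_mul (fun h k : 'M[R[i]]_n * R => (h.1 *m k.1, h.2 * k.2)) linUR.

End groups.

(** [psi] is an isomorphism of the group [G], with multiplication [mul], onto
    the group [H] of transformations of [X]. *)
Definition group_iso (S X : Type) (G : set S) (mul : S -> S -> S)
    (H : set (X -> X)) (psi : S -> X -> X) :=
  set_bij G H psi /\
  forall s t, G s -> G t -> psi (mul s t) = psi s \o psi t.

(* Main.v *)
(** Let [G] be the holomorphic conformal group of [g].  As [n > 1], the fundamental form [omega] is closed and nondegenerate, so [d (u omega) = du /\ omega] vanishes only if [du = 0]: every element [a] of [G] has a constant conformal factor, and [a^* g = (fac a)^2 g].  If all the factors are 1, then [h = g] is a solution of (i).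

    Distances are measured by duality, [d(x, y) <= r] meaning that 1-Lipschitz functions differ by at most [r] at [x] and [y]; no curve is needed, and [a] multiplies the distances by [fac a].

    Suppose that some ball is not relatively compact.  Then the supremum [rho x] of the radii [r] for which the ball at [x] lies in a compact set is finite, and [rho (a x) = fac a * rho x].  Hence [G] acts properly, and the ratios of covering numbers (Haar's construction) converge along an ultrafilter to an invariant functional on [G].  Averaging bump functions [f (a x)] over [G] gives invariant functions, averaging [fac a * f (a x)] gives functions multiplied by [(fac a)^-1].  These averages are smooth because the derivatives of holomorphic maps are controlled by Lipschitz bounds (Cauchy), uniformly in [a].  A partition of unity made of such averages yields a positive smooth [u] with [u (a x) = (fac a)^-1 * u x], and [h = u^2 g] is invariant under [G].

    Suppose that all balls are relatively compact and that some factor is not 1.  Then a contraction [al] in [G] has a fixed point [p].  In linear coordinates [psi] adapted to the metric at [p], its differential [B] is a multiple of a unitary map, and [B^-k psi (al^k x)] converges (Koenigs) to a holomorphic [Phi] with [Phi al = B Phi].  As [al^k] rescales the metric at [x] to the metric near [p], [Phi] is an isometry onto C^n.  Finally a holomorphic similarity of C^n has a bounded differential, which is constant by the Cauchy estimates. *)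
Require Import Defs.
From HB Require Import structures.
From mathcomp Require Import all_boot all_order all_algebra.
From mathcomp Require Import complex ring lra.
From mathcomp Require Import all_classical all_reals all_analysis.
From mathcomp Require Import measurable_realfun.
Set Implicit Arguments.
Unset Strict Implicit.
Unset Printing Implicit Defensive.
Import Order.TTheory GRing.Theory Num.Theory numFieldNormedType.Exports.
Local Open Scope classical_set_scope.
Local Open Scope ring_scope.
Local Open Scope complex_scope.

(** * Real norms and complex derivatives *)

(** A similarity controls only its own first derivatives, whereas smoothness of an average over the
    group asks for bounds of all orders, uniform in the group element. This is why holomorphic
    functions are carried together with a ball and a Lipschitz constant ([lhol]): the Cauchy
    formula, proved here by rotating circle averages, converts the constant into bounds of every
    order on smaller balls. The same estimates serve for the limit of Koenigs and for the rigidity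
    of similarities of C^n.

    The group receives no topology, only the relation [simN] of pointwise closeness of maps and
    inverses. What makes it usable is [rho]: it is 1-Lipschitz and multiplied by [fac a] under [a],
    so that a map moving one point little has a factor near 1, and maps sending a given point into a
    compact set have bounded factors.

    Both kinds of averages occur in the partition of unity. The invariant ones enter the cutoffs,
    which make a countable sum locally finite without disturbing the scaling of its terms; the
    others are these terms. *)

Section real_norm.
Context {R : realType}.

(** Norms over [R[i]] have values in [R[i]], whose order is partial. Passing to the real part once
    and for all puts every estimate in the ordered field [R]. *)
Definition rnorm (V : normedModType R[i]) (x : V) : R := complex.Re `|x|.

Lemma rnormE (V : normedModType R[i]) (x : V) : `|x| = (rnorm x)%:C.
Proof. by rewrite /rnorm RRe_real// normr_real. Qed.

Section generic.
Context {V : normedModType R[i]}.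
Implicit Types x y : V.

Lemma rnorm_ge0 x : 0 <= rnorm x.
Proof. by rewrite -lecR -rnormE normr_ge0. Qed.

Lemma rnormD x y : rnorm (x + y) <= rnorm x + rnorm y.
Proof. by rewrite -lecR rmorphD/= -!rnormE ler_normD. Qed.

Lemma rnormN x : rnorm (- x) = rnorm x.
Proof. by rewrite /rnorm normrN. Qed.

Lemma rnormB x y : rnorm (x - y) = rnorm (y - x).
Proof. by rewrite -rnormN opprB. Qed.

Lemma rnorm0 : rnorm (0 : V) = 0.
Proof. by rewrite /rnorm normr0. Qed.

Lemma rnorm_eq0 x : rnorm x = 0 -> x = 0.
Proof. by move=> x0; apply/eqP; rewrite -normr_eq0 rnormE x0. Qed.

Lemma rnorm_gt0 x : x != 0 -> 0 < rnorm x.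
Proof. by move=> x0; rewrite -ltcR -rnormE normr_gt0. Qed.

Lemma rnormZ (a : R[i]) x : rnorm (a *: x) = rnorm (a : R[i]^o) * rnorm x.
Proof. by apply/complexI; rewrite rmorphM/= -!rnormE normrZ. Qed.

Lemma rnormZr (t : R) x : rnorm (t%:C *: x) = `|t| * rnorm x.
Proof. by rewrite rnormZ /rnorm normc_def/= expr0n/= addr0 sqrtr_sqr. Qed.

Lemma rnormB_le x y z : rnorm (x - z) <= rnorm (x - y) + rnorm (y - z).
Proof. by rewrite (le_trans _ (rnormD _ _))// addrA subrK. Qed.

Lemma ler_rnormB x y : rnorm x - rnorm y <= rnorm (x - y).
Proof. by rewrite lerBlDr (le_trans _ (rnormD _ _))// subrK. Qed.

Lemma nbhs_rnormP x (A : set V) :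
  nbhs x A <-> exists2 r : R, 0 < r & forall y, rnorm (y - x) < r -> A y.
Proof.
rewrite nbhs_ballP; split.
  (* A positive element of [R[i]] has imaginary part 0, so the radius of the ball is already
     real. *)
  move=> [[e e'] /=]; rewrite ltcE/= => /andP[/eqP -> e0] eA.
  exists e => // y yx; apply: eA; rewrite -ball_normE/= distrC rnormE.
  by rewrite ltcR.
move=> [r r0 rA]; exists r%:C => /=; first by rewrite ltcR.
by move=> y; rewrite -ball_normE/= distrC rnormE ltcR; exact: rA.
Qed.

Lemma open_rnormP (U : set V) : open U <->
  forall x, U x -> exists2 r : R, 0 < r & forall y, rnorm (y - x) < r -> U y.
Proof.
by rewrite openE; split=> oU x /oU /nbhs_rnormP.
Qed.

End generic.

Lemma rnormM (a x : R[i]^o) : rnorm (a * x : R[i]^o) = rnorm a * rnorm x.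
Proof. exact: rnormZ. Qed.

Lemma rnorm_sqrt (x : R[i]^o) :
  rnorm x = Num.sqrt (complex.Re x ^+ 2 + complex.Im x ^+ 2).
Proof. by rewrite /rnorm normc_def. Qed.

Lemma rnorm_real (t : R) : rnorm (t%:C : R[i]^o) = `|t|.
Proof. by rewrite rnorm_sqrt/= expr0n/= addr0 sqrtr_sqr. Qed.

Lemma Re_le_rnorm (x : R[i]^o) : `|complex.Re x| <= rnorm x.
Proof.
case: x => a b /=; rewrite rnorm_sqrt/= -sqrtr_sqr ler_wsqrtr//.
by rewrite lerDl sqr_ge0.
Qed.

Lemma Im_le_rnorm (x : R[i]^o) : `|complex.Im x| <= rnorm x.
Proof.
case: x => a b /=; rewrite rnorm_sqrt/= -sqrtr_sqr ler_wsqrtr//.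
by rewrite lerDr sqr_ge0.
Qed.

Lemma rnorm_ReIm (x : R[i]^o) : rnorm x <= `|complex.Re x| + `|complex.Im x|.
Proof.
rewrite rnorm_sqrt; case: x => a b /=.
rewrite -[leRHS]ger0_norm ?addr_ge0// -sqrtr_sqr ler_wsqrtr//.
rewrite sqrrD !real_normK ?num_real// addrAC.
by rewrite lerDl mulrn_wge0// mulr_ge0.
Qed.

Section vectors.
Context {n : nat}.
Implicit Types v : Cn R n.

Lemma coord_le_rnorm v i : rnorm (v i 0 : R[i]^o) <= rnorm v.
Proof.
rewrite -lecR -!rnormE [leRHS]/Num.norm/= mx_normE.
rewrite -[leLHS]nngE num_le.
exact: (@le_bigmax _ _ _ _ (fun ij => `|v ij.1 ij.2|%:nng) (i, ord0)).
Qed.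

Lemma rnorm_le_coord v (r : R) : 0 <= r ->
  (forall i, rnorm (v i 0 : R[i]^o) <= r) -> rnorm v <= r.
Proof.
move=> r0 vr; rewrite -lecR -rnormE [leLHS]/Num.norm/= mx_normE.
have rC0 : 0 <= r%:C :> R[i] by rewrite lecR.
rewrite -[leRHS]/((NngNum rC0)%:num) num_le; apply/bigmax_leP; split=> //=.
move=> [i j] _; rewrite -num_le/= rnormE lecR ord1; exact: vr.
Qed.

End vectors.

End real_norm.

Section complex_derivative.
Context {R : realType}.
Local Notation C := (R[i]^o).

(** [L] is the complex differential of [f] at [z]; unlike ['d f z], it is a relation,
    with real bounds. *)
Definition cder (V W : normedModType R[i]) (f : V -> W) (z : V) (L : V -> W) :=
  linear L /\ forall e : R, 0 < e -> exists2 d : R, 0 < d &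
    forall h, rnorm h < d -> rnorm (f (z + h) - f z - L h) <= e * rnorm h.

Section linear_facts.
Context {V W : normedModType R[i]} (L : V -> W) (lL : linear L).

Lemma lin0 : L 0 = 0.
Proof.
by have := lL (-1) 0 0; rewrite scaler0 addr0 scaleN1r addNr.
Qed.
Lemma linD u v : L (u + v) = L u + L v.
Proof. by have := lL 1 u v; rewrite !scale1r. Qed.
Lemma linZ a u : L (a *: u) = a *: L u.
Proof. by have := lL a u 0; rewrite !addr0 lin0 addr0. Qed.
Lemma linB u v : L (u - v) = L u - L v.
Proof. by rewrite -scaleN1r linD linZ scaleN1r. Qed.
End linear_facts.

Lemma lin_sum (V W : normedModType R[i]) (L : V -> W) (lL : linear L) m
  (f : 'I_m -> V) : L (\sum_i f i) = \sum_i L (f i).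
Proof.
elim/big_rec2: _ => [|i x y _ <-]; first exact: lin0.
by rewrite linD.
Qed.

Lemma lin_bounded n (W : normedModType R[i]) (L : Cn R n -> W) : linear L ->
  exists2 k : R, 0 < k & forall h, rnorm (L h) <= k * rnorm h.
Proof.
move=> lL; exists (1 + \sum_i rnorm (L (delta_mx i 0))).
  by rewrite ltr_wpDr// sumr_ge0// => i _; exact: rnorm_ge0.
move=> h; have -> : h = \sum_i h i 0 *: (delta_mx i 0 : Cn R n).
  rewrite {1}[h]matrix_sum_delta; apply: eq_bigr => i _.
  by rewrite big_ord1.
rewrite (lin_sum lL); set s := \sum_i _ *: delta_mx _ _.
have le_sum (m : nat) (F : 'I_m -> W) : rnorm (\sum_i F i) <= \sum_i rnorm (F i).
  elim/big_ind2 : _ => // [|x a y b xa yb]; first by rewrite rnorm0.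
  by rewrite (le_trans (rnormD _ _))// lerD.
apply: le_trans (le_sum _ _) _; rewrite mulrDl mul1r mulr_suml.
have hs : h = s.
  rewrite {1}[h]matrix_sum_delta; apply: eq_bigr => i _.
  by rewrite big_ord1.
rewrite -hs ler_wpDl ?rnorm_ge0// ler_sum// => i _.
rewrite linZ// rnormZ mulrC ler_wpM2l ?rnorm_ge0//.
exact: coord_le_rnorm.
Qed.

Lemma lin_continuous n (W : normedModType R[i]) (L : Cn R n -> W) : linear L ->
  continuous L.
Proof.
move=> lL z; have [k k0 kL] := lin_bounded lL.
move=> A /nbhs_rnormP[r r0 rA]; apply/nbhs_rnormP; exists (r / k).
  by rewrite divr_gt0.
move=> y yz; apply: rA; rewrite -linB// (le_lt_trans (kL _))//.
by rewrite mulrC -ltr_pdivlMr.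
Qed.

Lemma differentiable_cder (V W : normedModType R[i]) (f : V -> W) z :
  differentiable f z -> cder f z ('d f z).
Proof.
move=> df; split; first exact: linearP.
move=> e e0; have /diff_locallyP[_] := df.
move=> /eqaddoP /(_ e%:C); rewrite ltcR => /(_ e0).
move=> /nbhs_rnormP[d d0 dP]; exists d => // h hd.
have := dP h; rewrite subr0 => /(_ hd) /=.
rewrite !fctE/= !rnormE -rmorphM/= lecR.
by rewrite opprD addrA (addrC h z).
Qed.

(** [differentiable] asks for a continuous differential, which [cder] does not mention; linear maps
    on [Cn R n] are continuous. *)
Lemma cder_differentiable n (W : normedModType R[i]) (f : Cn R n -> W) z L :
  cder f z L -> differentiable f z /\ ('d f z : Cn R n -> W) = L.
Proof.
move=> [lL fL].
pose L' : {linear Cn R n -> W} := HB.pack L (GRing.isLinear.Build _ _ _ _ L lL).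
have cL : continuous L' by exact: lin_continuous.
have fo : f \o shift z = cst (f z) + L' +o_ 0 id.
  apply/eqaddoP => e e0.
  have eE : e = (complex.Re e)%:C by rewrite RRe_real// gtr0_real.
  have e0' : 0 < complex.Re e by rewrite -ltcR -eE.
  have [d d0 dP] := fL _ e0'.
  apply/nbhs_rnormP; exists d => // h; rewrite subr0 => hd.
  rewrite !fctE/= !rnormE eE -rmorphM/= lecR opprD addrA (addrC h z).
  exact: dP.
have dL := diff_unique cL fo.
split=> //; apply/diff_locallyP; split; first by rewrite dL.
by rewrite [X in f \o _ = _ + X +o_ _ _]dL.
Qed.

End complex_derivative.

(** * Circle averages and the Cauchy formula *)

Section real_line.
Context {R : realType}.

Lemma is_derive_eps (f : R -> R) (x d : R) :
  (forall e : R, 0 < e -> exists2 r : R, 0 < r & forall t, `|t| < r ->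
    `|f (x + t) - f x - d * t| <= e * `|t|) ->
  is_derive x 1 f d.
Proof.
move=> fd.
have H : h^-1 *: ((f \o shift x) (h *: (1 : R)) - f x) @[h --> (0 : R)^'] --> d.
  apply/cvgrPdist_le => e e0.
  have [r r0 fr] := fd _ e0.
  apply/nbhs_ballP; exists r => //= t; rewrite -ball_normE/= sub0r normrN => tr t0.
  rewrite /= -[_ *: 1]/(t * 1) mulr1 -[t^-1 *: _]/(t^-1 * _) distrC.
  have t0' : 0 < `|t| by rewrite normr_gt0.
  rewrite -(ler_pM2r t0') -normrM mulrBl mulrAC mulVf// mul1r (addrC t).
  exact: fr.
apply: DeriveDef; first by apply/cvg_ex; exists d.
exact/cvg_lim.
Qed.

Lemma is_derive_inv (x : R) : x != 0 -> is_derive x 1 (fun y : R => y^-1) (- x ^- 2).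
Proof.
move=> x0; have xn : 0 < `|x| by rewrite normr_gt0.
apply: is_derive_eps => e e0.
exists (Num.min (`|x| / 2) (e * `|x| ^+ 3 / 2)).
  by rewrite lt_min !divr_gt0//= mulr_gt0// exprn_gt0.
move=> t; rewrite lt_min => /andP[t1 t2].
have xt : `|x| / 2 <= `|x + t|.
  have : `|x| <= `|x + t| + `|t| by rewrite -{1}(addrK t x) ler_normB.
  by lra.
have xt0 : x + t != 0 by rewrite -normr_gt0 (lt_le_trans _ xt)// divr_gt0.
have -> : (x + t)^-1 - x^-1 - - x ^- 2 * t = t ^+ 2 * (x ^- 2 * (x + t)^-1).
  by field; rewrite ?x0 ?xt0.
rewrite !normrM !normfV normrX expr2 -mulrA mulrC ler_wpM2r//.
rewrite -invfM ler_pdivrMr ?mulr_gt0 ?normr_gt0//.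
rewrite (le_trans (ltW t2))// -mulrA ler_pM2l//.
have -> : `|x| ^+ 3 / 2 = `|x| * `|x| * (`|x| / 2) by ring.
by rewrite ler_pM2l ?mulr_gt0.
Qed.

Lemma is_derive_continuous (f : R -> R) (x d : R) :
  is_derive x 1 f d -> {for x, continuous f}.
Proof. by move=> fd; apply/differentiable_continuous/derivable1_diffP. Qed.

Lemma is_derive_within (f df : R -> R) (a b : R) :
  (forall x, a <= x <= b -> is_derive x 1 f (df x)) ->
  {within `[a, b], continuous f}.
Proof.
move=> fd; apply/continuous_in_subspaceT => x.
rewrite inE/= in_itv/= => /fd; exact: is_derive_continuous.
Qed.

Lemma is_derive_bound (f df : R -> R) (a b M : R) : a <= b ->
  (forall x, a <= x <= b -> is_derive x 1 f (df x)) ->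
  (forall x, a <= x <= b -> `|df x| <= M) -> `|f b - f a| <= M * (b - a).
Proof.
move=> ab fd dM.
have [||c] := @MVT_segment R f df a b ab.
- move=> x; rewrite in_itv/= => /andP[ax xb]; apply: fd.
  by rewrite !ltW.
- exact: is_derive_within.
rewrite in_itv/= => /dM cM ->.
by rewrite normrM (ger0_norm (_ : 0 <= b - a)) ?subr_ge0// ler_wpM2r ?subr_ge0.
Qed.

Lemma is_derive_0_eq (f : R -> R) (a b : R) : a <= b ->
  (forall x, a <= x <= b -> is_derive x 1 f 0) -> f b = f a.
Proof.
move=> ab fd; apply/eqP; rewrite -subr_eq0 -normr_le0.
have := @is_derive_bound f (fun=> 0) a b 0 ab fd.
by rewrite mul0r; apply => x _; rewrite normr0.
Qed.

Lemma cvgn_eps (u : R^nat) (l : R) :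
  (forall e, 0 < e -> exists N, forall k, (N <= k)%N -> `|l - u k| <= e) ->
  u @ \oo --> l.
Proof.
move=> H; apply/cvgrPdist_le => e e0; have [N NP] := H _ e0.
by exists N => // k /= /NP.
Qed.

Lemma eps_cvgn (u : R^nat) (l : R) : u @ \oo --> l ->
  forall e, 0 < e -> exists N, forall k, (N <= k)%N -> `|l - u k| <= e.
Proof.
by move=> /cvgrPdist_le H e /H[N _ NP]; exists N => k /NP.
Qed.

End real_line.

Section circle_average.
Context {R : realType}.
Local Notation mu := (@lebesgue_measure R).
Local Notation T := (@pi R *+ 2).
Implicit Types p q : R -> R.

Definition avg p : R := T^-1 * (\int[mu]_(t in `[0%R, T]) p t)%R.

(** Continuity would not survive the pointwise limits of difference quotients taken under the
    average; measurability and a uniform bound do. *)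
Definition bounded_measurable p :=
  measurable_fun setT p /\ exists M : R, forall t, `|p t| <= M.

Let T_gt0 : 0 < T. Proof. by rewrite mulrn_wgt0// pi_gt0. Qed.

Let muT : mu `[0, T] = T%:E.
Proof.
by rewrite lebesgue_measure_itv/= lte_fin T_gt0 oppr0 adde0.
Qed.

Let itg p : bounded_measurable p -> mu.-integrable `[0%R, T] (EFin \o p).
Proof.
move=> [mp [M pM]]; apply: measurable_bounded_integrable => //.
- by rewrite [X in (X < _)%E]muT ltry.
- exact: measurable_funTS.
- exists M; split; first exact: num_real.
  by move=> x Mx y _ /=; rewrite (le_trans (pM y))// ltW.
Qed.

Lemma bm_cst a : bounded_measurable (fun=> a).
Proof. by split; [exact: measurable_cst|exists `|a|]. Qed.

Lemma bmD p q : bounded_measurable p -> bounded_measurable q ->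
  bounded_measurable (fun t => p t + q t).
Proof.
move=> [mp [M pM]] [mq [N qN]]; split; first exact: measurable_funD.
by exists (M + N) => t; rewrite (le_trans (ler_normD _ _))// lerD.
Qed.

Lemma bmM p q : bounded_measurable p -> bounded_measurable q ->
  bounded_measurable (fun t => p t * q t).
Proof.
move=> [mp [M pM]] [mq [N qN]]; split; first exact: measurable_funM.
by exists (M * N) => t; rewrite normrM ler_pM.
Qed.

Lemma bmN p : bounded_measurable p -> bounded_measurable (fun t => - p t).
Proof.
move=> [mp [M pM]]; split; first exact: measurable_funN.
by exists M => t; rewrite normrN.
Qed.

Lemma bm_continuous p (M : R) : continuous p -> (forall t, `|p t| <= M) ->
  bounded_measurable p.
Proof.
by move=> cp pM; split; [exact: continuous_measurable_fun|exists M].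
Qed.

Lemma avgD p q : bounded_measurable p -> bounded_measurable q ->
  avg (fun t => p t + q t) = avg p + avg q.
Proof.
by move=> /itg ip /itg iq; rewrite /avg RintegralD// mulrDr.
Qed.

Lemma avgZ a p : bounded_measurable p -> avg (fun t => a * p t) = a * avg p.
Proof. by move=> /itg ip; rewrite /avg RintegralZl// mulrCA. Qed.

Lemma avgN p : bounded_measurable p -> avg (fun t => - p t) = - avg p.
Proof.
move=> bp; rewrite -mulN1r -avgZ//; congr avg; apply/funext => t.
by rewrite mulN1r.
Qed.

Lemma avgB p q : bounded_measurable p -> bounded_measurable q ->
  avg (fun t => p t - q t) = avg p - avg q.
Proof. by move=> bp bq; rewrite avgD ?avgN//; exact: bmN. Qed.

Lemma avg_cst a : avg (fun=> a) = a.
Proof.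
rewrite /avg Rintegral_cst//= [X in fine X]muT/= mulrCA mulVf ?mulr1//.
by rewrite gt_eqF.
Qed.

Lemma avg_bound p (M : R) : bounded_measurable p ->
  (forall t, `|p t| <= M) -> `|avg p| <= M.
Proof.
move=> bp pM; have ip := itg bp.
have bM := itg (bm_cst M).
rewrite /avg normrM normfV (gtr0_norm T_gt0) mulrC ler_pdivrMr//.
apply: le_trans (le_normr_Rintegral _ ip) _ => //.
rewrite -[X in X * _](avg_cst M) /avg mulrAC mulVf ?gt_eqF// mul1r.
apply: le_Rintegral => //.
by apply: itg; split; [apply: measurableT_comp => //; exact: bp.1|exists M => t; rewrite normr_id].
Qed.

Lemma avg_cvg (p_ : nat -> R -> R) p (M : R) :
  (forall k, measurable_fun setT (p_ k)) ->
  (forall k t, `|p_ k t| <= M) -> (forall t, p_ ^~ t @ \oo --> p t) ->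
  bounded_measurable p /\ (avg (p_ k) @[k --> \oo] --> avg p).
Proof.
move=> mp pM pp.
have bp : bounded_measurable p.
  split.
    apply/measurable_EFinP.
    apply: (emeasurable_fun_cvg (fun k t => (p_ k t)%:E)) => //.
      by move=> k; exact/measurable_EFinP.
    by move=> t _; exact/cvg_EFin/pp/nearW.
  exists M => t; apply/ler_addgt0Pr => e e0.
  have [N /(_ N (leqnn _)) NP] := eps_cvgn (pp t) e0.
  rewrite -[p t](subrK (p_ N t)) (le_trans (ler_normD _ _))// addrC lerD//.
split=> //; have ip := itg bp.
have bM := itg (bm_cst M).
have bk k : bounded_measurable (p_ k) by split=> //; exists M.
apply: cvgMr; apply: fine_cvg.
rewrite fineK; last exact: integrable_fin_num.
apply: (@dominated_cvg _ _ _ mu _ _ (fun k t => (p_ k t)%:E) _ (EFin \o fun=> M)) => //=.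
- by move=> k; exact: (measurable_int mu (itg (bk k))).
- by move=> t _; apply: cvg_EFin; [exact: nearW|exact: pp].
- by move=> k t _; rewrite lee_fin.
Qed.

(** The integral over [[h, h + T]] has derivative [p (h + T) - p h = 0] in [h], by the fundamental
    theorem of calculus. *)
Lemma avg_shift p (h : R) : continuous p -> (forall t, p (t + T) = p t) ->
  0 <= h -> avg (fun t => p (t + h)) = avg p.
Proof.
move=> cp pT h0.
have ab_int a b : mu.-integrable `[a, b] (EFin \o p).
  by apply: continuous_compact_integrable; [exact: segment_compact|exact: continuous_subspaceT].
(* The primitive starts at -1 so as to be differentiable, on both sides, at the endpoint 0. *)
have [P dP] : exists P : R -> R, forall x : R, -1 < x -> is_derive x 1 P (p x).
  exists (fun x : R => (\int[mu]_(t in `[-1, x]) p t)%R) => x x1.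
  have [dx ex] := @continuous_FTC1_closed _ p (-1) x (x + 1) (ltr_pwDr ltr01 (lexx x)) (ab_int _ _) x1 (cp x).
  exact: (DeriveDef dx (etrans (esym (derive1E _ _)) ex)).
have dPh (c x : R) : -1 < x + c -> is_derive x 1 (fun y => P (y + c)) (p (x + c)).
  move=> xc; have d1 := dP _ xc.
  have d2 : is_derive x (1 : R) (fun y => y + c) 1.
    by apply: is_derive_eq; rewrite addr0.
  have := @is_derive1_comp _ P (fun y => y + c) x (p (x + c)) 1 d1 d2.
  by rewrite mulr1.
have intP c : 0 <= c -> (\int[mu]_(t in `[0%R, T]) p (t + c))%R = P (T + c) - P c.
  move=> c0; rewrite /Rintegral (@continuous_FTC2 _ (fun t => p (t + c)) (fun t => P (t + c)) 0 T)//=.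
  - by rewrite add0r.
  - apply: continuous_subspaceT => t; apply: continuous_comp; last exact: cp.
    by apply: continuousD => //; exact: cst_continuous.
  - have dd (t : R) : 0 <= t -> is_derive t (1 : R) (fun t => P (t + c)) (p (t + c)).
      by move=> t0; apply: dPh; rewrite (lt_le_trans (ltrN10 R))// addr_ge0.
    split=> [t||].
    + by rewrite in_itv/= => /andP[/ltW/dd].
    + by apply: cvg_at_right_filter; apply: is_derive_continuous (dd 0 _).
    + by apply: cvg_at_left_filter; apply: is_derive_continuous (dd T _); exact: ltW.
  - move=> t; rewrite in_itv/= => /andP[t0 _].
    rewrite derive1E; have := dPh c t; case=> //.
    by rewrite (lt_le_trans (ltrN10 R))// addr_ge0// ltW.
rewrite /avg intP//; have := intP 0 (lexx _).
under eq_Rintegral do rewrite addr0.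
move=> ->; congr (_ * _).
rewrite addr0.
have : (fun y => P (y + T) - P (y + 0)) h = (fun y => P (y + T) - P (y + 0)) 0.
  apply: (@is_derive_0_eq _ (fun y => P (y + T) - P (y + 0)) 0 h) => // x /andP[x0 xh].
  have x1 c : 0 <= c -> -1 < x + c.
    by move=> c0; rewrite (lt_le_trans (ltrN10 R))// addr_ge0.
  have d1 := dPh _ _ (x1 _ (ltW T_gt0)).
  have d2 := dPh _ _ (x1 _ (lexx 0)).
  by apply: is_derive_eq; rewrite pT addr0 subrr.
by rewrite /= !addr0 !add0r (addrC h).
Qed.

End circle_average.

Section complex_average.
Context {R : realType}.
Local Notation C := (R[i]^o).
Local Notation T := (@pi R *+ 2).
Implicit Types p q : R -> C.

Definition cavg p : C :=
  avg (fun t => complex.Re (p t)) +i* avg (fun t => complex.Im (p t)).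

Definition cbm p := bounded_measurable (fun t => complex.Re (p t)) /\
  bounded_measurable (fun t => complex.Im (p t)).

Lemma cavgD p q : cbm p -> cbm q ->
  cavg (fun t => p t + q t) = cavg p + cavg q.
Proof.
move=> [p1 p2] [q1 q2]; rewrite /cavg.
under [X in avg X +i* _]eq_fun do rewrite raddfD/=.
under [X in _ +i* avg X]eq_fun do rewrite raddfD/=.
by rewrite !avgD.
Qed.

Lemma cavgZ (a : C) p : cbm p -> cavg (fun t => a * p t) = a * cavg p.
Proof.
move=> [p1 p2]; case: a => a b; rewrite /cavg.
have -> : (fun t => complex.Re ((a +i* b) * p t : C)) =
    (fun t => a * complex.Re (p t) - b * complex.Im (p t)).
  by apply/funext => t; case: (p t).
have -> : (fun t => complex.Im ((a +i* b) * p t : C)) =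
    (fun t => a * complex.Im (p t) + b * complex.Re (p t)).
  by apply/funext => t; case: (p t) => x y /=.
have bZ c (r : R -> R) : bounded_measurable r -> bounded_measurable (fun t => c * r t).
  by move=> br; apply: bmM => //; exact: bm_cst.
by rewrite avgB ?avgD ?avgZ//; exact: bZ.
Qed.

Lemma cbm_cst (a : C) : cbm (fun=> a).
Proof. by split; exact: bm_cst. Qed.

Lemma cbmD p q : cbm p -> cbm q -> cbm (fun t => p t + q t).
Proof.
move=> [p1 p2] [q1 q2]; split.
  by under eq_fun do rewrite raddfD/=; exact: bmD.
by under eq_fun do rewrite raddfD/=; exact: bmD.
Qed.

Lemma cbmM p q : cbm p -> cbm q -> cbm (fun t => p t * q t).
Proof.
move=> [p1 p2] [q1 q2]; split.
  have -> : (fun t => complex.Re (p t * q t)) = (fun t => complex.Re (p t) *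
      complex.Re (q t) + - (complex.Im (p t) * complex.Im (q t))).
    by apply/funext => t; case: (p t) => a b; case: (q t).
  by apply: bmD; [exact: bmM|apply: bmN; exact: bmM].
have -> : (fun t => complex.Im (p t * q t)) = (fun t => complex.Re (p t) *
    complex.Im (q t) + complex.Im (p t) * complex.Re (q t)).
  by apply/funext => t; case: (p t) => a b; case: (q t).
by apply: bmD; exact: bmM.
Qed.

Lemma cavg_cst (a : C) : cavg (fun=> a) = a.
Proof. by rewrite /cavg !avg_cst; case: a. Qed.

Lemma cavgB p q : cbm p -> cbm q ->
  cavg (fun t => p t - q t) = cavg p - cavg q.
Proof.
move=> bp bq; rewrite -[in RHS]mulN1r -cavgZ//.
rewrite -cavgD//; last by apply: cbmM => //; exact: cbm_cst.
by congr cavg; apply/funext => t; rewrite mulN1r.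
Qed.

(** Bounding the two components separately costs the factor 2, which reappears in the constants of
    the Cauchy estimates. *)
Lemma cavg_bound p (M : R) : cbm p -> (forall t, rnorm (p t) <= M) ->
  rnorm (cavg p) <= M *+ 2.
Proof.
move=> [p1 p2] pM; rewrite (le_trans (rnorm_ReIm _))//= mulr2n lerD//.
  by apply: avg_bound => // t; rewrite (le_trans (Re_le_rnorm _)).
by apply: avg_bound => // t; rewrite (le_trans (Im_le_rnorm _)).
Qed.

Lemma cavg_dct (p_ : nat -> R -> C) p (M : R) :
  (forall k, cbm (p_ k)) -> (forall k t, rnorm (p_ k t) <= M) ->
  (forall t (e : R), 0 < e -> exists N, forall k, (N <= k)%N ->
    rnorm (p_ k t - p t) <= e) ->
  cbm p /\ forall e : R, 0 < e -> exists N, forall k, (N <= k)%N ->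
    rnorm (cavg (p_ k) - cavg p) <= e.
Proof.
move=> bp pM pp.
have [bRe cRe] : bounded_measurable (fun t => complex.Re (p t)) /\
    avg (fun t => complex.Re (p_ k t)) @[k --> \oo] --> avg (fun t => complex.Re (p t)).
  apply: (@avg_cvg _ _ _ M) => [k|k t|t].
  - exact: (bp k).1.1.
  - by rewrite (le_trans (Re_le_rnorm _)).
  - apply: cvgn_eps => e e0; have [N NP] := pp t _ e0; exists N => k /NP.
    by apply: le_trans; rewrite -raddfB -rnormN opprB Re_le_rnorm.
have [bIm cIm] : bounded_measurable (fun t => complex.Im (p t)) /\
    avg (fun t => complex.Im (p_ k t)) @[k --> \oo] --> avg (fun t => complex.Im (p t)).
  apply: (@avg_cvg _ _ _ M) => [k|k t|t].
  - exact: (bp k).2.1.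
  - by rewrite (le_trans (Im_le_rnorm _)).
  - apply: cvgn_eps => e e0; have [N NP] := pp t _ e0; exists N => k /NP.
    by apply: le_trans; rewrite -raddfB -rnormN opprB Im_le_rnorm.
split=> [//|e e0].
have e20 : 0 < e / 2 by rewrite divr_gt0.
have [N1 N1P] := eps_cvgn cRe e20.
have [N2 N2P] := eps_cvgn cIm e20.
exists (maxn N1 N2) => k; rewrite geq_max => /andP[/N1P k1 /N2P k2].
by rewrite (le_trans (rnorm_ReIm _))//= [leRHS]splitr lerD// distrC.
Qed.

Lemma cbm_continuous p (M : R) :
  (forall t (e : R), 0 < e -> exists2 d : R, 0 < d & forall s, `|s| < d ->
    rnorm (p (t + s) - p t) <= e) ->
  (forall t, rnorm (p t) <= M) ->
  [/\ continuous (fun t => complex.Re (p t)),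
      continuous (fun t => complex.Im (p t)) & cbm p].
Proof.
move=> cp pM.
have cRe : continuous (fun t => complex.Re (p t)).
  move=> t; apply/cvgrPdist_le => e e0; have [d d0 dP] := cp t _ e0.
  exists d => //= s /= std.
  rewrite -raddfB (le_trans (Re_le_rnorm _))// rnormB.
  by have := dP (s - t); rewrite addrCA subrr addr0 distrC; apply.
have cIm : continuous (fun t => complex.Im (p t)).
  move=> t; apply/cvgrPdist_le => e e0; have [d d0 dP] := cp t _ e0.
  exists d => //= s /= std.
  rewrite -raddfB (le_trans (Im_le_rnorm _))// rnormB.
  by have := dP (s - t); rewrite addrCA subrr addr0 distrC; apply.
split=> //; split; apply: (@bm_continuous _ _ M) => // t.
  by rewrite (le_trans (Re_le_rnorm _)).
by rewrite (le_trans (Im_le_rnorm _)).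
Qed.

Lemma cavg_shift p (M h : R) :
  (forall t (e : R), 0 < e -> exists2 d : R, 0 < d & forall s, `|s| < d ->
    rnorm (p (t + s) - p t) <= e) ->
  (forall t, rnorm (p t) <= M) ->
  (forall t, p (t + T) = p t) -> 0 <= h -> cavg (fun t => p (t + h)) = cavg p.
Proof.
move=> cp pM pT h0; have [cRe cIm _] := cbm_continuous cp pM.
by rewrite /cavg (avg_shift cRe)// ?(avg_shift cIm)// => t; rewrite pT.
Qed.

Definition expi (t : R) : C := cos t +i* sin t.

Lemma expiD s t : expi (s + t) = expi s * expi t.
Proof.
rewrite /expi cosD sinD; apply/eqP; rewrite eq_complex/= eqxx/=.
by rewrite addrC.
Qed.

Lemma expi0 : expi 0 = 1.
Proof. by rewrite /expi cos0 sin0. Qed.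

Lemma rnorm_expi t : rnorm (expi t) = 1.
Proof. by rewrite rnorm_sqrt/= cos2Dsin2 sqrtr1. Qed.

Lemma expiNK t : expi t * expi (- t) = 1.
Proof. by rewrite -expiD subrr expi0. Qed.

Lemma expiT t : expi (t + T) = expi t.
Proof. by rewrite /expi cosD2pi sinD2pi. Qed.

Lemma expi_continuous t (e : R) : 0 < e -> exists2 d : R, 0 < d &
  forall s, `|s| < d -> rnorm (expi (t + s) - expi t) <= e.
Proof.
move=> e0; have e20 : 0 < e / 2 by rewrite divr_gt0.
have /cvgrPdist_le/(_ _ e20)/nbhs_ballP[d1 /= d10 d1P] := @continuous_cos R t.
have /cvgrPdist_le/(_ _ e20)/nbhs_ballP[d2 /= d20 d2P] := @continuous_sin R t.
exists (Num.min d1 d2); first by rewrite lt_min d10.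
move=> s; rewrite lt_min => /andP[s1 s2].
rewrite (le_trans (rnorm_ReIm _))//= [leRHS]splitr lerD// distrC.
  by apply: d1P; rewrite -ball_normE/= opprD addrA subrr sub0r normrN.
by apply: d2P; rewrite -ball_normE/= opprD addrA subrr sub0r normrN.
Qed.

(** Small nontrivial rotations will probe a complex derivative in the direction tangent to a
    circle. *)
Lemma expi_small (d : R) : 0 < d -> exists2 h, 0 <= h &
  [/\ h < d & expi h != 1].
Proof.
move=> d0; pose h := Num.min (d / 2) 1.
have h0 : 0 < h by rewrite lt_min divr_gt0//=.
exists h; first exact: ltW.
split; first by rewrite gt_min ltr_pdivrMr// ltr_pMr// ltr1n.
apply/eqP => /(congr1 (@complex.Im R))/= sh.
have : 0 < sin h.
  apply: sin_gt0_pi; rewrite h0/= (le_lt_trans (_ : _ <= 1))//.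
    by rewrite ge_min lexx orbT.
  by rewrite (lt_le_trans _ (pi_ge2 R))// ltr1n.
by rewrite sh ltxx.
Qed.

End complex_average.

(** * Differentiation under a circle average *)

Section differentiation_under_average.
Context {R : realType}.
Local Notation C := (R[i]^o).
Local Notation T := (@pi R *+ 2).

Lemma rnorm_small (V : normedModType R[i]) (h : V) (d : R) : 0 < d ->
  exists N, forall k, (N <= k)%N -> rnorm ((k.+1%:R^-1 : R)%:C *: h) < d.
Proof.
move=> d0; have [N NP] := ltr_add_invr (divr_gt0 d0 (ltr_wpDl (rnorm_ge0 h) ltr01)).
rewrite add0r in NP; exists N => k Nk; rewrite rnormZr ger0_norm//.
have k0 : k.+1%:R^-1 <= N.+1%:R^-1 :> R by rewrite lef_pV2 ?posrE ?ltr0n// ler_nat.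
have := le_lt_trans k0 NP; rewrite ltr_pdivlMr; last exact: ltr_wpDl (rnorm_ge0 h) ltr01.
by apply: le_lt_trans; rewrite ler_wpM2l// lerDl.
Qed.

Lemma cder_lip (V W : normedModType R[i]) (f : V -> W) z L (d k : R) :
  0 < d -> cder f z L ->
  (forall h, rnorm h < d -> rnorm (f (z + h) - f z) <= k * rnorm h) ->
  forall h, rnorm (L h) <= k * rnorm h.
Proof.
move=> d0 [lL fL] fk h.
have [->|h0] := eqVneq h 0; first by rewrite lin0// !rnorm0 mulr0.
have hn : 0 < rnorm h by exact: rnorm_gt0.
rewrite -ler_pdivrMr//; apply/ler_addgt0Pr => e e0.
have [d' d'0 fd'] := fL _ e0.
have dd : 0 < Num.min d d' by rewrite lt_min d0.
have [N /(_ N (leqnn _))] := rnorm_small h dd.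
set s : R := N.+1%:R^-1; have s0 : 0 < s by rewrite invr_gt0 ltr0n.
rewrite lt_min => /andP[/fk h1 /fd' h2].
rewrite ler_pdivrMr//.
have : rnorm (L (s%:C *: h)) <= (k + e) * rnorm (s%:C *: h).
  rewrite mulrDl -[L _](subrK (f (z + s%:C *: h) - f z)).
  by rewrite addrC (le_trans (rnormD _ _))// lerD// rnormB.
by rewrite (linZ lL) !rnormZr gtr0_norm// mulrCA ler_pM2l.
Qed.

(** The Lipschitz bound [L], uniform in [t], dominates the difference quotients. *)
Lemma cavg_cder (V : normedModType R[i]) (F : V -> R -> C) (z : V)
    (G : R -> V -> C) (d0 L : R) : 0 < d0 ->
  (forall h, rnorm h < d0 -> cbm (F (z + h))) ->
  (forall h t, rnorm h < d0 -> rnorm (F (z + h) t - F z t) <= L * rnorm h) ->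
  (forall t, cder (F ^~ t) z (G t)) ->
  cder (fun y => cavg (F y)) z (fun h => cavg (fun t => G t h)) /\
  forall h, cbm (fun t => G t h).
Proof.
move=> d00 bF FL dF.
have GL t h : rnorm (G t h) <= L * rnorm h.
  by apply: (cder_lip d00 (dF t)) => k; exact: FL.
have bFz : cbm (F z) by rewrite -[z]addr0; apply: bF; rewrite rnorm0.
(* [t |-> G t h] is measurable as a pointwise limit of difference quotients. *)
have bG h : cbm (fun t => G t h).
  have [N NP] := rnorm_small h d00.
  pose s k : R := (k + N).+1%:R^-1.
  have s0 k : 0 < s k by rewrite invr_gt0 ltr0n.
  have sd k : rnorm ((s k)%:C *: h) < d0 by apply: NP; exact: leq_addl.
  pose p_ k t : C := ((s k)^-1)%:C * (F (z + (s k)%:C *: h) t - F z t).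
  have [] := @cavg_dct R p_ (fun t => G t h) (L * rnorm h); last by [].
  - move=> k; apply: cbmM; first exact: cbm_cst.
    apply: cbmD; first exact/bF/sd.
    have := cbmM (cbm_cst (-1)) bFz.
    by under eq_fun do rewrite mulN1r.
  - move=> k t; rewrite rnormM rnorm_real normfV gtr0_norm//.
    rewrite mulrC ler_pdivrMr// (le_trans (FL _ _ (sd k)))//.
    by rewrite rnormZr gtr0_norm// mulrCA mulrC.
  - move=> t e e0; have [lG GP] := dF t.
    have e'0 : 0 < e / (1 + rnorm h) by rewrite divr_gt0// ltr_pwDl// rnorm_ge0.
    have [d' d'0 d'P] := GP _ e'0; have [N' N'P] := rnorm_small h d'0.
    exists N' => k N'k; have : rnorm ((s k)%:C *: h) < d'.
      by apply: N'P; rewrite (leq_trans N'k)// leq_addr.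
    move=> /d'P; rewrite (linZ lG) => H.
    have -> : p_ k t - G t h = ((s k)^-1)%:C *: (F (z + (s k)%:C *: h) t - F z t - (s k)%:C *: G t h).
      rewrite scalerBr scalerA -rmorphM/= mulVf ?gt_eqF// scale1r.
      by rewrite /p_.
    rewrite rnormZr normfV gtr0_norm// mulrC ler_pdivrMr// (le_trans H)//.
    rewrite rnormZr gtr0_norm// [leLHS](_ : _ = e * s k * (rnorm h / (1 + rnorm h))); last by ring.
    have hp : 0 < 1 + rnorm h by rewrite ltr_pwDl// rnorm_ge0.
    by rewrite ler_piMr ?mulr_ge0 ?(ltW e0) ?(ltW (s0 k))// ler_pdivrMr// mul1r lerDr.
split=> //; split.
  move=> a u v.
  have -> : (fun t => G t (a *: u + v)) = (fun t => a * G t u + G t v).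
    by apply/funext => t; have [lG _] := dF t; rewrite lG.
  rewrite cavgD//; first by rewrite cavgZ.
  by apply: cbmM => //; exact: cbm_cst.
(* Dominated convergence is about sequences. If the estimate failed, some [h k] tending to 0 would
   violate it, although the remainders divided by [rnorm (h k)] are bounded by [L + L] and tend to 0
   pointwise. *)
move=> e e0; apply: contrapT => H.
have H' : forall k : nat, exists2 h : V,
    rnorm h < Num.min d0 k.+1%:R^-1 & e * rnorm h < rnorm (cavg (F (z + h)) - cavg (F z) - cavg (fun t => G t h)).
  move=> k; apply: contrapT => Hk; apply: H.
  exists (Num.min d0 k.+1%:R^-1); first by rewrite lt_min d00 invr_gt0 ltr0n.
  move=> h hd; rewrite leNgt; apply/negP => he; apply: Hk; by exists h.
have {}H' k := cid2 (H' k).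
pose h k := s2val (H' k).
have hd k : rnorm (h k) < d0 by have := s2valP (H' k); rewrite lt_min => /andP[].
have hk k : rnorm (h k) < k.+1%:R^-1 by have := s2valP (H' k); rewrite lt_min => /andP[].
have he k : e * rnorm (h k) < rnorm (cavg (F (z + h k)) - cavg (F z) - cavg (fun t => G t (h k))) := s2valP' (H' k).
have h0 k : 0 < rnorm (h k).
  rewrite lt_neqAle rnorm_ge0 andbT eq_sym; apply/negP => /eqP/rnorm_eq0 hk0.
  have := he k; rewrite hk0 addr0 subrr sub0r.
  have -> : (fun t => G t 0) = (fun=> 0) by apply/funext => t; have [lG _] := dF t; rewrite lin0.
  by rewrite cavg_cst oppr0 !rnorm0 mulr0 ltxx.
pose p_ k t : C := ((rnorm (h k))^-1)%:C * (F (z + h k) t - F z t - G t (h k)).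
have bN p : cbm p -> cbm (fun t => - p t).
  move=> bp; have := cbmM (cbm_cst (-1)) bp.
  by under eq_fun do rewrite mulN1r.
have bk k : cbm (fun t => F (z + h k) t - F z t).
  by apply: cbmD; [exact/bF/hd|exact: bN].
have bp k : cbm (p_ k).
  by apply: cbmM; [exact: cbm_cst|apply: cbmD; [exact: bk|exact: bN]].
have [] := @cavg_dct R p_ (fun=> 0) (L + L) bp.
- move=> k t; rewrite rnormM rnorm_real normfV gtr0_norm//.
  rewrite mulrC ler_pdivrMr// (le_trans (rnormD _ _))// mulrDl lerD//.
    exact/FL/hd.
  by rewrite rnormN.
- move=> t e' e'0; have [lG GP] := dF t; have [d' d'0 d'P] := GP _ e'0.
  have [N] := ltr_add_invr d'0; rewrite add0r => NP.
  exists N => k Nk; rewrite subr0 rnormM rnorm_real normfV gtr0_norm//.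
  rewrite mulrC ler_pdivrMr// d'P// (lt_trans (hk _))// (le_lt_trans _ NP)//.
  by rewrite lef_pV2 ?posrE ?ltr0n// ler_nat.
move=> _ /(_ _ e0)[N /(_ N (leqnn _))].
rewrite cavg_cst subr0 /p_ cavgZ; last by apply: cbmD => //; exact: bN.
rewrite cavgB// cavgB//; last exact/bF/hd.
rewrite rnormM rnorm_real normfV gtr0_norm// mulrC ler_pdivrMr// leNgt.
by rewrite he.
Qed.

Lemma cder_line (V : normedModType R[i]) (f : V -> C) z L h (t : R) :
  cder f (z + t%:C *: h) L ->
  is_derive t 1 (fun s => complex.Re (f (z + s%:C *: h))) (complex.Re (L h)) /\
  is_derive t 1 (fun s => complex.Im (f (z + s%:C *: h))) (complex.Im (L h)).
Proof.
move=> [lL fL].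
have key (e : R) : 0 < e -> exists2 r : R, 0 < r & forall s, `|s| < r ->
    rnorm (f (z + (t + s)%:C *: h) - f (z + t%:C *: h) - s%:C * L h : C) <= e * `|s|.
  move=> e0; have hp : 0 < 1 + rnorm h by rewrite ltr_pwDl// rnorm_ge0.
  have e'0 : 0 < e / (1 + rnorm h) by rewrite divr_gt0.
  have [d d0 dP] := fL _ e'0.
  exists (d / (1 + rnorm h)); first by rewrite divr_gt0.
  move=> s sd; have := dP (s%:C *: h).
  rewrite rnormZr (linZ lL) => H.
  rewrite rmorphD/= scalerDl addrA.
  apply: le_trans (H _) _.
    rewrite (le_lt_trans (_ : _ <= `|s| * (1 + rnorm h)))//.
      by rewrite ler_wpM2l// lerDr.
    by rewrite -ltr_pdivlMr.
  rewrite mulrAC ler_pdivrMr// -!mulrA ler_pM2l// ler_wpM2l// lerDr//.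
split; apply: is_derive_eps => e e0; have [r r0 rP] := key _ e0; exists r => // s /rP.
  apply: le_trans; apply: le_trans (Re_le_rnorm _).
  rewrite !raddfB/=; case: (L h) => a b /=; rewrite mul0r subr0 (mulrC s)//.
apply: le_trans; apply: le_trans (Im_le_rnorm _).
rewrite !raddfB/=; case: (L h) => a b /=; rewrite mul0r addr0 (mulrC s)//.
Qed.

End differentiation_under_average.

(** * The Cauchy formula for the first derivative *)

Section cauchy.
Context {R : realType}.
Local Notation C := (R[i]^o).
Local Notation T := (@pi R *+ 2).

(** The average [Psi w] of [q (w * expi t) * expi (- t)] satisfies
    [Psi (w * expi th) = expi th * Psi w], because a shift of [t] does not change an average.
    Differentiating in [th] gives [w * Psi' w = Psi w], hence [Psi w / w] is constant on the
    positive real axis; its limit at 0 is [q' 0]. *)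
Lemma cauchy_derivative (q q' : C -> C) (rho L r : R) : 0 < r < rho ->
  (forall w, rnorm w < rho -> cder q w (fun h => q' w * h)) ->
  (forall w w', rnorm w < rho -> rnorm w' < rho ->
    rnorm (q w - q w') <= L * rnorm (w - w')) ->
  cavg (fun t => q (r%:C * expi t) * expi (- t)) = r%:C * q' 0.
Proof.
move=> /andP[r0 rrho] dq qL.
have L0 : 0 <= L.
  have := qL 0 (r%:C); rewrite rnorm0 rnorm_real (gtr0_norm r0) => /(_ (lt_trans r0 rrho) rrho).
  move=> /(le_trans (rnorm_ge0 _)); rewrite sub0r rnormN rnorm_real gtr0_norm//.
  by rewrite pmulr_lge0.
have ne (w : C) t : rnorm (w * expi t : C) = rnorm w.
  by rewrite rnormM rnorm_expi mulr1.
pose F (w : C) t : C := q (w * expi t) * expi (- t).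
pose M : R := rnorm (q 0) + L * rho.
have qM w : rnorm w < rho -> rnorm (q w) <= M.
  move=> wr; rewrite -[q w](subrK (q 0)) addrC (le_trans (rnormD _ _))// lerD2l.
  rewrite (le_trans (qL _ _ _ _))// ?rnorm0 ?(lt_trans r0)//.
  by rewrite subr0 ler_wpM2l// ltW.
have FM w t : rnorm w < rho -> rnorm (F w t) <= M.
  by move=> wr; rewrite rnormM rnorm_expi mulr1 qM// ne.
have Fc w t (e : R) : rnorm w < rho -> 0 < e -> exists2 d : R, 0 < d & forall s, `|s| < d ->
    rnorm (F w (t + s) - F w t) <= e.
  move=> wr e0.
  pose k := M + L * rho + 1.
  have k0 : 0 < k.
    by rewrite ltr_wpDl// !addr_ge0 ?rnorm_ge0// mulr_ge0// ltW// (lt_trans r0).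
  have ek0 : 0 < e / k by rewrite divr_gt0.
  have [d1 d10 d1P] := expi_continuous t ek0.
  have [d2 d20 d2P] := expi_continuous (- t) ek0.
  exists (Num.min d1 d2); first by rewrite lt_min d10.
  move=> s; rewrite lt_min => /andP[s1 s2].
  have -> : F w (t + s) - F w t = q (w * expi (t + s)) * (expi (- (t + s)) - expi (- t)) +
      (q (w * expi (t + s)) - q (w * expi t)) * expi (- t).
    by rewrite /F mulrBr mulrBl addrA subrK.
  rewrite (le_trans (rnormD _ _))// !rnormM rnorm_expi mulr1.
  apply: (@le_trans _ _ (M * (e / k) + L * rho * (e / k))).
    rewrite lerD//.
      by rewrite ler_pM ?rnorm_ge0// ?qM ?ne// opprD d2P// normrN.
    rewrite (le_trans (qL _ _ _ _)) ?ne// -mulrA ler_wpM2l// -mulrBr rnormM.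
    by rewrite ler_pM ?rnorm_ge0 ?(ltW wr)// d1P.
  rewrite -mulrDl mulrA ler_pdivrMr// mulrC ler_wpM2l//; first exact: ltW.
  by rewrite lerDl.
have bF w : rnorm w < rho -> cbm (F w).
  by move=> wr; have [_ _ //] := cbm_continuous (fun t e => Fc w t e wr) (fun t => FM w t wr).
pose Psi w := cavg (F w).
pose D (w h : C) : C := cavg (fun t => q' (w * expi t) * (h * expi t) * expi (- t)).
have dPsi w : rnorm w < rho -> cder Psi w (D w).
  move=> wr; apply: (proj1 (@cavg_cder R C F w _ (rho - rnorm w) L _ _ _ _)).
  - by rewrite subr_gt0.
  - move=> h hw; apply: bF; rewrite (le_lt_trans (rnormD _ _))//.
    by rewrite addrC -ltrBrDr.
  - move=> h t hw; rewrite /F -mulrBl rnormM rnorm_expi mulr1.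
    rewrite (le_trans (qL _ _ _ _)) ?ne//.
      by rewrite (le_lt_trans (rnormD _ _))// addrC -ltrBrDr.
    by rewrite mulrDl addrAC subrr add0r ne.
  - move=> t; have /dq[lq qP] : rnorm (w * expi t : C) < rho by rewrite ne.
    split; first by move=> a u v; rewrite /GRing.scale/=; ring.
    move=> e /qP[d d0 dP]; exists d => // h hd.
    by rewrite /F mulrDl -!mulrBl rnormM rnorm_expi mulr1 -[in leRHS](ne h t) dP ?ne.
have rot (w : C) (th : R) : rnorm w < rho -> 0 <= th -> Psi (w * expi th) = expi th * Psi w.
  move=> wr th0.
  rewrite -[Psi w]/(cavg (F w)) -(@cavg_shift R (F w) M th (fun t e => Fc w t e wr) (fun t => FM w t wr) _ th0); last first.
    by move=> t; rewrite /F expiT -[expi (- (t + T))]expiT opprD subrK.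
  have Fsh t : F w (t + th) = expi (- th) * F (w * expi th) t.
    rewrite /F (_ : w * expi (t + th) = w * expi th * expi t); last first.
      by rewrite expiD; ring.
    by rewrite opprD expiD; ring.
  rewrite -cavgZ; last first.
    have wtr : rnorm (w * expi th : C) < rho by rewrite ne.
    have := cbmM (cbm_cst (expi (- th))) (bF _ wtr); congr cbm.
    by apply/funext => t; rewrite Fsh.
  by congr cavg; apply/funext => t; rewrite Fsh mulrA expiNK mul1r.
have Psi0 : Psi 0 = 0.
  have [th th0 [_ th1]] := expi_small (@ltr01 R).
  have := rot 0 th; rewrite rnorm0 mul0r => /(_ (lt_trans r0 rrho) th0) H.
  have : (expi th - 1) * Psi 0 = 0 by rewrite mulrBl -H mul1r subrr.
  by move=> /eqP; rewrite mulf_eq0 subr_eq0 (negbTE th1)/= => /eqP.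
(* From [s] to [s * expi th], [Psi] changes by [(expi th - 1) * Psi s] exactly and by
   [(expi th - 1) * D s s] to first order; divide by [expi th - 1], which is small but not 0. *)
have DP (s : R) : 0 < s < rho -> D s%:C s%:C = Psi s%:C.
  move=> /andP[s0 sr]; have sr' : rnorm (s%:C : C) < rho by rewrite rnorm_real gtr0_norm.
  have [lD DP] := dPsi _ sr'.
  apply/eqP; rewrite -subr_eq0; apply/eqP/rnorm_eq0/eqP; rewrite eq_le rnorm_ge0 andbT.
  apply/ler_addgt0Pr => e e0; rewrite add0r.
  have e'0 : 0 < e / s by rewrite divr_gt0.
  have [d d0 dP] := DP _ e'0.
  have d1 : 0 < d / s by rewrite divr_gt0.
  have [d2 d20 d2P] := expi_continuous 0 (divr_gt0 d1 (@ltr0n R 2)).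
  have [th th0 [thd th1]] := expi_small d20.
  have := d2P th; rewrite ger0_norm// add0r expi0 => /(_ thd) thd'.
  have := dP (s%:C * (expi th - 1)); rewrite rnormM rnorm_real (gtr0_norm s0).
  have -> : s%:C + s%:C * (expi th - 1) = s%:C * expi th :> C by ring.
  rewrite rot//.
  have -> : D s%:C (s%:C * (expi th - 1)) = (expi th - 1) * D s%:C s%:C.
    by rewrite (mulrC s%:C); exact: (linZ lD (expi th - 1) s%:C).
  have -> : expi th * Psi s%:C - Psi s%:C - (expi th - 1) * D s%:C s%:C =
     (expi th - 1) * (Psi s%:C - D s%:C s%:C) by ring.
  rewrite rnormM => H.
  have eth0 : 0 < rnorm (expi th - 1 : C) by rewrite rnorm_gt0// subr_eq0.
  rewrite rnormB -(ler_pM2l eth0) (le_trans (H _))//; last by rewrite mulrA divfK ?gt_eqF// mulrC.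
  rewrite mulrC -ltr_pdivlMr// (le_lt_trans thd')// ltr_pdivrMr// ltr_pMr// ltr1n//.
(* By [DP], both components of [Psi x / x] have derivative 0 on [[a, r]]. *)
have Psi_const (a : R) : 0 < a <= r -> Psi r%:C = (r / a)%:C * Psi a%:C.
  move=> /andP[a0 ar].
  have dl s : a <= s <= r -> is_derive s 1 (fun x : R => complex.Re (Psi x%:C) / x) 0 /\
      is_derive s 1 (fun x : R => complex.Im (Psi x%:C) / x) 0.
    move=> /andP[as_ sr]; have s0 : 0 < s by exact: lt_le_trans as_.
    have srho : s < rho by exact: le_lt_trans rrho.
    have := @cder_line R C Psi 0 (D s%:C) 1 s; rewrite add0r -[_ *: 1]/(_ * 1) mulr1.
    have srC : rnorm (s%:C : C) < rho by rewrite rnorm_real gtr0_norm.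
    move=> /(_ (dPsi _ srC)) [d1 d2].
    have d1' : is_derive s 1 (fun x : R => complex.Re (Psi x%:C)) (complex.Re (D s%:C 1)).
      by move: d1; under eq_fun do rewrite add0r -[_ *: 1]/(_ * 1) mulr1.
    have d2' : is_derive s 1 (fun x : R => complex.Im (Psi x%:C)) (complex.Im (D s%:C 1)).
      by move: d2; under eq_fun do rewrite add0r -[_ *: 1]/(_ * 1) mulr1.
    have dV : is_derive s 1 (fun x : R => x^-1) (- s ^- 2).
      by apply: is_derive_inv; rewrite gt_eqF.
    have lD : linear (D s%:C) by have [] := dPsi _ srC.
    have eD : Psi s%:C = s%:C * D s%:C 1.
      have := linZ lD s%:C 1; rewrite -[X in D _ X = _]/(s%:C * 1) mulr1 DP ?s0//.
    have eRe : complex.Re (Psi s%:C) = s * complex.Re (D s%:C 1).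
      by rewrite eD; case: (D _ _) => x y /=; rewrite mul0r subr0.
    have eIm : complex.Im (Psi s%:C) = s * complex.Im (D s%:C 1).
      by rewrite eD; case: (D _ _) => x y /=; rewrite mul0r addr0.
    split.
      apply: is_derive_eq (is_deriveM d1' dV) _.
      rewrite -![_ *: _]/(_ * _) eRe; field; exact: lt0r_neq0.
    apply: is_derive_eq (is_deriveM d2' dV) _.
    rewrite -![_ *: _]/(_ * _) eIm; field; exact: lt0r_neq0.
  have e1 : complex.Re (Psi r%:C) / r = complex.Re (Psi a%:C) / a := is_derive_0_eq ar (fun x xar => proj1 (dl x xar)).
  have e2 : complex.Im (Psi r%:C) / r = complex.Im (Psi a%:C) / a := is_derive_0_eq ar (fun x xar => proj2 (dl x xar)).
  have rn0 : r != 0 by rewrite gt_eqF.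
  have an0 : a != 0 by rewrite gt_eqF.
  move: e1 e2; case: (Psi r%:C) => x y; case: (Psi a%:C) => x' y' /= e1 e2.
  apply/eqP; rewrite eq_complex/= !mul0r subr0 addr0; apply/andP; split; apply/eqP.
    by rewrite -[LHS](divfK rn0) e1; ring.
  by rewrite -[LHS](divfK rn0) e2; ring.
apply/eqP; rewrite -subr_eq0; apply/eqP/rnorm_eq0/eqP; rewrite eq_le rnorm_ge0 andbT.
apply/ler_addgt0Pr => e e0; rewrite add0r.
have rho0 : rnorm (0 : C) < rho by rewrite rnorm0 (lt_trans r0).
have [lD DPs] := dPsi _ rho0; have e'0 : 0 < e / r by rewrite divr_gt0.
have [d d0 dP] := DPs _ e'0.
(* Close to 0, [Psi a] equals [a * q' 0] up to [e / r * a]; multiplication by [r / a] turns this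
   error into [e]. *)
pose a := Num.min (d / 2) r.
have a0 : 0 < a by rewrite lt_min r0 divr_gt0.
have ar : a <= r by rewrite ge_min lexx orbT.
have ad : a < d by rewrite gt_min ltr_pdivrMr// ltr_pMr// ltr1n.
have := dP a%:C; rewrite rnorm_real gtr0_norm// => /(_ ad).
rewrite add0r Psi0 subr0.
have -> : D 0 a%:C = a%:C * q' 0.
  rewrite /D; under eq_fun do rewrite mul0r -mulrA -(mulrA a%:C) expiNK mulr1.
  by rewrite cavg_cst mulrC.
move=> H; rewrite -/(Psi _) (Psi_const a) ?a0//.
have -> : (r / a)%:C * Psi a%:C - r%:C * q' 0 = (r / a)%:C * (Psi a%:C - a%:C * q' 0).
  rewrite mulrBr; congr (_ - _); rewrite mulrA -rmorphM/= divfK//.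
  by rewrite gt_eqF.
rewrite rnormM rnorm_real gtr0_norm ?divr_gt0// (le_trans (ler_wpM2l _ H))//.
  by rewrite divr_ge0// ltW.
by rewrite le_eqVlt; apply/orP; left; apply/eqP; field; rewrite !gt_eqF.
Qed.

End cauchy.

(** * Lipschitz holomorphic functions *)

Section holomorphic_lipschitz.
Context {R : realType}.
Local Notation C := (R[i]^o).

Lemma cder_near (V W : normedModType R[i]) (f g : V -> W) z L (r : R) : 0 < r ->
  (forall y, rnorm (y - z) < r -> f y = g y) -> cder f z L -> cder g z L.
Proof.
move=> r0 fg [lL fL]; split=> // e /fL[d d0 dP].
exists (Num.min d r) => [|h]; first by rewrite lt_min d0.
rewrite lt_min => /andP[hd hr]; rewrite -!fg ?dP//.
  by rewrite subrr rnorm0.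
by rewrite addrC addKr.
Qed.

Lemma cderZ (V : normedModType R[i]) (f : V -> C) z L (a : C) :
  cder f z L -> cder (fun y => a * f y) z (fun h => a * L h).
Proof.
move=> [lL fL]; split.
  by move=> b u v; rewrite lL mulrDr /GRing.scale/= mulrCA.
move=> e e0; have a1 : 0 < 1 + rnorm a by rewrite ltr_pwDl// rnorm_ge0.
have [d d0 dP] := fL _ (divr_gt0 e0 a1); exists d => // h /dP H.
rewrite -!mulrBr rnormM (le_trans (ler_wpM2l (rnorm_ge0 _) H))//.
rewrite mulrA ler_wpM2r ?rnorm_ge0// mulrCA ler_piMr ?(ltW e0)//.
by rewrite ler_pdivrMr// mul1r lerDr.
Qed.

Lemma rnorm_MVT (V : normedModType R[i]) (f : V -> C) (z h : V) (M : R) (L : R -> V -> C) :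
  (forall t : R, 0 <= t <= 1 -> cder f (z + t%:C *: h) (L t)) ->
  (forall t : R, 0 <= t <= 1 -> rnorm (L t h) <= M) ->
  rnorm (f (z + h) - f z) <= M *+ 2.
Proof.
move=> df LM; rewrite (le_trans (rnorm_ReIm _))// !raddfB mulr2n.
have e0 : z = z + (0 : R)%:C *: h by rewrite scale0r addr0.
have e1 : z + h = z + (1 : R)%:C *: h by rewrite scale1r.
have -> : f z = f (z + (0 : R)%:C *: h) by rewrite -e0.
rewrite e1 lerD//.
  have := @is_derive_bound _ (fun s => complex.Re (f (z + s%:C *: h))) (fun t => complex.Re (L t h)) 0 1 M ler01.
  rewrite subr0 mulr1; apply.
    by move=> t /df/cder_line[].
  by move=> t /LM; apply: le_trans; exact: Re_le_rnorm.
have := @is_derive_bound _ (fun s => complex.Im (f (z + s%:C *: h))) (fun t => complex.Im (L t h)) 0 1 M ler01.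
rewrite subr0 mulr1; apply.
  by move=> t /df/cder_line[].
by move=> t /LM; apply: le_trans; exact: Im_le_rnorm.
Qed.

Definition rball (V : normedModType R[i]) (z : V) (r : R) : set V :=
  [set y | rnorm (y - z) < r].

Lemma rball_open (V : normedModType R[i]) (z : V) r : open (rball z r).
Proof.
apply/open_rnormP => x xr; exists (r - rnorm (x - z)); first by rewrite subr_gt0.
move=> y yx; rewrite /rball/= (le_lt_trans (rnormB_le _ x _))//.
by rewrite -ltrBrDr.
Qed.

Lemma rball_center (V : normedModType R[i]) (z : V) r : 0 < r -> rball z r z.
Proof. by rewrite /rball/= subrr rnorm0. Qed.

Lemma rball_segment (V : normedModType R[i]) (z0 z h : V) r (t : R) : 0 <= t <= 1 ->
  rball z0 r z -> rball z0 r (z + h) -> rball z0 r (z + t%:C *: h).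
Proof.
move=> /andP[t0 t1]; rewrite /rball/= => zr zhr.
have -> : z + t%:C *: h - z0 = (1 - t)%:C *: (z - z0) + t%:C *: (z + h - z0).
  rewrite rmorphB/= scalerBl scale1r -[z + h - z0]addrAC [t%:C *: (z - z0 + h)]scalerDr addrA subrK.
  by rewrite addrAC.
rewrite (le_lt_trans (rnormD _ _))// !rnormZr !ger0_norm ?subr_ge0//.
have [->|tn0] := eqVneq t 0; first by rewrite subr0 mul1r mul0r addr0.
have tp : 0 < t by rewrite lt_neqAle eq_sym tn0.
rewrite (_ : r = (1 - t) * r + t * r); last by ring.
rewrite ler_ltD//.
  by rewrite ler_wpM2l ?subr_ge0// ltW.
by rewrite ltr_pM2l.
Qed.

Section vectors.
Context {n : nat}.
Local Notation V := (Cn R n).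
Implicit Types (f g : V -> C) (z v w h : V).

(** Besides differentiability, a Lipschitz constant is recorded: it is stable under pointwise
    limits, and all bounds on derivatives are computed from it. *)
Definition lhol z0 (rho L : R) f :=
  (forall z, rball z0 rho z -> differentiable f z) /\
  forall z z', rball z0 rho z -> rball z0 rho z' ->
    rnorm (f z - f z') <= L * rnorm (z - z').

Definition cD f z v : C := locked ('d f z v).

Lemma cder_cD f z L : cder f z L -> cD f z = L.
Proof. by move=> /cder_differentiable[_ <-]; apply/funext => v; rewrite /cD -lock. Qed.

Lemma differentiable_cD f z : differentiable f z -> cder f z (cD f z).
Proof. by move=> /differentiable_cder df; rewrite (cder_cD df). Qed.

Lemma lhol_cder z0 rho L f z : lhol z0 rho L f -> rball z0 rho z ->
  cder f z (cD f z).
Proof. by move=> [df _] /df; exact: differentiable_cD. Qed.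

Lemma lhol_dbound z0 rho L f z v : lhol z0 rho L f -> rball z0 rho z ->
  rnorm (cD f z v) <= L * rnorm v.
Proof.
move=> hf zr; have d0 : 0 < rho - rnorm (z - z0) by rewrite subr_gt0.
apply: (cder_lip d0 (lhol_cder hf zr)) => h hr.
have zhr : rball z0 rho (z + h).
  by rewrite /rball/= addrAC addrC (le_lt_trans (rnormD _ _))// -ltrBrDr.
by have := hf.2 _ _ zhr zr; rewrite [z + h - z]addrAC subrr add0r.
Qed.

Lemma lhol_T z0 rho L f z v (r : R) : lhol z0 rho L f -> 0 < r ->
  rnorm (z - z0) + r * rnorm v < rho ->
  cavg (fun t => f (z + (r%:C * expi t) *: v) * expi (- t)) = r%:C * cD f z v.
Proof.
move=> hf r0 zrv.
(* The Cauchy formula is applied to the slice [w |-> f (z + w *: v)], on a disc of radius larger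
   than [r]; for [v = 0] any larger radius will do. *)
have [rho' rr' r'v] : exists2 rho' : R, r < rho' & rnorm (z - z0) + rho' * rnorm v <= rho.
  have [v0|v0] := eqVneq v 0.
    exists (r + 1); first by rewrite ltrDl.
    by move: zrv; rewrite v0 rnorm0 !mulr0 => /ltW.
  exists ((rho - rnorm (z - z0)) / rnorm v); last by rewrite divfK ?gt_eqF ?rnorm_gt0// addrC subrK.
  by rewrite ltr_pdivlMr ?rnorm_gt0// ltrBrDl.
have inB (w : C) : rnorm w < rho' -> rball z0 rho (z + w *: v).
  move=> wr; rewrite /rball/= addrAC (le_lt_trans (rnormD _ _))// rnormZ.
  have [->|v0] := eqVneq v 0.
    by rewrite rnorm0 mulr0 addr0 (le_lt_trans _ zrv)// lerDl mulr_ge0 ?rnorm_ge0 ?ltW.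
  by rewrite (lt_le_trans _ r'v)// ltrD2l ltr_pM2r// rnorm_gt0.
have := @cauchy_derivative R (fun w : C => f (z + w *: v)) (fun w : C => cD f (z + w *: v) v) rho' (L * rnorm v) r.
rewrite r0 rr' scale0r addr0; apply=> //.
- move=> w wr; have [lD DP] := lhol_cder hf (inB _ wr); split.
    by move=> a x y; rewrite mulrDr /GRing.scale/= mulrCA.
  have v1 : 0 < 1 + rnorm v by rewrite ltr_pwDl// rnorm_ge0.
  move=> e e0; have [d d0 dP] := DP _ (divr_gt0 e0 v1).
  exists (d / (1 + rnorm v)); first by rewrite divr_gt0.
  move=> h hd; have := dP (h *: v); rewrite rnormZ => H.
  have hv : rnorm h * rnorm v < d.
    rewrite (le_lt_trans (_ : _ <= rnorm h * (1 + rnorm v)))//.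
      by rewrite ler_wpM2l ?rnorm_ge0// lerDr.
    by rewrite -ltr_pdivlMr.
  move: (H hv); rewrite (linZ lD) -(addrA z) -scalerDl => H'.
  rewrite mulrC (le_trans H')// mulrCA mulrC ler_wpM2r ?rnorm_ge0//.
  by rewrite mulrAC ler_pdivrMr// ler_pM2l// lerDr.
- move=> w w' wr w'r; rewrite (le_trans (hf.2 _ _ (inB _ wr) (inB _ w'r)))//.
  by rewrite opprD addrACA subrr add0r -scalerBl rnormZ mulrCA mulrC -mulrA mulrCA (mulrC (rnorm v)).
Qed.

Lemma lhol_cbm z0 rho L f z v (r : R) : lhol z0 rho L f -> 0 < r ->
  rnorm (z - z0) + r * rnorm v < rho ->
  cbm (fun t => f (z + (r%:C * expi t) *: v) * expi (- t)).
Proof.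
move=> hf r0 zrv.
have inB t : rball z0 rho (z + (r%:C * expi t) *: v).
  rewrite /rball/= addrAC (le_lt_trans (rnormD _ _))// rnormZ rnormM rnorm_real.
  by rewrite rnorm_expi mulr1 gtr0_norm.
have L0 : 0 <= L * rnorm v.
  have z0r : rball z0 rho z by rewrite /rball/= (le_lt_trans _ zrv)// lerDl mulr_ge0 ?rnorm_ge0// ltW.
  by have := lhol_dbound v hf z0r; apply: le_trans; exact: rnorm_ge0.
apply: cbmM.
  pose k := L * rnorm v * r + 1.
  have k0 : 0 < k by rewrite ltr_wpDl// mulr_ge0// ltW.
  have [|t|//] := @cbm_continuous R (fun t => f (z + (r%:C * expi t) *: v)) (rnorm (f (z + (r%:C * expi 0) *: v)) + 2 * k).
    move=> t e e0; have [d d0 dP] := expi_continuous t (divr_gt0 e0 k0).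
    exists d => // s /dP H; rewrite (le_trans (hf.2 _ _ (inB _) (inB _)))//.
    rewrite opprD addrACA subrr add0r -scalerBl -mulrBr rnormZ rnormM rnorm_real gtr0_norm//.
    have -> : L * (r * rnorm (expi (t + s) - expi t : C) * rnorm v) = L * rnorm v * r * rnorm (expi (t + s) - expi t : C) by ring.
    rewrite (le_trans (ler_wpM2l (mulr_ge0 L0 (ltW r0)) H))//.
    by rewrite mulrCA ler_piMr ?(ltW e0)// ler_pdivrMr// mul1r lerDl.
  rewrite -lerBlDl (le_trans (ler_rnormB _ _))// (le_trans (hf.2 _ _ (inB _) (inB _)))//.
  rewrite opprD addrACA subrr add0r -scalerBl -mulrBr rnormZ rnormM rnorm_real gtr0_norm//.
  have -> : L * (r * rnorm (expi t - expi 0 : C) * rnorm v) = rnorm (expi t - expi 0 : C) * (L * rnorm v * r) by ring.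
  rewrite ler_pM ?rnorm_ge0 ?(mulr_ge0 L0 (ltW r0))// ?lerDl//.
  by rewrite (le_trans (rnormD _ _))// rnormN !rnorm_expi.
have [||//] := @cbm_continuous R (fun t => expi (- t)) 1.
  move=> t e e0; have [d d0 dP] := expi_continuous (- t) e0.
  by exists d => // s sd; rewrite opprD dP// normrN.
by move=> t; rewrite rnorm_expi.
Qed.

(** Circles of half the available radius give one factor 2, [cavg_bound] the other. *)
Definition dlip (rho rho' L : R) : R := 4 * L / (rho - rho').

(* The Cauchy estimate for [f y - f (y + (z - z'))], which is bounded by [L * rnorm (z - z')]. *)
Lemma lhol_Dlip z0 rho rho' L f z z' v : lhol z0 rho L f -> rho' < rho ->
  rball z0 rho' z -> rball z0 rho' z' ->
  rnorm (cD f z v - cD f z' v) <= dlip rho rho' L * rnorm v * rnorm (z - z').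
Proof.
move=> hf rr zr z'r.
have [->|v0] := eqVneq v 0.
  have sub y : rball z0 rho' y -> rball z0 rho y by move=> /lt_trans; apply.
  have [lz _] := lhol_cder hf (sub _ zr); have [lz' _] := lhol_cder hf (sub _ z'r).
  by rewrite (lin0 lz) (lin0 lz') subrr !rnorm0 mulr0 mul0r.
have vn : 0 < rnorm v by rewrite rnorm_gt0.
have rr0 : 0 < rho - rho' by rewrite subr_gt0.
pose r := (rho - rho') / (2 * rnorm v).
have r0 : 0 < r by rewrite divr_gt0// mulr_gt0.
have rv : r * rnorm v < rho - rho'.
  by rewrite /r invfM mulrA divfK ?gt_eqF// ltr_pdivrMr// ltr_pMr// ltr1n.
have bnd y : rball z0 rho' y -> rnorm (y - z0) + r * rnorm v < rho.
  by move=> yr; rewrite -(subrKC rho' rho) ltrD.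
rewrite -(ler_pM2l r0) -[X in X * _](gtr0_norm r0) -rnorm_real -rnormM mulrBr.
have Tz := lhol_T hf r0 (bnd _ zr); have Tz' := lhol_T hf r0 (bnd _ z'r).
have bz := lhol_cbm hf r0 (bnd _ zr); have bz' := lhol_cbm hf r0 (bnd _ z'r).
have -> := congr2 (fun a b : C => a - b) (esym Tz) (esym Tz').
rewrite -cavgB//.
have -> : r * (dlip rho rho' L * rnorm v * rnorm (z - z')) = (L * rnorm (z - z')) *+ 2.
  rewrite /r /dlip mulr2n; field; rewrite (gt_eqF vn)/= (gt_eqF rr0)//.
have inB y t : rball z0 rho' y -> rball z0 rho (y + (r%:C * expi t) *: v).
  move=> yr; rewrite /rball/= addrAC (le_lt_trans (rnormD _ _))// rnormZ rnormM rnorm_real.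
  by rewrite rnorm_expi mulr1 gtr0_norm// bnd.
apply: cavg_bound.
  apply: cbmD => //.
  have := cbmM (cbm_cst (-1)) bz'.
  by congr cbm; apply/funext => t; rewrite mulN1r.
move=> t; rewrite -mulrBl rnormM rnorm_expi mulr1.
rewrite (le_trans (hf.2 _ _ (inB _ _ zr) (inB _ _ z'r)))//.
by rewrite opprD addrACA subrr addr0.
Qed.

(** The Cauchy formula expresses [cD f y v] through values of [f] alone, so that first derivatives
    of [f] suffice to differentiate it: a holomorphic function has a holomorphic derivative. *)
Lemma lhol_dT z0 rho rho' L f z v (r : R) : lhol z0 rho L f ->
  rball z0 rho' z -> 0 < r -> r * rnorm v < rho - rho' ->
  cder (fun y => cD f y v) z (fun h => (r^-1)%:C *
    cavg (fun t => cD f (z + (r%:C * expi t) *: v) h * expi (- t))).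
Proof.
move=> hf zr r0 rv.
pose d0 := rho' - rnorm (z - z0).
have d00 : 0 < d0 by rewrite subr_gt0.
have near_z y : rnorm (y - z) < d0 -> rball z0 rho' y.
  move=> yz; rewrite /rball/= (le_lt_trans (rnormB_le _ z _))//.
  by rewrite -ltrBrDr.
have bnd y : rball z0 rho' y -> rnorm (y - z0) + r * rnorm v < rho.
  by move=> yr; rewrite -(subrKC rho' rho) ltrD.
have inB y t : rball z0 rho' y -> rball z0 rho (y + (r%:C * expi t) *: v).
  move=> yr; rewrite /rball/= addrAC (le_lt_trans (rnormD _ _))// rnormZ rnormM rnorm_real.
  by rewrite rnorm_expi mulr1 gtr0_norm// bnd.
have zh h : rnorm h < d0 -> rball z0 rho' (z + h).
  by move=> hd; apply: near_z; rewrite addrAC subrr add0r.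
have [] := @cavg_cder R V (fun y t => f (y + (r%:C * expi t) *: v) * expi (- t)) z
  (fun t h => cD f (z + (r%:C * expi t) *: v) h * expi (- t)) d0 L d00.
- by move=> h /zh/bnd B; exact: (lhol_cbm hf r0 B).
- move=> h t /zh zhr; rewrite -mulrBl rnormM rnorm_expi mulr1.
  rewrite (le_trans (hf.2 _ _ (inB _ _ zhr) (inB _ _ zr)))//.
  by rewrite opprD addrACA subrr addr0 addrAC subrr add0r.
- move=> t; have dft := lhol_cder hf (inB _ t zr).
  have : cder (fun y => f (y + (r%:C * expi t) *: v)) z (cD f (z + (r%:C * expi t) *: v)).
    move: dft => [lD DP]; split=> // e /DP[d dp dP]; exists d => // h /dP.
    by rewrite (addrAC z h).
  move=> /(cderZ (expi (- t))); congr cder; apply/funext => y; exact: mulrC.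
move=> /(cderZ (r^-1)%:C) H _; apply: (cder_near d00 _ H) => y /near_z yr /=.
rewrite (lhol_T hf r0 (bnd _ yr)) mulrA -rmorphM/= mulVf ?gt_eqF//.
by rewrite [1%:C](_ : _ = 1)// mul1r.
Qed.

Lemma lhol_D z0 rho rho' L f v : lhol z0 rho L f -> rho' < rho ->
  lhol z0 rho' (dlip rho rho' L * rnorm v) (fun z => cD f z v).
Proof.
move=> hf rr; split; last by move=> z z' zr z'r; apply: (lhol_Dlip _ hf).
move=> z zr.
have rr0 : 0 < rho - rho' by rewrite subr_gt0.
have v1 : 0 < 1 + rnorm v by rewrite ltr_pwDl// rnorm_ge0.
have r0 : 0 < (rho - rho') / (1 + rnorm v) by rewrite divr_gt0.
have rv : (rho - rho') / (1 + rnorm v) * rnorm v < rho - rho'.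
  by rewrite mulrAC ltr_pdivrMr// ltr_pM2l// ltrDr.
by have /cder_differentiable[] := lhol_dT hf zr r0 rv.
Qed.

(* [cD f z v] is a circle average of values of [f], so that it can be differentiated under
   the average. *)
Lemma lhol_sym z0 rho L f z v w : lhol z0 rho L f -> rball z0 rho z ->
  cD (fun y => cD f y v) z w = cD (fun y => cD f y w) z v.
Proof.
move=> hf zr.
pose s := (rho - rnorm (z - z0)) / 3.
have s0 : 0 < s by rewrite divr_gt0// subr_gt0.
have er : rho = rnorm (z - z0) + s + s + s.
  by rewrite /s; field.
pose rho' := rnorm (z - z0) + s + s.
have v1 : 0 < 1 + rnorm v by rewrite ltr_pwDl// rnorm_ge0.
pose r := s / (1 + rnorm v).
have r0 : 0 < r by rewrite divr_gt0.
have rv : r * rnorm v < s by rewrite mulrAC ltr_pdivrMr// ltr_pM2l// ltrDr.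
have rr : rho' < rho by rewrite er ltrDl.
have zr' : rball z0 rho' z by rewrite /rball/= /rho' -addrA ltrDl addr_gt0.
have rv' : r * rnorm v < rho - rho' by rewrite er /rho' addrAC subrr add0r.
rewrite (cder_cD (lhol_dT hf zr' r0 rv')).
have hg := lhol_D w hf rr.
have B : rnorm (z - z0) + r * rnorm v < rho' by rewrite /rho' -addrA ltrD2l ltr_wpDl// ltW.
rewrite (lhol_T hg r0 B) mulrA -rmorphM/= mulVf ?gt_eqF//.
by rewrite [1%:C](_ : _ = 1)// mul1r.
Qed.

Lemma lhol_taylor z0 rho rho' L f z h : lhol z0 rho L f -> rho' < rho ->
  rball z0 rho' z -> rball z0 rho' (z + h) ->
  rnorm (f (z + h) - f z - cD f z h) <= (dlip rho rho' L * rnorm h ^+ 2) *+ 2.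
Proof.
move=> hf rr zr zhr.
have sub y : rball z0 rho' y -> rball z0 rho y by move=> /lt_trans; apply.
have [lz _] := lhol_cder hf (sub _ zr).
(* Once the linear part at [z] is removed, the Lipschitz estimate for [cD f] bounds the derivative
   along the segment. *)
pose F y := f y - cD f z y.
have gen2 (a b c d e : C) : a - b - c = a - (e + d) - (b - e) - (c - d) by ring.
have -> : f (z + h) - f z - cD f z h = F (z + h) - F z.
  rewrite /F (linD lz).
  have gen (a b c d : C) : a - b - c = a - (d + c) - (b - d) by ring.
  exact: gen.
have K0 : 0 <= dlip rho rho' L * rnorm h.
  have [->|h0] := eqVneq h 0; first by rewrite rnorm0 mulr0.
  have := lhol_Dlip h hf rr zr zhr; rewrite -rnormB opprD addNKr rnormN => /(le_trans (rnorm_ge0 _)).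
  by rewrite pmulr_lge0// rnorm_gt0.
apply: (@rnorm_MVT _ F z h _ (fun t v => cD f (z + t%:C *: h) v - cD f z v)).
  move=> t /rball_segment/(_ zr zhr)/sub/(lhol_cder hf)[lD DP]; split.
    by move=> a u v; rewrite lD lz scalerBr opprD addrACA.
  move=> e /DP[d d0 dP]; exists d => // k /dP; congr (rnorm _ <= _).
  rewrite /F (linD lz _ k).
  exact: gen2.
move=> t t01; have tr := rball_segment t01 zr zhr.
rewrite (le_trans (lhol_Dlip h hf rr tr zr))//.
rewrite addrAC subrr add0r rnormZr expr2 mulrA ler_wpM2l//.
by case/andP: t01 => t0 t1; rewrite ger0_norm// ler_piMl// rnorm_ge0.
Qed.

End vectors.
End holomorphic_lipschitz.

(** * Families of smooth functions and cutoffs *)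

Section regularity.
Context {R : realType} {n : nat}.
Local Notation V := (Cn R n).

Lemma is_derive_near (f g : R -> R) (x d r : R) : 0 < r ->
  (forall t, `|t - x| < r -> f t = g t) -> is_derive x 1 f d -> is_derive x 1 g d.
Proof.
move=> r0 fg; apply: near_eq_is_derive; exists r => //= t /=.
by rewrite distrC => /fg.
Qed.

Lemma is_derive_comp_real (f g : R -> R) (x a b : R) :
  is_derive (g x) 1 f a -> is_derive x 1 g b -> is_derive x 1 (f \o g) (b * a).
Proof.
by move=> df dg; rewrite mulrC; exact: is_derive1_comp.
Qed.

Lemma line_dirder (f : V -> R) z v : derivable (line f z v) 0 1 ->
  is_derive (0 : R) 1 (line f z v) (dirder f v z).
Proof. by move=> df; apply: (DeriveDef df); rewrite /dirder derive1E. Qed.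

Lemma dirder_line (f : V -> R) z v d : is_derive (0 : R) 1 (line f z v) d ->
  derivable (line f z v) 0 1 /\ dirder f v z = d.
Proof. by move=> df; split=> //; rewrite /dirder derive1E; case: df. Qed.

Lemma line_shift (f : V -> R) z v (t d : R) :
  is_derive (0 : R) 1 (line f (z + t%:C *: v) v) d ->
  is_derive t 1 (line f z v) d.
Proof.
move=> df; have ds : is_derive t (1 : R) (fun s : R => s - t) 1.
  exact: is_derive_shift.
have df' : is_derive ((fun s : R => s - t) t) 1 (line f (z + t%:C *: v) v) d.
  by rewrite subrr.
have := @is_derive_comp_real (line f (z + t%:C *: v) v) (fun s : R => s - t) t _ _ df' ds.
rewrite mul1r; congr is_derive.
apply/funext => s; rewrite /line/= -addrA -scalerDl -rmorphD/=.
by rewrite subrKC.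
Qed.

Lemma line_near (f g : V -> R) (U : set V) z v d : open U -> U z ->
  (forall y, U y -> f y = g y) ->
  is_derive (0 : R) 1 (line f z v) d -> is_derive (0 : R) 1 (line g z v) d.
Proof.
move=> /open_rnormP oU /oU[r r0 rU] fg.
have v1 : 0 < 1 + rnorm v by rewrite ltr_pwDl// rnorm_ge0.
apply: (@is_derive_near _ _ _ _ (r / (1 + rnorm v))); first by rewrite divr_gt0.
move=> t; rewrite subr0 => tr; apply: fg; apply: rU.
rewrite addrAC subrr add0r rnormZr.
rewrite (le_lt_trans (_ : _ <= `|t| * (1 + rnorm v)))//.
  by rewrite ler_wpM2l// lerDr.
by rewrite -ltr_pdivlMr.
Qed.

Section reg.
Context {I : Type} (P : (I -> V -> R) -> Prop) (U : set V).
Implicit Types f g : I -> V -> R.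

(** One recursion for several notions: [P] is imposed on every iterated directional derivative.
    Continuity and an index in [unit] give [Ck]; uniform boundedness gives families with bounds
    independent of the index. *)
Fixpoint reg k f : Prop :=
  P f /\
  if k is k'.+1 then
    forall v, (forall i z, U z -> derivable (line (f i) z v) 0 1) /\
              reg k' (fun i => dirder (f i) v)
  else True.

Hypothesis oU : open U.
Hypothesis P_ext : forall f g, (forall i z, U z -> f i z = g i z) -> P f -> P g.
Hypothesis P_add : forall f g, P f -> P g -> P (fun i z => f i z + g i z).
Hypothesis P_mul : forall f g, P f -> P g -> P (fun i z => f i z * g i z).
Hypothesis P_cst : forall a, P (fun _ _ => a).

Lemma reg_ext k f g : (forall i z, U z -> f i z = g i z) -> reg k f -> reg k g.
Proof.
elim: k f g => [|k IH] f g fg /=; first by move=> [Pf _]; split=> //; apply: P_ext Pf.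
move=> [Pf df]; split=> [|v]; first exact: P_ext Pf.
have [dfv rfv] := df v.
have dg i z : U z -> is_derive (0 : R) 1 (line (g i) z v) (dirder (f i) v z).
  by move=> Uz; apply: (line_near oU Uz (fg i)); exact/line_dirder/dfv.
split=> [i z Uz|]; first by have [] := dirder_line (dg i z Uz).
by apply: IH rfv => i z Uz; have [] := dirder_line (dg i z Uz).
Qed.

Lemma regS k f : reg k.+1 f -> reg k f.
Proof.
elim: k f => [|k IH] f; first by move=> [].
by move=> [Pf df]; split=> // v; have [dfv rfv] := df v; split=> //; exact: IH.
Qed.

Lemma reg_cst k a : reg k (fun _ _ => a).
Proof.
elim: k a => [|k IH] a; split=> // v.
have d (z : V) : is_derive (0 : R) 1 (line (fun=> a) z v) 0 by exact: is_derive_cst.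
split=> [i z _|]; first by have [] := dirder_line (d z).
have -> : (fun _ : I => dirder (fun=> a) v) = (fun _ _ => 0).
  by apply/funext => i; apply/funext => z; have [] := dirder_line (d z).
exact: IH.
Qed.

Lemma reg_add k f g : reg k f -> reg k g -> reg k (fun i z => f i z + g i z).
Proof.
elim: k f g => [|k IH] f g [Pf df] [Pg dg]; split; do ?exact: P_add; move=> // v.
have [dfv rfv] := df v; have [dgv rgv] := dg v.
have d i z : U z -> is_derive (0 : R) 1 (line (fun z => f i z + g i z) z v)
    (dirder (f i) v z + dirder (g i) v z).
  move=> Uz; exact: is_deriveD (line_dirder (dfv i z Uz)) (line_dirder (dgv i z Uz)).
split=> [i z Uz|]; first by have [] := dirder_line (d i z Uz).
apply: reg_ext (IH _ _ rfv rgv) => i z Uz.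
by have [_ ->] := dirder_line (d i z Uz).
Qed.

Lemma reg_mul k f g : reg k f -> reg k g -> reg k (fun i z => f i z * g i z).
Proof.
elim: k f g => [|k IH] f g rf rg.
  by split=> //; apply: P_mul; [case: rf|case: rg].
have rf' := regS rf; have rg' := regS rg.
case: rf => Pf df; case: rg => Pg dg; split; first exact: P_mul.
move=> v; have [dfv rfv] := df v; have [dgv rgv] := dg v.
have d i z : U z -> is_derive (0 : R) 1 (line (fun z => f i z * g i z) z v)
    (f i z * dirder (g i) v z + g i z * dirder (f i) v z).
  move=> Uz; apply: is_derive_eq (is_deriveM (line_dirder (dfv i z Uz)) (line_dirder (dgv i z Uz))) _.
  by rewrite -![_ *: _]/(_ * _) /line scale0r addr0.
split=> [i z Uz|]; first by have [] := dirder_line (d i z Uz).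
apply: reg_ext (reg_add (IH _ _ rf' rgv) (IH _ _ rg' rfv)) => i z Uz.
by have [_ ->] := dirder_line (d i z Uz).
Qed.

Lemma reg_sum k m (f : 'I_m -> I -> V -> R) : (forall j, reg k (f j)) ->
  reg k (fun i z => \sum_j f j i z).
Proof.
elim: m f => [|m IH] f rf.
  by under eq_fun do under eq_fun do rewrite big_ord0; exact: reg_cst.
under eq_fun do under eq_fun do rewrite big_ord_recl.
by apply: reg_add => //; exact: IH.
Qed.

(** [psi] lists an outer function and its successive derivatives: the induction on [k] needs the
    statement for [psi m.+1] as well as for [psi m]. *)
Lemma reg_comp (D : set R) (psi : nat -> R -> R) k m f :
  (forall m x, D x -> is_derive x 1 (psi m) (psi m.+1 x)) ->
  (forall m g, P g -> (forall i z, U z -> D (g i z)) -> P (fun i z => psi m (g i z))) ->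
  (forall i z, U z -> D (f i z)) ->
  reg k f -> reg k (fun i z => psi m (f i z)).
Proof.
move=> dpsi Ppsi fD; elim: k m => [|k IH] m rf.
  by split=> //; apply: Ppsi => //; case: rf.
have rf' := regS rf; case: rf => Pf df; split; first exact: Ppsi.
move=> v; have [dfv rfv] := df v.
have d i z : U z -> is_derive (0 : R) 1 (line (fun z => psi m (f i z)) z v)
    (dirder (f i) v z * psi m.+1 (f i z)).
  move=> Uz; have l0 : line (f i) z v 0 = f i z by rewrite /line scale0r addr0.
  have := @is_derive_comp_real (psi m) (line (f i) z v) 0 (psi m.+1 (f i z)) _ _ (line_dirder (dfv i z Uz)).
  by apply; rewrite l0; apply: dpsi; exact: fD.
split=> [i z Uz|]; first by have [] := dirder_line (d i z Uz).
apply: reg_ext (reg_mul rfv (IH m.+1 rf')) => i z Uz.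
by have [_ ->] := dirder_line (d i z Uz).
Qed.

End reg.

Definition ubounded (U : set V) (I : Type) (f : I -> V -> R) :=
  exists M : R, forall i z, U z -> `|f i z| <= M.

Section ubounded.
Context (U : set V) (I : Type).
Implicit Types f g : I -> V -> R.

Lemma ub_ext f g : (forall i z, U z -> f i z = g i z) ->
  ubounded U f -> ubounded U g.
Proof. by move=> fg [M fM]; exists M => i z Uz; rewrite -fg// fM. Qed.

Lemma ub_add f g : ubounded U f -> ubounded U g ->
  ubounded U (fun i z => f i z + g i z).
Proof.
move=> [M fM] [N gN]; exists (M + N) => i z Uz.
by rewrite (le_trans (ler_normD _ _))// lerD ?fM ?gN.
Qed.

Lemma ub_mul f g : ubounded U f -> ubounded U g ->
  ubounded U (fun i z => f i z * g i z).
Proof.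
move=> [M fM] [N gN]; exists (M * N) => i z Uz.
by rewrite normrM ler_pM ?fM ?gN.
Qed.

Lemma ub_cst a : ubounded U (fun (_ : I) _ => a).
Proof. by exists `|a|. Qed.

End ubounded.

(* The families of functions whose derivatives of each order are bounded on [U],
   uniformly in the index. *)
Definition bounded_smooth (I : Type) U (f : I -> V -> R) :=
  forall k, reg (@ubounded U I) U k f.

Definition pcontinuous (U : set V) (f : unit -> V -> R) :=
  forall z, U z -> {for z, continuous (f tt)}.

Section Ck.
Context (U : set V) (oU : open U).
Implicit Types f g : V -> R.

Lemma Ck_reg k f : Ck k U f <-> reg (pcontinuous U) U k (fun=> f).
Proof.
elim: k f => [|k IH] f; first by split=> -[]; split.
split=> -[cf df]; split=> // v; have [dfv rfv] := df v; split.
- by move=> _; exact: dfv.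
- exact/IH.
- by move=> z; exact: (dfv tt).
- exact/IH.
Qed.

Lemma pc_ext (f g : unit -> V -> R) : (forall i z, U z -> f i z = g i z) -> pcontinuous U f ->
  pcontinuous U g.
Proof.
move=> fg cf z Uz; have fz := cf z Uz.
have H : g tt y @[y --> z] --> f tt z.
  move/open_rnormP : oU => /(_ z Uz)[r r0 rU].
  move=> A /fz/nbhs_rnormP[r1 r10 r1P]; apply/nbhs_rnormP.
  exists (Num.min r r1) => [|y]; first by rewrite lt_min r0.
  by rewrite lt_min => /andP[/rU Uy /r1P]; rewrite /= (fg tt y Uy).
by move: H; rewrite (fg tt z Uz).
Qed.

Lemma Ck_ext k f g : (forall z, U z -> f z = g z) -> Ck k U f -> Ck k U g.
Proof.
move=> fg /Ck_reg rf; apply/Ck_reg; apply: (reg_ext oU (@pc_ext)) rf.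
by move=> _; exact: fg.
Qed.

Let pc_add (f g : unit -> V -> R) : pcontinuous U f -> pcontinuous U g ->
  pcontinuous U (fun i z => f i z + g i z).
Proof. by move=> cf cg z Uz; exact: cvgD (cf z Uz) (cg z Uz). Qed.

Let pc_mul (f g : unit -> V -> R) : pcontinuous U f -> pcontinuous U g ->
  pcontinuous U (fun i z => f i z * g i z).
Proof. by move=> cf cg z Uz; exact: cvgM (cf z Uz) (cg z Uz). Qed.

Lemma Ck_add k f g : Ck k U f -> Ck k U g -> Ck k U (fun z => f z + g z).
Proof.
move=> /Ck_reg rf /Ck_reg rg; apply/Ck_reg.
exact: (reg_add oU (@pc_ext) (@pc_add) rf rg).
Qed.

Lemma Ck_mul k f g : Ck k U f -> Ck k U g -> Ck k U (fun z => f z * g z).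
Proof.
move=> /Ck_reg rf /Ck_reg rg; apply/Ck_reg.
exact: (reg_mul oU (@pc_ext) (@pc_add) (@pc_mul) rf rg).
Qed.

Lemma Ck_comp (D : set R) (psi : nat -> R -> R) k f :
  (forall m x, D x -> is_derive x 1 (psi m) (psi m.+1 x)) ->
  (forall z, U z -> D (f z)) -> Ck k U f -> Ck k U (fun z => psi 0%N (f z)).
Proof.
move=> dpsi fD /Ck_reg rf; apply/Ck_reg.
have H := @reg_comp unit (pcontinuous U) U oU pc_ext pc_add pc_mul D psi k 0 (fun=> f) dpsi.
apply: H rf => [m g cg gD z Uz|_]; last exact: fD.
apply: continuous_comp; first exact: cg.
by have /is_derive_continuous := dpsi m _ (gD tt z Uz).
Qed.

End Ck.

Lemma Ck_subset k (U U' : set V) f : U' `<=` U -> Ck k U f -> Ck k U' f.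
Proof.
move=> sub; elim: k f => [|k IH] f [cf df]; split=> //.
- by move=> z /sub/cf.
- by move=> z /sub/cf.
- by move=> v; have [dfv rfv] := df v; split=> [z /sub/dfv//|]; exact: IH.
Qed.

(** [Ck] is a conjunction of conditions at single points on total functions, and the derivatives in
    it do not depend on the set. *)
Lemma Ck_local k (U : set V) f :
  (forall z, U z -> exists2 W, W z & Ck k W f) -> Ck k U f.
Proof.
elim: k f => [|k IH] f Uf; split=> //.
- by move=> z /Uf[W Wz [cf _]]; exact: cf.
- by move=> z /Uf[W Wz [cf _]]; exact: cf.
- move=> v; split; first by move=> z /Uf[W Wz [_ /(_ v)[dfv _]]]; exact: dfv.
  by apply: IH => z /Uf[W Wz [_ /(_ v)[_ rfv]]]; exists W.
Qed.

(** Each derivative costs a factor [dlip] and a part of the ball; the resulting bounds involve only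
    [L], [M], the radii and the directions, hence not the index [i]. *)
Lemma hol_bounded_smooth (I : Type) z0 (rho rho' L M : R) (f : I -> V -> R[i]^o) :
  0 < rho' -> rho' < rho ->
  (forall i, lhol z0 rho L (f i)) ->
  (forall i z, rball z0 rho z -> rnorm (f i z) <= M) ->
  bounded_smooth (rball z0 rho') (fun i z => complex.Re (f i z)) /\
  bounded_smooth (rball z0 rho') (fun i z => complex.Im (f i z)).
Proof.
move=> r0 rr hf fM.
suff H k : reg (@ubounded (rball z0 rho') I) (rball z0 rho') k (fun i z => complex.Re (f i z)) /\
    reg (@ubounded (rball z0 rho') I) (rball z0 rho') k (fun i z => complex.Im (f i z)).
  by split=> k; have [] := H k.
elim: k rho rr L M f hf fM => [|k IH] rho rr L M f hf fM.
  have sub z : rball z0 rho' z -> rball z0 rho z by move=> /lt_trans; apply.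
  split; split=> //; exists M => i z /sub/(fM i); apply: le_trans.
    exact: Re_le_rnorm.
  exact: Im_le_rnorm.
(* Stopping halfway leaves room for the remaining [k] derivatives. *)
pose r1 := (rho' + rho) / 2.
have [r'1 r1r] : rho' < r1 /\ r1 < rho by rewrite /r1; split; lra.
have sub z : rball z0 rho' z -> rball z0 rho z by move=> /lt_trans; apply.
have IHv v := @IH r1 r'1 (dlip rho r1 L * rnorm v) (L * rnorm v) (fun i z => cD (f i) z v)
  (fun i => lhol_D v (hf i) r1r)
  (fun i z zr => lhol_dbound v (hf i) (lt_trans zr r1r)).
have d i z v : rball z0 rho' z ->
    is_derive (0 : R) 1 (line (fun z => complex.Re (f i z)) z v) (complex.Re (cD (f i) z v)) /\
    is_derive (0 : R) 1 (line (fun z => complex.Im (f i z)) z v) (complex.Im (cD (f i) z v)).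
  move=> /sub/(lhol_cder (hf i)) df; apply: cder_line.
  by rewrite scale0r addr0.
split; split.
- by exists M => i z /sub/(fM i); apply: le_trans; exact: Re_le_rnorm.
- move=> v; have [IH1 _] := IHv v; split.
    by move=> i z /(d i z v)[/dirder_line[]].
  apply: (@reg_ext I (@ubounded (rball z0 rho') I) _ (@rball_open _ _ _ _) (@ub_ext (rball z0 rho') I) k _ _ _ IH1) => i z /(d i z v)[].
  by move=> /dirder_line[_ ->].
- by exists M => i z /sub/(fM i); apply: le_trans; exact: Im_le_rnorm.
- move=> v; have [_ IH1] := IHv v; split.
    by move=> i z /(d i z v)[_ /dirder_line[]].
  apply: (@reg_ext I (@ubounded (rball z0 rho') I) _ (@rball_open _ _ _ _) (@ub_ext (rball z0 rho') I) k _ _ _ IH1) => i z /(d i z v)[_].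
  by move=> /dirder_line[_ ->].
Qed.

End regularity.

(** * A smooth cutoff function on the real line *)

Section cutoff.
Context {R : realType}.
Implicit Types (p : {poly R}) (t : R).

Lemma is_derive_horner p (x : R) : is_derive x 1 (fun y : R => p.[y]) (p^`().[x]).
Proof.
elim/poly_ind: p => [|p c IH].
  by under eq_fun do rewrite horner0; rewrite deriv0 horner0; exact: is_derive_cst.
have -> : (fun y => (p * 'X + c%:P).[y]) = (fun y => p.[y] * y + c).
  by apply/funext => y; rewrite hornerMXaddC.
have d1 := is_deriveM IH (is_derive_id x 1).
have d2 := is_deriveD d1 (is_derive_cst c x 1).
apply: is_derive_eq d2 _.
by rewrite derivMXaddC hornerD hornerMX addr0 -![_ *: _]/(_ * _) mulr1 (mulrC x).
Qed.

(** The functions [p (1 / t) * exp (- 1 / t)], extended by 0 to [t <= 0], form a class stable under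
    differentiation: it contains the flat function, given by [p = 1], together with all its
    derivatives. *)
Definition theta p t : R := if 0 < t then p.[t^-1] * expR (- t^-1) else 0.

Lemma expX_bound k : exists2 M : R, 0 <= M & forall s : R, 0 <= s -> s ^+ k * expR (- s) <= M.
Proof.
exists (k`!%:R) => // s s0; rewrite expRN ler_pdivrMr ?expR_gt0//.
case: k => [|k]; first by rewrite fact0 expr0 mul1r (le_trans _ (expR_ge1Dx s))// lerDl.
rewrite mulrC -ler_pdivrMr ?ltr0n ?fact_gt0// (le_trans _ (expR_ge1Dxn k s0))// lerDr//.
Qed.

Lemma poly_exp_bound p : exists2 M : R, 0 <= M &
  forall s : R, 0 <= s -> `|p.[s] * expR (- s)| <= M.
Proof.
have /(_ _)/cid2-/all_sig := @expX_bound.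
move=> [B BP].
exists (\sum_(i < size p) `|p`_i| * B i).
  by apply: sumr_ge0 => i _; rewrite mulr_ge0//; have [] := BP i.
move=> s s0; rewrite horner_coef mulr_suml (le_trans (ler_norm_sum _ _ _))//.
apply: ler_sum => i _; rewrite -mulrA normrM ler_wpM2l// ger0_norm.
  by have [_] := BP i; apply.
by rewrite mulr_ge0 ?exprn_ge0 ?expR_ge0.
Qed.

Lemma theta_bound p : exists2 M : R, 0 <= M & forall t, `|theta p t| <= M.
Proof.
have [M M0 pM] := poly_exp_bound p; exists M => // t; rewrite /theta.
by case: ifPn => [t0|_]; rewrite ?normr0// pM// invr_ge0 ltW.
Qed.

Lemma theta_derive p t : is_derive t 1 (theta p) (theta ('X^2 * (p - p^`())) t).
Proof.
have [t0|t0|->] := ltrgt0P t.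
- apply: (@is_derive_near _ (fun t => p.[t^-1] * expR (- t^-1)) _ _ _ t t0) => [s|].
    move=> st; rewrite /theta ifT//.
    by rewrite ltNge; apply/negP => s0; move: st; rewrite ler0_norm; lra.
  have dV := is_derive_inv (lt0r_neq0 t0).
  have d1 := is_derive_comp_real (is_derive_horner p t^-1) dV.
  have dN : is_derive t 1 (fun y : R => - y^-1) (t ^- 2).
    by apply: is_derive_eq (is_deriveN dV) _; rewrite opprK.
  have d2 := @is_derive_comp_real _ expR (fun y : R => - y^-1) t _ _ (is_derive_expR _) dN.
  apply: is_derive_eq (is_deriveM d1 d2) _.
  rewrite /theta t0 -![_ *: _]/(_ * _) !hornerE /=.
  by rewrite exprVn; ring.
- apply: (@is_derive_near _ (fun=> 0) _ _ _ (- t)) => [|s st|].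
  + by rewrite oppr_gt0.
  + rewrite /theta ifF//; apply/negbTE; rewrite -leNgt.
    rewrite leNgt; apply/negP => s0; move: st; rewrite ger0_norm; lra.
  + by rewrite /theta ltNge ltW//=; exact: is_derive_cst.
(* For [s > 0], [theta p s = s ^+ 2 * theta ('X^2 * p) s] with a bounded second factor, so that the
   increment at 0 is quadratic in [s]. *)
- rewrite {2}/theta ltxx; apply: is_derive_eps => e e0.
  have [M M0 pM] := theta_bound ('X^2 * p).
  have M1 : 0 < M + 1 by rewrite ltr_wpDl.
  exists (e / (M + 1)); first by rewrite divr_gt0.
  move=> s se; rewrite add0r mul0r subr0 {2}/theta ltxx subr0.
  rewrite /theta; case: ifPn => [s0|_]; last by rewrite normr0 mulr_ge0// ltW.
  have := pM s; rewrite /theta s0 hornerM hornerXn => H.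
  have -> : p.[s^-1] * expR (- s^-1) = s ^+ 2 * (s^-1 ^+ 2 * p.[s^-1] * expR (- s^-1)).
    by field; rewrite gt_eqF.
  move: H; move: (s^-1 ^+ 2 * _ * _) => Y H.
  rewrite normrM normrX expr2 -mulrA (mulrC e) ler_wpM2l//.
  rewrite (le_trans (ler_wpM2l (normr_ge0 s) H))//.
  rewrite (le_trans (_ : _ <= `|s| * (M + 1)))//; first by rewrite ler_wpM2l// lerDl.
  by rewrite -ler_pdivlMr// ltW.
Qed.

(* The [m]-th derivative of [expR (- (1 - t)^-1)] is [theta (cutoff_poly m) (1 - t)]. *)
Fixpoint cutoff_poly m : {poly R} :=
  if m is m'.+1 then - ('X^2 * (cutoff_poly m' - (cutoff_poly m')^`())) else 1.

Definition cutoff m t : R := theta (cutoff_poly m) (1 - t).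

Lemma thetaN p t : theta (- p) t = - theta p t.
Proof. by rewrite /theta; case: ifP => _; rewrite ?oppr0// hornerN mulNr. Qed.

Lemma cutoff_derive m t : is_derive t 1 (cutoff m) (cutoff m.+1 t).
Proof.
have d1 : is_derive t (1 : R) (fun s : R => 1 - s) (-1).
  by apply: is_derive_eq (is_deriveB (is_derive_cst (1 : R) t (1 : R)) (is_derive_id t (1 : R))) _; rewrite sub0r.
apply: is_derive_eq (is_derive_comp_real (theta_derive _ _) d1) _.
by rewrite mulN1r -thetaN.
Qed.

Lemma cutoff_bound m : exists2 M : R, 0 <= M & forall t, `|cutoff m t| <= M.
Proof. by have [M M0 H] := theta_bound (cutoff_poly m); exists M => // t; exact: H. Qed.

Lemma cutoff_gt0 t : t < 1 -> 0 < cutoff 0 t.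
Proof. by move=> t1; rewrite /cutoff /theta subr_gt0 t1 hornerC mul1r expR_gt0. Qed.

Lemma cutoff_eq0 t : 1 <= t -> cutoff 0 t = 0.
Proof. by move=> t1; rewrite /cutoff /theta subr_gt0 ltNge t1. Qed.

Lemma cutoff_ge0 t : 0 <= cutoff 0 t.
Proof. by have [/cutoff_gt0/ltW//|/cutoff_eq0->] := ltP t 1. Qed.

End cutoff.

(** * An invariant functional on a group with totally bounded neighbourhoods *)

Section haar.
Context {R : realType} {G J : Type} (mul : G -> G -> G) (inv : G -> G) (one : G).
(* [N j a g] says that [a * g^-1] lies in the [j]-th neighbourhood of the unit. *)
Context (N : J -> G -> G -> Prop).
Hypotheses (mulA : associative mul) (mulV : right_inverse one inv mul)
  (Vmul : left_inverse one inv mul) (mul1 : right_id one mul) (onemul : left_id one mul).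
Hypothesis N_refl : forall j a, N j a a.
Hypothesis N_inv : forall j a g b, N j (mul a b) (mul g b) <-> N j a g.
Hypothesis N_dir : forall i j, exists k, forall a g, N k a g -> N i a g /\ N j a g.

(** Relative compactness, expressed through the relation [N] alone. *)
Definition tot_bounded (B : set G) :=
  forall j, exists l : seq G, forall a, B a -> exists2 g, List.In g l & N j a g.

Context (j0 : J).
Hypothesis W_tb : tot_bounded [set a | N j0 a one].

Let ind (P : Prop) : R := `[< P >]%:R.
Let ind0 P : 0 <= ind P. Proof. by rewrite ler0n. Qed.
Let ind1 P : ind P <= 1. Proof. by rewrite /ind; case: asbool. Qed.

Implicit Types (F : G -> R) (l : seq (R * G)).

(* [num j F] is the infimum of the total weights of the combinations of translates of the
   [j]-th neighbourhood that dominate [F]. *)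
Let dom j l a : R := \sum_(p <- l) p.1 * ind (N j a p.2).
Let cost l : R := \sum_(p <- l) p.1.
Let pos l := forall p, List.In p l -> 0 <= p.1.
Let cov j F := [set cost l | l in [set l | pos l /\ forall a, F a <= dom j l a]].
Let num j F : R := inf (cov j F).

Let sum_ge0 l (f : R * G -> R) : (forall p, List.In p l -> 0 <= f p) -> 0 <= \sum_(p <- l) f p.
Proof.
elim: l => [|p l IH] H; first by rewrite big_nil.
rewrite big_cons addr_ge0//; first by apply: H; left.
by apply: IH => q ql; apply: H; right.
Qed.

Let ler_suml l (f g : R * G -> R) : (forall p, List.In p l -> f p <= g p) ->
  \sum_(p <- l) f p <= \sum_(p <- l) g p.
Proof.
move=> fg; rewrite -subr_ge0 -sumrB; apply: sum_ge0 => p /fg.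
by rewrite subr_ge0.
Qed.

Let cost_ge0 l : pos l -> 0 <= cost l.
Proof. exact: sum_ge0. Qed.

Let cov_lb j F : has_lbound (cov j F).
Proof. by exists 0 => _ [l [pl _] <-]; exact: cost_ge0. Qed.

Let num_le j F l : pos l -> (forall a, F a <= dom j l a) -> num j F <= cost l.
Proof. by move=> pl Fl; apply: ge_inf; [exact: cov_lb|exists l]. Qed.

Definition admissible F := [/\ (forall a, 0 <= F a), (exists M, forall a, F a <= M) &
  exists2 B, tot_bounded B & forall a, F a != 0 -> B a].

Let adm_cov j F : admissible F -> cov j F !=set0.
Proof.
move=> [F0 [M FM] [B tB FB]]; have [s sB] := tB j.
have M0 : 0 <= M by exact: le_trans (F0 one) (FM one).
exists (cost [seq (M, g) | g <- s]); exists [seq (M, g) | g <- s] => //.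
have ps : pos [seq (M, g) | g <- s].
  elim: s {sB} => [//|g s IH] p /= [<-//|]; exact: IH.
split=> // a; have [Fa|Fa] := eqVneq (F a) 0.
  by rewrite Fa; apply: sum_ge0 => p /ps p0; rewrite mulr_ge0.
have [g gs Nag] := sB _ (FB _ Fa).
rewrite (le_trans (FM a))//.
elim: s gs {sB} ps => [//|g' s IH] /= gs ps; rewrite /dom big_cons/=.
case: gs => [->|gs].
  rewrite /ind (asboolT Nag) mulr1 lerDl; apply: sum_ge0 => p pl.
  by rewrite mulr_ge0//; apply: ps; right.
by rewrite ler_wpDl ?mulr_ge0//; apply: IH => // p pl; apply: ps; right.
Qed.

Let num_adh j F (e : R) : admissible F -> 0 < e ->
  exists l, [/\ pos l, forall a, F a <= dom j l a & cost l < num j F + e].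
Proof.
move=> aF e0; have [|_ [l [pl Fl] <-] H] := @inf_adherent R (cov j F) e e0.
  by split; [exact: adm_cov|exact: cov_lb].
by exists l.
Qed.

Let num_ge0 j F : admissible F -> 0 <= num j F.
Proof.
move=> aF; apply: lb_le_inf; first exact: adm_cov.
by move=> _ [l [pl _] <-]; exact: cost_ge0.
Qed.

Let num_mono j F F' : admissible F' -> (forall a, F a <= F' a) -> num j F <= num j F'.
Proof.
move=> aF' FF'; apply/ler_addgt0Pr => e e0.
have [l [pl F'l /ltW cl]] := num_adh j aF' e0.
by rewrite (le_trans _ cl)// num_le// => a; exact: le_trans (FF' a) _.
Qed.

Let num_add j F F' : admissible F -> admissible F' ->
  num j (fun a => F a + F' a) <= num j F + num j F'.
Proof.
move=> aF aF'; apply/ler_addgt0Pr => e e0.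
have e20 : 0 < e / 2 by rewrite divr_gt0.
have [l [pl Fl /ltW cl]] := num_adh j aF e20.
have [l' [pl' F'l' /ltW cl']] := num_adh j aF' e20.
apply: (@le_trans _ _ (cost (l ++ l'))).
  apply: num_le.
    by move=> p Hp; have [/pl|/pl'] := List.in_app_or _ _ _ Hp.
  by move=> a; rewrite /dom big_cat/= lerD.
by rewrite /cost big_cat/= (splitr e) addrACA lerD.
Qed.

Let num_scale j F c : admissible F -> 0 <= c -> num j (fun a => c * F a) <= c * num j F.
Proof.
move=> aF c0; apply/ler_addgt0Pr => e e0.
have c1 : 0 < c + 1 by rewrite ltr_wpDl.
have [l [pl Fl /ltW cl]] := num_adh j aF (divr_gt0 e0 c1).
apply: (@le_trans _ _ (cost [seq (c * p.1, p.2) | p <- l])).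
  apply: num_le.
    elim: l {Fl cl} pl => [//|q l IH] pl p /= [<-/=|]; first by rewrite mulr_ge0//; apply: pl; left.
    by apply: IH => p' p'l; apply: pl; right.
  move=> a; rewrite /dom big_map/=; under eq_bigr do rewrite -mulrA.
  by rewrite -mulr_sumr ler_wpM2l//; exact: Fl.
rewrite /cost big_map/= -mulr_sumr (le_trans (ler_wpM2l c0 cl))// mulrDr lerD2l.
by rewrite mulrCA ler_piMr ?(ltW e0)// ler_pdivrMr// mul1r lerDl.
Qed.

Let Nr j a g b : N j (mul a b) g <-> N j a (mul g (inv b)).
Proof. by rewrite -{1}(mul1 g) -(Vmul b) mulA; exact: N_inv. Qed.

Lemma tb_translate B b : tot_bounded B -> tot_bounded [set a | B (mul a b)].
Proof.
move=> tB j; have [s sB] := tB j; exists [seq mul g (inv b) | g <- s].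
move=> a /sB[g gs Nag]; exists (mul g (inv b)); last exact/Nr.
by elim: s gs {sB} => [//|x s IH] /= [->|/IH]; [left|right].
Qed.

Lemma tb_union B B' : tot_bounded B -> tot_bounded B' -> tot_bounded (B `|` B').
Proof.
move=> tB tB' j; have [s sB] := tB j; have [s' sB'] := tB' j.
exists (s ++ s') => a [/sB|/sB'] [g gs Nag]; exists g => //.
  by apply: List.in_or_app; left.
by apply: List.in_or_app; right.
Qed.

Lemma tb_sub B B' : B `<=` B' -> tot_bounded B' -> tot_bounded B.
Proof. by move=> sub tB j; have [s sB] := tB j; exists s => a /sub/sB. Qed.

Let adm_translate F b : admissible F -> admissible (fun a => F (mul a b)).
Proof.
move=> [F0 [M FM] [B tB FB]]; split=> //; first by exists M.
exists [set a | B (mul a b)]; first exact: tb_translate.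
by move=> a /FB.
Qed.

Let num_translate j F b : admissible F -> num j (fun a => F (mul a b)) <= num j F.
Proof.
move=> aF; apply/ler_addgt0Pr => e e0.
have [l [pl Fl /ltW cl]] := num_adh j aF e0.
apply: (@le_trans _ _ (cost [seq (p.1, mul p.2 (inv b)) | p <- l])); last first.
  by rewrite /cost big_map/=.
apply: num_le.
  elim: l {Fl cl} pl => [//|q l IH] pl p /= [<-/=|]; first by apply: pl; left.
  by apply: IH => p' p'l; apply: pl; right.
move=> a; rewrite (le_trans (Fl _))// /dom big_map/= le_eqVlt; apply/orP; left.
apply/eqP; apply: eq_bigr => p _; congr (_ * _); rewrite /ind; congr (_%:R).
by congr (nat_of_bool _); apply/asbool_equiv_eq; exact: Nr.
Qed.

Lemma adm_add F F' : admissible F -> admissible F' -> admissible (fun a => F a + F' a).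
Proof.
move=> [F0 [M FM] [B tB FB]] [F'0 [M' F'M] [B' tB' F'B]]; split.
- by move=> a; rewrite addr_ge0.
- by exists (M + M') => a; rewrite lerD.
- exists (B `|` B'); first exact: tb_union.
  move=> a; have [->|/FB] := eqVneq (F a) 0; last by left.
  by rewrite add0r => /F'B; right.
Qed.

Lemma adm_scale F c : 0 <= c -> admissible F -> admissible (fun a => c * F a).
Proof.
move=> c0 [F0 [M FM] [B tB FB]]; split; first by move=> a; rewrite mulr_ge0.
  by exists (c * M) => a; rewrite ler_wpM2l.
by exists B => // a; rewrite mulf_eq0 negb_or => /andP[_ /FB].
Qed.

Let W a : R := ind (N j0 a one).

Let adm_ind B : tot_bounded B -> admissible (fun a => ind (B a)).
Proof.
move=> tB; split => //; first by exists 1.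
exists B => // a; apply: contraNP => Ba.
by rewrite /ind (asboolF Ba).
Qed.

Let adm_W : admissible W. Proof. exact: adm_ind. Qed.

(** A combination that dominates [W] has value at least 1 at the unit, and its value there is at
    most its total weight. This allows the normalization by [num j W]. *)
Let num_W j : 1 <= num j W.
Proof.
apply: lb_le_inf; first exact: adm_cov.
move=> _ [l [pl /(_ one) Wl] <-]; have := Wl.
rewrite /W /ind (asboolT (N_refl _ _)) => /le_trans; apply.
apply: ler_suml => p /pl p0; rewrite ler_piMr// ind1//.
Qed.

Let W0 j : 0 < num j W. Proof. exact: lt_le_trans ltr01 (num_W j). Qed.

(** The support of [F] is covered by finitely many translates of the neighbourhood [j0]; their
    number, which does not depend on [j], bounds the ratio to [num j W] up to the maximum of [F]. *)
Let num_bound F : admissible F -> exists2 C, 0 <= C & forall j, num j F <= C * num j W.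
Proof.
move=> [F0 [M FM] [B tB FB]]; have M0 : 0 <= M := le_trans (F0 one) (FM one).
have [s sB] := tB j0.
have tr (g a : G) : N j0 a g <-> N j0 (mul a (inv g)) one.
  by rewrite -(mulV g) N_inv.
have aWg g : admissible (fun a => W (mul a (inv g))) by exact: adm_translate.
have aS s' : admissible (fun a => \sum_(g <- s') W (mul a (inv g))).
  elim: s' => [|g s' IH].
    split; [by move=> a; rewrite big_nil|by exists 0 => a; rewrite big_nil|].
    by exists set0 => [j|a]; [exists [::]|rewrite big_nil eqxx].
  under eq_fun do rewrite big_cons; exact: adm_add.
exists (M * (size s)%:R) => [|j]; first by rewrite mulr_ge0.
apply: (@le_trans _ _ (num j (fun a => M * \sum_(g <- s) W (mul a (inv g))))).
  apply: num_mono; first exact: adm_scale.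
  move=> a; have [Fa|Fa] := eqVneq (F a) 0.
    by rewrite Fa mulr_ge0// sumr_ge0// => g _; exact: ind0.
  rewrite (le_trans (FM a))// ler_peMr//; have [g gs Nag] := sB _ (FB _ Fa).
  elim: s gs {sB} => [//|g' s IH] /=; rewrite big_cons => -[->|/IH H].
    rewrite /W /ind (asboolT (proj1 (tr _ _) Nag)) lerDl sumr_ge0// => x _; exact: ind0.
  by rewrite ler_wpDl//; exact: ind0.
rewrite (le_trans (num_scale j (aS s) M0))// -mulrA ler_wpM2l//.
elim: s {sB} => [|g s IH].
  rewrite mul0r; have -> : (fun a : G => \sum_(g <- [::]) W (mul a (inv g))) = (fun a => dom j [::] a).
    by apply/funext => a; rewrite /dom !big_nil.
  have := @num_le j (fun a => dom j [::] a) [::] (fun p pl => match pl with end) (fun a => lexx _).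
  by rewrite /cost big_nil.
under eq_fun do rewrite big_cons.
rewrite (le_trans (num_add j (aWg g) (aS s)))//= -[X in X%:R]add1n natrD mulrDl mul1r lerD//.
exact: num_translate.
Qed.

(** The filter of arbitrarily small neighbourhoods. An ultrafilter above it gives all bounded ratios
    a limit at once, compatibly with sums and inequalities. *)
Let base : set_system J := filter_from setT (fun k => [set j | forall a g, N j a g -> N k a g]).

Let base_proper : ProperFilter base.
Proof.
apply: filter_from_proper; last by move=> k _; exists k.
apply: filter_from_filter; first by exists j0.
move=> i j _ _; have [k kP] := N_dir i j; exists k => // m mk; split=> a g /mk/kP[].
  by [].
by move=> _.
Qed.

Let ultra_ex := ultraFilterLemma base_proper.
Let U : set_system J := sval (cid ultra_ex).
Let UU : UltraFilter U := (svalP (cid ultra_ex)).1.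
Let Ubase : base `<=` U := (svalP (cid ultra_ex)).2.
Local Instance U_proper : ProperFilter U := ultra_proper (UltraFilter := UU).

Let ratio F j : R := num j F / num j W.

Let ratio_bound F : admissible F -> exists2 C, 0 <= C & forall j, 0 <= ratio F j <= C.
Proof.
move=> aF; have [C C0 CP] := num_bound aF; exists C => // j.
by rewrite /ratio divr_ge0 ?num_ge0 ?(ltW (W0 j))//= ler_pdivrMr.
Qed.

Let J_ F : R := lim (ratio F @ U).

(** The limit is the supremum of the levels [r] such that [r <= u] on a member of [U]; above it,
    maximality of [U] puts the complementary set in [U]. *)
Let ultra_cvg (u : J -> R) (C : R) : (forall j, 0 <= u j <= C) -> cvg (u @ U).
Proof.
move=> uC; pose S := [set r | U [set j | r <= u j]].
have S0 : S 0 by apply: filterE => j; have /andP[] := uC j.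
have SC : ubound S C.
  move=> r /filter_ex[j /= rj]; rewrite (le_trans rj)//.
  by have /andP[] := uC j.
have hS : has_sup S by split; [exists 0|exists C].
apply/cvg_ex; exists (sup S); apply/cvgrPdist_le => e e0.
have [r Sr rS] := sup_adherent e0 hS.
have nS : U (~` [set j | sup S + e <= u j]).
  have [H|//] := in_ultra_setVsetC [set j | sup S + e <= u j] UU.
  have : sup S + e <= sup S by apply: ub_le_sup => //; exists C.
  by rewrite gerDl leNgt e0.
suff : U [set j | `|sup S - u j| <= e] by [].
apply: (@filterS _ U _ _ _ _ (filterI Sr nS)) => j [/= rj /negP]; rewrite -ltNge => uj.
by rewrite ler_distl; lra.
Qed.

Let ulim_le (u v : J -> R) : cvg (u @ U) -> cvg (v @ U) ->
  U [set j | u j <= v j] -> lim (u @ U) <= lim (v @ U).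
Proof.
move=> cu cv uv; rewrite -subr_ge0 -limB//; apply: limr_ge; first exact: is_cvgB.
by apply: filterS uv => j /=; rewrite subr_ge0.
Qed.

Let ratio_cvg F : admissible F -> cvg (ratio F @ U).
Proof. by move=> /ratio_bound[C _ CP]; exact: ultra_cvg CP. Qed.

Let J_ge0 F : admissible F -> 0 <= J_ F.
Proof.
move=> aF; apply: limr_ge; first exact: ratio_cvg.
by apply: nearW => j; have [C _ /(_ j)/andP[]] := ratio_bound aF.
Qed.

Let J_mono F F' : admissible F -> admissible F' -> (forall a, F a <= F' a) -> J_ F <= J_ F'.
Proof.
move=> aF aF' FF'; apply: ulim_le; [exact: ratio_cvg|exact: ratio_cvg|].
by apply: filterE => j /=; rewrite ler_pM2r ?invr_gt0// num_mono.
Qed.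

Let J_subadd F F' : admissible F -> admissible F' -> J_ (fun a => F a + F' a) <= J_ F + J_ F'.
Proof.
move=> aF aF'; rewrite /J_ -limD; [|exact: ratio_cvg|exact: ratio_cvg].
apply: ulim_le; first exact/ratio_cvg/adm_add.
  by apply: is_cvgD; exact: ratio_cvg.
by apply: filterE => j; rewrite /= -mulrDl ler_pM2r ?invr_gt0// num_add.
Qed.

Let J_scale_le F c : admissible F -> 0 <= c -> J_ (fun a => c * F a) <= c * J_ F.
Proof.
move=> aF c0.
have cF : (c * ratio F j) @[j --> U] --> c * lim (ratio F @ U).
  by apply: cvgMr; exact: ratio_cvg.
rewrite /J_ -(cvg_lim _ cF)//.
apply: ulim_le; first exact/ratio_cvg/adm_scale.
  by apply/cvg_ex; eexists; exact: cF.
by apply: filterE => j; rewrite /= mulrA ler_pM2r ?invr_gt0// num_scale.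
Qed.

Let J_scale F c : admissible F -> 0 <= c -> J_ (fun a => c * F a) = c * J_ F.
Proof.
move=> aF c0; apply/eqP; rewrite eq_le J_scale_le//=.
have [->|cn0] := eqVneq c 0; first by rewrite mul0r J_ge0//; exact: adm_scale.
have cp : 0 < c by rewrite lt_neqAle eq_sym cn0.
have := @J_scale_le (fun a => c * F a) c^-1 (adm_scale c0 aF).
rewrite invr_ge0 => /(_ c0).
under [X in J_ X]eq_fun do rewrite mulrA mulVf// mul1r.
by rewrite mulrC ler_pdivlMr// mulrC.
Qed.

Let J_translate F b : admissible F -> J_ (fun a => F (mul a b)) = J_ F.
Proof.
have H F' b' : admissible F' -> J_ (fun a => F' (mul a b')) <= J_ F'.
  move=> aF; apply: ulim_le; [exact/ratio_cvg/adm_translate|exact: ratio_cvg|].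
  by apply: filterE => j /=; rewrite ler_pM2r ?invr_gt0// num_translate.
move=> aF; apply/eqP; rewrite eq_le H//=.
have := H _ (inv b) (adm_translate b aF).
by under [X in J_ X]eq_fun do rewrite -mulA Vmul mul1.
Qed.

Let J_W : J_ W = 1.
Proof.
apply/cvg_lim => //; have -> : ratio W = fun=> 1; last exact: cvg_cst.
by apply/funext => j; rewrite /ratio divff// gt_eqF.
Qed.

Definition unif_cont F := forall e : R, 0 < e -> exists j, forall a g, N j a g -> `|F a - F g| <= e.

(* Haar's argument: the multipliers [Fi / max(F1 + F2, d)] are uniformly continuous, hence
   almost constant on small neighbourhoods. *)
Let J_superadd F1 F2 : admissible F1 -> admissible F2 -> unif_cont F1 -> unif_cont F2 ->
  J_ F1 + J_ F2 <= J_ (fun a => F1 a + F2 a).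
Proof.
move=> aF1 aF2 uF1 uF2; pose F a := F1 a + F2 a.
have aF : admissible F by exact: adm_add.
have [F10 _ [B1 tB1 F1B]] := aF1; have [F20 _ [B2 tB2 F2B]] := aF2.
pose B := B1 `|` B2; have tB : tot_bounded B by exact: tb_union.
pose K a := ind (B a); have aK : admissible K by exact: adm_ind.
(* [F1 + F2] may vanish, so the denominator of the multipliers is [max(F, d)]: this loses at most
   [d] on the common support [B], whence the terms in [K]. *)
suff H d eta : 0 < d -> 0 < eta -> J_ F1 + J_ F2 <= (1 + eta *+ 2) * J_ F + d *+ 2 * J_ K.
  apply/ler_addgt0Pr => e e0.
  have k0 : 0 < 2 * (J_ F + J_ K + 1) by rewrite mulr_gt0// ltr_wpDl// addr_ge0 ?J_ge0.
  have e'0 := divr_gt0 e0 k0.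
  apply: le_trans (H _ _ e'0 e'0) _; rewrite mulrDl mul1r -addrA lerD2l.
  rewrite [leLHS](_ : _ = e * ((2 * (J_ F + J_ K)) / (2 * (J_ F + J_ K + 1)))); last by ring.
  by rewrite ler_piMr ?(ltW e0)// ler_pdivrMr// mul1r ler_pM2l// lerDl.
move=> d0 eta0; pose D a := Num.max (F a) d.
have D0 a : 0 < D a by rewrite lt_max d0 orbT.
(* If [F1] and [F2] vary by at most [eta * d / 3], the denominator varies by at most twice that; as
   it is at least [d], the multipliers increase by at most [eta]. *)
have e0 : 0 < eta * d / 3 by rewrite divr_gt0// mulr_gt0.
have [j1 j1P] := uF1 _ e0; have [j2 j2P] := uF2 _ e0.
have [k kP] := N_dir j1 j2.
have key j : (forall a g, N j a g -> N k a g) ->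
    num j F1 + num j F2 <= (1 + eta *+ 2) * num j F + d *+ 2 * num j K.
  move=> jk; pose h (Fi : G -> R) a := Fi a / D a.
  have F_ge0 a : 0 <= F a by rewrite addr_ge0.
  have hi (Fi : G -> R) : (forall a, 0 <= Fi a) -> (forall a, Fi a <= F a) ->
      (forall a g, N j a g -> `|Fi a - Fi g| <= eta * d / 3) ->
      (forall a, Fi a != 0 -> B a) -> admissible Fi ->
      forall l, pos l -> (forall a, F a <= dom j l a) ->
      num j Fi <= \sum_(p <- l) p.1 * (h Fi p.2 + eta) + d * num j K.
    move=> Fi0 FiF uFi FiB aFi l pl Fl.
    have h_ge0 a : 0 <= h Fi a by rewrite divr_ge0 ?(ltW (D0 a)).
    have hun a g : N j a g -> h Fi a <= h Fi g + eta.
      move=> Nag; have /kP[/j1P n1 /j2P n2] := jk _ _ Nag; have n3 := uFi _ _ Nag.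
      have DD : D g <= D a + 2 * (eta * d / 3).
        rewrite /D ge_max; apply/andP; split.
          rewrite (@le_trans _ _ (F a + 2 * (eta * d / 3)))//; last by rewrite lerD2r le_max lexx.
          move: n1 n2; rewrite !ler_distl /F; lra.
        by rewrite ler_wpDr ?le_max ?lexx ?orbT// mulr_ge0// ltW.
      rewrite /h ler_pdivrMr// mulrDl.
      have e1 : Fi g / D g * D g <= Fi g / D g * (D a + 2 * (eta * d / 3)) by rewrite ler_wpM2l ?divr_ge0 ?(ltW (D0 _)).
      have e2 : Fi g / D g <= 1.
        by rewrite ler_pdivrMr// mul1r /D le_max FiF.
      have e3 : Fi a <= Fi g + eta * d / 3 by move: n3; rewrite ler_distl; lra.
      have e4 : eta * d <= eta * D a by rewrite ler_pM2l// le_max lexx orbT.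
      have e5 : Fi g / D g * (2 * (eta * d / 3)) <= 2 * (eta * d / 3).
        by rewrite ler_piMl// mulr_ge0// ltW.
      rewrite divfK ?gt_eqF// mulrDr in e1; lra.
    have split_F a : Fi a <= h Fi a * F a + d * K a.
      have [dF|Fd] := leP d (F a).
        by rewrite /h /D max_l// divfK ?gt_eqF ?(lt_le_trans d0)// lerDl mulr_ge0// ?(ltW d0)//; exact: ind0.
      have [Fa|Fa] := eqVneq (Fi a) 0.
        by rewrite Fa addr_ge0// mulr_ge0// ?(ltW d0)//; exact: ind0.
      rewrite /K /ind (asboolT (FiB _ Fa)) mulr1 ler_wpDl ?(mulr_ge0 (h_ge0 a) (F_ge0 a))//.
      by rewrite (le_trans (FiF a))// ltW.
    have adhF : admissible (fun a => h Fi a * F a).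
      have [_ [M FM] [B' tB' FB']] := aF; split; first by move=> a; rewrite mulr_ge0.
        exists M => a; rewrite (le_trans _ (FM a))// ler_piMl// /h ler_pdivrMr// mul1r.
        by rewrite le_max FiF.
      by exists B' => // a; rewrite mulf_eq0 negb_or => /andP[_ /FB'].
    have adK : admissible (fun a => d * K a) by apply: adm_scale => //; exact: ltW.
    apply: le_trans (num_mono j (adm_add adhF adK) split_F) _.
    apply: le_trans (num_add j adhF adK) _; apply: lerD; last exact: num_scale (ltW d0).
    apply: (@le_trans _ _ (cost [seq (p.1 * (h Fi p.2 + eta), p.2) | p <- l])); last first.
      by rewrite /cost big_map.
    apply: num_le.
      elim: l {Fl} pl => [//|q l IH] pl p /= [<-/=|].
        by rewrite mulr_ge0 ?addr_ge0 ?(ltW eta0)//; apply: pl; left.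
      by apply: IH => p' p'l; apply: pl; right.
    move=> a; rewrite (le_trans (ler_wpM2l (h_ge0 a) (Fl a)))// /dom mulr_sumr big_map/=.
    apply: ler_suml => p /pl p0; rewrite /ind; case: asboolP => [Nap|_]; last by rewrite !mulr0.
    by rewrite !mulr1 mulrC ler_wpM2l//; exact: hun.
  apply/ler_addgt0Pr => e ep.
  have c0 : 0 < 1 + eta *+ 2 by rewrite ltr_pwDl// mulrn_wge0// ltW.
  have [l [pl Fl /ltW cl]] := num_adh j aF (divr_gt0 ep c0).
  have F1F a : F1 a <= F a by rewrite lerDl.
  have F2F a : F2 a <= F a by rewrite lerDr.
  have b1 := hi F1 F10 F1F (fun a g Nag => j1P _ _ (proj1 (kP _ _ (jk _ _ Nag)))) (fun a Fa => or_introl (F1B a Fa)) aF1 l pl Fl.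
  have b2 := hi F2 F20 F2F (fun a g Nag => j2P _ _ (proj2 (kP _ _ (jk _ _ Nag)))) (fun a Fa => or_intror (F2B a Fa)) aF2 l pl Fl.
  (* The multipliers of [F1] and [F2] add up to at most 1, so the weights are shared between the two
     functions. *)
  have b3 : \sum_(p <- l) p.1 * (h F1 p.2 + eta) + \sum_(p <- l) p.1 * (h F2 p.2 + eta) <= (1 + eta *+ 2) * cost l.
    rewrite -big_split/= /cost mulr_sumr; apply: ler_suml => p /pl p0.
    rewrite -mulrDr mulrC ler_wpM2r// addrACA mulr2n lerD2r /h -mulrDl ler_pdivrMr//.
    by rewrite mul1r /D le_max lexx.
  have b4 : (1 + eta *+ 2) * cost l <= (1 + eta *+ 2) * num j F + e.
    by rewrite (le_trans (ler_wpM2l (ltW c0) cl))// mulrDr mulrCA divff ?gt_eqF// mulr1.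
  rewrite mulr2n mulrDl; lra.
have c1 := ratio_cvg aF1; have c2 := ratio_cvg aF2; have c3 := ratio_cvg aF; have c4 := ratio_cvg aK.
have L : (fun j => ratio F1 j + ratio F2 j) j @[j --> U] --> J_ F1 + J_ F2 by exact: cvgD.
have L' : (fun j => (1 + eta *+ 2) * ratio F j + d *+ 2 * ratio K j) j @[j --> U] -->
    (1 + eta *+ 2) * J_ F + d *+ 2 * J_ K.
  by apply: cvgD; exact: cvgMr.
rewrite -(cvg_lim _ L)// -(cvg_lim _ L')//.
apply: ulim_le; [by apply/cvg_ex; eexists; exact: L|by apply/cvg_ex; eexists; exact: L'|].
apply: Ubase; exists k => // j /key H /=.
by rewrite /ratio !mulrA -!mulrDl ler_pM2r// invr_gt0.
Qed.

Let J_add F1 F2 : admissible F1 -> admissible F2 -> unif_cont F1 -> unif_cont F2 ->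
  J_ (fun a => F1 a + F2 a) = J_ F1 + J_ F2.
Proof. by move=> *; apply/eqP; rewrite eq_le J_subadd//= J_superadd. Qed.

Let adm_pos F : (exists M, forall a, `|F a| <= M) ->
  (exists2 B, tot_bounded B & forall a, F a != 0 -> B a) ->
  admissible (fun a => Num.max (F a) 0).
Proof.
move=> [M FM] [B tB FB]; split=> [a||]; first by rewrite le_max lexx orbT.
  exists M => a; rewrite ge_max (le_trans (ler_norm _) (FM a))/=.
  exact: le_trans (normr_ge0 _) (FM a).
exists B => // a; have [->|/FB//] := eqVneq (F a) 0.
by rewrite maxxx eqxx.
Qed.

Let uc_pos F : unif_cont F -> unif_cont (fun a => Num.max (F a) 0).
Proof.
move=> uF e /uF[j jP]; exists j => a g /jP; apply: le_trans.
rewrite ler_norml; have := ler_norm (F a - F g); have := ler_norm (- (F a - F g)).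
rewrite normrN; case: (leP (F a) 0); case: (leP (F g) 0); lra.
Qed.

Definition haar_dom F := [/\ (exists M, forall a, `|F a| <= M),
  (exists2 B, tot_bounded B & forall a, F a != 0 -> B a) & unif_cont F].

Lemma haar_domN F : haar_dom F -> haar_dom (fun a => - F a).
Proof.
move=> [[M FM] [B tB FB] uF]; split; first by exists M => a; rewrite normrN.
  by exists B => // a; rewrite oppr_eq0; exact: FB.
by move=> e /uF[j jP]; exists j => a g /jP; rewrite -opprD normrN.
Qed.

Lemma haar_domD F F' : haar_dom F -> haar_dom F' -> haar_dom (fun a => F a + F' a).
Proof.
move=> [[M FM] [B tB FB] uF] [[M' FM'] [B' tB' FB'] uF']; split.
- by exists (M + M') => a; rewrite (le_trans (ler_normD _ _))// lerD.
- exists (B `|` B'); first exact: tb_union.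
  move=> a; have [->|/FB] := eqVneq (F a) 0; last by left.
  by rewrite add0r => /FB'; right.
- move=> e e0; have e20 : 0 < e / 2 by rewrite divr_gt0.
  have [j jP] := uF _ e20; have [j' jP'] := uF' _ e20.
  have [k kP] := N_dir j j'; exists k => a g /kP[/jP H /jP' H'].
  by rewrite opprD addrACA (le_trans (ler_normD _ _))// (splitr e) lerD.
Qed.

Lemma haar_domZ F c : haar_dom F -> haar_dom (fun a => c * F a).
Proof.
move=> [[M FM] [B tB FB] uF]; split.
- by exists (`|c| * M) => a; rewrite normrM ler_wpM2l.
- by exists B => // a; rewrite mulf_eq0 negb_or => /andP[_ /FB].
- move=> e e0; have c1 : 0 < `|c| + 1 by rewrite ltr_wpDl.
  have [j jP] := uF _ (divr_gt0 e0 c1); exists j => a g /jP H.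
  rewrite -mulrBr normrM (le_trans (ler_wpM2l _ H))//.
  by rewrite mulrCA ler_piMr ?(ltW e0)// ler_pdivrMr// mul1r lerDl.
Qed.

(** Meant for derivatives, which will be uniform limits of difference quotients with supports in a
    common set. *)
Lemma haar_dom_lim B F : tot_bounded B ->
  (forall e : R, 0 < e -> exists2 F', haar_dom F' & forall a, `|F a - F' a| <= e) ->
  (forall a, F a != 0 -> B a) -> haar_dom F.
Proof.
move=> tB FF' FB; split; last 1 first.
- move=> e e0; have e30 : 0 < e / 3 by rewrite divr_gt0.
  have [F' [_ _ uF'] H] := FF' _ e30.
  have [j jP] := uF' _ e30; exists j => a g /jP.
  by move: (H a) (H g); rewrite !ler_norml; lra.
- have [F' [[M FM] _ _] H] := FF' 1 ltr01.
  exists (1 + M) => a; rewrite -[F a](subrK (F' a)) (le_trans (ler_normD _ _))//.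
  by rewrite lerD.
- by exists B.
Qed.

(** [J_] is additive on nonnegative functions, so [J_ P - J_ Q] depends only on [P - Q], and
    positive and negative parts extend it to signed functions. In the bound, [C] depends on the set
    [B] only, as differentiation under the functional requires. *)
Theorem haar_functional : exists I : (G -> R) -> R,
  [/\ forall F F', haar_dom F -> haar_dom F' -> I (fun a => F a + F' a) = I F + I F',
      forall c F, haar_dom F -> I (fun a => c * F a) = c * I F,
      forall B, tot_bounded B -> exists2 C, 0 <= C & forall F m, haar_dom F ->
        (forall a, F a != 0 -> B a) -> (forall a, `|F a| <= m) -> `|I F| <= C * m,
      forall F b, haar_dom F -> I (fun a => F (mul a b)) = I F &
      forall F c j, haar_dom F -> (forall a, 0 <= F a) -> 0 < c ->
        (forall a, N j a one -> c <= F a) -> 0 < I F].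
Proof.
pose p F a : R := Num.max (F a) 0; pose I F := J_ (p F) - J_ (p (fun a => - F a)).
have ap F : haar_dom F -> admissible (p F) by move=> [bF sF _]; exact: adm_pos.
have up F : haar_dom F -> unif_cont (p F) by move=> [_ _ uF]; exact: uc_pos.
have pN F a : p F a - p (fun a => - F a) a = F a.
  by rewrite /p; case: (leP (F a) 0); case: (leP (- F a) 0); lra.
have IE F P Q : haar_dom F -> admissible P -> admissible Q -> unif_cont P -> unif_cont Q ->
    (forall a, F a = P a - Q a) -> I F = J_ P - J_ Q.
  move=> hF aP aQ uP uQ FE; have hN := haar_domN hF.
  apply/eqP; rewrite subr_eq addrAC eq_sym subr_eq; apply/eqP.
  rewrite -(J_add aP (ap _ hN) uP (up _ hN)) -(J_add (ap _ hF) aQ (up _ hF) uQ).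
  congr J_; apply/funext => a.
  by have := pN F a; rewrite FE; lra.
have hP F : haar_dom F -> (forall a, 0 <= F a) -> I F = J_ F.
  move=> hF F0; have pF : p F = F by apply/funext => a; rewrite /p max_l.
  have p0 : p (fun a => - F a) = fun=> 0 by apply/funext => a; rewrite /p max_r// oppr_le0.
  have aF : admissible F by rewrite -pF; exact: ap.
  rewrite /I pF p0; have := J_scale aF (lexx 0); rewrite mul0r.
  by under eq_fun do rewrite mul0r; move=> ->; rewrite subr0.
have tbind B : tot_bounded B -> admissible (fun a => ind (B a)) by exact: adm_ind.
exists I; split.
- move=> F F' hF hF'; have hN := haar_domN hF; have hN' := haar_domN hF'.
  rewrite (@IE (fun a => F a + F' a) (fun a => p F a + p F' a)
    (fun a => p (fun a => - F a) a + p (fun a => - F' a) a)).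
  + rewrite (J_add (ap _ hF) (ap _ hF') (up _ hF) (up _ hF')).
    by rewrite (J_add (ap _ hN) (ap _ hN') (up _ hN) (up _ hN')) /I opprD addrACA.
  + exact: haar_domD.
  + by apply: adm_add; exact: ap.
  + by apply: adm_add; exact: ap.
  + move=> e e0; have [_ _ H] := haar_domD hF hF'.
    have e20 : 0 < e / 2 by rewrite divr_gt0.
    have [j jP] := up _ hF _ e20; have [j' jP'] := up _ hF' _ e20.
    have [k kP] := N_dir j j'; exists k => a g /kP[/jP H1 /jP' H2].
    by rewrite opprD addrACA (le_trans (ler_normD _ _))// (splitr e) lerD.
  + move=> e e0.
    have e20 : 0 < e / 2 by rewrite divr_gt0.
    have [j jP] := up _ hN _ e20; have [j' jP'] := up _ hN' _ e20.
    have [k kP] := N_dir j j'; exists k => a g /kP[/jP H1 /jP' H2].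
    by rewrite opprD addrACA (le_trans (ler_normD _ _))// (splitr e) lerD.
  + by move=> a; have := pN F a; have := pN F' a; lra.
- have Ipos c F : 0 <= c -> haar_dom F -> I (fun a => c * F a) = c * I F.
    move=> c0 hF; rewrite /I mulrBr -(J_scale (ap _ hF) c0) -(J_scale (ap _ (haar_domN hF)) c0).
    congr (J_ _ - J_ _); apply/funext => a; rewrite /p ?maxr_pMr// ?mulr0//.
    by rewrite mulrN.
  move=> c F hF; have [c0|c0] := leP 0 c; first exact: Ipos.
  have IN F' : haar_dom F' -> I (fun a => - F' a) = - I F'.
    move=> hF'; rewrite /I opprB; congr (_ - J_ _); congr p.
    by apply/funext => a; rewrite opprK.
  rewrite -[c * I F]opprK -mulNr -Ipos ?oppr_ge0 ?(ltW c0)// -IN; last exact: haar_domZ.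
  by congr I; apply/funext => a; rewrite mulNr opprK.
- move=> B tB; exists (J_ (fun a => ind (B a))); first exact/J_ge0/tbind.
  move=> F m hF FB Fm; have hN := haar_domN hF.
  have m0 : 0 <= m by exact: le_trans (normr_ge0 _) (Fm one).
  have b F' : haar_dom F' -> (forall a, F' a != 0 -> B a) -> (forall a, `|F' a| <= m) ->
      0 <= J_ (p F') <= J_ (fun a => ind (B a)) * m.
    move=> hF' F'B F'm; apply/andP; split; first exact/J_ge0/ap.
    rewrite mulrC -(J_scale (tbind _ tB) m0).
    apply: J_mono; [exact: ap|by apply: adm_scale => //; exact: tbind|].
    move=> a; rewrite /p; have [Fa|Fa] := eqVneq (F' a) 0.
      by rewrite Fa maxxx mulr_ge0//; exact: ind0.
    rewrite /ind (asboolT (F'B _ Fa)) mulr1 ge_max m0 andbT.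
    exact: le_trans (ler_norm _) (F'm a).
  have /andP[b1 b2] := b _ hF FB Fm.
  have /andP[b3 b4] : 0 <= J_ (p (fun a => - F a)) <= J_ (fun a => ind (B a)) * m.
    apply: b => // a; first by rewrite oppr_eq0; exact: FB.
    by rewrite normrN.
  by rewrite /I ler_norml; lra.
- move=> F b hF; have hN := haar_domN hF.
  rewrite /I -(J_translate b (ap _ hF)) -(J_translate b (ap _ hN))//.
- move=> F c j hF F0 c0 Fc; rewrite hP//.
  have aF : admissible F.
    by move: (ap _ hF); congr admissible; apply/funext => a; rewrite /p max_l.
  (* The neighbourhood [j0] of the unit is covered by finitely many translates of the neighbourhood
     [j], so that finitely many translates of [F] dominate [c * W], whose value is [c]. *)
  have [s sB] := W_tb j.
  have aFg g : admissible (fun a => F (mul a (inv g))) by exact: adm_translate.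
  have aS s' : admissible (fun a => \sum_(g <- s') F (mul a (inv g))).
    elim: s' => [|g s' IH].
      split; [by move=> a; rewrite big_nil|by exists 0 => a; rewrite big_nil|].
      by exists set0 => [i|a]; [exists [::]|rewrite big_nil eqxx].
    under eq_fun do rewrite big_cons; exact: adm_add.
  have tr (g a : G) : N j a g <-> N j (mul a (inv g)) one.
    by rewrite -(mulV g) N_inv.
  have JS s' : J_ (fun a => \sum_(g <- s') F (mul a (inv g))) <= (size s')%:R * J_ F.
    elim: s' => [|g s' IH].
      rewrite [leRHS](_ : _ = J_ (fun a => 0 * F a)); last by rewrite J_scale// !mul0r.
      by apply: J_mono; [exact: aS|exact: adm_scale|move=> a; rewrite big_nil mul0r].
    under eq_fun do rewrite big_cons.
    rewrite (le_trans (J_subadd (aFg g) (aS s')))// J_translate//.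
    by rewrite -[X in _ <= X%:R * _]add1n natrD mulrDl mul1r lerD2l.
  have : c * 1 <= (size s)%:R * J_ F.
    have <- : J_ (fun a => c * W a) = c * 1 by rewrite (J_scale adm_W (ltW c0)) J_W.
    apply: le_trans (JS s).
    apply: J_mono; [by apply: adm_scale => //; exact: ltW|exact: aS|].
    move=> a; rewrite /W /ind; case: asboolP => [Wa|_]; last by rewrite mulr0 sumr_ge0.
    rewrite mulr1; have [g gs Nag] := sB a Wa.
    elim: s gs {sB JS} => [//|g' s IH] /=; rewrite big_cons => -[->|/IH H].
      by rewrite (le_trans (Fc _ (proj1 (tr _ _) Nag)))// lerDl sumr_ge0.
    by rewrite ler_wpDl.
  rewrite mulr1 => H; have := lt_le_trans c0 H.
  have [->|Jn] := eqVneq (J_ F) 0; first by rewrite mulr0 ltxx.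
  by rewrite [0 < J_ F]lt_neqAle eq_sym Jn (J_ge0 aF).
Qed.

End haar.

(** * Hermitian forms and metrics *)

Section hermitian_algebra.
Local Open Scope sesquilinear_scope.
Context {R : realType} {n : nat}.
Local Notation C := R[i].
Local Notation V := (Cn R n).

Definition hermitian_form (h : V -> V -> R) :=
  [/\ forall (t : R) u v w, h (t%:C *: u + v) w = t * h u w + h v w,
      forall v w, h v w = h w v,
      forall v, v != 0 -> 0 < h v v &
      forall v w, h ('i *: v) ('i *: w) = h v w].

Section form.
Context (h : V -> V -> R) (hh : hermitian_form h).

Lemma hf0l w : h 0 w = 0.
Proof. by have [H _ _ _] := hh; have := H (-1) 0 0 w; rewrite scaler0 addr0 mulN1r addNr. Qed.
Lemma hfDl u v w : h (u + v) w = h u w + h v w.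
Proof. by have [H _ _ _] := hh; have := H 1 u v w; rewrite scale1r mul1r. Qed.
Lemma hfZl (t : R) u w : h (t%:C *: u) w = t * h u w.
Proof. by have [H _ _ _] := hh; have := H t u 0 w; rewrite !addr0 hf0l addr0. Qed.
Lemma hfC v w : h v w = h w v. Proof. by have [_ H _ _] := hh. Qed.
Lemma hfDr u v w : h w (u + v) = h w u + h w v.
Proof. by rewrite hfC hfDl !(hfC w). Qed.
Lemma hfZr (t : R) u w : h w (t%:C *: u) = t * h w u.
Proof. by rewrite hfC hfZl (hfC w). Qed.
Lemma hfJ v w : h ('i *: v) ('i *: w) = h v w. Proof. by have [_ _ _ H] := hh. Qed.
Lemma hfNl v w : h (- v) w = - h v w.
Proof. have -> : - v = (-1 : R)%:C *: v by rewrite rmorphN scaleN1r.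
by rewrite hfZl mulN1r. Qed.
Lemma hfJr v w : h v ('i *: w) = - h ('i *: v) w.
Proof. by rewrite -hfJ scalerA -expr2 sqr_i scaleN1r hfC hfNl hfC. Qed.
Lemma hf_ge0 v : 0 <= h v v.
Proof. by have [->|v0] := eqVneq v 0; [rewrite hf0l|have [_ _ H _] := hh; rewrite ltW// H]. Qed.

(** The sesquilinear form with real part [h]; invariance under ['i] makes it complex linear in
    [v]. *)
Let hc (v w : V) : C := (h v w) +i* (h v ('i *: w)).

Let hcD u v w : hc (u + v) w = hc u w + hc v w.
Proof. by rewrite /hc !hfDl. Qed.

Let hcZ (a : C) v w : hc (a *: v) w = a * hc v w.
Proof.
case: a => a b; have -> : (a +i* b) *: v = a%:C *: v + b%:C *: ('i *: v).
  rewrite scalerA -scalerDl; congr (_ *: _); apply/eqP; rewrite eq_complex/=.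
  by rewrite !mul0r !mulr0 mulr1 !addr0 subrr addr0 add0r !eqxx.
rewrite hcD /hc !hfZl hfJ -(opprK (h ('i *: v) w)) -hfJr.
by apply/eqP; rewrite eq_complex/= mulrN eqxx/= addrC.
Qed.

Let hc_conj v w : hc w v = (hc v w)^*%C.
Proof. by rewrite /hc/= (hfC w v) hfJr (hfC _ v) hfJr. Qed.

Let delta (i : 'I_n) : V := delta_mx i 0.
Let H : 'M[C]_n := \matrix_(j, k) hc (delta j) (delta k).

Let colE (v : V) : v = \sum_i v i 0 *: delta i.
Proof.
by rewrite {1}[v]matrix_sum_delta; apply: eq_bigr => i _; rewrite big_ord1.
Qed.

Let hcE v w : hc v w = \sum_j \sum_k v j 0 * (w k 0)^*%C * H j k.
Proof.
have hc0 u : hc 0 u = 0 by rewrite -(scale0r 0) hcZ mul0r.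
have sl (I : Type) (r : seq I) (f : I -> V) u : hc (\sum_(i <- r) f i) u = \sum_(i <- r) hc (f i) u.
  elim: r => [|i r IH]; first by rewrite !big_nil hc0.
  by rewrite !big_cons hcD IH.
rewrite {1}(colE v) sl; apply: eq_bigr => j _; rewrite hcZ.
rewrite hc_conj {1}(colE w) sl rmorph_sum mulr_sumr; apply: eq_bigr => k _.
have -> : H j k = (hc (delta k) (delta j))^*%C by rewrite mxE hc_conj.
by rewrite hcZ -mulrA; congr (_ * _); exact: (rmorphM (@conjc R)).
Qed.

Let Hherm : H \is hermsymmx.
Proof.
apply/is_hermitianmxP; rewrite expr0 scale1r; apply/matrixP => j k.
by rewrite !mxE hc_conj.
Qed.

Let P := spectralmx H.
Let D := spectral_diag H.

Let HE : H = P^t* *m diag_mx D *m P.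
Proof.
have /hermitian_normalmx/orthomx_spectralP HE := Hherm.
by rewrite {1}HE invmx_unitary ?spectral_unitarymx.
Qed.

(** Spectral theorem for the Gram matrix: [S] is a unitary matrix followed by the square roots of
    the eigenvalues, which are positive because [h] is. *)
Lemma hermitian_form_diag : exists2 S : 'M[C]_n, S \in unitmx &
  forall v w, flat_form (S *m v) (S *m w) = h v w.
Proof.
(* In [v^T H conj(w)] the matrix acting on vectors is the conjugate of [P]. *)
pose Q : 'M[C]_n := map_mx Num.conj P.
have Qu : Q \in unitmx.
  by apply: unitarymx_unit; rewrite conjC_unitary spectral_unitarymx.
have DR j : D 0 j = (complex.Re (D 0 j))%:C.
  by rewrite RRe_real//; have /mxOverP := hermitian_spectral_diag_real Hherm; apply.
have key v w : hc v w = \sum_j (Q *m v) j 0 * D 0 j * Num.conj ((Q *m w) j 0).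
  have -> : hc v w = (v^T *m H *m map_mx Num.conj w) 0 0.
    rewrite hcE mxE exchange_big; apply: eq_bigr => k _.
    rewrite !mxE mulr_suml; apply: eq_bigr => j _; rewrite mxE.
    by rewrite !mxE mulrAC.
  have -> : v^T *m H *m map_mx Num.conj w =
      (Q *m v)^T *m diag_mx D *m map_mx Num.conj (Q *m w).
    rewrite HE trmx_mul -map_trmx map_mxM -map_mx_comp (map_mx_id (@conjCK _)).
    by rewrite !mulmxA.
  rewrite mxE; apply: eq_bigr => j _; rewrite !mxE; congr (_ * _).
  by rewrite (bigD1 j)//= big1 ?addr0 => [|k kj]; rewrite !mxE ?eqxx ?mulr1n ?(negbTE kj) ?mulr0n ?mulr0.
have D0 j : 0 < complex.Re (D 0 j).
  pose v : V := invmx Q *m delta j.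
  have v0 : v != 0.
    apply/eqP => /(congr1 (mulmx Q)); rewrite mulKVmx// mulmx0 => /matrixP/(_ j 0).
    by rewrite !mxE !eqxx => /eqP; rewrite oner_eq0.
  have : 0 < h v v by have [_ _ H' _] := hh; exact: H'.
  have := key v v; rewrite mulKVmx// (bigD1 j)//= big1 => [|k kj]; last first.
    by rewrite !mxE (negbTE kj) !mul0r.
  rewrite !mxE !eqxx conjC1 mul1r mulr1 addr0.
  by move=> <-.
pose s : 'rV[C]_n := \row_j (Num.sqrt (complex.Re (D 0 j)))%:C.
exists (diag_mx s *m Q).
  rewrite unitmx_mul Qu andbT unitmxE det_diag unitfE.
  apply/prodf_neq0 => j _; rewrite mxE; apply/eqP => -[] /eqP.
  by rewrite sqrtr_eq0 leNgt D0.
move=> v w; have -> : h v w = complex.Re (hc v w) by [].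
rewrite key /flat_form; congr (complex.Re _); apply: eq_bigr => j _.
have Sj u : (diag_mx s *m Q *m u) j 0 = s 0 j * (Q *m u) j 0.
  rewrite -mulmxA mxE (bigD1 j)//= big1 ?addr0 => [|k kj]; rewrite !mxE ?eqxx ?mulr1n//.
  by rewrite eq_sym (negbTE kj) mulr0n mul0r.
rewrite !Sj [(_ * _)^*%C]rmorphM /= [s 0 j]mxE conjc_real.
have DE : D 0 j = (Num.sqrt (complex.Re (D 0 j)))%:C * (Num.sqrt (complex.Re (D 0 j)))%:C.
  by rewrite -rmorphM -expr2 sqr_sqrtr ?(ltW (D0 j))// -DR.
rewrite [X in _ = _ * X * _]DE.
move: (Num.sqrt _)%:C ((Q *m v) j 0) ((Q *m w) j 0) => a b c.
have -> : Num.conj c = c^*%C by [].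
move: (c^*%C) => c'; ring.
Qed.

End form.

End hermitian_algebra.

(** * Comparison of a metric with the norm of C^n *)

Section metric_bounds.
Context {R : realType} {n : nat}.
Local Notation V := (Cn R n).

Definition metric_on (U : set V) (G : V -> V -> V -> R) :=
  (forall z, U z -> hermitian_form (G z)) /\
  forall v w, smooth_on U (fun z => G z v w).

Lemma flat_form_hermitian : hermitian_form (@flat_form R n).
Proof.
pose F := Cn_flat R n; split=> [t u v w|v w|v|v w].
- exact: (@hm_linear R n _ F tt 0 I).
- exact: (@hm_sym R n _ F tt 0 I).
- exact: (@hm_pos R n _ F tt 0 I).
- exact: (@hm_J R n _ F tt 0 I).
Qed.

Lemma metric_on_chart (X : complexManifold R n) (g : hermitianMetric X) c :
  metric_on (chart c @` dom c) (fun z => g c (chart_inv c z)).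
Proof.
split=> [_ [x cx <-]|v w]; last exact: hm_smooth.
rewrite cm_chartK//; split.
- exact: hm_linear.
- exact: hm_sym.
- exact: hm_pos.
- exact: hm_J.
Qed.

(** A metric is only real bilinear, so C^n is given the real basis [e_i], ['i *: e_i]; the
    coefficients of a metric in it are smooth functions. *)
Definition rbasis (k : 'I_(n + n)) : V :=
  match fintype.split k with inl i => delta_mx i 0 | inr i => 'i *: delta_mx i 0 end.

Definition rcoord (k : 'I_(n + n)) (v : V) : R :=
  match fintype.split k with inl i => complex.Re (v i 0) | inr i => complex.Im (v i 0) end.

Lemma rcoordE v : v = \sum_k (rcoord k v)%:C *: rbasis k.
Proof.
rewrite big_split_ord/= -big_split/= {1}[v]matrix_sum_delta.
apply: eq_bigr => i _; rewrite big_ord1 /rcoord /rbasis.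
rewrite (unsplitK (inl i)) (unsplitK (inr i)) scalerA -scalerDl.
by congr (_ *: _); rewrite {1}[v i 0]complexE mulrC.
Qed.

Lemma rcoord_le k v : `|rcoord k v| <= rnorm v.
Proof.
rewrite /rcoord; case: fintype.split => i; rewrite (le_trans _ (coord_le_rnorm v i))//.
  exact: Re_le_rnorm.
exact: Im_le_rnorm.
Qed.

Lemma rcoordD k u v : rcoord k (u + v) = rcoord k u + rcoord k v.
Proof. by rewrite /rcoord; case: fintype.split => i; rewrite mxE raddfD. Qed.

Lemma rcoordZ k (t : R) v : rcoord k (t%:C *: v) = t * rcoord k v.
Proof.
rewrite /rcoord; case: fintype.split => i; rewrite mxE; case: (v i 0) => a b /=.
  by rewrite mul0r subr0.
by rewrite mul0r addr0.
Qed.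

Definition rlinear (L : V -> R) := forall (t : R) u v, L (t%:C *: u + v) = t * L u + L v.

Lemma rlinearE (L : V -> R) v : rlinear L -> L v = \sum_k rcoord k v * L (rbasis k).
Proof.
move=> lL; have L0 : L 0 = 0.
  by have := lL (-1) 0 0; rewrite scaler0 addr0 mulN1r addNr.
rewrite {1}(rcoordE v); elim/big_rec2: _ => // k x u _ <-.
exact: lL.
Qed.

Lemma hf_rlinear_l (h : V -> V -> R) w : hermitian_form h -> rlinear (h^~ w).
Proof. by move=> [H _ _ _] t u v; rewrite H. Qed.

Lemma hf_rlinear_r (h : V -> V -> R) w : hermitian_form h -> rlinear (h w).
Proof. by move=> [H S _ _] t u v; rewrite S H !(S w). Qed.

Lemma hf_expand (h : V -> V -> R) v w : hermitian_form h ->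
  h v w = \sum_k \sum_l rcoord k v * rcoord l w * h (rbasis k) (rbasis l).
Proof.
move=> hh; rewrite (rlinearE v (hf_rlinear_l w hh)); apply: eq_bigr => k _.
rewrite (rlinearE w (hf_rlinear_r _ hh)) mulr_sumr; apply: eq_bigr => l _.
by rewrite mulrA.
Qed.

Lemma finite_eps (I : finType) (P : I -> R -> Prop) :
  (forall i, exists2 d : R, 0 < d & P i d) ->
  (forall i d d', 0 < d' -> d' <= d -> P i d -> P i d') ->
  exists2 d : R, 0 < d & forall i, P i d.
Proof.
move=> H mP; have H' i : exists d : R, 0 < d /\ P i d by have [d] := H i; exists d.
have [d dP] := choice H'.
have d0 : 0 < \big[Num.min/1]_i d i.
  by elim/big_ind: _ => // [x y x0 y0|i _]; [rewrite lt_min x0|have [] := dP i].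
exists (\big[Num.min/1]_i d i) => // i; apply: mP (proj2 (dP i)) => //.
by rewrite (bigD1 i)//= ge_min lexx.
Qed.

Lemma continuous_eps (f : V -> R) z (e : R) : {for z, continuous f} -> 0 < e ->
  exists2 d : R, 0 < d & forall y, rnorm (y - z) < d -> `|f y - f z| <= e.
Proof.
move=> cf e0; have /cvgrPdist_le/(_ _ e0)/nbhs_rnormP[d d0 dP] := cf.
by exists d => // y /dP; rewrite distrC.
Qed.

Lemma eps_continuous (f : V -> R) z :
  (forall e : R, 0 < e -> exists2 d : R, 0 < d &
    forall y, rnorm (y - z) < d -> `|f y - f z| <= e) -> {for z, continuous f}.
Proof.
move=> H A /nbhs_ballP[e /= e0 eA].
have [|d d0 dP] := H (e / 2); first by rewrite divr_gt0.
apply/nbhs_rnormP; exists d => // y /dP yd; apply: eA.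
by rewrite -ball_normE/= distrC (le_lt_trans yd)// ltr_pdivrMr// mulr2n mulrDr mulr1 ltrDl.
Qed.

(** Smoothness is stated for one pair of vectors at a time; the finitely many pairs of basis vectors
    make the estimate uniform in [v] and [w]. *)
Lemma metric_continuous U G z0 (e : R) : open U -> metric_on U G -> U z0 -> 0 < e ->
  exists2 d : R, 0 < d & forall z, rnorm (z - z0) < d -> U z /\
    forall v w, `|G z v w - G z0 v w| <= e * (rnorm v * rnorm w).
Proof.
move=> oU [hG sG] Uz0 e0; pose m := (n + n)%N; pose e' := e / (m * m).+1%:R.
have e'0 : 0 < e' by rewrite divr_gt0.
have [d0 d00 d0P] : exists2 d : R, 0 < d & forall z, rnorm (z - z0) < d -> U z.
  by have /open_rnormP/(_ _ Uz0) := oU.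
have [d1 d10 d1P] : exists2 d : R, 0 < d & forall kl : 'I_m * 'I_m, forall z, rnorm (z - z0) < d ->
    `|G z (rbasis kl.1) (rbasis kl.2) - G z0 (rbasis kl.1) (rbasis kl.2)| <= e'.
  apply: finite_eps => [kl|kl d d' _ d'd + z zd']; last by apply; exact: lt_le_trans d'd.
  have [/(_ z0 Uz0) cG _] := sG (rbasis kl.1) (rbasis kl.2) 0%N.
  by have [d d0' dP] := continuous_eps cG e'0; exists d.
exists (Num.min d0 d1); rewrite ?lt_min ?d00// => z; rewrite lt_min => /andP[/d0P Uz kP].
split=> // v w.
rewrite (hf_expand v w (hG _ Uz)) (hf_expand v w (hG _ Uz0)) -sumrB.
under eq_bigr do rewrite -sumrB.
under eq_bigr do under eq_bigr do rewrite -mulrBr.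
rewrite (le_trans (ler_norm_sum _ _ _))//.
apply: (@le_trans _ _ (\sum_(k < m) \sum_(l < m) rnorm v * rnorm w * e')).
  apply: ler_sum => k _; rewrite (le_trans (ler_norm_sum _ _ _))//.
  apply: ler_sum => l _; rewrite !normrM ler_pM ?mulr_ge0 ?ler_pM ?rcoord_le//.
  exact: d1P (k, l) _ kP.
rewrite !sumr_const !card_ord -!mulrnA -mulr_natr -mulrA mulrC ler_wpM2r ?mulr_ge0 ?rnorm_ge0//.
by rewrite /e' mulrAC ler_pdivrMr// ler_pM2l// ler_nat.
Qed.

(** At [z0] the diagonalizing matrix compares the metric with the flat one; nearby, a variation by
    [m / 2] leaves half of the lower bound. *)
Lemma metric_bounds U G z0 : open U -> metric_on U G -> U z0 ->
  exists r m M : R, [/\ 0 < r, 0 < m, 0 < M & forall z, rnorm (z - z0) < r -> U z /\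
    forall v, m * rnorm v ^+ 2 <= G z v v <= M * rnorm v ^+ 2].
Proof.
move=> oU mG Uz0; have [hG _] := mG.
have [S Su SE] := hermitian_form_diag (hG _ Uz0).
have lS (A : 'M[R[i]]_n) : linear (fun v : V => A *m v : V).
  by move=> a u v; rewrite mulmxDr -scalemxAr.
have [k k0 kP] := lin_bounded (lS S).
have [k' k'0 k'P] := lin_bounded (lS (invmx S)).
have flat_le (v : V) : rnorm v ^+ 2 <= flat_form v v.
  have f0 : 0 <= flat_form v v by exact: hf_ge0 flat_form_hermitian _.
  rewrite -[leRHS]sqr_sqrtr// ler_sqr ?nnegrE ?rnorm_ge0 ?sqrtr_ge0//.
  apply: rnorm_le_coord; first exact: sqrtr_ge0.
  move=> i; rewrite rnorm_sqrt ler_wsqrtr// /flat_form raddf_sum/= (bigD1 i)//= ler_wpDr//.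
    by apply: sumr_ge0 => j _; case: (v j 0) => a b /=; rewrite mulrN opprK -!expr2 addr_ge0 ?sqr_ge0.
  by case: (v i 0) => a b /=; rewrite mulrN opprK -!expr2.
have flat_ge (v : V) : flat_form v v <= n%:R * rnorm v ^+ 2 *+ 2.
  rewrite /flat_form raddf_sum/= -mulr_natl mulrCA -[n in n%:R]card_ord.
  rewrite -sumr_const mulr_suml; apply: ler_sum => i _; rewrite mul1r.
  have H := coord_le_rnorm v i.
  have h1 := le_trans (Re_le_rnorm _) H; have h2 := le_trans (Im_le_rnorm _) H.
  case: (v i 0) h1 h2 => a b /=; rewrite mulrN opprK -!expr2 => h1 h2.
  have a2 : a ^+ 2 <= rnorm v ^+ 2 by rewrite -real_normK ?num_real// ler_sqr ?nnegrE ?rnorm_ge0.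
  have b2 : b ^+ 2 <= rnorm v ^+ 2 by rewrite -real_normK ?num_real// ler_sqr ?nnegrE ?rnorm_ge0.
  by lra.
pose m := (k' ^+ 2)^-1; have m0 : 0 < m by rewrite invr_gt0 exprn_gt0.
have low v : m * rnorm v ^+ 2 <= G z0 v v.
  rewrite -SE (le_trans _ (flat_le _))// /m mulrC ler_pdivrMr ?exprn_gt0//.
  rewrite -exprMn ler_sqr ?nnegrE ?mulr_ge0 ?rnorm_ge0 ?(ltW k'0)// mulrC.
  by have := k'P (S *m v); rewrite mulKmx.
pose M := (n%:R *+ 2) * k ^+ 2; have M0 : 0 <= M by rewrite mulr_ge0 ?mulrn_wge0 ?exprn_ge0 ?(ltW k0).
have high v : G z0 v v <= M * rnorm v ^+ 2.
  rewrite -SE (le_trans (flat_ge _))// /M -mulrA -exprMn -mulrnAl ler_wpM2l ?mulrn_wge0//.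
  by rewrite ler_sqr ?nnegrE ?mulr_ge0 ?rnorm_ge0 ?(ltW k0)//; exact: kP.
have m20 : 0 < m / 2 by rewrite divr_gt0.
have [r r0 rP] := metric_continuous oU mG Uz0 m20.
exists r, (m / 2), (M + m); split=> //; first by rewrite ltr_wpDl.
move=> z /rP[Uz H]; split=> // v; have := H v v; rewrite -expr2 ler_distl => /andP[h1 h2].
have := low v; have := high v; have n2 : 0 <= m * rnorm v ^+ 2 by rewrite mulr_ge0 ?(ltW m0) ?exprn_ge0 ?rnorm_ge0.
by rewrite mulrDl; lra.
Qed.

Lemma metric_CS U G z0 : open U -> metric_on U G -> U z0 ->
  exists r M : R, [/\ 0 < r, 0 < M & forall z, rnorm (z - z0) < r -> U z /\
    forall v w, `|G z v w| <= M * (rnorm v * rnorm w)].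
Proof.
move=> oU mG Uz0; have [hG _] := mG.
have [r r0 rP] := metric_continuous oU mG Uz0 ltr01.
pose M0 := \sum_(k < n + n) \sum_(l < n + n) `|G z0 (rbasis k) (rbasis l)|.
have M00 : 0 <= M0 by do 2!apply: sumr_ge0 => ? _.
exists r, (1 + M0); split=> //; first by rewrite ltr_wpDr.
move=> z /rP[Uz H]; split=> // v w; rewrite mulrDl -[G z v w](subrK (G z0 v w)).
rewrite (le_trans (ler_normD _ _))// lerD//.
rewrite (hf_expand v w (hG _ Uz0)) (le_trans (ler_norm_sum _ _ _))// mulr_suml.
apply: ler_sum => k _; rewrite (le_trans (ler_norm_sum _ _ _))// mulr_suml.
apply: ler_sum => l _; rewrite !normrM mulrC ler_wpM2l// ler_pM ?rcoord_le//.
Qed.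

End metric_bounds.

(** * Constancy of the conformal factor *)

Section curves.
Context {R : realType} {n : nat}.
Local Notation V := (Cn R n).
Implicit Types (f : V -> R) (U : set V).

Lemma is_deriveM_real (f g : R -> R) (x a b : R) : is_derive x 1 f a -> is_derive x 1 g b ->
  is_derive x 1 (fun t => f t * g t) (a * g x + f x * b).
Proof.
move=> df dg; have := is_deriveM df dg; congr is_derive.
by rewrite -[_ *: b]/(f x * b) -[_ *: a]/(g x * a) mulrC [g x * a]mulrC addrC mulrC.
Qed.

Lemma is_deriveMc (f : R -> R) (x a c : R) : is_derive x 1 f a ->
  is_derive x 1 (fun t => f t * c) (a * c).
Proof.
move=> df; have := is_deriveM_real df (is_derive_cst c x 1).
by rewrite mulr0 addr0.
Qed.

Lemma is_derive_sum_real m (f : 'I_m -> R -> R) (x : R) (a : 'I_m -> R) :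
  (forall k, is_derive x 1 (f k) (a k)) ->
  is_derive x 1 (fun t => \sum_k f k t) (\sum_k a k).
Proof.
move=> df; have := @is_derive_sum _ _ _ m f x 1 a df; congr is_derive.
by apply/funext => t; rewrite fct_sumE.
Qed.

Lemma rnorm_sum (W : normedModType R[i]) m (F : 'I_m -> W) :
  rnorm (\sum_i F i) <= \sum_i rnorm (F i).
Proof.
elim/big_ind2 : _ => // [|x a y b xa yb]; first by rewrite rnorm0.
by rewrite (le_trans (rnormD _ _))// lerD.
Qed.

Lemma rnorm_rbasis k : rnorm (rbasis k : V) <= 1.
Proof.
apply: rnorm_le_coord => // i; rewrite /rbasis; case: fintype.split => j; rewrite !mxE.
  by case: (_ && _); rewrite ?rnorm0// (rnorm_real 1) normr1.
by case: (_ && _); rewrite ?mulr1 ?mulr0 ?rnorm0// rnorm_sqrt/= expr0n expr1n add0r sqrtr1.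
Qed.

Lemma Ck_line U f z v k : Ck k.+1 U f -> U z ->
  is_derive (0 : R) 1 (line f z v) (dirder f v z).
Proof. by move=> [_ /(_ v)[H _]] /H; exact: line_dirder. Qed.

(** The classical theorem on continuous partial derivatives: go from [z] to [z + h] along the
    [n + n] real coordinate directions, applying the mean value theorem on each leg. *)
Lemma Ck1_frechet U f z : open U -> Ck 1 U f -> U z ->
  forall e : R, 0 < e -> exists2 d : R, 0 < d & forall h, rnorm h < d ->
    `|f (z + h) - f z - \sum_k rcoord k h * dirder f (rbasis k) z| <= e * rnorm h.
Proof.
move=> oU sf Uz e e0; pose m := (n + n)%N.
have [rU rU0 rUP] : exists2 r : R, 0 < r & forall y, rnorm (y - z) < r -> U y.
  by have /open_rnormP/(_ _ Uz) := oU.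
pose e' := e / m.+1%:R; have e'0 : 0 < e' by rewrite divr_gt0.
have [r r0 rP] : exists2 r : R, 0 < r & forall k : 'I_m, forall y, rnorm (y - z) < r ->
    `|dirder f (rbasis k) y - dirder f (rbasis k) z| <= e'.
  apply: finite_eps => [k|k d d' _ d'd + y yd']; last by apply; exact: lt_le_trans d'd.
  have [_ /(_ (rbasis k))[_ [/(_ z Uz) cG _]]] := sf.
  by have [d d0' dP] := continuous_eps cG e'0; exists d.
pose r1 := Num.min rU r; have r10 : 0 < r1 by rewrite lt_min rU0.
exists (r1 / m.+1%:R); first by rewrite divr_gt0.
move=> h; rewrite ltr_pdivlMr// => hr.
(* The displacement after the first [j] legs. *)
pose H (j : nat) : V := \sum_(k < m | (k < j)%N) (rcoord k h)%:C *: rbasis k.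
have Hm : H m = h.
  by rewrite /H [RHS]rcoordE; apply: eq_bigl => k; rewrite ltn_ord.
have H0 : H 0%N = 0 by rewrite /H big1.
have HS (k : 'I_m) : H k.+1 = H k + (rcoord k h)%:C *: rbasis k.
  rewrite /H (bigD1 k)//= addrC; congr (_ + _); apply: eq_bigl => i.
  by rewrite ltnS ltn_neqAle andbC.
have Hs j : rnorm (H j) <= m%:R * rnorm h.
  rewrite /H big_mkcond (le_trans (rnorm_sum _))// mulr_natl -[m in leRHS]card_ord -sumr_const.
  apply: ler_sum => k _; case: ifP => _; last by rewrite rnorm0 rnorm_ge0.
  by rewrite rnormZr (le_trans _ (rcoord_le k h))// ler_piMr ?rnorm_rbasis.
pose S (j : nat) : R := \sum_(k < m | (k < j)%N) rcoord k h * dirder f (rbasis k) z.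
have main (j : nat) : (j <= m)%N -> `|f (z + H j) - f z - S j| <= j%:R * (e' * rnorm h).
  elim: j => [_|j IH jm].
    by rewrite H0 addr0 subrr /S big1// subr0 normr0 mul0r.
  pose k := Ordinal jm.
  have Sk : S j.+1 = S j + rcoord k h * dirder f (rbasis k) z.
    rewrite /S (bigD1 k)//= addrC; congr (_ + _); apply: eq_bigl => i.
    by rewrite ltnS [in RHS]ltn_neqAle andbC.
  pose c := rcoord k h; pose p := dirder f (rbasis k) z.
  have seg (t : R) : 0 <= t <= 1 -> rnorm (z + H j + (t * c)%:C *: rbasis k - z) < r1.
    move=> /andP[t0 t1]; rewrite -[z + H j + _]addrA addrAC subrr add0r.
    rewrite (le_lt_trans (rnormD _ _))// (le_lt_trans _ hr)// -natr1 mulrDr mulr1 lerD//.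
      by rewrite mulrC.
    rewrite rnormZr normrM (ger0_norm t0) (le_trans (_ : _ <= `|t| * (`|c| * 1)))//.
      by rewrite (ger0_norm t0) -[leLHS]mulrA ler_wpM2l// ler_wpM2l// rnorm_rbasis.
    by rewrite mulr1 ger0_norm// (le_trans _ (rcoord_le k h))// ler_piMl.
  have := @is_derive_bound R (fun t => f (z + H j + (t * c)%:C *: rbasis k) - t * (c * p))
    (fun t => c * dirder f (rbasis k) (z + H j + (t * c)%:C *: rbasis k) - c * p) 0 1 (e' * rnorm h) ler01.
  rewrite !mul0r !mul1r scale0r addr0 subr0 subr0 mulr1 => B.
  have {B}B : `|f (z + H j + c%:C *: rbasis k) - c * p - f (z + H j)| <= e' * rnorm h.
    apply: B => t t01.
      have /rUP Ut : rnorm (z + H j + (t * c)%:C *: rbasis k - z) < rU.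
        by have := seg t t01; rewrite lt_min => /andP[].
      have d1 := line_shift (Ck_line (rbasis k) sf Ut).
      have lin (x : R) : is_derive t 1 (fun s : R => s * x) x.
        by rewrite -[X in is_derive _ _ _ X]mul1r; exact: is_deriveMc (is_derive_id t 1).
      have d2 := lin c; have d3 := lin (c * p).
      have d4 := @is_derive_comp_real _ (line f (z + H j) (rbasis k)) (fun s => s * c) t _ _ d1 d2.
      exact: is_deriveB d4 d3.
    rewrite -mulrBr normrM mulrC ler_pM ?rcoord_le//; apply: rP.
    by have := seg t t01; rewrite lt_min => /andP[].
  have -> : H j.+1 = H j + c%:C *: rbasis k := HS k.
  rewrite addrA Sk -natr1 mulrDl mul1r.
  have -> : f (z + H j + c%:C *: rbasis k) - f z - (S j + c * p) =
    (f (z + H j) - f z - S j) + (f (z + H j + c%:C *: rbasis k) - c * p - f (z + H j)) by ring.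
  by rewrite (le_trans (ler_normD _ _))// lerD// IH// ltnW.
have := main m (leqnn _); rewrite Hm; have -> : S m = \sum_k rcoord k h * dirder f (rbasis k) z.
  by apply: eq_bigl => k; rewrite ltn_ord.
move=> B; rewrite (le_trans B)// mulrA ler_wpM2r ?rnorm_ge0//.
by rewrite /e' mulrCA ler_piMr ?(ltW e0)// ler_pdivrMr// mul1r ler_nat.
Qed.

Definition rder (c : R -> V) (w : V) := forall e : R, 0 < e -> exists2 r : R, 0 < r &
  forall t, `|t| < r -> rnorm (c t - c 0 - t%:C *: w) <= e * `|t|.

Lemma rder_rcoord c w k : rder c w ->
  is_derive (0 : R) 1 (fun t => rcoord k (c t)) (rcoord k w).
Proof.
move=> cw; apply: is_derive_eps => e /cw[r r0 rP]; exists r => // t /rP; rewrite add0r.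
apply: le_trans; rewrite mulrC -rcoordZ.
have rB u v : rcoord k (u - v) = rcoord k u - rcoord k v :> R.
  by rewrite -(scaleN1r v) -(rmorphN1 (real_complex R)) rcoordD rcoordZ mulN1r.
by rewrite -!rB rcoord_le.
Qed.

Lemma rder_lip c w : rder c w -> exists K r : R, [/\ 0 < K, 0 < r & forall t, `|t| < r ->
  rnorm (c t - c 0) <= K * `|t|].
Proof.
move=> /(_ 1 ltr01)[r r0 rP]; exists (1 + rnorm w), r; split=> //.
  by rewrite ltr_wpDr ?rnorm_ge0.
move=> t /rP; rewrite mul1r => H; rewrite -[c t - c 0](subrK (t%:C *: w)) (le_trans (rnormD _ _))//.
by rewrite mulrDl mul1r lerD// rnormZr mulrC.
Qed.

Lemma rder_comp U f c w : open U -> Ck 1 U f -> U (c 0) -> rder c w ->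
  is_derive (0 : R) 1 (f \o c) (dirder f w (c 0)).
Proof.
move=> oU sf Uc cw.
pose L h := \sum_k rcoord k h * dirder f (rbasis k) (c 0).
have key (c' : R -> V) w' : c' 0 = c 0 -> rder c' w' -> is_derive (0 : R) 1 (f \o c') (L w').
  move=> c'0 cw'; have [K [r [K0 r0 rP]]] := rder_lip cw'.
  have dL : is_derive (0 : R) 1 (fun t => L (c' t)) (L w').
    apply: is_derive_sum_real => k.
    exact: is_deriveMc (rder_rcoord k cw').
  have dG : is_derive (0 : R) 1 (fun t => f (c' t) - L (c' t)) 0.
    apply: is_derive_eps => e e0.
    have [d d0 dP] := Ck1_frechet oU sf Uc (divr_gt0 e0 K0).
    exists (Num.min r (d / K)); first by rewrite lt_min r0 divr_gt0.
    move=> t; rewrite lt_min ltr_pdivlMr// => /andP[/rP H td]; rewrite add0r mul0r subr0.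
    have Hd : rnorm (c' t - c 0) < d by rewrite -c'0 (le_lt_trans H)// mulrC.
    have := dP _ Hd; rewrite subrKC -/(L (c' t - c 0)) => B.
    have -> : f (c' t) - L (c' t) - (f (c' 0) - L (c' 0)) =
       f (c' t) - f (c 0) - (L (c' t) - L (c 0)) by rewrite c'0; ring.
    rewrite [L _ - _](_ : _ = L (c' t - c 0)).
      rewrite (le_trans B)// mulrAC ler_pdivrMr// -mulrA ler_pM2l// mulrC.
      by rewrite -c'0.
    rewrite /L -sumrB; apply: eq_bigr => k _; rewrite -mulrBl; congr (_ * _).
    by rewrite -[in RHS]scaleN1r -(rmorphN1 (real_complex R)) rcoordD rcoordZ mulN1r.
  have := is_deriveD dG dL; rewrite add0r; congr is_derive.
  by apply/funext => t /=; rewrite fctE subrK.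
(* The same computation along the straight line identifies [L w] with the directional derivative. *)
have -> : dirder f w (c 0) = L w; last exact: key.
have lw : rder (fun t => c 0 + t%:C *: w) w.
  move=> e e0; exists 1 => // t _; rewrite scale0r addr0 [X in X - _]addrAC subrr add0r subrr rnorm0.
  by rewrite mulr_ge0// ltW.
by have := key _ w _ lw; rewrite scale0r addr0 => /(_ erefl) /dirder_line[].
Qed.

(** Expansion in the real basis reduces the Leibniz rule to products of real functions; only the
    coefficients see the motion of the base point. *)
Lemma metric_along U G c w (a b : R -> V) a' b' : open U -> metric_on U G -> U (c 0) ->
  rder c w -> rder a a' -> rder b b' ->
  is_derive (0 : R) 1 (fun t => G (c t) (a t) (b t))
    (dirder (fun z => G z (a 0) (b 0)) w (c 0) + G (c 0) a' (b 0) + G (c 0) (a 0) b').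
Proof.
move=> oU [hG sG] Uc0 cw aa bb.
have [d d0 Uc] : exists2 d : R, 0 < d & forall t, `|t| < d -> U (c t).
  have [r r0 rP] : exists2 r : R, 0 < r & forall y, rnorm (y - c 0) < r -> U y.
    by have /open_rnormP/(_ _ Uc0) := oU.
  have [K [d [K0 d0 dP]]] := rder_lip cw.
  exists (Num.min d (r / K)); first by rewrite lt_min d0 divr_gt0.
  move=> t; rewrite lt_min => /andP[/dP H tr]; apply: rP.
  by rewrite (le_lt_trans H)// mulrC -ltr_pdivlMr.
pose g k l t := G (c t) (rbasis k) (rbasis l).
have dg k l : is_derive (0 : R) 1 (g k l) (dirder (fun z => G z (rbasis k) (rbasis l)) w (c 0)).
  exact: (rder_comp oU (sG _ _ 1%N) Uc0 cw).
have gen (al bl : R -> V) al' bl' : rder al al' -> rder bl bl' ->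
  is_derive (0 : R) 1 (fun t => G (c t) (al t) (bl t))
    (\sum_k \sum_l (rcoord k al' * rcoord l (bl 0) + rcoord k (al 0) * rcoord l bl') * g k l 0 +
     \sum_k \sum_l rcoord k (al 0) * rcoord l (bl 0) * dirder (fun z => G z (rbasis k) (rbasis l)) w (c 0)).
  move=> ala blb.
  apply: (@is_derive_near _ (fun t => \sum_k \sum_l rcoord k (al t) * rcoord l (bl t) * g k l t) _ _ _ d d0).
    by move=> t; rewrite subr0 => td; rewrite (hf_expand _ _ (hG _ (Uc t td))).
  rewrite -big_split/=; apply: is_derive_sum_real => k.
  rewrite -big_split/=; apply: is_derive_sum_real => l.
  exact: is_deriveM_real (is_deriveM_real (rder_rcoord k ala) (rder_rcoord l blb)) (dg k l).
have cst (v : V) : rder (fun=> v) 0.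
  by move=> e e0; exists 1 => // t _; rewrite subrr scaler0 subrr rnorm0 mulr_ge0// ltW.
have rc0 k : rcoord k (0 : V) = 0 by rewrite -(scale0r 0) (rcoordZ k 0) mul0r.
have -> : dirder (fun z => G z (a 0) (b 0)) w (c 0) =
  \sum_k \sum_l rcoord k (a 0) * rcoord l (b 0) * dirder (fun z => G z (rbasis k) (rbasis l)) w (c 0).
  have d1 := rder_comp oU (sG (a 0) (b 0) 1%N) Uc0 cw.
  have d2 := gen _ _ _ _ (cst (a 0)) (cst (b 0)).
  have [_ <-] := d1; have [_ ->] := d2.
  rewrite [X in X + _]big1 ?add0r// => k _; rewrite big1// => l _.
  by rewrite !rc0 mul0r mulr0 addr0 mul0r.
rewrite -addrA [X in is_derive _ _ _ X]addrC.
rewrite (hf_expand a' _ (hG _ Uc0)) (hf_expand _ b' (hG _ Uc0)) -big_split/=.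
have -> : \sum_k (\sum_l rcoord k a' * rcoord l (b 0) * G (c 0) (rbasis k) (rbasis l) +
   \sum_l rcoord k (a 0) * rcoord l b' * G (c 0) (rbasis k) (rbasis l)) =
   \sum_k \sum_l (rcoord k a' * rcoord l (b 0) + rcoord k (a 0) * rcoord l b') * g k l 0.
  by apply: eq_bigr => k _; rewrite -big_split/=; apply: eq_bigr => l _; rewrite mulrDl.
exact: gen.
Qed.

End curves.

(** * Holomorphic maps with values in C^n *)

Section vector_holomorphic.
Context {R : realType} {n : nat}.
Local Notation V := (Cn R n).
Implicit Types (F : V -> V) (z v w : V).

(* Locked, since the unification of differentials of different maps is very slow. *)
Definition vD F z v : V := locked ('d F z v).

Lemma cder_vD F z L : cder F z L -> vD F z = L.
Proof. by move=> /cder_differentiable[_ <-]; apply/funext => v; rewrite /vD -lock. Qed.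

Lemma differentiable_vD F z : differentiable F z -> cder F z (vD F z).
Proof. by move=> /differentiable_cder df; rewrite (cder_vD df). Qed.

Lemma vDE F z v : 'd F z v = vD F z v.
Proof. by rewrite /vD -lock. Qed.

Lemma cder_ext (f : V -> R[i]^o) z (L L' : V -> R[i]^o) : (forall h, L h = L' h) ->
  cder f z L -> cder f z L'.
Proof. by move=> /funext ->. Qed.

Lemma cder_coord F z L : cder F z L <->
  forall j, cder (fun y => F y j 0 : R[i]^o) z (fun h => L h j 0).
Proof.
split=> [[lL FL] j|FL].
  split=> [a u v|e /FL[d d0 dP]]; first by rewrite lL !mxE.
  exists d => // h /dP; apply: le_trans.
  by have := coord_le_rnorm (F (z + h) - F z - L h) j; rewrite !mxE.
split=> [a u v|e e0].
  by apply/colP => j; rewrite !mxE; have [lL _] := FL j; exact: lL.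
have [d d0 dP] : exists2 d : R, 0 < d & forall j, forall h, rnorm h < d ->
    rnorm (F (z + h) j 0 - F z j 0 - L h j 0 : R[i]^o) <= e * rnorm h.
  apply: finite_eps => [j|j d d' _ d'd + h hd']; last by apply; exact: lt_le_trans d'd.
  by have [_ /(_ e e0)] := FL j.
exists d => // h /dP H; apply: rnorm_le_coord; first by rewrite mulr_ge0 ?(ltW e0) ?rnorm_ge0.
by move=> j; rewrite !mxE; exact: H.
Qed.

Definition vlhol z0 (r K : R) F := forall j, lhol z0 r K (fun y => F y j 0 : R[i]^o).

Lemma vlhol_cder z0 r K F z : vlhol z0 r K F -> rball z0 r z -> cder F z (vD F z).
Proof.
move=> hF zr; have H : cder F z (fun h => \col_j cD (fun y => F y j 0 : R[i]^o) z h).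
  apply/cder_coord => j; have := lhol_cder (hF j) zr.
  by congr (cder _ _ _); apply/funext => h; rewrite mxE.
by rewrite (cder_vD H).
Qed.

Lemma vlhol_coord z0 r K F z v j : vlhol z0 r K F -> rball z0 r z ->
  vD F z v j 0 = cD (fun y => F y j 0 : R[i]^o) z v.
Proof. by move=> hF zr; have /cder_coord/(_ j)/cder_cD -> := vlhol_cder hF zr. Qed.

Lemma vlhol_lip z0 r K F z z' : 0 <= K -> vlhol z0 r K F -> rball z0 r z -> rball z0 r z' ->
  rnorm (F z - F z') <= K * rnorm (z - z').
Proof.
move=> K0 hF zr zr'; apply: rnorm_le_coord; first by rewrite mulr_ge0// rnorm_ge0.
by move=> j; rewrite !mxE; exact: (hF j).2.
Qed.

Lemma vlhol_of_bound z0 (r K : R) F :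
  (forall z, rball z0 r z -> differentiable F z) ->
  (forall z v, rball z0 r z -> rnorm (vD F z v) <= K * rnorm v) ->
  vlhol z0 r (K *+ 2) F.
Proof.
move=> dF FK j; split=> [z zr|z z' zr z'r].
  have /differentiable_vD/cder_coord/(_ j) := dF z zr.
  by move=> /cder_differentiable[].
have -> : z = z' + (z - z') by rewrite subrKC.
rewrite [X in _ * rnorm X](_ : _ = z - z'); last by rewrite subrKC.
rewrite mulrnAl.
have zz : z' + (z - z') = z by rewrite subrKC.
have seg (t : R) : 0 <= t <= 1 -> rball z0 r (z' + t%:C *: (z - z')).
  by move=> t01; apply: (rball_segment t01 z'r); rewrite zz.
apply: (@rnorm_MVT _ _ (fun y => F y j 0 : R[i]^o) z' (z - z') _
  (fun t v => vD F (z' + t%:C *: (z - z')) v j 0)) => t /seg tr.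
  by have /differentiable_vD/cder_coord/(_ j) := dF _ tr.
by rewrite (le_trans (coord_le_rnorm _ j))// FK.
Qed.

Lemma rder_cder F z L v : cder F z L -> rder (fun t => F (z + t%:C *: v)) (L v).
Proof.
move=> [lL FL] e e0; have v1 : 0 < 1 + rnorm v by rewrite ltr_pwDl// rnorm_ge0.
have [d d0 dP] := FL _ (divr_gt0 e0 v1).
exists (d / (1 + rnorm v)); first by rewrite divr_gt0.
move=> t; rewrite ltr_pdivlMr// => td; rewrite scale0r addr0 -(linZ lL).
have le : rnorm (t%:C *: v) <= `|t| * (1 + rnorm v) by rewrite rnormZr ler_wpM2l// lerDr.
rewrite (le_trans (dP _ (le_lt_trans le td)))// mulrAC ler_pdivrMr// -mulrA ler_pM2l//.
Qed.

Lemma vlhol_D2 z0 r K F z v : vlhol z0 r K F -> rball z0 r z ->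
  exists2 D2 : V -> V, cder (fun y => vD F y v) z D2 &
    forall w j, D2 w j 0 = cD (fun y => cD (fun y => F y j 0 : R[i]^o) y v) z w.
Proof.
move=> hF zr; exists (fun w => \col_j cD (fun y => cD (fun y => F y j 0 : R[i]^o) y v) z w); last first.
  by move=> w j; rewrite mxE.
pose s := (r - rnorm (z - z0)) / 2; have s0 : 0 < s by rewrite divr_gt0// subr_gt0.
have er : r = rnorm (z - z0) + s + s by rewrite /s; field.
have rr : rnorm (z - z0) + s < r by rewrite er ltrDl.
have zr' : rball z0 (rnorm (z - z0) + s) z by rewrite /rball/= ltrDl.
apply/cder_coord => j.
apply: (@cder_ext _ z (cD (fun y => cD (fun y => F y j 0 : R[i]^o) y v) z)) => [h|]; first by rewrite mxE.
have := lhol_cder (lhol_D v (hF j) rr) zr'.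
apply: (@cder_near _ _ _ _ _ _ _ s s0) => y ys.
have yr : rball z0 r y.
  by rewrite /rball/= (le_lt_trans (rnormB_le _ z _))// er; lra.
by rewrite (vlhol_coord v j hF yr).
Qed.

Lemma vlhol_D2_sym z0 r K F z v w D2v D2w : vlhol z0 r K F -> rball z0 r z ->
  cder (fun y => vD F y v) z D2v -> cder (fun y => vD F y w) z D2w -> D2v w = D2w v.
Proof.
move=> hF zr dv dw; have [Lv Hv LvE] := vlhol_D2 v hF zr; have [Lw Hw LwE] := vlhol_D2 w hF zr.
rewrite -(cder_vD dv) (cder_vD Hv) -(cder_vD dw) (cder_vD Hw).
by apply/colP => j; rewrite LvE LwE (lhol_sym _ _ (hF j) zr).
Qed.

End vector_holomorphic.

Section conformal_factor.
Context {R : realType} {n : nat}.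
Local Notation V := (Cn R n).

(* For [n > 1], the real span of [u] and [i u] is not the whole space. *)
Lemma hf_orth (h : V -> V -> R) u : hermitian_form h -> (1 < n)%N ->
  exists v, [/\ v != 0, h u v = 0 & h ('i *: u) v = 0].
Proof.
move=> hh n1; have [S Su SE] := hermitian_form_diag hh.
pose x := S *m u; pose i0 := Ordinal (ltnW n1); pose i1 := Ordinal n1.
have i01 : (i1 == i0) = false by [].
have sumE (y : V) (a : R[i]) : (forall j, j != i0 -> j != i1 -> y j 0 = 0) ->
    flat_form (a *: x) y = complex.Re (a * (x i0 0 * (y i0 0)^*%C + x i1 0 * (y i1 0)^*%C)).
  move=> y0; rewrite /flat_form (bigD1 i0)//= (bigD1 i1)//= big1 ?addr0.
    by rewrite !mxE mulrDr !mulrA.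
  by move=> j /andP[j0 j1]; rewrite y0// conjc0 mulr0.
have done_ (y : V) : y != 0 -> (forall j, j != i0 -> j != i1 -> y j 0 = 0) ->
    x i0 0 * (y i0 0)^*%C + x i1 0 * (y i1 0)^*%C = 0 ->
    exists v, [/\ v != 0, h u v = 0 & h ('i *: u) v = 0].
  move=> yn0 y0 y1; exists (invmx S *m y); split.
  - by apply: contra_neq yn0 => H; rewrite -(mulKVmx Su y) H mulmx0.
  - by rewrite -SE mulKVmx// -/x -(scale1r x) sumE// y1 mulr0.
  - by rewrite -SE mulKVmx// -scalemxAr -/x sumE// y1 mulr0.
have [/andP[/eqP a0 /eqP a1]|aN] := boolP ((x i0 0 == 0) && (x i1 0 == 0)).
  apply: (done_ (delta_mx i0 0)); last by rewrite a0 a1 !mul0r addr0.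
    by apply/eqP => /matrixP/(_ i0 0); rewrite !mxE !eqxx => /eqP; rewrite oner_eq0.
  by move=> j j0 _; rewrite mxE (negbTE j0).
(* Orthogonal to [x] for the complex Hermitian product, hence to [x] and ['i *: x] for its real
   part. *)
pose y : V := \col_j if j == i0 then (x i1 0)^*%C else if j == i1 then - (x i0 0)^*%C else 0.
apply: (done_ y).
- apply: contraNneq aN => y0.
  have := congr1 (fun m : V => m i0 0) y0; have := congr1 (fun m : V => m i1 0) y0.
  rewrite !mxE !eqxx i01 => /eqP; rewrite oppr_eq0 => e1 /eqP e2.
  by move: e1 e2; rewrite !conjc_eq0 => -> ->.
- by move=> j j0 j1; rewrite mxE (negbTE j0) (negbTE j1).
- rewrite !mxE !eqxx i01 conjcK rmorphN/= conjcK mulrN mulrC subrr//.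
Qed.

Definition closed_form (U : set V) (G : V -> V -> V -> R) := forall z, U z -> forall u v w,
  ext_der (fun v w z => G z ('i *: v) w) u v w z = 0.

Lemma rderZ c w (a : R[i]) : rder c w -> rder (fun t => a *: c t : V) (a *: w).
Proof.
move=> cw e e0; have a1 : 0 < 1 + rnorm (a : R[i]^o) by rewrite ltr_pwDl// rnorm_ge0.
have [r r0 rP] := cw _ (divr_gt0 e0 a1); exists r => // t /rP H.
have -> : a *: c t - a *: c 0 - t%:C *: (a *: w) = a *: (c t - c 0 - t%:C *: w).
  by rewrite !scalerBr !scalerA [a * t%:C]mulrC.
rewrite rnormZ (le_trans (ler_wpM2l (rnorm_ge0 _) H))// mulrA ler_wpM2r//.
by rewrite mulrCA ler_piMr ?(ltW e0)// ler_pdivrMr// mul1r lerDr.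
Qed.

(* The cyclic sum of [du] with the fundamental form vanishes; it is evaluated at [u], [v], [i v]
   with [v] orthogonal to [u] and [i u]. *)
Lemma factor_derive U U' (G1 G2 : V -> V -> V -> R) F nu z0 (r K : R) z u :
  (1 < n)%N -> open U -> open U' -> metric_on U G1 -> metric_on U' G2 ->
  closed_form U G1 -> closed_form U' G2 ->
  vlhol z0 r K F -> (forall z, rball z0 r z -> U z /\ U' (F z)) ->
  (forall z, rball z0 r z -> forall v w, G2 (F z) (vD F z v) (vD F z w) = nu z * G1 z v w) ->
  rball z0 r z -> is_derive (0 : R) 1 (line nu z u) 0.
Proof.
move=> n1 oU oU' mG1 mG2 cG1 cG2 hF FU FG zr.
have [Uz U'Fz] := FU _ zr; have [hG1 sG1] := mG1; have [hG2 sG2] := mG2.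
have e0 (v : V) : z + (0 : R)%:C *: v = z by rewrite scale0r addr0.
have [d d0 dP] : exists2 d : R, 0 < d & forall v, forall t, `|t| * (1 + rnorm v) < d -> rball z0 r (z + t%:C *: v).
  exists (r - rnorm (z - z0)) => [|v t]; first by rewrite subr_gt0.
  rewrite ltrBrDr => H; rewrite /rball/= addrAC (le_lt_trans (rnormD _ _))// (le_lt_trans _ H)//.
  by rewrite [leRHS]addrC lerD2l rnormZr ler_wpM2l// lerDr.
have near (v : V) : exists2 e : R, 0 < e & forall t, `|t - 0| < e -> rball z0 r (z + t%:C *: v).
  have v1 : 0 < 1 + rnorm v by rewrite ltr_pwDl// rnorm_ge0.
  exists (d / (1 + rnorm v)); first by rewrite divr_gt0.
  by move=> t; rewrite subr0 => te; apply: dP; rewrite -ltr_pdivlMr.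
have D2 v : exists D, cder (fun y => vD F y v) z D by have [D HD _] := vlhol_D2 v hF zr; exists D.
have [D DP] := choice D2.
have Dsym v w : D v w = D w v by exact: vlhol_D2_sym hF zr (DP v) (DP w).
pose O (a b : V) := G2 (F z) ('i *: a) b.
have Osym a b : O b a = - O a b by rewrite /O hfC ?hfJr//; exact: hG2.
pose O1 (a b : V) := G1 z ('i *: a) b.
have dW p v w : is_derive (0 : R) 1 (fun t => G2 (F (z + t%:C *: p)) ('i *: vD F (z + t%:C *: p) v) (vD F (z + t%:C *: p) w))
  (dirder (fun y => G2 y ('i *: vD F z v) (vD F z w)) (vD F z p) (F z) + O (D v p) (vD F z w) + O (vD F z v) (D w p)).
  have Fc : rder (fun t => F (z + t%:C *: p)) (vD F z p) := rder_cder p (vlhol_cder hF zr).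
  have := metric_along oU' mG2 _ Fc (rderZ 'i (rder_cder p (DP v))) (rder_cder p (DP w)).
  by rewrite e0; apply.
have dG p v w : is_derive (0 : R) 1 (line (fun y => G1 y v w) z p) (dirder (fun y => G1 y v w) p z).
  exact: Ck_line (sG1 v w 1%N) Uz.
have Fi y v : rball z0 r y -> vD F y ('i *: v) = 'i *: vD F y v.
  by move=> yr; have [lD _] := vlhol_cder hF yr; rewrite (linZ lD).
(* [nu] is differentiable as the quotient of [G2] by [G1], both evaluated on one fixed vector
   [e]. *)
have dnu p : is_derive (0 : R) 1 (line nu z p) (dirder nu p z).
  pose e : V := delta_mx (Ordinal n1) 0.
  have en0 : e != 0.
    by apply/eqP => /matrixP/(_ (Ordinal n1) 0); rewrite !mxE !eqxx => /eqP; rewrite oner_eq0.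
  have G1e y : U y -> G1 y e e != 0 by move=> /hG1[_ _ H _]; rewrite gt_eqF// H.
  suff [x xP] : exists x, is_derive (0 : R) 1 (line nu z p) x by have [H ->] := dirder_line xP.
  have [eps eps0 epsP] := near p.
  have Fc : rder (fun t => F (z + t%:C *: p)) (vD F z p) := rder_cder p (vlhol_cder hF zr).
  have dq := metric_along oU' mG2 _ Fc (rder_cder p (DP e)) (rder_cder p (DP e)).
  have {}dq := dq ltac:(by rewrite e0).
  have di : is_derive ((line (fun y => G1 y e e) z p) 0) 1 (fun y : R => y^-1) (- (G1 z e e) ^- 2).
    by rewrite /line e0; apply: is_derive_inv; exact: G1e.
  have := is_deriveM_real dq (is_derive_comp_real di (dG p e e)).
  set x := (X in is_derive _ _ _ X) => dx; exists x.
  apply: is_derive_near eps0 _ dx => t /epsP tr; rewrite /line/= FG// mulfK// G1e//.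
  by have [] := FU _ tr.
pose N p := dirder nu p z.
(* The conformality relation between the two fundamental forms, differentiated in the direction
   [p]. *)
have E p v w : dirder (fun y => G2 y ('i *: vD F z v) (vD F z w)) (vD F z p) (F z) + O (D v p) (vD F z w) + O (vD F z v) (D w p) =
    N p * O1 v w + nu z * dirder (fun y => G1 y ('i *: v) w) p z.
  have [eps eps0 epsP] := near p.
  have d1 := is_deriveM_real (dnu p) (dG p ('i *: v) w).
  have d2 : is_derive (0 : R) 1 (fun t => line nu z p t * line (fun y => G1 y ('i *: v) w) z p t)
     (dirder (fun y => G2 y ('i *: vD F z v) (vD F z w)) (vD F z p) (F z) + O (D v p) (vD F z w) + O (vD F z v) (D w p)).
    apply: is_derive_near eps0 _ (dW p v w) => t /epsP tr.
    by rewrite -Fi// FG.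
  by have [_ <-] := d2; have [_ ->] := d1; rewrite /line e0.
(* In the alternating sum of the relations [E], the second derivatives of [F] cancel by symmetry,
   and closedness removes the derivatives of both forms. *)
have cyc p v w : N p * O1 v w - N v * O1 p w + N w * O1 p v = 0.
  have := cG1 _ Uz p v w; rewrite /ext_der => C1.
  have := cG2 _ U'Fz (vD F z p) (vD F z v) (vD F z w); rewrite /ext_der => C2.
  have := E p v w; have := E v p w; have := E w p v.
  rewrite (Dsym v p) (Dsym w p) (Dsym w v) (Osym (D p w) (vD F z v)).
  move: C1 C2; rewrite -/(O1 _ _).
  set a1 := dirder _ _ z; set a2 := dirder _ _ z; set a3 := dirder _ _ z.
  set b1 := dirder _ _ (F z); set b2 := dirder _ _ (F z); set b3 := dirder _ _ (F z).
  move=> C1 C2 E1 E2 E3.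
  have -> : N p * O1 v w - N v * O1 p w + N w * O1 p v =
     (N p * O1 v w + nu z * a1) - (N v * O1 p w + nu z * a2) + (N w * O1 p v + nu z * a3) - nu z * (a1 - a2 + a3) by ring.
  rewrite C1 mulr0 subr0 -E1 -E2 -E3.
  move: C2; lra.
have [v [v0 v1 v2]] := hf_orth u (hG1 _ Uz) n1.
have := cyc u v ('i *: v); rewrite /O1 hfJ ?v1; last exact: hG1.
rewrite hfJ ?v1; last exact: hG1.
rewrite v2 !mulr0 addr0 subr0 => /eqP; rewrite mulf_eq0.
have [_ _ pos _] := hG1 _ Uz; rewrite (gt_eqF (pos _ v0)) orbF => /eqP Nu.
by have := dnu u; rewrite -/(N u) Nu.
Qed.

Lemma line_const (f : V -> R) z0 (r : R) z :
  (forall y v, rball z0 r y -> is_derive (0 : R) 1 (line f y v) 0) -> rball z0 r z -> f z = f z0.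
Proof.
move=> df zr; have r0 : 0 < r by exact: le_lt_trans (rnorm_ge0 _) zr.
have := @is_derive_0_eq R (line f z0 (z - z0)) 0 1 ler01.
rewrite /line scale0r scale1r addr0 subrKC; apply => t t01.
apply: line_shift; apply: df; apply: rball_segment t01 (rball_center _ r0) _.
by rewrite subrKC.
Qed.

End conformal_factor.

(** * The dual distance *)

Section real_pointwise_lipschitz.
Context {R : realType}.

(** Continuous induction: the supremum of the times at which the estimate from 0 holds is itself
    such a time, and it can be passed unless it is 1. *)
Lemma pointwise_lipschitz (f : R -> R) (K : R) :
  (forall t, 0 <= t <= 1 -> exists2 d : R, 0 < d & forall s, 0 <= s <= 1 -> `|s - t| < d ->
     `|f s - f t| <= K * `|s - t|) -> `|f 1 - f 0| <= K.
Proof.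
move=> fK; pose A := [set t : R | 0 <= t <= 1 /\ `|f t - f 0| <= K * t].
have A0 : A 0 by rewrite /A/= lexx ler01 subrr normr0 mulr0.
have hA : has_sup A by split; [exists 0|exists 1 => t [/andP[]]].
have ubA := sup_upper_bound hA.
pose s := sup A; have s0 : 0 <= s by exact: ubA.
have s1 : s <= 1 by apply: ge_sup; [exists 0|move=> t [/andP[]]].
have s01 : 0 <= s <= 1 by rewrite s0.
have [d d0 dP] := fK s s01.
have split_le (x y z : R) : `|f x - f z| <= `|f x - f y| + `|f y - f z|.
  by rewrite -[f x - f z](_ : (f x - f y) + (f y - f z) = _) ?ler_normD//; ring.
have As : A s.
  have [t At ts] := sup_adherent d0 hA; have [t01 H] := At.
  have tle : t <= s by exact: ubA.
  have ts' : `|t - s| < d by rewrite ler0_norm ?subr_le0// opprB ltrBlDr -ltrBlDl.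
  split=> //; have H' := dP t t01 ts'.
  rewrite (le_trans (split_le s t 0))// distrC (le_trans (lerD H' H))//.
  by rewrite ler0_norm ?subr_le0//; lra.
have [/eqP s1'|sn1] := boolP (s == 1).
  by have [_] := As; rewrite s1' mulr1.
have slt : s < 1 by rewrite lt_neqAle sn1.
pose t := s + Num.min (d / 2) (1 - s).
have d2 : 0 < d / 2 by rewrite divr_gt0.
have st : s < t by rewrite ltrDl lt_min d2 subr_gt0.
have t1 : t <= 1 by rewrite /t -lerBrDl ge_min lexx orbT.
have t01 : 0 <= t <= 1 by rewrite t1 (le_trans s0 (ltW st)).
have ts : `|t - s| < d.
  rewrite gtr0_norm ?subr_gt0// ltrBlDl ltrD2l gt_min.
  by rewrite ltr_pdivrMr// mulr_natr mulr2n ltrDl d0.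
have At : A t.
  split=> //; have [_ H] := As; rewrite (le_trans (split_le t s 0))//.
  by rewrite (le_trans (lerD (dP _ t01 ts) H))// gtr0_norm ?subr_gt0//; lra.
by have := ubA _ At; rewrite leNgt st.
Qed.
End real_pointwise_lipschitz.

Section form_norm.
Context {R : realType} {n : nat}.
Local Notation V := (Cn R n).
Context (h : V -> V -> R) (hh : hermitian_form h).

Lemma hf_CS v w : h v w ^+ 2 <= h v v * h w w.
Proof.
have [->|w0] := eqVneq w 0.
  by rewrite (hfC hh v) !(hf0l hh) expr0n mulr0.
have hw : 0 < h w w by have [_ _ H _] := hh; exact: H.
pose t := - (h v w / h w w).
have := hf_ge0 hh (v + t%:C *: w).
rewrite (hfDl hh) !(hfDr hh) !(hfZl hh) !(hfZr hh) (hfC hh w v).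
have -> : h v v + t * h v w + (t * h v w + t * (t * h w w)) = h v v - h v w ^+ 2 / h w w.
  by rewrite /t; field; rewrite gt_eqF.
by rewrite subr_ge0 ler_pdivrMr.
Qed.

Definition hnorm v : R := Num.sqrt (h v v).

Lemma hnorm_ge0 v : 0 <= hnorm v. Proof. exact: sqrtr_ge0. Qed.

Lemma hnorm_sqr v : hnorm v ^+ 2 = h v v.
Proof. by rewrite sqr_sqrtr// hf_ge0. Qed.

Lemma hnormD v w : hnorm (v + w) <= hnorm v + hnorm w.
Proof.
rewrite -ler_sqr ?nnegrE ?addr_ge0 ?hnorm_ge0// sqrrD !hnorm_sqr.
rewrite (hfDl hh) !(hfDr hh) (hfC hh w v).
have : h v w <= hnorm v * hnorm w.
  rewrite (le_trans (ler_norm _))// -ler_sqr ?nnegrE ?mulr_ge0 ?hnorm_ge0//.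
  by rewrite real_normK ?num_real// exprMn !hnorm_sqr hf_CS.
by rewrite mulr2n; lra.
Qed.

End form_norm.

Lemma metric_norm_bounds {R : realType} {n : nat} U (G : Cn R n -> Cn R n -> Cn R n -> R) z0 :
  open U -> metric_on U G -> U z0 ->
  exists r m M : R, [/\ 0 < r, 0 < m, 0 < M & forall z, rnorm (z - z0) < r -> U z /\
    forall v, m * rnorm v <= hnorm (G z) v <= M * rnorm v].
Proof.
move=> oU mG Uz0; have [r [m [M [r0 m0 M0 H]]]] := metric_bounds oU mG Uz0.
exists r, (Num.sqrt m), (Num.sqrt M); rewrite !sqrtr_gt0; split=> // z /H[Uz Hv]; split=> // v.
have [h1 h2] := andP (Hv v).
have sq (x : R) : 0 < x -> Num.sqrt x * rnorm v = Num.sqrt (x * rnorm v ^+ 2).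
  by move=> x0; rewrite sqrtrM ?(ltW x0)// sqrtr_sqr ger0_norm// rnorm_ge0.
by rewrite !sq// !ler_wsqrtr.
Qed.

Section pointwise_lipschitz_maps.
Context {R : realType} {n : nat}.
Implicit Types X Y : complexManifold R n.

Lemma nbhs_chart X (c : cm_index X) x (A : set X) : dom c x ->
  nbhs x A <-> exists2 d : R, 0 < d & forall y, dom c y -> rnorm (chart c y - chart c x) < d -> A y.
Proof.
move=> cx; split=> [nA|[d d0 dP]].
  have := cm_inv_continuous (ex_intro2 _ _ x cx erefl : (chart c @` dom c) (chart c x)).
  move=> /(_ A); rewrite cm_chartK// => /(_ nA) /nbhs_rnormP[d d0 dP].
  by exists d => // y cy /dP; rewrite /= cm_chartK.
pose B := rball (chart c x) d.
have nb : nbhs (chart c x) B by apply/nbhs_rnormP; exists d.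
have nB := cm_chart_continuous cx nb; rewrite nbhs_filterE /fmap /= in nB.
have nD : nbhs x (dom c) by apply: open_nbhs_nbhs; split=> //; exact: cm_dom_open.
by apply: filterS (filterI nB nD) => y [h1 h2]; exact: dP.
Qed.

Lemma chart_ball X (c : cm_index X) x : dom c x ->
  exists2 r : R, 0 < r & forall z, rnorm (z - chart c x) < r -> dom c (chart_inv c z) /\ chart c (chart_inv c z) = z.
Proof.
move=> cx; have /open_rnormP/(_ (chart c x)) := @cm_image_open _ _ X c.
case=> [|r r0 rP]; first by exists x.
by exists r => // z /rP[y cy <-]; rewrite cm_chartK.
Qed.

Context {X : complexManifold R n} (g : hermitianMetric X).

Lemma chart_hermitian c x : dom c x -> hermitian_form (g c x).
Proof.
move=> cx; have [H _] := metric_on_chart g c.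
by have := H (chart c x); rewrite cm_chartK//; apply; exists x.
Qed.

Lemma chart_norm_bounds (c : cm_index X) x : dom c x ->
  exists r m M : R, [/\ 0 < r, 0 < m, 0 < M &
   (forall z, rnorm (z - chart c x) < r -> dom c (chart_inv c z) /\ chart c (chart_inv c z) = z) /\
    forall y, dom c y -> rnorm (chart c y - chart c x) < r ->
    forall v, m * rnorm v <= hnorm (g c y) v <= M * rnorm v].
Proof.
move=> cx; have [r1 r10 r1P] := chart_ball cx.
have Ix : (chart c @` dom c) (chart c x) by exists x.
have [r [m [M [r0 m0 M0 H]]]] := metric_norm_bounds (@cm_image_open _ _ X c) (metric_on_chart g c) Ix.
exists (Num.min r r1), m, M; rewrite lt_min r0 r10; split=> //; split.
  by move=> z; rewrite lt_min => /andP[_ /r1P].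
by move=> y cy; rewrite lt_min => /andP[/H[_ +] _]; rewrite cm_chartK.
Qed.

Lemma chart_norm_equiv (c : cm_index X) x : dom c x -> exists m M : R, [/\ 0 < m, 0 < M &
  forall v, m * rnorm v <= hnorm (g c x) v <= M * rnorm v].
Proof.
move=> cx; have [r [m [M [r0 m0 M0 [_ H]]]]] := chart_norm_bounds cx.
by exists m, M; split=> //; apply: H => //; rewrite subrr rnorm0.
Qed.

(* The pointwise Lipschitz constant of [phi] at [x] is at most [K]. *)
Definition plip (K : R) (phi : X -> R) (c : cm_index X) x := forall e : R, 0 < e ->
  exists2 d : R, 0 < d & forall y, dom c y -> rnorm (chart c y - chart c x) < d ->
    `|phi y - phi x| <= (K + e) * hnorm (g c x) (chart c y - chart c x).

End pointwise_lipschitz_maps.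

Lemma plip_comp {R : realType} {n : nat} (X Y : complexManifold R n) (g : hermitianMetric X)
    (h : hermitianMetric Y) (f : X -> Y) (phi : Y -> R) c d x (K s : R) :
  dom c x -> dom d (f x) -> {for x, continuous f} ->
  differentiable (local_rep f c d) (chart c x) -> 0 <= K -> 0 <= s ->
  (forall v, hnorm (h d (f x)) (vD (local_rep f c d) (chart c x) v) <= s * hnorm (g c x) v) ->
  plip h K phi d (f x) -> plip g (K * s) (phi \o f) c x.
Proof.
move=> cx dfx cf df K0 s0 Fs pphi e e0.
have [m [M1 [m0 _ mP]]] := chart_norm_equiv g cx.
have [m2 [M [_ M0 MP]]] := chart_norm_equiv h dfx.
have hd := chart_hermitian h dfx; have hc := chart_hermitian g cx.
(* The constants are such that [(K + e1) * (s + e3) <= K * s + e], each of the terms [K * e3] and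
   [e1 * (s + e3)] being at most [e / 2]. *)
pose e1 := e / (2 * (s + 1)); have e10 : 0 < e1 by rewrite divr_gt0// mulr_gt0// ltr_wpDl.
pose e3 := Num.min 1 (e / (2 * (K + 1))).
have e30 : 0 < e3 by rewrite lt_min ltr01 divr_gt0// mulr_gt0// ltr_wpDl.
have [d1 d10 d1P] := pphi _ e10.
have [lD /(_ (e3 * m / M))[|d2 d20 d2P]] := differentiable_vD df.
  by rewrite divr_gt0// mulr_gt0.
have nb : nbhs (f x) [set y | dom d y /\ rnorm (chart d y - chart d (f x)) < d1].
  by apply/(nbhs_chart _ dfx); exists d1.
have /(nbhs_chart _ cx)[d3 d30 d3P] := cf _ nb.
exists (Num.min d2 d3); first by rewrite lt_min d20.
move=> y cy; rewrite lt_min => /andP[yd2 yd3].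
have [dfy fyd] := d3P y cy yd3; set v := chart c y - chart c x in yd2 *.
have H1 := d1P _ dfy fyd; have H2 := d2P _ yd2.
set D := vD (local_rep f c d) (chart c x) in Fs H2.
have H3 : hnorm (h d (f x)) (chart d (f y) - chart d (f x)) <= (s + e3) * hnorm (g c x) v.
  set w := local_rep _ _ _ _ - _ - _ in H2.
  have -> : chart d (f y) - chart d (f x) = D v + w.
    rewrite /w subrKC /local_rep/= /v subrKC !cm_chartK//.
  rewrite (le_trans (hnormD hd _ _))// mulrDl lerD//.
  have /andP[_ H4] := MP w; rewrite (le_trans H4)// (le_trans (ler_wpM2l (ltW M0) H2))//.
  rewrite mulrA mulrCA mulrV ?unitfE ?gt_eqF// mulr1 -mulrA ler_wpM2l ?(ltW e30)//.
  by have /andP[] := mP v.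
rewrite /= (le_trans H1)// (le_trans (ler_wpM2l _ H3))//; first by rewrite addr_ge0// ltW.
rewrite mulrA ler_wpM2r ?hnorm_ge0//.
have e31 : e3 <= 1 by rewrite ge_min lexx.
have H4 : K * e3 <= e / 2.
  rewrite (le_trans (_ : _ <= (K + 1) * (e / (2 * (K + 1)))))//.
    by rewrite ler_pM ?(ltW e30)// ?lerDl// /e3 ge_min lexx orbT.
  by rewrite le_eqVlt; apply/orP; left; apply/eqP; field; rewrite gt_eqF// ltr_wpDl.
have H5 : e1 * (s + e3) <= e / 2.
  rewrite (le_trans (_ : _ <= e1 * (s + 1)))//; first by rewrite ler_wpM2l ?(ltW e10)// lerD2l.
  by rewrite le_eqVlt; apply/orP; left; apply/eqP; rewrite /e1; field; rewrite gt_eqF// ltr_wpDl.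
by move: H4 H5; lra.
Qed.

Section compact_boxes.
Context {R : realType} {n : nat}.
Local Notation V := (Cn R n).

(** Bounds on the real coordinates make this set an image of a product of segments, which is
    compact. *)
Definition cbox (a : V) (r : R) : set V := [set z | forall k, `|rcoord k (z - a)| <= r].

Lemma rnorm_rcoord (v : V) (r : R) : 0 <= r -> (forall k, `|rcoord k v| <= r) -> rnorm v <= r *+ 2.
Proof.
move=> r0 H; apply: rnorm_le_coord; first by rewrite mulrn_wge0.
move=> i; rewrite (le_trans (rnorm_ReIm _))// mulr2n lerD//.
  by have := H (unsplit (inl i)); rewrite /rcoord unsplitK.
by have := H (unsplit (inr i)); rewrite /rcoord unsplitK.
Qed.

Lemma cbox_compact (a : V) (r : R) : compact (cbox a r).
Proof.
pose m := (n + n)%N.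
pose f (x : 'rV[R]_m) : V := a + \sum_k (x 0 k)%:C *: rbasis k.
pose B : set 'rV[R]_m := [set v | forall k, `[- r, r]%classic (v 0 k)].
have cB : compact B := @rV_compact R m (fun=> `[- r, r]%classic) (fun=> @segment_compact R (- r) r).
have fE k x : rcoord k (f x - a) = x 0 k.
  rewrite /f addrAC subrr add0r.
  have lin (I : Type) (s : seq I) (P : pred I) (F : I -> V) : rcoord k (\sum_(i <- s | P i) F i) = \sum_(i <- s | P i) rcoord k (F i) :> R.
    by elim/big_rec2: _ => [|i y z _ <-]; [rewrite -(scale0r 0) (rcoordZ k 0) mul0r|rewrite rcoordD].
  rewrite lin (bigD1 k)//= big1 => [|l lk]; rewrite rcoordZ.
    rewrite /rcoord /rbasis; case: splitP => i _; rewrite !mxE !eqxx ?mulr1/= ?mulr1 addr0//.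
  rewrite (_ : rcoord k (rbasis l) = 0) ?mulr0//; move: lk; rewrite -(inj_eq (@ord_inj _)) /rcoord /rbasis.
  case: splitP => i ->; case: splitP => j ->; rewrite !mxE !eqxx ?andbT => ij.
  - by rewrite eq_sym -val_eqE/= (negbTE ij).
  - by case: (_ == _); rewrite ?mulr1 ?mulr0.
  - by case: (_ == _).
  - by rewrite eqn_add2l in ij; rewrite eq_sym -val_eqE/= (negbTE ij) mulr0.
have -> : cbox a r = f @` B.
  apply/seteqP; split=> [z H|_ [x xB <-] k]; last first.
    by rewrite fE; have := xB k; rewrite /= in_itv/= ler_norml.
  exists (\row_k rcoord k (z - a)).
    by move=> k; rewrite /= in_itv/= mxE -ler_norml; exact: H.
  rewrite /f (_ : \sum_k _ = z - a) ?subrKC// [RHS]rcoordE.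
  by apply: eq_bigr => k _; rewrite mxE.
apply: continuous_compact cB; apply/continuous_in_subspaceT => x _.
move=> A /nbhs_rnormP[e e0 eA].
have e'0 : 0 < e / m.+1%:R by rewrite divr_gt0.
apply/nbhs_ballP; exists (e / m.+1%:R) => // y xy; apply: eA.
rewrite /f opprD addrACA subrr add0r -sumrB.
rewrite (le_lt_trans (rnorm_sum _))//.
apply: (@le_lt_trans _ _ (\sum_(k < m) e / m.+1%:R)); last first.
  by rewrite sumr_const card_ord -[_ *+ m]mulr_natr mulrAC ltr_pdivrMr// ltr_pM2l// ltr_nat.
apply: ler_sum => k _; rewrite -scalerBl -rmorphB/= rnormZr.
rewrite (le_trans (_ : _ <= `|y 0 k - x 0 k|))//; first by rewrite ler_piMr ?rnorm_rbasis.
by rewrite distrC ltW//; case: xy => _; exact.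
Qed.

End compact_boxes.

Section distance.
Context {R : realType} {n : nat} {X : complexManifold R n} (g : hermitianMetric X).

Definition lip1 (phi : X -> R) := forall c x, dom c x -> plip g 1 phi c x.

Lemma vD_chart c d x v : dom c x -> dom d x ->
  hnorm (g d x) (vD (@local_rep R n X X id c d) (chart c x) v) = hnorm (g c x) v.
Proof. by move=> cx dx; rewrite /hnorm -!vDE (hm_compat g cx dx). Qed.

Lemma plip_chart K phi c d x : 0 <= K -> dom c x -> dom d x -> plip g K phi d x -> plip g K phi c x.
Proof.
move=> K0 cx dx H; rewrite -(mulr1 K) -[phi]/(phi \o id).
apply: (@plip_comp _ _ X X g g id phi c d x) => //.
  exact: (cm_holomorphic cx dx).
by move=> v; rewrite mul1r (vD_chart v cx dx).
Qed.

Lemma plipZ K phi c x (a : R) : plip g K phi c x -> plip g (`|a| * K) (fun y => a * phi y) c x.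
Proof.
move=> H e e0; have a1 : 0 < 1 + `|a| by rewrite ltr_pwDl.
have [d d0 dP] := H _ (divr_gt0 e0 a1); exists d => // y cy /dP-/(_ cy) yd.
rewrite -mulrBr normrM (le_trans (ler_wpM2l (normr_ge0 a) yd))// mulrA ler_wpM2r ?hnorm_ge0//.
rewrite mulrDr lerD2l mulrCA ler_piMr ?(ltW e0)// ler_pdivrMr// mul1r lerDr//.
Qed.

(* The distance from [x] to [y] is at most [r]. *)
Definition dle x y (r : R) := forall phi, lip1 phi -> `|phi x - phi y| <= r.

Lemma lip1_cst a : lip1 (fun=> a).
Proof.
move=> c x cx e e0; exists 1 => // y _ _; rewrite subrr normr0.
by rewrite mulr_ge0 ?hnorm_ge0// addr_ge0// ltW.
Qed.

Lemma dle_ge0 x y r : dle x y r -> 0 <= r.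
Proof. by move=> /(_ _ (lip1_cst 0)); rewrite subrr normr0. Qed.

Lemma dle_refl x r : 0 <= r -> dle x x r.
Proof. by move=> r0 phi _; rewrite subrr normr0. Qed.

Lemma dle_sym x y r : dle x y r -> dle y x r.
Proof. by move=> H phi /H; rewrite distrC. Qed.

Lemma dle_trans y x z r s : dle x y r -> dle y z s -> dle x z (r + s).
Proof.
move=> H1 H2 phi lp; have -> : phi x - phi z = (phi x - phi y) + (phi y - phi z) by ring.
by rewrite (le_trans (ler_normD _ _))// lerD ?H1 ?H2.
Qed.

Lemma dle_le x y r s : r <= s -> dle x y r -> dle x y s.
Proof. by move=> rs H phi /H/le_trans; apply. Qed.

Lemma dle_upper c x : dom c x -> exists r M : R, [/\ 0 < r, 0 < M &
  forall y y', dom c y -> dom c y' -> rnorm (chart c y - chart c x) < r ->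
    rnorm (chart c y' - chart c x) < r -> dle y y' (M * rnorm (chart c y - chart c y'))].
Proof.
move=> cx; have [r [m [M [r0 m0 M0 [inv bd]]]]] := chart_norm_bounds g cx.
exists r, (2 * M); split=> //; first by rewrite mulr_gt0.
move=> y y' cy cy' yr y'r phi lp.
have zz : chart c y' + (chart c y - chart c y') = chart c y by rewrite subrKC.
pose z t := chart c y' + t%:C *: (chart c y - chart c y').
have zr t : 0 <= t <= 1 -> rnorm (z t - chart c x) < r.
  move=> t01; have zr : rball (chart c x) r (chart c y' + (chart c y - chart c y')) by rewrite zz.
  exact: (rball_segment t01 y'r zr).
have := @pointwise_lipschitz R (fun t => phi (chart_inv c (z t))) (2 * M * rnorm (chart c y - chart c y')).
rewrite /z scale0r addr0 scale1r zz !cm_chartK//; apply => t t01.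
have [zd zc] := inv _ (zr _ t01).
have [d d0 dP] := lp c _ zd 1 ltr01.
have v1 : 0 < 1 + rnorm (chart c y - chart c y') by rewrite ltr_pwDl// rnorm_ge0.
exists (d / (1 + rnorm (chart c y - chart c y'))); first by rewrite divr_gt0.
move=> s s01; rewrite ltr_pdivlMr// => st.
have [zds zcs] := inv _ (zr _ s01).
have zst : z s - z t = (s - t)%:C *: (chart c y - chart c y').
  by rewrite /z opprD addrACA subrr add0r rmorphB scalerBl.
have := dP _ zds; rewrite zc zcs zst rnormZr => H.
rewrite (le_trans (H _))//.
  by rewrite (le_lt_trans _ st)// ler_wpM2l// lerDr.
have := bd _ zd; rewrite zc => /(_ (zr _ t01)) /(_ ((s - t)%:C *: (chart c y - chart c y'))) /andP[_ H'].
rewrite rnormZr in H'.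
have -> : 2 * M * rnorm (chart c y - chart c y') * `|s - t| =
  (1 + 1) * (M * (`|s - t| * rnorm (chart c y - chart c y'))) by ring.
by rewrite ler_wpM2l.
Qed.

(** The test function is [m] times the distance to [y] in the chart, truncated at [m * r]. Being
    constant off a compact box, it remains 1-Lipschitz when extended by the value [m * r] to all of
    [X]. *)
Lemma dle_lower c x : dom c x -> exists r m : R, [/\ 0 < r, 0 < m &
  forall y y' s, dom c y -> rnorm (chart c y - chart c x) < r -> s < m * r -> dle y y' s ->
    dom c y' /\ m * rnorm (chart c y' - chart c y) <= s].
Proof.
move=> cx; have [r0 [m [M [r00 m0 M0 [inv bd]]]]] := chart_norm_bounds g cx.
(* A box of radius [r] at [y] lies within [2 * r] of [y], hence within [3 * r] of [x], where the
   bounds on the metric hold. *)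
pose r := r0 / 8; have r_gt0 : 0 < r by rewrite divr_gt0.
exists r, m; split=> // y y' s cy yr sr.
pose phi w : R := if `[< dom c w /\ rnorm (chart c w - chart c y) < r >] then m * rnorm (chart c w - chart c y) else m * r.
pose K := chart_inv c @` cbox (chart c y) r.
have sub z : cbox (chart c y) r z -> rnorm (z - chart c x) < r0.
  move=> /(rnorm_rcoord (ltW r_gt0)) H.
  have -> : z - chart c x = (z - chart c y) + (chart c y - chart c x) by rewrite addrA subrK.
  rewrite (le_lt_trans (rnormD _ _))// (le_lt_trans (lerD H (ltW yr)))// -mulrSr -mulr_natr /r.
  by rewrite mulrAC -mulrA gtr_pMr// ltr_pdivrMr// mul1r ltr_nat.
have cK : compact K.
  have wc : {within cbox (chart c y) r, continuous (chart_inv c)}; last first.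
    exact: (continuous_compact wc (@cbox_compact R n (chart c y) r)).
  apply/continuous_in_subspaceT => z; rewrite inE => /sub /inv[zd zc]; apply: cm_inv_continuous.
  by exists (chart_inv c z).
(* Hausdorff separation enters here: the complement of [K] must be open for the extended function to
   be locally constant on it. *)
have clK : closed K by apply: compact_closed cK; exact: cm_hausdorff.
have inK w : dom c w -> rnorm (chart c w - chart c y) < r -> K w.
  move=> cw wr; exists (chart c w); last by rewrite cm_chartK.
  by move=> k; rewrite (le_trans (rcoord_le _ _))// ltW.
have phiE w : dom c w -> phi w = Num.min (m * rnorm (chart c w - chart c y)) (m * r).
  move=> cw; rewrite /phi; case: asboolP => [[_ H]|H].
    by rewrite min_l// ler_pM2l// ltW.
  by rewrite min_r// ler_pM2l// leNgt; apply/negP => H'; apply: H.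
have lphi : lip1 phi.
  move=> d x' dx'; have [[z zK zx']|nK] := pselect (K x').
    have [zd zc] := inv _ (sub _ zK); rewrite zx' in zd zc.
    apply: (plip_chart ler01 dx' zd) => e e0; exists 1 => // w cw _.
    rewrite !phiE//; have minB (a b k : R) : `|Num.min a k - Num.min b k| <= `|a - b|.
      by case: (leP a k) => ?; case: (leP b k) => ? //; rewrite ?subrr ?normr0 ?normr_ge0// ler_norml; apply/andP; split; have := ler_norm (a - b); have := ler_norm (b - a); rewrite (distrC b a); lra.
    rewrite (le_trans (minB _ _ _))// -mulrBr normrM gtr0_norm//.
    have tri : `|rnorm (chart c w - chart c y) - rnorm (chart c x' - chart c y)| <= rnorm (chart c w - chart c x').
      rewrite ler_norml; apply/andP; split.
        have := rnormB_le (chart c x') (chart c w) (chart c y).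
        by rewrite (rnormB (chart c x') (chart c w)); lra.
      by have := rnormB_le (chart c w) (chart c x') (chart c y); lra.
    rewrite (le_trans (ler_wpM2l (ltW m0) tri))//.
    have := bd _ zd; rewrite zc => /(_ (sub _ zK) (chart c w - z)) /andP[H _].
    by rewrite (le_trans H)// ler_peMl ?hnorm_ge0// lerDl ltW.
  have oK : nbhs x' (~` K) by apply: open_nbhs_nbhs; split=> //; rewrite openC.
  have /(nbhs_chart _ dx')[dd dd0 ddP] := oK.
  move=> e e0; exists dd => // w dw /(ddP _ dw) nKw.
  have phiN v : ~ K v -> phi v = m * r by move=> nv; rewrite /phi; case: asboolP => // -[? ?]; case: nv; exact: inK.
  by rewrite !phiN// subrr normr0 mulr_ge0 ?hnorm_ge0// addr_ge0// ltW.
have mr0 : 0 <= m * r by rewrite mulr_ge0 ?(ltW m0) ?(ltW r_gt0).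
move=> /(_ phi lphi); rewrite (phiE _ cy) subrr rnorm0 mulr0 min_l//.
rewrite sub0r normrN /phi; case: asboolP => [[H1 H2]|_].
  by rewrite ger0_norm ?mulr_ge0 ?rnorm_ge0 ?(ltW m0).
by rewrite ger0_norm// => H; move: sr; rewrite ltNge H.
Qed.

Lemma nbhs_dle x (A : set X) : nbhs x A <-> exists2 s : R, 0 < s & forall y, dle x y s -> A y.
Proof.
have [c cx] := cm_cover x; split=> [/(nbhs_chart _ cx)[d d0 dP]|[s s0 sA]].
  have [r [m [r0 m0 H]]] := dle_lower cx; pose s := Num.min (m * d) (m * r) / 2.
  have s0 : 0 < s by rewrite divr_gt0// lt_min !mulr_gt0.
  have sd : s < Num.min (m * d) (m * r) by rewrite ltr_pdivrMr// mulr_natr mulr2n ltrDl lt_min !mulr_gt0.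
  rewrite lt_min in sd; have [sd1 sd2] := andP sd.
  exists s => // y /(H x y s cx); rewrite subrr rnorm0 => /(_ r0 sd2)[cy ym].
  by apply: dP => //; rewrite -(ltr_pM2l m0) (le_lt_trans ym).
have [r [M [r0 M0 H]]] := dle_upper cx; apply/(nbhs_chart _ cx).
exists (Num.min r (s / M)); first by rewrite lt_min r0 divr_gt0.
move=> y cy; rewrite lt_min => /andP[yr ys]; apply: sA.
apply: dle_le (H _ _ cx cy _ yr); last by rewrite subrr rnorm0.
by rewrite rnormB mulrC -ler_pdivlMr// ltW.
Qed.

End distance.

(** * Maps between complex manifolds *)

Section compact_connected.
Context {T : topologicalType}.

(** If [P K] failed, the sets whose removal from [K] leaves a set satisfying [P] would form a proper
    filter containing [K]. At a cluster point, the complement of a neighbourhood satisfying [P]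
    would belong to this filter. *)
Lemma compact_induction (K : set T) (P : set T -> Prop) : compact K ->
  (forall A B, A `<=` B -> P B -> P A) -> P set0 ->
  (forall A B, P A -> P B -> P (A `|` B)) ->
  (forall x, K x -> exists2 U, nbhs x U & P U) -> P K.
Proof.
move=> cK mP P0 PU Pl; apply: contrapT => nPK.
pose F : set_system T := [set S | P (K `\` S)].
have FF : Filter F.
  split.
  - by rewrite /F/= setDT.
  - by move=> A B FA FB; rewrite /F/= setDIr; exact: PU.
  - by move=> A B AB; apply: mP; exact: setDS.
have pF : ProperFilter F by split=> //; rewrite /F/= setD0.
have FK : F K by rewrite /F/= setDv.
have [x [Kx clx]] := cK F pF FK.
have [U nU PU'] := Pl x Kx.
have FU : F (~` U) by rewrite /F/=; apply: mP PU' => y [_ /contrapT].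
by have [y []] := clx _ _ FU nU.
Qed.

Lemma connected_induction (P : T -> Prop) x0 : connected [set: T] -> P x0 ->
  (forall x, exists2 U, nbhs x U & forall y, U y -> (P x <-> P y)) -> forall x, P x.
Proof.
move=> cT Px0 Pl x.
have oP (Q : T -> Prop) : (forall x, exists2 U, nbhs x U & forall y, U y -> (Q x <-> Q y)) -> open [set x | Q x].
  move=> Ql; rewrite openE => y Qy; have [U nU UQ] := Ql y.
  by apply: filterS nU => z Uz; exact: (iffLR (UQ z Uz)).
have o1 := oP _ Pl.
have o2 : open (~` [set x | P x]).
  apply: (oP (fun x => ~ P x)) => y; have [U nU UP] := Pl y; exists U => // z /UP.
  by tauto.
have -> // : P = setT.
apply: cT; first by exists x0.
  by exists [set x | P x] => //; rewrite setTI.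
by exists [set x | P x]; [rewrite -openC|rewrite setTI].
Qed.

End compact_connected.

Section local_representations.
Context {R : realType} {n : nat}.
Implicit Types X Y Z : complexManifold R n.
Local Notation V := (Cn R n).

Lemma cder_comp (F F' : V -> V) z L L' : cder F z L -> cder F' (F z) L' ->
  cder (F' \o F) z (L' \o L).
Proof.
move=> [lL FL] [lL' FL']; split.
  by move=> a u v /=; rewrite lL lL'.
move=> e e0; have [k k0 kP] := lin_bounded lL; have [k' k'0 k'P] := lin_bounded lL'.
pose e1 := e / (2 * (k + 1)); have k1 : 0 < k + 1 by rewrite addr_gt0.
have e10 : 0 < e1 by rewrite divr_gt0// mulr_gt0.
pose e2 := Num.min 1 (e / (2 * k')); have e20 : 0 < e2 by rewrite lt_min ltr01 divr_gt0// mulr_gt0.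
have [d1 d10 d1P] := FL' _ e10; have [d2 d20 d2P] := FL _ e20.
exists (Num.min d2 (d1 / (k + 1))); first by rewrite lt_min d20 divr_gt0.
move=> h; rewrite lt_min ltr_pdivlMr// => /andP[/d2P H1 hd].
set w := F (z + h) - F z - L h in H1.
have H2 : rnorm (F (z + h) - F z) <= (k + 1) * rnorm h.
  rewrite -[F (z + h) - F z](subrK (L h)) -/w (le_trans (rnormD _ _))// mulrDl mul1r addrC.
  rewrite lerD// (le_trans H1)// ler_piMl ?rnorm_ge0// ge_min lexx//.
have H3 : rnorm (F (z + h) - F z) < d1 by rewrite (le_lt_trans H2)// mulrC.
have := d1P _ H3; rewrite subrKC => H4.
have -> : (F' \o F) (z + h) - (F' \o F) z - (L' \o L) h =
    (F' (F (z + h)) - F' (F z) - L' (F (z + h) - F z)) + L' w.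
  by rewrite /w (linB lL' _ (L h)) addrA subrK.
rewrite (le_trans (rnormD _ _))// (splitr e) mulrDl lerD//.
  rewrite (le_trans H4)// (le_trans (ler_wpM2l (ltW e10) H2))// mulrA ler_wpM2r ?rnorm_ge0//.
  by rewrite le_eqVlt; apply/orP; left; apply/eqP; rewrite /e1; field; rewrite gt_eqF.
rewrite (le_trans (k'P _))// (le_trans (ler_wpM2l (ltW k'0) H1))// mulrA ler_wpM2r ?rnorm_ge0//.
rewrite (le_trans (_ : _ <= k' * (e / (2 * k'))))//.
  by rewrite ler_wpM2l ?(ltW k'0)// ge_min lexx orbT.
by rewrite le_eqVlt; apply/orP; left; apply/eqP; field; rewrite gt_eqF.
Qed.

Lemma cder_id z : cder (id : V -> V) z id.
Proof.
by split=> // e e0; exists 1 => // h _; rewrite [X in X - _]addrAC subrr add0r subrr rnorm0 mulr_ge0 ?(ltW e0) ?rnorm_ge0.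
Qed.

Lemma cder_local_comp X Y Z (f : X -> Y) (f' : Y -> Z) c d e x L L' :
  dom c x -> dom d (f x) -> {for x, continuous f} ->
  cder (local_rep f c d) (chart c x) L -> cder (local_rep f' d e) (chart d (f x)) L' ->
  cder (local_rep (f' \o f) c e) (chart c x) (L' \o L).
Proof.
move=> cx dfx cf H H'.
have nb : nbhs (f x) (dom d) by apply: open_nbhs_nbhs; split=> //; exact: cm_dom_open.
have /(nbhs_chart _ cx)[r1 r10 r1P] := cf _ nb.
have [r2 r20 r2P] := chart_ball cx.
have E : local_rep f c d (chart c x) = chart d (f x) by rewrite /local_rep/= cm_chartK.
rewrite -E in H'; have := cder_comp H H'.
apply: (@cder_near _ _ _ _ _ _ _ (Num.min r1 r2)); first by rewrite lt_min r10.
move=> y; rewrite lt_min => /andP[y1 /r2P[yd yc]].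
rewrite /local_rep/= cm_chartK//; apply: r1P => //.
by rewrite yc.
Qed.

Lemma cder_local_id X (c : cm_index X) x : dom c x -> cder (local_rep (@id X) c c) (chart c x) id.
Proof.
move=> cx; have [r r0 rP] := chart_ball cx.
apply: (@cder_near _ _ _ id _ _ _ r) => //; last exact: cder_id.
by move=> y /rP[yd yc]; rewrite /local_rep/= yc.
Qed.

Lemma holomorphic_cder X Y (f : X -> Y) c d x : holomorphic f -> dom c x -> dom d (f x) ->
  cder (local_rep f c d) (chart c x) (vD (local_rep f c d) (chart c x)).
Proof. by move=> [_ H] cx dfx; apply: differentiable_vD; exact: H. Qed.

Lemma vD_local_comp X Y Z (f : X -> Y) (f' : Y -> Z) c d e x v : holomorphic f -> holomorphic f' ->
  dom c x -> dom d (f x) -> dom e (f' (f x)) ->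
  vD (local_rep (f' \o f) c e) (chart c x) v =
  vD (local_rep f' d e) (chart d (f x)) (vD (local_rep f c d) (chart c x) v).
Proof.
move=> hf hf' cx dx ex; have [cf _] := hf.
by rewrite (cder_vD (cder_local_comp cx dx (cf x) (holomorphic_cder hf cx dx) (holomorphic_cder hf' dx ex))).
Qed.

Lemma holomorphic_comp X Y Z (f : X -> Y) (f' : Y -> Z) :
  holomorphic f -> holomorphic f' -> holomorphic (f' \o f).
Proof.
move=> hf hf'; have [cf _] := hf; have [cf' _] := hf'; split.
  by move=> x; exact: (continuous_comp (cf x) (cf' (f x))).
move=> c e x cx ex; have [d dx] := cm_cover (f x).
by have /cder_differentiable[] := cder_local_comp cx dx (cf x) (holomorphic_cder hf cx dx) (holomorphic_cder hf' dx ex).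
Qed.

Lemma holomorphic_id X : holomorphic (@id X).
Proof. by split=> [x|c d x cx dx]; [exact: cvg_id|exact: (cm_holomorphic cx dx)]. Qed.

Lemma pullback_vD X Y (f : X -> Y) (h : hermitianMetric Y) u (g : hermitianMetric X) :
  pullback_eq f h u g <-> forall c d x, dom c x -> dom d (f x) -> forall v w,
   h d (f x) (vD (local_rep f c d) (chart c x) v) (vD (local_rep f c d) (chart c x) w) = u x * g c x v w.
Proof. by split=> H c d x cx dx v w; have := H c d x cx dx v w; rewrite !vDE. Qed.

Lemma pullback_comp X Y Z (f : X -> Y) (f' : Y -> Z) g h k u u' : holomorphic f -> holomorphic f' ->
  pullback_eq f h u g -> pullback_eq f' k u' h -> pullback_eq (f' \o f) k (fun x => u' (f x) * u x) g.
Proof.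
move=> hf hf' /pullback_vD H /pullback_vD H'; apply/pullback_vD => c e x cx ex v w.
have [d dx] := cm_cover (f x).
by rewrite !(vD_local_comp _ hf hf' cx dx ex) H'// H// mulrA.
Qed.

Lemma pullback_id X (g : hermitianMetric X) : pullback_eq id g (fun=> 1) g.
Proof. by move=> c d x cx dx v w; rewrite mul1r; exact: hm_compat. Qed.

Lemma vD_inverse X Y (f : X -> Y) (f' : Y -> X) c d y v : holomorphic f -> holomorphic f' ->
  cancel f' f -> dom d y -> dom c (f' y) ->
  vD (local_rep f c d) (chart c (f' y)) (vD (local_rep f' d c) (chart d y) v) = v.
Proof.
move=> hf hf' f'K dy cy; have dfy : dom d (f (f' y)) by rewrite f'K.
rewrite -(vD_local_comp _ hf' hf dy cy dfy).
have -> : f \o f' = id by apply/funext.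
by rewrite (cder_vD (cder_local_id dy)).
Qed.

Lemma pullback_inv X Y (f : X -> Y) (f' : Y -> X) g h u : holomorphic f -> holomorphic f' ->
  cancel f' f -> (forall x, 0 < u x) ->
  pullback_eq f h u g -> pullback_eq f' g (fun y => (u (f' y))^-1) h.
Proof.
move=> hf hf' f'K u0 /pullback_vD H; apply/pullback_vD => d c y dy cy v w.
have dfy : dom d (f (f' y)) by rewrite f'K.
have := H c d (f' y) cy dfy (vD (local_rep f' d c) (chart d y) v) (vD (local_rep f' d c) (chart d y) w).
rewrite !(vD_inverse _ hf hf' f'K dy cy) f'K => ->.
by rewrite mulKf// gt_eqF.
Qed.

(** Conformality bounds the differential by the square root of the factor times the ratio of the
    metric bounds, which supplies the Lipschitz constant of [vlhol]. *)
Lemma pullback_bound X Y (f : X -> Y) g h u c d x : holomorphic f ->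
  pullback_eq f h u g -> {for x, continuous u} -> dom c x -> dom d (f x) ->
  exists r K : R, [/\ 0 < r, 0 < K, vlhol (chart c x) r K (local_rep f c d) &
    forall z, rball (chart c x) r z ->
     [/\ dom c (chart_inv c z), chart c (chart_inv c z) = z & dom d (f (chart_inv c z))]].
Proof.
move=> hf /pullback_vD H cu cx dx; have [cf _] := hf.
have [r1 [m1 [M1 [r10 m10 M10 [inv bd1]]]]] := chart_norm_bounds g cx.
have [r2 [m2 [M2 [r20 m20 M20 [_ bd2]]]]] := chart_norm_bounds h dx.
have nb : nbhs (f x) [set y | dom d y /\ rnorm (chart d y - chart d (f x)) < r2].
  by apply/(nbhs_chart _ dx); exists r2.
have /(nbhs_chart _ cx)[r3 r30 r3P] := cf x _ nb.
pose B := `|u x| + 1; have B0 : 0 < B by rewrite ltr_wpDl.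
have nu : nbhs x [set y | u y <= B].
  have /cvgrPdist_le/(_ _ ltr01) := cu; apply: filterS => y /=.
  by rewrite ler_distl /B => /andP[H1 H2]; have := ler_norm (u x); lra.
have /(nbhs_chart _ cx)[r4 r40 r4P] := nu.
pose r := Num.min (Num.min r1 r3) r4.
have r0 : 0 < r by rewrite !lt_min r10 r30.
have rP z : rball (chart c x) r z -> [/\ dom c (chart_inv c z), chart c (chart_inv c z) = z, dom d (f (chart_inv c z)),
    rnorm (chart d (f (chart_inv c z)) - chart d (f x)) < r2 & rnorm (z - chart c x) < r1 /\ u (chart_inv c z) <= B].
  rewrite /rball/= !lt_min => /andP[/andP[z1 z3] z4]; have [zd zc] := inv _ z1.
  have [dz z2] := r3P (chart_inv c z) zd ltac:(by rewrite zc); split=> //; split=> //.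
  by apply: r4P; rewrite ?zc.
pose K := Num.sqrt B * M1 / m2; have K0 : 0 < K by rewrite divr_gt0// mulr_gt0// sqrtr_gt0.
exists r, (K *+ 2); split=> //; first by rewrite pmulrn_rgt0.
  apply: vlhol_of_bound => [z /rP[zd zc dz _ _]|z v /rP[zd zc dz dz2 [z1 zB]]].
    by have [_ /(_ c d _ zd dz)] := hf; rewrite zc.
  have := H c d _ zd dz v v; rewrite zc => E.
  have /andP[b1 _] := bd2 _ dz dz2 (vD (local_rep f c d) z v).
  have := bd1 _ zd; rewrite zc => /(_ z1 v) /andP[_ b2].
  rewrite /K mulrAC ler_pdivlMr// mulrC (le_trans b1)//.
  rewrite /hnorm E.
  have B1 : Num.sqrt (u (chart_inv c z) * g c (chart_inv c z) v v) <= Num.sqrt (B * g c (chart_inv c z) v v).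
    by rewrite ler_wsqrtr// ler_wpM2r// (hf_ge0 (chart_hermitian g zd)).
  by rewrite (le_trans B1)// sqrtrM ?(ltW B0)// -mulrA ler_wpM2l// sqrtr_ge0.
by move=> z /rP[].
Qed.

Lemma factor_locally_constant X Y (f : X -> Y) g h u : (1 < n)%N -> holomorphic f ->
  kaehler g -> kaehler h -> continuous u -> pullback_eq f h u g ->
  forall x, exists2 U, nbhs x U & forall y, U y -> u y = u x.
Proof.
move=> n1 hf kg kh cu H x; have [c cx] := cm_cover x; have [d dx] := cm_cover (f x).
have [r [K [r0 K0 hF rP]]] := pullback_bound hf H (cu x) cx dx.
exists [set y | dom c y /\ rnorm (chart c y - chart c x) < r].
  by apply/(nbhs_chart _ cx); exists r.
move=> y [cy yr].
pose nu z := u (chart_inv c z).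
have -> : u y = nu (chart c y) by rewrite /nu cm_chartK.
have -> : u x = nu (chart c x) by rewrite /nu cm_chartK.
apply: (@line_const _ _ nu (chart c x) r) => // z v zr.
apply: (@factor_derive _ _ (chart c @` dom c) (chart d @` dom d)
  (fun z => g c (chart_inv c z)) (fun z => h d (chart_inv d z)) (local_rep f c d) nu (chart c x) r K) => //.
- exact: cm_image_open.
- exact: cm_image_open.
- exact: metric_on_chart.
- exact: metric_on_chart.
- exact: kg.
- exact: kh.
- move=> z' /rP[zd zc dz]; split; first by exists (chart_inv c z').
  by exists (f (chart_inv c z')).
- move=> z' /rP[zd zc dz] v' w'; have /pullback_vD/(_ c d _ zd dz v' w') := H.
  by rewrite zc /local_rep/= cm_chartK.
Qed.

End local_representations.

(** * The group of similarities *)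

Section similarities.
Context {R : realType} {n : nat}.
Implicit Types X Y : complexManifold R n.

(** If [phi] is a test function on [Y], then [s^-1 * (phi \o f)] is one on [X]. *)
Lemma pullback_dle X Y (f : X -> Y) g h (s : R) x y r : holomorphic f -> 0 < s ->
  pullback_eq f h (fun=> s ^+ 2) g -> dle g x y r -> dle h (f x) (f y) (s * r).
Proof.
move=> hf s0 /pullback_vD H dxy phi lphi; have [cf df] := hf.
have lf : lip1 g (fun z => s^-1 * (phi \o f) z).
  move=> c z cz; have [d dz] := cm_cover (f z).
  have := @plip_comp _ _ X Y g h f phi c d z 1 s cz dz (cf z) (df _ _ _ cz dz) ler01 (ltW s0).
  move=> /(_ _ (lphi d _ dz)) P.
  have {}P : plip g (1 * s) (phi \o f) c z.
    by apply: P => v; rewrite /hnorm (H c d z cz dz) sqrtrM ?sqr_ge0// sqrtr_sqr ger0_norm ?(ltW s0).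
  have := plipZ s^-1 P; rewrite mul1r ger0_norm ?invr_ge0 ?(ltW s0)// mulVf// gt_eqF//.
have := dxy _ lf; rewrite /= -mulrBr normrM gtr0_norm ?invr_gt0// mulrC ler_pdivrMr//.
by rewrite mulrC.
Qed.

End similarities.

Section similarity_group.
Context {R : realType} {n : nat} {X : complexManifold R n} (g : hermitianMetric X).

(* [t = ((f, f^-1), s)]; the factor [s] is part of the data, as it is not determined by [f]
   when [X] is empty. *)
Definition simP (t : (X -> X) * (X -> X) * R) :=
  [/\ holomorphic t.1.1, holomorphic t.1.2, cancel t.1.1 t.1.2, cancel t.1.2 t.1.1 &
      0 < t.2 /\ pullback_eq t.1.1 g (fun=> t.2 ^+ 2) g].

Definition simG := {t | simP t}.
Definition fwd (a : simG) : X -> X := (sval a).1.1.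
Definition bwd (a : simG) : X -> X := (sval a).1.2.
Definition fac (a : simG) : R := (sval a).2.

Lemma fwd_hol a : holomorphic (fwd a). Proof. by case: (svalP a). Qed.
Lemma bwd_hol a : holomorphic (bwd a). Proof. by case: (svalP a). Qed.
Lemma fwdK a : cancel (fwd a) (bwd a). Proof. by case: (svalP a). Qed.
Lemma bwdK a : cancel (bwd a) (fwd a). Proof. by case: (svalP a). Qed.
Lemma fac_gt0 a : 0 < fac a. Proof. by case: (svalP a) => _ _ _ _ []. Qed.
Lemma fwd_pullback a : pullback_eq (fwd a) g (fun=> fac a ^+ 2) g.
Proof. by case: (svalP a) => _ _ _ _ []. Qed.

Lemma simG_eq (a b : simG) : fwd a = fwd b -> bwd a = bwd b -> fac a = fac b -> a = b.
Proof.
case: a b => [[[f f'] s] P] [[[k k'] r] Q]; rewrite /fwd/bwd/fac/= => E1 E2 E3.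
by move: P Q; rewrite E1 E2 E3 => P Q; congr exist; exact: Prop_irrelevance.
Qed.

Lemma simP_mul (a b : simG) : simP (fwd a \o fwd b, bwd b \o bwd a, fac a * fac b).
Proof.
split=> /=.
- by apply: holomorphic_comp; exact: fwd_hol.
- by apply: holomorphic_comp; exact: bwd_hol.
- by move=> x /=; rewrite !fwdK.
- by move=> x /=; rewrite !bwdK.
split; first by rewrite mulr_gt0// fac_gt0.
have := pullback_comp (@fwd_hol b) (@fwd_hol a) (@fwd_pullback b) (@fwd_pullback a).
by rewrite exprMn.
Qed.
Definition sim_mul a b : simG := exist _ _ (simP_mul a b).

Lemma simP_inv (a : simG) : simP (bwd a, fwd a, (fac a)^-1).
Proof.
split=> /=; [exact: bwd_hol|exact: fwd_hol|exact: bwdK|exact: fwdK|].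
split; first by rewrite invr_gt0 fac_gt0.
have a20 (x : X) : 0 < fac a ^+ 2 by rewrite exprn_gt0// fac_gt0.
have := pullback_inv (@fwd_hol a) (@bwd_hol a) (@bwdK a) a20 (@fwd_pullback a).
by rewrite exprVn.
Qed.
Definition sim_inv a : simG := exist _ _ (simP_inv a).

Lemma simP_one : simP (id, id, 1).
Proof.
split=> //=; try exact: holomorphic_id.
split; first exact: ltr01.
by rewrite expr1n; exact: pullback_id.
Qed.
Definition sim_one : simG := exist _ _ simP_one.

Lemma sim_mulA : associative sim_mul.
Proof. by move=> a b c; apply: simG_eq => //=; rewrite /fac/= mulrA. Qed.
Lemma sim_mulV : right_inverse sim_one sim_inv sim_mul.
Proof.
move=> a; apply: simG_eq; rewrite /fwd/bwd/fac/=.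
- by apply/funext => x; exact: bwdK.
- by apply/funext => x; exact: bwdK.
- by rewrite mulfV// gt_eqF// fac_gt0.
Qed.
Lemma sim_Vmul : left_inverse sim_one sim_inv sim_mul.
Proof.
move=> a; apply: simG_eq; rewrite /fwd/bwd/fac/=.
- by apply/funext => x; exact: fwdK.
- by apply/funext => x; exact: fwdK.
- by rewrite mulVf// gt_eqF// fac_gt0.
Qed.
Lemma sim_mul1 : right_id sim_one sim_mul.
Proof. by move=> a; apply: simG_eq => //; rewrite /fac/= mulr1. Qed.
Lemma sim_dle a x y r : dle g x y r -> dle g (fwd a x) (fwd a y) (fac a * r).
Proof. exact: pullback_dle (@fwd_hol a) (@fac_gt0 a) (@fwd_pullback a). Qed.

Lemma sim_dleV a x y r : dle g x y r -> dle g (bwd a x) (bwd a y) (r / fac a).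
Proof. by move=> H; rewrite mulrC; exact: (@sim_dle (sim_inv a) x y r H). Qed.

Lemma sim_conf a : Conf g (fwd a).
Proof.
split; first by split; [exact: fwd_hol|exists (bwd a); split; [exact: fwdK|exact: bwdK|exact: bwd_hol]].
exists (fun=> fac a ^+ 2); split.
- by move=> c; exact: smooth_cst.
- by move=> _; rewrite exprn_gt0// fac_gt0.
- exact: fwd_pullback.
Qed.

Lemma smooth_fun_continuous (u : X -> R) : smooth_fun u -> continuous u.
Proof.
move=> su x; have [c cx] := cm_cover x.
have Ic : (chart c @` dom c) (chart c x) by exists x.
have [/(_ _ Ic) cu _] := su c 0%N.
move=> A /nbhs_ballP[e /= e0 eA]; apply/(nbhs_chart _ cx).
have e20 : 0 < e / 2 by rewrite divr_gt0.
have [d d0 dP] := continuous_eps cu e20.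
exists d => // y cy /dP /=; rewrite !cm_chartK// => H; apply: eA.
by rewrite -ball_normE/= distrC (le_lt_trans H)// ltr_pdivrMr// mulr2n mulrDr mulr1 ltrDl.
Qed.

Lemma conf_sim f : (1 < n)%N -> kaehler g -> connected [set: X] -> Conf g f ->
  exists a : simG, fwd a = f.
Proof.
move=> n1 kg cX [[hf [f' [fK f'K hf']]] [u [su u0 pu]]].
have cu := smooth_fun_continuous su.
have [s s0 us] : exists2 s : R, 0 < s & forall x, u x = s ^+ 2.
  (* On the empty manifold the factor is 1 by default. *)
  have [[x0 _]|nX] := pselect (exists x : X, True); last by exists 1 => // x; case: nX; exists x.
  exists (Num.sqrt (u x0)); rewrite ?sqrtr_gt0// => x; rewrite sqr_sqrtr ?(ltW (u0 _))//.
  move: x; apply: (connected_induction (P := fun x => u x = u x0) (x0 := x0)) => // x.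
  have [U nU UP] := factor_locally_constant n1 hf kg kg cu pu x.
  by exists U => // y /UP ->.
have P : simP (f, f', s).
  split=> //=; split=> // c d x cx dx v w; rewrite -(us x).
  exact: pu.
by exists (exist _ _ P).
Qed.

End similarity_group.

(** * Relatively compact balls and totally bounded sets of maps *)

Section total_boundedness.
Context {R : realType} {n : nat} {X : complexManifold R n} (g : hermitianMetric X).

(* The ball of radius [r] at [x] is relatively compact. *)
Definition rc x r := exists2 K : set X, compact K & forall y, dle g x y r -> K y.

Lemma rc_le x r s : r <= s -> rc x s -> rc x r.
Proof. by move=> rs [K cK KP]; exists K => // y /(dle_le rs)/KP. Qed.

Lemma rc_move x y r s : dle g x y s -> rc x (s + r) -> rc y r.
Proof. by move=> xy [K cK KP]; exists K => // z yz; apply: KP; exact: dle_trans xy yz. Qed.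

Lemma rc_small x : exists2 r : R, 0 < r & rc x r.
Proof.
have [c cx] := cm_cover x; have [r [m [r0 m0 H]]] := dle_lower g cx.
have [r1 r10 inv] := chart_ball cx.
pose e := Num.min r (r1 / 4); have e0 : 0 < e by rewrite lt_min r0 divr_gt0.
exists (m * e / 2); first by rewrite divr_gt0// mulr_gt0.
have sub z : cbox (chart c x) e z -> rnorm (z - chart c x) < r1.
  move=> /(rnorm_rcoord (ltW e0)) B; rewrite (le_lt_trans B)//.
  have : e <= r1 / 4 by rewrite ge_min lexx orbT.
  by rewrite mulr2n; lra.
exists (chart_inv c @` cbox (chart c x) e).
  have wc : {within cbox (chart c x) e, continuous (chart_inv c)}.
    apply/continuous_in_subspaceT => z; rewrite inE => /sub/inv[zd zc].
    by apply: cm_inv_continuous; exists (chart_inv c z).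
  exact: (continuous_compact wc (@cbox_compact R n (chart c x) e)).
move=> y xy; have me : m * e / 2 < m * r.
  rewrite (lt_le_trans (y := m * e))//; last by rewrite ler_pM2l// ge_min lexx.
  by rewrite ltr_pdivrMr// mulr_natr mulr2n ltrDl mulr_gt0.
have [|cy ym] := H x y _ cx _ me xy; first by rewrite subrr rnorm0.
exists (chart c y); last by rewrite cm_chartK.
move=> k; rewrite (le_trans (rcoord_le _ _))//.
rewrite -(ler_pM2l m0) (le_trans ym)// ler_pdivrMr// mulr_natr mulr2n lerDl.
by rewrite mulr_ge0// ltW.
Qed.

Lemma sim_rc (a : simG g) x r : rc x r -> rc (fwd a x) (fac a * r).
Proof.
move=> [K cK KP]; exists (fwd a @` K).
  apply: (@continuous_compact _ _ (fwd a) K _ cK); apply/continuous_in_subspaceT => y _.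
  by have [cf _] := fwd_hol a; exact: cf.
move=> y /(sim_dleV a); rewrite fwdK mulrAC mulfV ?gt_eqF ?fac_gt0// mul1r => /KP Ky.
by exists (bwd a y) => //; rewrite bwdK.
Qed.

Section classes.
Context {W : Type}.
Implicit Types (S : set W) (phi : W -> X).

(** [phi @` S] is totally bounded *)
Definition tbm S phi := forall e : R, 0 < e -> exists (T : finType) (f : W -> T),
  forall a b, S a -> S b -> f a = f b -> dle g (phi a) (phi b) e.

Lemma tbm_bigU S (T : finType) (f : W -> T) phi :
  (forall t, tbm [set a | S a /\ f a = t] phi) -> tbm S phi.
Proof.
move=> H e e0.
have [Tt Tf] := choice (fun t => H t e e0).
pose ft t := sval (cid (Tf t)); have fP t := svalP (cid (Tf t)).
exists {t : T & Tt t}, (fun a => Tagged Tt (ft (f a) a)) => a b Sa Sb E.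
have ab : f a = f b := congr1 tag E.
move: E => /eqP; move: (fP (f a)); rewrite ab => P; rewrite eq_Tagged => /eqP.
exact: P.
Qed.

Lemma tbm_compact S phi K : compact K -> (forall a, S a -> K (phi a)) -> tbm S phi.
Proof.
move=> cK SK e e0; have e20 : 0 < e / 2 by rewrite divr_gt0.
have [T [f fP]] : exists (T : finType) (f : X -> T), forall x y, K x -> K y -> f x = f y -> dle g x y e.
  apply: (@compact_induction _ K (fun A => exists (T : finType) (f : X -> T), forall x y, A x -> A y -> f x = f y -> dle g x y e)) => //.
  - by move=> A B AB [T [f fP]]; exists T, f => x y /AB + /AB; exact: fP.
  - by exists unit, (fun=> tt).
  - move=> A B [T [f fP]] [T' [f' f'P]].
    exists (bool * (T * T'))%type, (fun x => (`[< A x >], (f x, f' x))) => x y xAB yAB [Axy fxy fxy'].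
    case: xAB => [Ax|Bx].
      apply: fP => //; apply/asboolP; rewrite -Axy; exact/asboolP.
    case: yAB => [Ay|By]; last exact: f'P.
    apply: fP => //; apply/asboolP; rewrite Axy; exact/asboolP.
  - move=> x _; exists [set y | dle g x y (e / 2)].
      by apply/(nbhs_dle g); exists (e / 2).
    exists unit, (fun=> tt) => y z xy xz _; rewrite (splitr e).
    exact: dle_trans (dle_sym xy) xz.
by exists T, (f \o phi) => a b /SK Ka /SK Kb; exact: fP.
Qed.

Lemma tbm_rc S phi x r : rc x r -> (forall a, S a -> dle g x (phi a) r) -> tbm S phi.
Proof. by move=> [K cK KP] SP; apply: (tbm_compact cK) => a /SP/KP. Qed.

(** Divide [S] into finitely many classes on which [phi] varies by at most [r]: on each of them
    [psi] stays in a single relatively compact ball, of radius [d + r]. *)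
Lemma tbm_move S phi psi (d r : R) : 0 < r -> tbm S phi ->
  (forall a, S a -> dle g (phi a) (psi a) d) -> (forall a, S a -> rc (phi a) (d + r)) ->
  tbm S psi.
Proof.
move=> r0 tS pp rS; have [T [f fP]] := tS r r0.
apply: (@tbm_bigU _ T f) => t.
have [[b [Sb bt]]|nb] := pselect (exists b, S b /\ f b = t); last first.
  by move=> e _; exists unit, (fun=> tt) => a b [Sa fa]; case: nb; exists a.
apply: (@tbm_rc _ _ (phi b) (d + r)); first exact: rS.
move=> a [Sa fa]; rewrite addrC; apply: dle_trans (pp a Sa).
by apply: fP => //; rewrite bt fa.
Qed.

End classes.

End total_boundedness.

(** * Metrics with a ball that is not relatively compact *)

Section finite_distance.
Context {R : realType} {n : nat} {X : complexManifold R n} (g : hermitianMetric X).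

Lemma dle_finite x y : connected [set: X] -> exists r, dle g x y r.
Proof.
move=> cX; move: y; apply: (connected_induction (P := fun y => exists r, dle g x y r) (x0 := x)) => //.
  by exists 0; exact: dle_refl.
move=> y; exists [set z | dle g y z 1]; first by apply/(nbhs_dle g); exists 1.
move=> z yz; split=> -[r H].
  by exists (r + 1); exact: dle_trans H yz.
by exists (r + 1); exact: dle_trans H (dle_sym yz).
Qed.

End finite_distance.

Section radius.
Context {R : realType} {n : nat} {X : complexManifold R n} (g : hermitianMetric X).
Hypothesis cX : connected [set: X].
Hypothesis nrc : forall x, exists r, ~ rc g x r.

Definition rho x : R := sup [set r | rc g x r].

Let rc_sup x : has_sup [set r | rc g x r].
Proof.
have [r r0 rP] := rc_small g x; have [s sP] := nrc x; split; first by exists r.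
exists s => t tP; rewrite leNgt; apply/negP => st; apply: sP.
exact: rc_le (ltW st) tP.
Qed.

Lemma rc_rho x r : rc g x r -> r <= rho x.
Proof. by move=> xr; apply: sup_upper_bound. Qed.

Lemma rho_rc x r : r < rho x -> rc g x r.
Proof.
move=> rx; have e0 : 0 < rho x - r by rewrite subr_gt0.
have [s sP] := sup_adherent e0 (rc_sup x); rewrite -/(rho x) subKr => rs.
exact: rc_le (ltW rs) sP.
Qed.

Lemma rho_gt0 x : 0 < rho x.
Proof. by have [r r0 /rc_rho] := rc_small g x; exact: lt_le_trans. Qed.

Lemma rho_move x y s : dle g x y s -> rho x <= rho y + s.
Proof.
move=> xy; rewrite leNgt; apply/negP => H.
pose r := rho x - s; have e0 : 0 < rho x - (rho y + s) by rewrite subr_gt0.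
pose t := (rho x - (rho y + s)) / 2; have t0 : 0 < t by rewrite divr_gt0.
have : rc g x (s + (rho y + t)) by apply: rho_rc; rewrite /t; lra.
by move=> /(rc_move xy)/rc_rho; rewrite gerDl leNgt t0.
Qed.

Lemma rho_sim (a : simG g) x : rho (fwd a x) = fac a * rho x.
Proof.
have le (b : simG g) y : fac b * rho y <= rho (fwd b y).
  rewrite leNgt; apply/negP; rewrite mulrC -ltr_pdivrMr ?fac_gt0// => H.
  pose t := (rho y - rho (fwd b y) / fac b) / 2; have t0 : 0 < t by rewrite divr_gt0// subr_gt0.
  have /(sim_rc b)/rc_rho : rc g y (rho (fwd b y) / fac b + t) by apply: rho_rc; rewrite /t; lra.
  rewrite mulrDr mulrCA mulfV ?gt_eqF ?fac_gt0// mulr1 gerDl leNgt mulr_gt0 ?fac_gt0//.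
apply/eqP; rewrite eq_le le andbT.
have := le (sim_inv a) (fwd a x); have -> : fwd (sim_inv a) (fwd a x) = x := fwdK a x.
by rewrite /fac/= -/(fac a) mulrC ler_pdivrMr ?fac_gt0// mulrC.
Qed.

Context (k0 : X).

(* The neighbourhoods of pointwise convergence, for maps and their inverses. *)
Definition simN (j : seq X * {posnum R}) (a b : simG g) := forall k, List.In k (k0 :: j.1) ->
  dle g (fwd a (bwd b k)) k j.2%:num /\ dle g (fwd b (bwd a k)) k j.2%:num.

Lemma simN_refl j a : simN j a a.
Proof. by move=> k _; rewrite !bwdK; split; exact: dle_refl. Qed.

Lemma simN_inv j (a h b : simG g) : simN j (sim_mul a b) (sim_mul h b) <-> simN j a h.
Proof.
have E (a' h' : simG g) k : fwd (sim_mul a' b) (bwd (sim_mul h' b) k) = fwd a' (bwd h' k).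
  by rewrite /fwd/bwd/= -/(bwd b _) -/(fwd b _) bwdK.
by split=> H k /H; rewrite !E.
Qed.

Lemma simN_dir i j : exists k, forall a b, simN k a b -> simN i a b /\ simN j a b.
Proof.
have [e [ei ej]] : exists e : {posnum R}, e%:num <= i.2%:num /\ e%:num <= j.2%:num.
  have m0 : 0 < Num.min i.2%:num j.2%:num by rewrite lt_min !gt0.
  by exists (PosNum m0); rewrite /= !ge_min !lexx orbT.
exists (i.1 ++ j.1, e) => a b H; split=> k kl.
  have [|H1 H2] := H k; last by split; [exact: dle_le ei H1|exact: dle_le ei H2].
  by case: kl => [->|kl]; [left|right; apply: List.in_or_app; left].
have [|H1 H2] := H k; last by split; [exact: dle_le ej H1|exact: dle_le ej H2].
by case: kl => [->|kl]; [left|right; apply: List.in_or_app; right].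
Qed.

(** By [tbm_move], total boundedness of the backward images passes from one point to any
    sufficiently near one, hence to all points by connectedness. Maps [a] and [b] in the same class
    then satisfy [simN], since both multiply the distance between [bwd a k] and [bwd b k] by at most
    [L]. *)
Lemma simG_tb (S : set (simG g)) (L : R) y : 1 <= L ->
  (forall a, S a -> L^-1 <= fac a <= L) -> tbm g S (fun a => bwd a y) -> tot_bounded simN S.
Proof.
move=> L1 SL tS; have L0 : 0 < L by exact: lt_le_trans ltr01 L1.
have step k k' s : dle g k k' s -> 2 * L ^+ 2 * s <= rho k ->
    tbm g S (fun a => bwd a k) -> tbm g S (fun a => bwd a k').
  move=> kk' sk tk; have s0 := dle_ge0 kk'.
  have r0 : 0 < rho k / (4 * L) by rewrite divr_gt0 ?rho_gt0// mulr_gt0.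
  have facV a : S a -> (fac a)^-1 <= L /\ L^-1 <= (fac a)^-1.
    move=> /SL/andP[a1 a2]; have a0 := fac_gt0 a; split.
      by rewrite -[leRHS]invrK lef_pV2 ?posrE ?invr_gt0.
    by rewrite lef_pV2 ?posrE.
  apply: (@tbm_move _ _ _ _ _ _ _ _ (s * L) _ r0 tk) => a Sa.
    by apply: dle_le (sim_dleV a kk'); rewrite ler_wpM2l//; have [] := facV a Sa.
  apply: rho_rc; have -> : rho (bwd a k) = (fac a)^-1 * rho k := rho_sim (sim_inv a) k.
  have [_ a2] := facV a Sa.
  rewrite (lt_le_trans (y := L^-1 * rho k))//; last by rewrite ler_wpM2r// ltW// rho_gt0.
  have -> : L^-1 * rho k = rho k / (2 * L) + (rho k / (4 * L) + rho k / (4 * L)) by field; rewrite gt_eqF.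
  rewrite addrA ltr_pwDr// lerD2r ler_pdivlMr ?mulr_gt0//.
  by rewrite (le_trans _ sk)// le_eqVlt; apply/orP; left; apply/eqP; ring.
have allk : forall k, tbm g S (fun a => bwd a k).
  apply: (connected_induction (P := fun k => tbm g S (fun a => bwd a k)) (x0 := y)) => // k.
  (* Half the length allowed by [step], so that the step can also be made backwards, from [k'] to
     [k], although [rho] may be smaller at [k']. *)
  pose s := rho k / (4 * L ^+ 2).
  have s0 : 0 < s by rewrite divr_gt0 ?rho_gt0// mulr_gt0// exprn_gt0.
  have sE : 4 * L ^+ 2 * s = rho k by rewrite /s; field; rewrite gt_eqF.
  exists [set k' | dle g k k' s]; first by apply/(nbhs_dle g); exists s.
  move=> k' kk'; have L2 : 1 <= L ^+ 2 by rewrite exprn_ege1.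
  have L2s : s <= L ^+ 2 * s by rewrite ler_peMl// ltW.
  split; first by apply: step kk' _; have := rho_gt0 k; lra.
  by apply: step (dle_sym kk') _; have := rho_move kk'; lra.
move=> [s e]; pose e1 := e%:num / L; have e10 : 0 < e1 by rewrite divr_gt0.
have [T [f fP]] : exists (T : finType) (f : simG g -> T), forall a b, S a -> S b -> f a = f b ->
    forall k, List.In k (k0 :: s) -> dle g (bwd a k) (bwd b k) e1.
  elim: (k0 :: s) => [|k l [T [f fP]]]; first by exists unit, (fun=> tt).
  have [T' [f' f'P]] := allk k e1 e10.
  exists (T' * T)%type, (fun a => (f' a, f a)) => a b Sa Sb [E1 E2] k' [<-|k'l].
    exact: f'P.
  exact: (fP _ _ Sa Sb E2 k' k'l).
have repP t : exists b, (exists a, S a /\ f a = t) -> S b /\ f b = t.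
  have [[a aP]|na] := pselect (exists a, S a /\ f a = t); first by exists a.
  by exists (sim_one g) => -[a aP]; case: na; exists a.
have [rep rP] := choice repP.
exists [seq rep t | t <- enum T] => a Sa.
have [Sb fb] := rP (f a) (ex_intro _ a (conj Sa erefl)).
exists (rep (f a)).
  have : f a \in enum T by rewrite mem_enum.
  by elim: (enum T) => // t l IH; rewrite inE => /orP[/eqP ->|/IH]; [left|right].
have le1 (c : simG g) : S c -> fac c * e1 <= e%:num.
  by move=> /SL/andP[_ cL]; rewrite /e1 mulrCA ler_piMr// ler_pdivrMr// mul1r.
move=> k kl; have H := fP _ _ Sa Sb (esym fb) k kl; split.
  apply: dle_le (le1 a Sa) _; have := sim_dle a (dle_sym H).
  by rewrite bwdK.
apply: dle_le (le1 _ Sb) _; have := sim_dle (rep (f a)) H.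
by rewrite bwdK.
Qed.

(** [rho] takes the values [fac a * rho x] and [rho x] at two points at distance at most [e]. *)
Lemma fac_near (a : simG g) x e : dle g (fwd a x) x e -> `|fac a - 1| * rho x <= e.
Proof.
move=> H; rewrite -[rho x]gtr0_norm ?rho_gt0// -normrM mulrBl mul1r -rho_sim ler_norml.
by have := rho_move H; have := rho_move (dle_sym H); lra.
Qed.

Lemma tb_dist (S : set (simG g)) x y (r : R) : r < rho y -> (forall a, S a -> dle g y (fwd a x) r) ->
  (exists2 r', r' < rho x & forall a, S a -> r / fac a <= r') -> tot_bounded simN S.
Proof.
move=> ry Sr [r' r'x Sr'].
have rx := rho_gt0 x; have ry0 := rho_gt0 y.
(* Since [rho] is 1-Lipschitz and [rho (fwd a x) = fac a * rho x], the factor lies between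
   [(rho y - r) / rho x] and [(rho y + r) / rho x]. *)
pose L := Num.max 1 (Num.max (rho x / (rho y - r)) ((rho y + r) / rho x)).
have L1 : 1 <= L by rewrite le_max lexx.
have L0 : 0 < L by exact: lt_le_trans ltr01 L1.
apply: (@simG_tb S L y L1) => [a Sa|].
  have yr : 0 < rho y - r by rewrite subr_gt0.
  have := rho_move (Sr a Sa); have := rho_move (dle_sym (Sr a Sa)); rewrite rho_sim => H1 H2.
  apply/andP; split.
    rewrite invf_ple ?posrE ?fac_gt0//.
    rewrite (le_trans (y := rho x / (rho y - r)))//; last by rewrite !le_max lexx !orbT.
    by rewrite ler_pdivlMr// mulrC ler_pdivrMr ?fac_gt0// mulrC; lra.
  rewrite (le_trans (y := (rho y + r) / rho x))//; last by rewrite !le_max lexx !orbT.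
  by rewrite ler_pdivlMr.
apply: (@tbm_rc _ _ _ _ _ _ _ x r'); first exact: rho_rc.
move=> a Sa; apply: dle_le (Sr' a Sa) _; apply: dle_sym.
by have := sim_dleV a (Sr a Sa); rewrite fwdK.
Qed.

Lemma simN_tb : exists j, tot_bounded simN [set a | simN j a (sim_one g)].
Proof.
have r0 := rho_gt0 k0; have e0 : 0 < rho k0 / 4 by rewrite divr_gt0.
(* With a displacement of [k0] by at most [rho k0 / 4] the factor is at least [3 / 4], and the
   backward displacement stays below [rho k0 / 2]. *)
exists ([::], PosNum e0); apply: (@tb_dist _ k0 k0 (rho k0 / 4)).
- by lra.
- by move=> a /= /(_ k0 (or_introl erefl))[H _]; exact: dle_sym.
- exists (rho k0 / 2); first by lra.
  move=> a /= /(_ k0 (or_introl erefl))[H _].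
  have := fac_near H; rewrite ler_pdivrMr ?fac_gt0// => H'.
  have H2 : `|fac a - 1| <= 4^-1 by rewrite -(ler_pM2r r0) [leRHS]mulrC.
  have : 3 / 4 <= fac a by move: H2; rewrite ler_norml => /andP[]; lra.
  move=> h; have h2 : rho k0 * (3 / 4) <= rho k0 * fac a by rewrite ler_pM2l.
  by lra.
Qed.

(** Properness of the action. When [fwd a x] is near [y], the relation
    [fac a * rho x = rho (fwd a x)] bounds the factor from below, so that [bwd a y] stays in a ball
    at [x] of radius smaller than [rho x]. *)
Lemma tb_orbit (K : set X) x : compact K -> tot_bounded simN [set a | K (fwd a x)].
Proof.
move=> cK; apply: (@compact_induction _ K (fun A => tot_bounded simN [set a | A (fwd a x)])) => //.
- by move=> A B AB; apply: tb_sub => a /AB.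
- by move=> j; exists [::].
- by move=> A B tA tB; have := tb_union tA tB; apply: tb_sub => a [/=|/=]; [left|right].
move=> y _; have ry := rho_gt0 y; have rx := rho_gt0 x.
have e0 : 0 < rho y / 4 by rewrite divr_gt0.
exists [set z | dle g y z (rho y / 4)]; first by apply/(nbhs_dle g); exists (rho y / 4).
apply: (@tb_dist _ x y (rho y / 4)) => //; first by lra.
exists (rho x / 2); first by lra.
move=> a /= H; have := rho_move H; rewrite rho_sim => H'.
by rewrite ler_pdivrMr ?fac_gt0//; lra.
Qed.

Definition lipd (L : R) (f : X -> R) := forall y z r, dle g y z r -> `|f y - f z| <= L * r.

(* [m] selects the averages that are multiplied by [(fac a)^-1] instead of being invariant. *)
Definition weight (m : bool) (a : simG g) : R := if m then fac a else 1.

Lemma weight_gt0 m a : 0 < weight m a.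
Proof. by case: m => //=; exact: fac_gt0. Qed.

(** For uniform continuity, points of the orbit matter only when they lie in [K], which has a finite
    net; maps that nearly agree at the points of the net and at [k0] give close values of [f] and
    have close factors. *)
Lemma haar_dom_orbit (m : bool) (f : X -> R) (L M : R) (K : set X) x : 0 < L -> compact K ->
  (forall y, f y != 0 -> K y) -> lipd L f -> (forall y, `|f y| <= M) ->
  haar_dom simN (fun a => weight m a * f (fwd a x)).
Proof.
move=> L0 cK fK lf fM.
have M0 : 0 <= M by exact: le_trans (normr_ge0 _) (fM x).
have [C C0 CP] : exists2 C : R, 0 < C & forall a, K (fwd a x) -> weight m a <= C.
  have [P P0 rP] : exists2 P : R, 0 < P & forall y, K y -> rho y <= P.
    apply: (@compact_induction _ K (fun A => exists2 P : R, 0 < P & forall y, A y -> rho y <= P)) => //.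
    - by move=> A B AB [r r0 rP]; exists r => // y /AB/rP.
    - by exists 1.
    - move=> A B [r r0 rP] [s s0 sP]; exists (Num.max r s); first by rewrite lt_max r0.
      by move=> y [/rP|/sP] H; rewrite le_max H ?orbT.
    - move=> y _; have ry := rho_gt0 y; exists [set z | dle g y z (rho y)].
        by apply/(nbhs_dle g); exists (rho y).
      exists (rho y * 2); first by rewrite mulr_gt0.
      by move=> z /= /dle_sym/rho_move; lra.
  exists (1 + P / rho x); first by rewrite ltr_wpDr// divr_ge0// ltW// rho_gt0.
  move=> a /rP; rewrite rho_sim /weight; case: m => H; last by rewrite lerDl divr_ge0 ?(ltW P0) ?(ltW (rho_gt0 x)).
  apply: (@le_trans _ _ (P / rho x)); last by rewrite lerDr.
  by rewrite ler_pdivlMr// rho_gt0.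
split.
- exists (C * M) => a; rewrite normrM (gtr0_norm (weight_gt0 m a)).
  have [->|/fK Ka] := eqVneq (f (fwd a x)) 0; last by rewrite ler_pM ?(ltW (weight_gt0 m a)) ?CP.
  by rewrite normr0 mulr0 mulr_ge0// ltW.
- exists [set a | K (fwd a x)]; first exact: tb_orbit.
  by move=> a; rewrite mulf_eq0 negb_or => /andP[_ /fK].
move=> e e0; have r0 := rho_gt0 k0.
(* [d] bounds both the displacement on [K] and, through [fac_near], the distortion of [fac] *)
pose A := C * (2 * (4 * L) + M / rho k0) + 1.
have A0 : 0 < A by rewrite ltr_wpDl// mulr_ge0 ?(ltW C0)// addr_ge0 ?divr_ge0 ?(ltW r0) ?mulr_ge0// ltW.
pose d := Num.min (e / A) (rho k0); have d0 : 0 < d by rewrite lt_min r0 divr_gt0.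
have [s sP] : exists s, forall y, K y -> exists2 k, List.In k s & dle g y k d.
  apply: (@compact_induction _ K (fun A => exists s, forall y, A y -> exists2 k, List.In k s & dle g y k d)) => //.
  - by move=> B B' BB' [s sP]; exists s => y /BB'/sP.
  - by exists [::].
  - move=> B B' [s sP] [s' s'P]; exists (s ++ s') => y [/sP|/s'P] [k ks yk]; exists k => //.
      by apply: List.in_or_app; left.
    by apply: List.in_or_app; right.
  - move=> y _; exists [set z | dle g y z d]; first by apply/(nbhs_dle g); exists d.
    by exists [:: y] => z /= yz; exists y; [left|exact: dle_sym].
exists (s, PosNum d0).
have key (a b : simG g) : simN (s, PosNum d0) a b -> K (fwd b x) ->
    `|weight m a * f (fwd a x) - weight m b * f (fwd b x)| <= e.
  move=> N Kb; have [k ks bk] := sP _ Kb.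
  have [N1 _] := N k (or_intror ks); have [N3 _] := N k0 (or_introl erefl).
  rewrite /= in N1 N3.
  pose v := sim_mul a (sim_inv b).
  have vE y : fwd v y = fwd a (bwd b y) by [].
  have v1 : `|fac v - 1| * rho k0 <= d := @fac_near v k0 d N3.
  have dr : d <= rho k0 by rewrite ge_min lexx orbT.
  have v2 : fac v <= 2.
    have : `|fac v - 1| <= 1 by rewrite -(ler_pM2r r0) mul1r (le_trans v1).
    by have := ler_norm (fac v - 1); lra.
  (* The map [v] sends [fwd b x] to [fwd a x]: the image of the passage to the net point [k] costs
     [2 * d], the displacement of [k] costs [d], and the return [d]. *)
  have D : dle g (fwd a x) (fwd b x) (4 * d).
    have := sim_dle v bk; rewrite !vE fwdK => H.
    have := dle_trans (dle_trans H N1) (dle_sym bk); apply: dle_le.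
    have h : fac v * d <= 2 * d by rewrite ler_pM2r.
    by lra.
  have fD := lf _ _ _ D.
  have wE : `|weight m a - weight m b| <= C * (d / rho k0) /\ weight m a <= 2 * C.
    have := CP b Kb; move=> {CP}; rewrite /weight; case: m => Cb; last first.
      rewrite subrr normr0; split; last by move: C0 Cb; lra.
      by rewrite mulr_ge0 ?divr_ge0 ?(ltW C0) ?(ltW d0) ?(ltW r0).
    have aE : fac a = fac v * fac b.
      have -> : fac v = fac a * (fac b)^-1 by [].
      by rewrite mulfVK// gt_eqF// fac_gt0.
    rewrite aE; split; last by rewrite ler_pM ?(ltW (fac_gt0 _)).
    rewrite -[X in _ - X]mul1r -mulrBl normrM mulrC gtr0_norm ?fac_gt0//.
    by rewrite ler_pM ?(ltW (fac_gt0 b))// ler_pdivlMr.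
  have [wD wC] := wE.
  have -> : weight m a * f (fwd a x) - weight m b * f (fwd b x) =
    weight m a * (f (fwd a x) - f (fwd b x)) + (weight m a - weight m b) * f (fwd b x) by ring.
  rewrite (le_trans (ler_normD _ _))// !normrM (gtr0_norm (weight_gt0 m a)).
  apply: (@le_trans _ _ (2 * C * (L * (4 * d)) + C * (d / rho k0) * M)).
    by apply: lerD; apply: ler_pM => //; exact: ltW (weight_gt0 m a).
  have -> : 2 * C * (L * (4 * d)) + C * (d / rho k0) * M = (C * (2 * (4 * L) + M / rho k0)) * d by ring.
  rewrite (le_trans (_ : _ <= A * d))//; first by rewrite ler_pM2r// lerDl.
  by rewrite mulrC -ler_pdivlMr// ge_min lexx.
move=> a b N.
have [Kb|nKb] := pselect (K (fwd b x)); first exact: key.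
have [Ka|nKa] := pselect (K (fwd a x)).
  rewrite distrC; apply: key => // k kl; have [] := N k kl; split=> //.
have f0 c : ~ K (fwd c x) -> f (fwd c x) = 0.
  by move=> nK; apply/eqP; apply: contrapT => /negP/fK.
by rewrite !f0// !mulr0 subrr normr0 ltW.
Qed.

End radius.

(** * Differentiation under an invariant functional *)

Section differentiation_under_functional.
Context {R : realType} {n : nat}.
Local Notation V := (Cn R n).

Lemma is_derive_bound0 (f df : R -> R) (M t : R) :
  (forall s : R, `|s| <= `|t| -> is_derive s 1 f (df s)) ->
  (forall s : R, `|s| <= `|t| -> `|df s| <= M) -> `|f t - f 0| <= M * `|t|.
Proof.
move=> fd dM; have [t0|t0] := leP 0 t.
  have in_ s : 0 <= s <= t -> `|s| <= `|t| by move=> /andP[s0 st]; rewrite !ger0_norm.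
  have := @is_derive_bound R f df 0 t M t0 (fun s H => fd s (in_ s H)) (fun s H => dM s (in_ s H)).
  by rewrite subr0 (ger0_norm t0).
have in_ s : t <= s <= 0 -> `|s| <= `|t|.
  by move=> /andP[ts s0]; rewrite (ler0_norm s0) (ltr0_norm t0) lerN2.
have := @is_derive_bound R f df t 0 M (ltW t0) (fun s H => fd s (in_ s H)) (fun s H => dM s (in_ s H)).
by rewrite sub0r -(ltr0_norm t0) distrC.
Qed.

Lemma rball_line (z0 z v : V) r : rball z0 r z -> exists2 d : R, 0 < d &
  forall t, `|t| < d -> rball z0 r (z + t%:C *: v).
Proof.
move=> zr; have v1 : 0 < 1 + rnorm v by rewrite ltr_pwDl// rnorm_ge0.
exists ((r - rnorm (z - z0)) / (1 + rnorm v)); first by rewrite divr_gt0// subr_gt0.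
move=> t td; have H : `|t| * (1 + rnorm v) < r - rnorm (z - z0) by rewrite -ltr_pdivlMr.
rewrite ltrBrDr in H.
rewrite /rball/= addrAC (le_lt_trans (rnormD _ _))// (le_lt_trans _ H)//.
by rewrite [leRHS]addrC lerD2l rnormZr ler_wpM2l// lerDr.
Qed.

(** A path along the real coordinate directions, short enough to stay in the ball; the bounds on the
    partial derivatives do not depend on [i]. *)
Lemma step_bound (I : Type) (F : I -> V -> R) z0 (r : R) z : rball z0 r z ->
  reg (@ubounded R n (rball z0 r) I) (rball z0 r) 1 F ->
  exists K d : R, [/\ 0 <= K, 0 < d & forall i h, rnorm h < d -> `|F i (z + h) - F i z| <= K * rnorm h].
Proof.
move=> zr [_ rF]; pose m := (n + n)%N.
have HM (k : 'I_m) : exists Mk : R, forall i y, rball z0 r y -> `|dirder (F i) (rbasis k) y| <= Mk.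
  by have [_ [H _]] := rF (rbasis k).
have [M MP] := choice HM.
pose d := (r - rnorm (z - z0)) / m.+1%:R; have d0 : 0 < d by rewrite divr_gt0// subr_gt0.
exists (\sum_k `|M k|), d; split=> //; first by apply: sumr_ge0.
move=> i h hd.
pose H (j : nat) : V := \sum_(k < m | (k < j)%N) (rcoord k h)%:C *: rbasis k.
have Hm : H m = h by rewrite /H [RHS]rcoordE; apply: eq_bigl => k; rewrite ltn_ord.
have H0 : H 0%N = 0 by rewrite /H big1.
have HS (k : 'I_m) : H k.+1 = H k + (rcoord k h)%:C *: rbasis k.
  rewrite /H (bigD1 k)//= addrC; congr (_ + _); apply: eq_bigl => l.
  by rewrite ltnS ltn_neqAle andbC.
have Hs j : rnorm (H j) <= m%:R * rnorm h.
  rewrite /H big_mkcond (le_trans (rnorm_sum _))// mulr_natl -[m in leRHS]card_ord -sumr_const.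
  apply: ler_sum => k _; case: ifP => _; last by rewrite rnorm0 rnorm_ge0.
  by rewrite rnormZr (le_trans _ (rcoord_le k h))// ler_piMr ?rnorm_rbasis.
pose S (j : nat) : R := \sum_(k < m | (k < j)%N) `|M k| * rnorm h.
have main (j : nat) : (j <= m)%N -> `|F i (z + H j) - F i z| <= S j.
  elim: j => [_|j IH jm]; first by rewrite H0 addr0 subrr normr0 /S big1.
  pose k := Ordinal jm.
  have Sk : S j.+1 = S j + `|M k| * rnorm h.
    rewrite /S (bigD1 k)//= addrC; congr (_ + _); apply: eq_bigl => l.
    by rewrite ltnS [in RHS]ltn_neqAle andbC.
  have HSk : H j.+1 = H j + (rcoord k h)%:C *: rbasis k := HS k.
  have seg t : `|t| <= `|rcoord k h| -> rball z0 r (z + H j + t%:C *: rbasis k).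
    move=> tk; rewrite /rball/=; have -> : z + H j + t%:C *: rbasis k - z0 = (z - z0) + (H j + t%:C *: rbasis k).
      by rewrite -[z + H j + _]addrA addrAC.
    rewrite (le_lt_trans (rnormD _ _))// -ltrBrDl.
    apply: le_lt_trans (_ : m.+1%:R * rnorm h < _); last by rewrite mulrC -ltr_pdivlMr.
    rewrite (le_trans (rnormD _ _))// -natr1 mulrDl mul1r lerD//.
    rewrite rnormZr (le_trans _ (rcoord_le k h))// (le_trans _ tk)// ler_piMr ?rnorm_rbasis//.
  have := @is_derive_bound0 (line (F i) (z + H j) (rbasis k)) (fun t => dirder (F i) (rbasis k) (z + H j + t%:C *: rbasis k)) `|M k| (rcoord k h).
  rewrite /line scale0r addr0 -addrA -HSk => B.
  have {}B : `|F i (z + H j.+1) - F i (z + H j)| <= `|M k| * rnorm h.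
    apply: le_trans (B _ _) _.
    - by move=> t /seg tr; apply: line_shift; apply: line_dirder; have [H1 _] := rF (rbasis k); exact: H1.
    - by move=> t /seg tr; rewrite (le_trans (MP k i _ tr))// ler_norm.
    - by rewrite ler_wpM2l// rcoord_le.
  rewrite Sk; have -> : F i (z + H j.+1) - F i z = (F i (z + H j) - F i z) + (F i (z + H j.+1) - F i (z + H j)) by ring.
  by rewrite (le_trans (ler_normD _ _))// lerD// IH// ltnW.
have := main m (leqnn _); rewrite Hm mulr_suml; congr (_ <= _).
by apply: eq_bigl => k; rewrite ltn_ord.
Qed.

Section functional.
Context {G J : Type} (N : J -> G -> G -> Prop).
Hypothesis N_dir : forall i j, exists k, forall a g, N k a g -> N i a g /\ N j a g.
Context (I : (G -> R) -> R) (B : set G).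
Hypothesis I_add : forall F F', haar_dom N F -> haar_dom N F' -> I (fun a => F a + F' a) = I F + I F'.
Hypothesis I_scale : forall c F, haar_dom N F -> I (fun a => c * F a) = c * I F.
Hypothesis I_bound : exists2 C : R, 0 <= C & forall F m, haar_dom N F ->
  (forall a, F a != 0 -> B a) -> (forall a, `|F a| <= m) -> `|I F| <= C * m.
Hypothesis B_tb : tot_bounded N B.

Let I_sub F1 F2 : haar_dom N F1 -> haar_dom N F2 -> haar_dom N (fun a => F1 a - F2 a) /\
  I (fun a => F1 a - F2 a) = I F1 - I F2.
Proof.
move=> h1 h2; have E : (fun a => F1 a - F2 a) = (fun a => F1 a + -1 * F2 a).
  by apply/funext => a; rewrite mulN1r.
have h3 := haar_domZ (-1) h2; rewrite E; split; first exact: haar_domD.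
by rewrite I_add// I_scale// mulN1r.
Qed.

Lemma functional_continuous (F : G -> V -> R) z0 r z :
  reg (@ubounded R n (rball z0 r) G) (rball z0 r) 1 F ->
  (forall z, rball z0 r z -> haar_dom N (F^~ z)) ->
  (forall z a, rball z0 r z -> F a z != 0 -> B a) -> rball z0 r z ->
  {for z, continuous (fun z => I (F^~ z))}.
Proof.
move=> rF hF FB zr; have [C C0 CP] := I_bound.
have [K [d [K0 d0 KP]]] := step_bound zr rF.
apply: eps_continuous => e e0; have CK : 0 < C * K + 1 by rewrite ltr_wpDl// mulr_ge0.
exists (Num.min (Num.min d (r - rnorm (z - z0))) (e / (C * K + 1))).
  by rewrite !lt_min d0 subr_gt0 zr divr_gt0.
move=> y; rewrite !lt_min => /andP[/andP[yd yr] ye].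
have yr' : rball z0 r y by rewrite /rball/= (le_lt_trans (rnormB_le _ z _))// -ltrBrDr.
have [hD ID] := I_sub (hF _ yr') (hF _ zr); rewrite -ID.
rewrite (le_trans (CP _ (K * rnorm (y - z)) hD _ _))//.
- move=> a; have [Fz0|/(FB _ _ zr)//] := eqVneq (F a z) 0.
  by rewrite Fz0 subr0 => /(FB _ _ yr').
- by move=> a; have := KP a (y - z) yd; rewrite subrKC.
- rewrite mulrA (le_trans (_ : _ <= (C * K + 1) * rnorm (y - z)))//.
    by rewrite ler_wpM2r ?rnorm_ge0// lerDl.
  by rewrite mulrC -ler_pdivlMr// ltW.
Qed.

(** The bound on second derivatives gives a Taylor remainder [M * t ^+ 2] uniform over [G]. The
    difference quotients therefore converge uniformly with supports in [B], and on such functions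
    [I] is continuous for the uniform norm. *)
Lemma functional_derive (F : G -> V -> R) z0 r z v :
  reg (@ubounded R n (rball z0 r) G) (rball z0 r) 2 F ->
  (forall z, rball z0 r z -> haar_dom N (F^~ z)) ->
  (forall z a, rball z0 r z -> F a z != 0 -> B a) -> rball z0 r z ->
  [/\ haar_dom N (fun a => dirder (F a) v z), (forall a, dirder (F a) v z != 0 -> B a) &
     is_derive (0 : R) 1 (line (fun z => I (F^~ z)) z v) (I (fun a => dirder (F a) v z))].
Proof.
move=> [_ rF] hF FB zr; have [C C0 CP] := I_bound.
have [dF [_ rF']] := rF v; have [ddF [[M MP] _]] := rF' v.
have [d d0 dP] := rball_line v zr.
have l0 a : line (F a) z v 0 = F a z by rewrite /line scale0r addr0.
have taylor t a : `|t| < d -> `|F a (z + t%:C *: v) - F a z - t * dirder (F a) v z| <= M * `|t| * `|t|.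
  move=> td; have dt s : `|s| <= `|t| -> rball z0 r (z + s%:C *: v) by move=> st; apply: dP; exact: le_lt_trans td.
  have H1 s : `|s| <= `|t| -> `|dirder (F a) v (z + s%:C *: v) - dirder (F a) v z| <= M * `|t|.
    move=> st; have := @is_derive_bound0 (line (dirder (F a) v) z v) (fun s => dirder (dirder (F a) v) v (z + s%:C *: v)) M s.
    rewrite /line scale0r addr0 => B1; apply: le_trans (B1 _ _) _.
    - move=> u us; apply: line_shift; apply: line_dirder; apply: ddF; apply: dt; exact: le_trans st.
    - by move=> u us; apply: MP; apply: dt; exact: le_trans st.
    - by rewrite ler_wpM2l// (le_trans (normr_ge0 _) (MP a z zr)).
  have := @is_derive_bound0 (fun s => line (F a) z v s - s * dirder (F a) v z)
    (fun s => dirder (F a) v (z + s%:C *: v) - dirder (F a) v z) (M * `|t|) t.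
  rewrite l0 mul0r subr0 => B2.
  rewrite addrAC; apply: B2 => s st; last exact: H1.
  have e1 : is_derive s (1 : R) (line (F a) z v) (dirder (F a) v (z + s%:C *: v)).
    by apply: line_shift; apply: line_dirder; apply: dF; exact: dt.
  have e2 : is_derive s (1 : R) (fun s : R => s * dirder (F a) v z) (dirder (F a) v z).
    by rewrite -[X in is_derive _ _ _ X]mul1r; exact: is_deriveMc (is_derive_id s 1).
  exact: is_deriveB e1 e2.
(* For [a] outside [B] the function [F a] vanishes on the whole ball, hence so does its
   derivative. *)
have dB a : dirder (F a) v z != 0 -> B a.
  apply: contra_neqP => nB; have [_ ->//] : derivable (line (F a) z v) 0 1 /\ dirder (F a) v z = 0.
  apply: dirder_line; apply: (@is_derive_near R (fun=> (0 : R)) (line (F a) z v) 0 0 d d0).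
  move=> t; rewrite subr0 => /dP tr; rewrite /line; apply/esym/eqP; apply: contra_notT nB.
  exact: FB.
have hd : haar_dom N (fun a => dirder (F a) v z).
  apply: (haar_dom_lim B_tb) => // e e0.
  have M1 : 0 < `|M| + 1 by rewrite ltr_wpDl.
  pose t := Num.min (d / 2) (e / (`|M| + 1)).
  have t0 : 0 < t by rewrite lt_min !divr_gt0.
  have td : `|t| < d.
    by rewrite gtr0_norm// gt_min ltr_pdivrMr// mulr_natr mulr2n ltrDl d0.
  have [h1 _] := I_sub (hF _ (dP _ td)) (hF _ zr).
  exists (fun a => t^-1 * (F a (z + t%:C *: v) - F a z)); first exact: haar_domZ.
  move=> a; rewrite distrC; have := taylor t a td; rewrite (gtr0_norm t0) => H.
  rewrite -(ler_pM2l t0) -[X in X * `|_|](gtr0_norm t0) -normrM mulrBr mulVKf ?gt_eqF//.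
  rewrite (le_trans H)// mulrC ler_wpM2l ?(ltW t0)//.
  rewrite (le_trans (_ : _ <= (`|M| + 1) * t))//.
    by rewrite ler_pM2r// (le_trans (ler_norm _))// lerDl.
  by rewrite mulrC -ler_pdivlMr// ge_min lexx orbT.
split=> //; apply: is_derive_eps => e e0.
have CM : 0 < C * `|M| + 1 by rewrite ltr_wpDl// mulr_ge0.
exists (Num.min d (e / (C * `|M| + 1))); first by rewrite lt_min d0 divr_gt0.
move=> t; rewrite lt_min => /andP[td te]; rewrite add0r /line scale0r addr0.
have [h1 E1] := I_sub (hF _ (dP _ td)) (hF _ zr).
have [h2 E2] := I_sub h1 (haar_domZ t hd).
rewrite [_ * t]mulrC -(I_scale t hd) -E1 -E2.
rewrite (le_trans (CP _ (`|M| * `|t| * `|t|) h2 _ _))//.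
- move=> a; have [d0'|/dB//] := eqVneq (dirder (F a) v z) 0; rewrite d0' mulr0 subr0.
  have [Fz0|/(FB _ _ zr)//] := eqVneq (F a z) 0.
  by rewrite Fz0 subr0 => /(FB _ _ (dP _ td)).
- by move=> a; rewrite (le_trans (taylor t a td))// ler_wpM2r// ler_wpM2r// ler_norm.
- rewrite mulrA ler_wpM2r// mulrA (le_trans (_ : _ <= (C * `|M| + 1) * `|t|))//.
    by rewrite ler_wpM2r// lerDl.
  by rewrite mulrC -ler_pdivlMr// ltW.
Qed.

Lemma functional_smooth (F : G -> V -> R) z0 r k :
  (forall k, reg (@ubounded R n (rball z0 r) G) (rball z0 r) k F) ->
  (forall z, rball z0 r z -> haar_dom N (F^~ z)) ->
  (forall z a, rball z0 r z -> F a z != 0 -> B a) ->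
  Ck k (rball z0 r) (fun z => I (F^~ z)).
Proof.
elim: k F => [|k IH] F rF hF FB; split=> //; do ?[move=> z zr; exact: functional_continuous (rF 1%N) hF FB zr].
move=> v; have D z (zr : rball z0 r z) := functional_derive v (rF 2%N) hF FB zr.
split=> [z /D[_ _ /dirder_line[]]//|].
apply: (@Ck_ext _ _ (rball z0 r) _ k (fun z => I (fun a => dirder (F a) v z))).
- exact: rball_open.
- by move=> z /D[_ _ /dirder_line[]].
- apply: IH => [l|z /D[]//|z a /D[_ H _]]; last exact: H.
  by have [_ /(_ v)[]] := rF l.+1.
Qed.

End functional.
End differentiation_under_functional.

(** * Bump functions along a holomorphic family *)

Section cutoff_family.
Context {R : realType} {n : nat}.
Local Notation V := (Cn R n).

(** The square of the Euclidean distance in units of [s]: a polynomial in the real coordinates,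
    which keeps uniform bounds under composition with holomorphic families. *)
Definition qd (p : V) (s : R) (z : V) : R := \sum_k rcoord k (z - p) ^+ 2 * (s ^+ 2)^-1.

Lemma qd_center p s : qd p s p = 0.
Proof.
by rewrite /qd big1// => k _; rewrite subrr -(scale0r 0) (rcoordZ k 0) mul0r expr0n mul0r.
Qed.

Lemma qd_cbox p s z : 0 < s -> qd p s z < 1 -> cbox p s z.
Proof.
move=> s0 q1 k; rewrite leNgt; apply/negP => H.
have : 1 <= qd p s z.
  rewrite /qd (bigD1 k)//= ler_wpDr//.
    by apply: sumr_ge0 => l _; rewrite mulr_ge0 ?invr_ge0 ?sqr_ge0.
  rewrite ler_pdivlMr ?exprn_gt0// mul1r -[leRHS]real_normK ?num_real//.
  by rewrite ler_sqr ?nnegrE// ?ltW.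
by rewrite leNgt q1.
Qed.

Lemma qd_lip p s (M : R) z z' : 0 < s -> rnorm (z - p) <= M -> rnorm (z' - p) <= M ->
  `|qd p s z - qd p s z'| <= (n + n)%:R * ((M *+ 2) * (s ^+ 2)^-1) * rnorm (z - z').
Proof.
move=> s0 zM z'M; rewrite /qd -sumrB (le_trans (ler_norm_sum _ _ _))//.
have M0 : 0 <= M by exact: le_trans (rnorm_ge0 _) zM.
apply: (@le_trans _ _ (\sum_(k < n + n) (M *+ 2) * (s ^+ 2)^-1 * rnorm (z - z'))); last first.
  by rewrite sumr_const card_ord -[leLHS]mulr_natl !mulrA.
apply: ler_sum => k _; rewrite -mulrBl normrM [`|_^-1|]ger0_norm ?invr_ge0 ?sqr_ge0//.
rewrite mulrAC ler_wpM2r ?invr_ge0 ?sqr_ge0//.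
rewrite subr_sqr normrM mulrC ler_pM//.
  by rewrite (le_trans (ler_normD _ _))// mulr2n lerD// (le_trans (rcoord_le _ _)).
have -> : rcoord k (z - p) - rcoord k (z' - p) = rcoord k (z - z').
  have -> : z - p = (z - z') + (z' - p) by rewrite addrA subrK.
  by rewrite rcoordD addrK.
exact: rcoord_le.
Qed.

Lemma cutoff_lip : exists2 M : R, 0 <= M & forall s t : R, `|cutoff 0 s - cutoff 0 t| <= M * `|s - t|.
Proof.
have [M M0 MP] := @cutoff_bound R 1; exists M => // s t.
wlog st : s t / t <= s.
  move=> H; have [/H//|/ltW/H] := leP t s.
  by rewrite distrC (distrC t).
have := @is_derive_bound R (cutoff 0) (cutoff 1) t s M st (fun x _ => cutoff_derive 0 x) (fun x _ => MP x).
by rewrite [X in _ -> _ <= _ * X]ger0_norm ?subr_ge0.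
Qed.

Lemma reg_index (I : Type) (U : set V) (c : I -> R) (M : R) k : (forall i, `|c i| <= M) ->
  reg (@ubounded R n U I) U k (fun i _ => c i).
Proof.
elim: k c M => [|k IH] c M cM; split=> //; do ?[by exists M => i z _].
move=> v.
have d i (z : V) : is_derive (0 : R) 1 (line (fun=> c i) z v) 0 by exact: is_derive_cst.
split=> [i z _|]; first by have [] := dirder_line (d i z).
have -> : (fun i : I => dirder (fun=> c i) v) = (fun _ _ => 0).
  by apply/funext => i; apply/funext => z; have [] := dirder_line (d i z).
by apply: (IH _ 0) => i; rewrite normr0.
Qed.

(** All derivatives of the cutoff are bounded, so the bounds for the coordinates of [F i] pass
    through the polynomial [qd] and then through the cutoff. *)
Lemma cutoff_family (I : Type) z0 (rho rho' L M s : R) (F : I -> V -> V) p k :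
  0 < rho' -> rho' < rho -> (forall i, vlhol z0 rho L (F i)) ->
  (forall i z, rball z0 rho z -> rnorm (F i z - p) <= M) ->
  reg (@ubounded R n (rball z0 rho') I) (rball z0 rho') k (fun i z => cutoff 0 (qd p s (F i z))).
Proof.
move=> r0 rr hF FM.
have ext := @ub_ext R n (rball z0 rho') I.
have oB : open (rball z0 rho') by exact: rball_open.
have [M' MP] : exists M', forall i z, rball z0 rho z -> rnorm (F i z) <= M'.
  exists (M + rnorm p) => i z zr; rewrite -[F i z](subrK p) (le_trans (rnormD _ _))// lerD2r.
  exact: FM.
have rc (j : 'I_(n + n)) : reg (@ubounded R n (rball z0 rho') I) (rball z0 rho') k (fun i z => rcoord j (F i z)).
  rewrite /rcoord; case: (fintype.split j) => l.
    by have [H _] := @hol_bounded_smooth R n I z0 rho rho' L M' (fun i z => F i z l 0) r0 rr (fun i => hF i l)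
      (fun i z zr => le_trans (coord_le_rnorm _ l) (MP i z zr)); exact: H.
  by have [_ H] := @hol_bounded_smooth R n I z0 rho rho' L M' (fun i z => F i z l 0) r0 rr (fun i => hF i l)
      (fun i z zr => le_trans (coord_le_rnorm _ l) (MP i z zr)); exact: H.
have rq : reg (@ubounded R n (rball z0 rho') I) (rball z0 rho') k (fun i z => qd p s (F i z)).
  apply: (reg_sum oB ext) => [f g|a|j]; [exact: ub_add|exact: ub_cst|].
  have rm := reg_mul oB ext (@ub_add _ _ _ _) (@ub_mul _ _ _ _).
  have ra := reg_add oB ext (@ub_add _ _ _ _).
  have rk := @reg_cst R n I (@ubounded R n (rball z0 rho') I) (rball z0 rho') (@ub_cst _ _ _ _) k.
  have rd : reg (@ubounded R n (rball z0 rho') I) (rball z0 rho') k (fun i z => rcoord j (F i z - p)).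
    have -> : (fun (i : I) z => rcoord j (F i z - p)) = (fun i z => rcoord j (F i z) + rcoord j (- p)).
      by apply/funext => i; apply/funext => z; rewrite rcoordD.
    by apply: ra; [exact: rc|exact: rk].
  exact: (rm _ _ _ (rm _ _ _ rd rd) (rk (s ^+ 2)^-1)).
apply: (@reg_comp R n I (@ubounded R n (rball z0 rho') I) (rball z0 rho') oB ext (@ub_add _ _ _ _) (@ub_mul _ _ _ _) setT cutoff) => //.
  by move=> m x _; exact: cutoff_derive.
move=> m g _ _; have [C _ CP] := @cutoff_bound R m; exists C => i z _; exact: CP.
Qed.

End cutoff_family.

(** * Averages over the group of similarities *)

Section orbit_average.
Context {R : realType} {n : nat} {X : complexManifold R n} (g : hermitianMetric X).
Hypothesis n0 : (0 < n)%N.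
Hypothesis cX : connected [set: X].
Hypothesis nrc : forall x, exists r, ~ rc g x r.
Local Notation V := (Cn R n).
Local Notation rho := (@rho R n X g).

Lemma chart_box_compact (e : cm_index X) p (r1 s : R) : dom e p -> 0 <= s -> s *+ 2 < r1 ->
  (forall z, rnorm (z - chart e p) < r1 -> dom e (chart_inv e z) /\ chart e (chart_inv e z) = z) ->
  compact (chart_inv e @` cbox (chart e p) s).
Proof.
move=> ep s0 sr inv.
have wc : {within cbox (chart e p) s, continuous (chart_inv e)}.
  apply/continuous_in_subspaceT => z; rewrite inE => /(rnorm_rcoord s0) H.
  have [zd zc] := inv z (le_lt_trans H sr).
  by apply: cm_inv_continuous; exists (chart_inv e z).
exact: (continuous_compact wc (@cbox_compact R n (chart e p) s)).
Qed.

Definition cbump (e : cm_index X) p s y : R :=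
  if `[< dom e y >] then cutoff 0 (qd (chart e p) s (chart e y)) else 0.

Lemma cbump_ge0 e p s y : 0 <= cbump e p s y.
Proof. by rewrite /cbump; case: asbool => //; exact: cutoff_ge0. Qed.

Lemma cbump_bound : exists2 M : R, 0 <= M & forall e p s y, `|cbump e p s y| <= M.
Proof.
have [M M0 MP] := @cutoff_bound R 0; exists M => // e p s y.
by rewrite /cbump; case: asbool => //; rewrite normr0.
Qed.

(** [u x] is the functional at [a |-> weight m a * f (fwd a x)]; a right translation replaces [x] by
    its image and extracts a weight, because [weight] is multiplicative. *)
Lemma average (m : bool) (k0 : X) (f : X -> R) (K : set X) (L Mb : R) : 0 < L -> compact K ->
  (forall y, f y != 0 -> K y) -> lipd g L f -> (forall y, `|f y| <= Mb) -> (forall y, 0 <= f y) ->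
  (forall c x0, dom c x0 -> exists (r : R) (B : set (simG g)),
  [/\ 0 < r, forall z, rball (chart c x0) r z -> dom c (chart_inv c z),
   tot_bounded (simN k0) B,
   forall k, reg (@ubounded R n (rball (chart c x0) r) (simG g)) (rball (chart c x0) r) k
     (fun a z => weight m a * f (fwd a (chart_inv c z))) &
   forall z a, rball (chart c x0) r z -> weight m a * f (fwd a (chart_inv c z)) != 0 -> B a]) ->
  exists u : X -> R,
  [/\ smooth_fun u, forall (a : simG g) x, u (fwd a x) = (weight m a)^-1 * u x,
      forall x, 0 <= u x & forall x, 0 < u x <-> exists a : simG g, 0 < f (fwd a x)].
Proof.
move=> L0 cK fK fL fM f0 family; have [j0 W_tb] := simN_tb cX nrc k0.
have [I [I_add I_scale I_bound I_inv I_pos]] := @haar_functional R _ _ _ _ _ _ (@sim_mulA R n X g) (@sim_mulV R n X g)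
  (@sim_Vmul R n X g) (@sim_mul1 R n X g) (@simN_refl R n X g k0) (@simN_inv R n X g k0) (@simN_dir R n X g k0) _ W_tb.
have hd (m' : bool) x : haar_dom (simN k0) (fun a : simG g => weight m' a * f (fwd a x)).
  exact: (haar_dom_orbit cX nrc k0 m' x L0 cK fK fL fM).
pose u x := I (fun a : simG g => weight m a * f (fwd a x)).
have uE (a : simG g) x : u (fwd a x) = (weight m a)^-1 * u x.
  have w0 := weight_gt0 m a.
  rewrite /u -(I_inv _ a (hd m x)).
  have -> : (fun b => weight m (sim_mul b a) * f (fwd (sim_mul b a) x)) =
     (fun b => weight m a * (weight m b * f (fwd b (fwd a x)))).
    apply/funext => b; rewrite mulrA; congr (_ * _).
    rewrite /weight; case: (m); rewrite ?mul1r//.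
    have -> : fac (sim_mul b a) = fac b * fac a by [].
    by rewrite mulrC.
  by rewrite I_scale// mulKf// gt_eqF.
have pos x : 0 < f x -> 0 < u x.
  (* Within [d], [f] keeps half of its value at [x] and the factor stays above 1/2, whence the lower
     bound [f x / 4]. *)
  move=> fx; pose d := Num.min (f x / (2 * L)) (2^-1 * rho k0).
  have d0 : 0 < d.
    by rewrite lt_min; apply/andP; split; [rewrite divr_gt0// mulr_gt0|rewrite mulr_gt0// rho_gt0].
  apply: (I_pos _ (f x / 4) ([:: x], PosNum d0) (hd m x)) => [a|| a N].
  - by rewrite mulr_ge0 ?(ltW (weight_gt0 m a)).
  - by rewrite divr_gt0.
  - have [N1 _] := N x (or_intror (or_introl erefl)); have [N2 _] := N k0 (or_introl erefl).
    rewrite /= in N1 N2.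
    have h1 := @fac_near _ _ _ _ nrc a k0 d N2.
    have h2 : 2^-1 <= fac a.
      have r0 := rho_gt0 nrc k0.
      have dr : d <= 2^-1 * rho k0 by rewrite ge_min lexx orbT.
      have : `|fac a - 1| <= 2^-1 by rewrite -(ler_pM2r r0) (le_trans h1).
      by rewrite ler_norml => /andP[]; lra.
    have h3 : f x / 2 <= f (fwd a x).
      have := fL _ _ _ N1; rewrite ler_distl => /andP[h _].
      have : L * d <= f x / 2.
        have -> : f x / 2 = L * (f x / (2 * L)) by field; rewrite gt_eqF.
        by rewrite ler_pM2l// ge_min lexx.
      by lra.
    have h4 : 2^-1 <= weight m a.
      by rewrite /weight; case: (m) => //; rewrite invf_le1// ler1n.
    have -> : f x / 4 = 2^-1 * (f x / 2) by field.
    by rewrite ler_pM ?invr_ge0 ?divr_ge0.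
have posE x : (exists a : simG g, 0 < f (fwd a x)) -> 0 < u x.
  by move=> [a /pos]; rewrite uE pmulr_rgt0// invr_gt0 weight_gt0.
have zero x : ~ (exists a : simG g, 0 < f (fwd a x)) -> u x = 0.
  move=> nE; rewrite /u; have -> : (fun a : simG g => weight m a * f (fwd a x)) = (fun a => 0 * (weight m a * f (fwd a x))).
    apply/funext => a; rewrite mul0r; have [fa|fa] := ltP 0 (f (fwd a x)); first by case: nE; exists a.
    have -> : f (fwd a x) = 0 by apply/eqP; rewrite eq_le fa f0.
    by rewrite mulr0.
  by rewrite I_scale// mul0r.
exists u; split=> //.
- move=> c k; apply: Ck_local => _ [x cx <-].
  have [r [B [r0 rd Btb rF FB]]] := family c x cx.
  exists (rball (chart c x) r); first exact: rball_center.
  apply: (functional_smooth (@simN_dir R n X g k0) I_add I_scale (I_bound B Btb) Btb) => //.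
- move=> x; have [H|H] := pselect (exists a : simG g, 0 < f (fwd a x)); first exact/ltW/posE.
  by rewrite zero.
- move=> x; split=> [ux|]; last exact: posE.
  by apply: contrapT => /zero u0; rewrite u0 ltxx in ux.
Qed.

Section at_point.
Context (e : cm_index X) (p : X) (r1 m1 M1 r2 m2 s : R).
Hypothesis ep : dom e p.
(** The factor 8 leaves room for the support of the bump, within [2 * s] of [p], for the images of
    points close to those sent into it, within [3 * s], and for the box of radius [3 * s], within
    [6 * s]. *)
Hypotheses (m10 : 0 < m1) (m20 : 0 < m2) (s0 : 0 < s) (sr1 : s * 8 < r1) (sr2 : s * 8 < r2).
Hypothesis inv : forall z, rnorm (z - chart e p) < r1 -> dom e (chart_inv e z) /\ chart e (chart_inv e z) = z.
Hypothesis bd : forall y, dom e y -> rnorm (chart e y - chart e p) < r1 ->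
    forall v, m1 * rnorm v <= hnorm (g e y) v <= M1 * rnorm v.
Hypothesis low : forall y y' t, dom e y -> rnorm (chart e y - chart e p) < r2 -> t < m2 * r2 -> dle g y y' t ->
    dom e y' /\ m2 * rnorm (chart e y' - chart e y) <= t.

Let f := cbump e p s.
Let K := chart_inv e @` cbox (chart e p) s.

Let cK : compact K.
Proof. by apply: (chart_box_compact ep (ltW s0) _ inv); move: s0 sr1; rewrite mulr2n; lra. Qed.

Let fK y : f y != 0 -> K y.
Proof.
rewrite /f /cbump; case: asboolP => [ey|]; last by rewrite eqxx.
have [/qd_cbox H|/cutoff_eq0 ->] := ltP (qd (chart e p) s (chart e y)) 1; last by rewrite eqxx.
by move=> _; exists (chart e y); [exact: H|rewrite cm_chartK].
Qed.

Let K_dom y : K y -> dom e y /\ rnorm (chart e y - chart e p) <= s *+ 2.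
Proof.
move=> [z /(rnorm_rcoord (ltW s0)) zs <-].
have [|zd zc] := inv (z := z); last by rewrite zc.
by apply: le_lt_trans zs _; move: s0 sr1; rewrite mulr2n; lra.
Qed.

(** On [K] this follows from the Lipschitz constants of [cutoff] and [qd] and from the lower bound
    [m1] on the metric; off the closed set [K] the bump is locally 0. *)
Let lf : exists2 L : R, 0 < L & lipd g L f.
Proof.
have [Mc Mc0 McP] := @cutoff_lip R.
have [C C0 CP] : exists2 C : R, 0 <= C & forall z z', rnorm (z - chart e p) <= s * 4 -> rnorm (z' - chart e p) <= s * 4 ->
    `|qd (chart e p) s z - qd (chart e p) s z'| <= C * rnorm (z - z').
  exists ((n + n)%:R * ((s * 4 *+ 2) * (s ^+ 2)^-1)); last by move=> z' z'' h1 h2; exact: qd_lip.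
  by rewrite mulr_ge0// mulr_ge0 ?invr_ge0 ?sqr_ge0// mulrn_wge0// mulr_ge0// ltW.
pose L0 := Mc * C / m1; have L00 : 0 <= L0 by rewrite divr_ge0 ?(ltW m10)// mulr_ge0.
pose L := L0 + 1; have L_gt0 : 0 < L by rewrite ltr_wpDl.
exists L => // y z r yz.
suff lp : lip1 g (fun y => L^-1 * f y).
  have := yz _ lp; rewrite -mulrBr normrM gtr0_norm ?invr_gt0// mulrC ler_pdivrMr//.
  by rewrite mulrC.
move=> c x cx; have [Kx|nKx] := pselect (K x).
  have [ex xs] := K_dom Kx.
  apply: (plip_chart ler01 cx ex).
  have P : plip g L f e x.
    move=> t t0; exists s => // w ew ws.
    have ws4 : rnorm (chart e w - chart e p) <= s * 4.
      rewrite (le_trans (rnormB_le _ (chart e x) _))// (le_trans (lerD (ltW ws) xs))//.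
      by rewrite mulr2n; move: s0; lra.
    have xs4 : rnorm (chart e x - chart e p) <= s * 4 by rewrite (le_trans xs)// mulr2n; move: s0; lra.
    rewrite /f /cbump (asboolT ew) (asboolT ex) (le_trans (McP _ _))//.
    apply: (@le_trans _ _ (Mc * (C * rnorm (chart e w - chart e x)))).
      by rewrite ler_wpM2l//; exact: CP.
    have /andP[b1 _] : m1 * rnorm (chart e w - chart e x) <= hnorm (g e x) (chart e w - chart e x) <= M1 * rnorm (chart e w - chart e x).
      by apply: bd => //; apply: le_lt_trans xs _; move: s0 sr1; rewrite mulr2n; lra.
    apply: (@le_trans _ _ (L0 * hnorm (g e x) (chart e w - chart e x))).
      have -> : L0 * hnorm (g e x) (chart e w - chart e x) = Mc * (C * (hnorm (g e x) (chart e w - chart e x) / m1)).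
        by rewrite /L0; ring.
      by rewrite ler_wpM2l// ler_wpM2l// ler_pdivlMr// mulrC.
    by rewrite ler_wpM2r ?hnorm_ge0// /L -addrA lerDl addr_ge0// ltW.
  have := plipZ L^-1 P; rewrite ger0_norm ?invr_ge0 ?(ltW L_gt0)// mulVf// gt_eqF//.
have oK : nbhs x (~` K).
  by apply: open_nbhs_nbhs; split=> //; rewrite openC; apply: compact_closed cK; exact: cm_hausdorff.
have /(nbhs_chart _ cx)[d d0 dP] := oK => t t0; exists d => // w cw /(dP _ cw) nKw.
have f0 v : ~ K v -> f v = 0 by move=> nK; apply/eqP; apply: contrapT => /negP/fK.
by rewrite !f0// mulr0 subrr normr0 mulr_ge0 ?hnorm_ge0// addr_ge0// ltW.
Qed.

Let rho_K : exists2 P : R, 0 < P & forall y, K y -> rho y <= P.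
Proof.
apply: (@compact_induction _ K (fun A => exists2 P : R, 0 < P & forall y, A y -> rho y <= P)) => //.
- by move=> A B AB [P P0 H]; exists P => // y /AB/H.
- by exists 1.
- move=> A B [P P0 H] [P' P'0 H']; exists (Num.max P P'); first by rewrite lt_max P0.
  by move=> y [/H|/H'] h; rewrite le_max h ?orbT.
- move=> y _; have ry := rho_gt0 nrc y; exists [set z | dle g y z (rho y)].
    by apply/(nbhs_dle g); exists (rho y).
  exists (rho y * 2); first by rewrite mulr_gt0.
  by move=> z /= /dle_sym/(rho_move nrc); lra.
Qed.

(** Over a small ball at [x0] only the maps bringing some point of it into [K] contribute. Their
    factors are at most [L] and they send the whole ball within [3 * s] of [p], so that they are
    uniformly Lipschitz in the charts. The other maps are replaced by a constant at which the bump
    vanishes. *)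
Let family c x0 (m : bool) k0 : dom c x0 -> exists (r : R) (B : set (simG g)),
  [/\ 0 < r, forall z, rball (chart c x0) r z -> dom c (chart_inv c z),
   tot_bounded (simN k0) B,
   forall k, reg (@ubounded R n (rball (chart c x0) r) (simG g)) (rball (chart c x0) r) k
     (fun a z => weight m a * f (fwd a (chart_inv c z))) &
   forall z a, rball (chart c x0) r z -> weight m a * f (fwd a (chart_inv c z)) != 0 -> B a].
Proof.
move=> cx; have [P P0 rK] := rho_K.
have [r3 [m3 [M3 [r30 m30 M30 [inv3 bd3]]]]] := chart_norm_bounds g cx.
have [r4 [M4 [r40 M40 up]]] := dle_upper g cx.
have rx := rho_gt0 nrc x0.
(* On the ball [rho] is at least [rho x0 / 2], on [K] it is at most [P], and [a] multiplies it by
   [fac a]. *)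
pose L := 2 * P / rho x0; have L0 : 0 < L by rewrite divr_gt0// mulr_gt0.
(* The last two bounds keep [rho] within a factor 2 of [rho x0], and the images of the ball under
   good maps within [m2 * s] of one another. *)
pose r := Num.min (Num.min r3 r4) (Num.min (rho x0 / (2 * M4)) (m2 * s / (2 * L * M4))).
have r5 : 0 < rho x0 / (2 * M4) by apply: divr_gt0 => //; exact: mulr_gt0.
have r6 : 0 < m2 * s / (2 * L * M4) by apply: divr_gt0; [exact: mulr_gt0|apply: mulr_gt0 => //; exact: mulr_gt0].
have r0 : 0 < r by rewrite !lt_min r30 r40 r5 r6.
have rP z : rball (chart c x0) r z -> [/\ dom c (chart_inv c z), chart c (chart_inv c z) = z,
     rnorm (z - chart c x0) < r3, rnorm (z - chart c x0) < r4 & rho x0 / 2 <= rho (chart_inv c z) <= 2 * rho x0].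
  rewrite /rball/= !lt_min => /andP[/andP[z3 z4] /andP[z5 _]].
  have [zd zc] := inv3 _ z3; split=> //.
  have := up _ _ zd cx; rewrite zc => /(_ z4); rewrite subrr rnorm0 => /(_ r40) H.
  have h1 := rho_move nrc H; have h2 := rho_move nrc (dle_sym H).
  have h3 : M4 * rnorm (z - chart c x0) <= rho x0 / 2.
    have -> : rho x0 / 2 = M4 * (rho x0 / (2 * M4)) by field; rewrite gt_eqF.
    by rewrite ler_pM2l// ltW.
  by apply/andP; split; lra.
pose good (a : simG g) := exists2 z, rball (chart c x0) r z & K (fwd a (chart_inv c z)).
have goodP a : good a -> fac a <= L /\ (
    forall z, rball (chart c x0) r z -> dom e (fwd a (chart_inv c z)) /\
      rnorm (chart e (fwd a (chart_inv c z)) - chart e p) <= s * 3).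
  move=> [z zr Kz]; have [zd zc z3 z4 /andP[zl zu]] := rP z zr.
  have := rK _ Kz; rewrite (rho_sim nrc) => k2.
  have a0 := fac_gt0 a.
  have aL : fac a <= L.
    rewrite /L ler_pdivlMr//.
    have : fac a * (rho x0 / 2) <= P by rewrite (le_trans _ k2)// ler_pM2l.
    by rewrite mulrA; lra.
  split=> // z' zr'; have [zd' zc' z3' z4' _] := rP z' zr'.
  have [ez ezs] := K_dom Kz.
  have D : dle g (fwd a (chart_inv c z)) (fwd a (chart_inv c z')) (m2 * s).
    have := up _ _ zd zd'; rewrite zc zc' => /(_ z4 z4') /(sim_dle a); apply: dle_le.
    have h1 : rnorm (z - z') <= 2 * r.
      rewrite (le_trans (rnormB_le _ (chart c x0) _))// (rnormB (chart c x0)).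
      rewrite mulrDl mul1r; exact: lerD (ltW zr) (ltW zr').
    have h2 : r <= m2 * s / (2 * L * M4) by rewrite !ge_min lexx !orbT.
    rewrite (le_trans (_ : _ <= L * (M4 * (2 * r))))//.
      by rewrite ler_pM ?(ltW a0) ?mulr_ge0 ?(ltW M40) ?rnorm_ge0// ler_pM2l.
    have -> : L * (M4 * (2 * r)) = (2 * L * M4) * r by ring.
    have q0 : 0 < 2 * L * M4 by apply: mulr_gt0 => //; exact: mulr_gt0.
    by rewrite mulrC -ler_pdivlMr.
  have [||ez' ezz] := low ez _ _ D.
  - by apply: le_lt_trans ezs _; move: s0 sr2; rewrite mulr2n; lra.
  - by rewrite ltr_pM2l//; move: s0 sr2; lra.
  split=> //; rewrite (le_trans (rnormB_le _ (chart e (fwd a (chart_inv c z))) _))//.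
  have ezz1 : rnorm (chart e (fwd a (chart_inv c z')) - chart e (fwd a (chart_inv c z))) <= s.
    by rewrite -(ler_pM2l m20).
  by apply: (le_trans (lerD ezz1 ezs)); rewrite mulr2n; lra.
pose i0 := Ordinal n0.
(* A value for the discarded maps: one coordinate differs from that of [p] by [s], so that [qd] is
   at least 1. Such a coordinate exists because [0 < n]. *)
pose far : V := chart e p + s%:C *: delta_mx i0 0.
pose F a : V -> V := if `[< good a >] then local_rep (fwd a) c e else fun=> far.
pose M := s * 3.
have farM : rnorm (far - chart e p) <= M.
  rewrite /far addrAC subrr add0r rnormZr gtr0_norm// /M ler_pM2l//.
  rewrite (le_trans _ (_ : 1 <= _))//; last by rewrite ler1n.
  have := @rnorm_rbasis R n (unsplit (inl i0)).
  by rewrite /rbasis unsplitK.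
have far1 : 1 <= qd (chart e p) s far.
  have E : rcoord (unsplit (inl i0)) (far - chart e p) = s.
    by rewrite /far addrAC subrr add0r rcoordZ /rcoord unsplitK mxE !eqxx mulr1.
  rewrite /qd (bigD1 (unsplit (inl i0)))// E ler_wpDr//.
    by apply: sumr_ge0 => l _; rewrite mulr_ge0 ?invr_ge0 ?sqr_ge0.
  by rewrite mulfV// expf_neq0// gt_eqF.
have FM a z : rball (chart c x0) r z -> rnorm (F a z - chart e p) <= M.
  move=> zr; rewrite /F; case: asboolP => [/goodP[_ H]|_//].
  by have [] := H z zr.
pose Kc := (L * M3 / m1) *+ 2.
have Kc0 : 0 <= Kc by exact: mulrn_wge0 (divr_ge0 (mulr_ge0 (ltW L0) (ltW M30)) (ltW m10)).
have hF a : vlhol (chart c x0) r Kc (F a).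
  rewrite /F; case: asboolP => [/goodP[aL H]|_]; last first.
    move=> j; split=> [z _|z z' _ _]; first by exact: differentiable_cst.
    by rewrite subrr rnorm0 mulr_ge0// rnorm_ge0.
  apply: vlhol_of_bound => [z zr|z v zr]; have [zd zc z3 z4 _] := rP z zr; have [ez ezs] := H z zr.
    by have [_ /(_ c e _ zd ez)] := fwd_hol a; rewrite zc.
  have /pullback_vD/(_ c e _ zd ez v v) := @fwd_pullback _ _ _ _ a; rewrite zc => E.
  have /andP[b1 _] : m1 * rnorm (vD (local_rep (fwd a) c e) z v) <= hnorm (g e (fwd a (chart_inv c z))) (vD (local_rep (fwd a) c e) z v) <= M1 * rnorm (vD (local_rep (fwd a) c e) z v).
    by apply: bd => //; apply: le_lt_trans ezs _; move: s0 sr1; lra.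
  have := bd3 _ zd; rewrite zc => /(_ z3 v) /andP[_ b2].
  rewrite mulrAC ler_pdivlMr// mulrC (le_trans b1)// /hnorm E sqrtrM ?sqr_ge0// sqrtr_sqr.
  rewrite gtr0_norm ?fac_gt0// -mulrA ler_pM ?(ltW (fac_gt0 a)) ?sqrtr_ge0//.
pose w a := if `[< good a >] then weight m a else 0.
have wM : exists W : R, forall a, `|w a| <= W.
  exists (1 + L) => a; rewrite /w; case: asboolP => [/goodP[a1 _]|_]; last by rewrite normr0 addr_ge0// ltW.
  rewrite (gtr0_norm (weight_gt0 m a)) /weight; case: (m); first by rewrite (le_trans a1)// lerDr.
  by rewrite lerDl ltW.
have r20 : 0 < r / 2 by rewrite divr_gt0.
have r2r : r / 2 < r by rewrite ltr_pdivrMr// mulr_natr mulr2n ltrDl.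
have sub z : rball (chart c x0) (r / 2) z -> rball (chart c x0) r z by move=> /lt_trans; apply.
have FE a z : rball (chart c x0) r z -> w a * cutoff 0 (qd (chart e p) s (F a z)) = weight m a * f (fwd a (chart_inv c z)).
  move=> zr; rewrite /w /F; case: asboolP => [/goodP[_ H]|ng].
    by have [ez _] := H z zr; rewrite /f /cbump (asboolT ez).
  rewrite mul0r; have [->|/fK Kz] := eqVneq (f (fwd a (chart_inv c z))) 0; first by rewrite mulr0.
  by case: ng; exists z.
have cK3 : compact (chart_inv e @` cbox (chart e p) (s * 3)).
  apply: (chart_box_compact ep _ _ inv); first by rewrite mulr_ge0// ltW.
  by move: s0 sr1; rewrite mulr2n; lra.
exists (r / 2), [set a | (chart_inv e @` cbox (chart e p) (s * 3)) (fwd a x0)]; split=> //.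
- by move=> z /sub/rP[].
- exact: tb_orbit.
- move=> k; have [W WP] := wM.
  have oB : open (rball (chart c x0) (r / 2)) by exact: rball_open.
  apply: (reg_ext oB (@ub_ext _ _ _ _) (f := fun a z => w a * cutoff 0 (qd (chart e p) s (F a z)))).
    by move=> a z /sub; exact: FE.
  apply: (reg_mul oB (@ub_ext _ _ _ _) (@ub_add _ _ _ _) (@ub_mul _ _ _ _)).
    exact: reg_index WP.
  exact: (@cutoff_family R n (simG g) (chart c x0) r (r / 2) Kc M s F (chart e p) k r20 r2r hF FM).
- move=> z a /sub zr; rewrite mulf_eq0 negb_or => /andP[_ /fK Kz].
  have /goodP[_ H] : good a by exists z.
  have xr : rball (chart c x0) r (chart c x0) by exact: rball_center.
  have := H _ xr; rewrite cm_chartK// => -[ex exs].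
  exists (chart e (fwd a x0)); last by rewrite cm_chartK.
  by move=> k; rewrite (le_trans (rcoord_le _ _)).
Qed.

Lemma average_at_point (m : bool) : exists u : X -> R,
  [/\ smooth_fun u, forall (a : simG g) x, u (fwd a x) = (weight m a)^-1 * u x,
      forall x, 0 <= u x & forall x, 0 < u x <-> exists a : simG g, 0 < f (fwd a x)].
Proof.
have [L L0 fL] := lf; have [Mb _ MbP] := cbump_bound.
have A := @average m p f K L Mb L0 cK fK fL (MbP e p s) (@cbump_ge0 e p s).
by apply: A => c x0 cx; exact: family.
Qed.

End at_point.

(** The averages of one bump with the two weights are positive on the same set, the union of the
    translates of the set where the bump is; so the invariant one can tell where the other is
    positive. *)
Lemma orbit_average p : exists u0 u1 : X -> R,
  [/\ smooth_fun u0, smooth_fun u1,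
      forall (a : simG g) x, u0 (fwd a x) = u0 x /\ u1 (fwd a x) = (fac a)^-1 * u1 x,
      forall x, 0 <= u0 x /\ 0 <= u1 x & (forall x, 0 < u0 x <-> 0 < u1 x) /\ 0 < u0 p].
Proof.
have [e ep] := cm_cover p.
have [r1 [m1 [M1 [r10 m10 M10 [inv bd]]]]] := chart_norm_bounds g ep.
have [r2 [m2 [r20 m20 low]]] := dle_lower g ep.
pose s := Num.min r1 r2 / 16.
have s0 : 0 < s by rewrite divr_gt0// lt_min r10.
have s8 : s * 8 < Num.min r1 r2.
  have -> : s * 8 = Num.min r1 r2 / 2 by rewrite /s; field.
  by rewrite ltr_pdivrMr// mulr_natr mulr2n ltrDl lt_min r10.
move: s8; rewrite lt_min => /andP[s1 s2].
have avg m := average_at_point ep m10 m20 s0 s1 s2 inv bd low m.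
have [u0 [su0 e0 p0 pos0]] := avg false; have [u1 [su1 e1 p1 pos1]] := avg true.
exists u0, u1; split=> //.
- by move=> a x; rewrite e0 e1 /weight invr1 mul1r.
- split=> [x|]; first by rewrite pos0 pos1.
  apply/pos0; exists (sim_one g); rewrite /cbump (asboolT ep) qd_center.
  exact: cutoff_gt0.
Qed.

(** Each member of the countable base that fits in some [U p] selects one such [p]. *)
Lemma lindelof (U : X -> set X) (x0 : X) : (forall p, nbhs p (U p)) ->
  exists P : nat -> X, forall x, exists j, U (P j) x.
Proof.
move=> nU; have [B cB [Bo Bb]] := @cm_second_countable _ _ X.
have [f fi] : exists f : set X -> nat, {in B &, injective f} by exact/countable_injP.
have PP j : exists p, forall b, B b -> f b = j -> (exists p, b `<=` U p) -> b `<=` U p.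
  have [[b [Bb' fb [p bp]]]|nE] := pselect (exists b, [/\ B b, f b = j & exists p, b `<=` U p]).
    exists p => b' Bb'' fb' _; rewrite (_ : b' = b)//.
    by apply: fi; rewrite ?inE// fb' fb.
  by exists x0 => b Bb' fb pb; case: nE; exists b.
have [P PE] := choice PP; exists P => x.
have [b [Bb' bx] bU] := Bb x _ (nU x).
by exists (f b); apply: (PE _ b Bb' erefl) => //; exists x.
Qed.

Lemma smooth_fun_mul (u v : X -> R) : smooth_fun u -> smooth_fun v -> smooth_fun (fun x => u x * v x).
Proof. by move=> su sv c k; apply: Ck_mul; [exact: cm_image_open|exact: su|exact: sv]. Qed.

Lemma smooth_fun_add (u v : X -> R) : smooth_fun u -> smooth_fun v -> smooth_fun (fun x => u x + v x).
Proof. by move=> su sv c k; apply: Ck_add; [exact: cm_image_open|exact: su|exact: sv]. Qed.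

Lemma smooth_fun_cst a : smooth_fun (fun _ : X => a).
Proof. by move=> c; exact: smooth_cst. Qed.

Lemma smooth_fun_sum (F : nat -> X -> R) N : (forall j, smooth_fun (F j)) ->
  smooth_fun (fun x => \sum_(j < N) F j x).
Proof.
move=> sF; elim: N => [|N IH].
  by under eq_fun do rewrite big_ord0; exact: smooth_fun_cst.
by under eq_fun do rewrite big_ord_recr/=; apply: smooth_fun_add.
Qed.

Lemma smooth_fun_prod (F : nat -> X -> R) N : (forall j, smooth_fun (F j)) ->
  smooth_fun (fun x => \prod_(j < N) F j x).
Proof.
move=> sF; elim: N => [|N IH].
  by under eq_fun do rewrite big_ord0; exact: smooth_fun_cst.
by under eq_fun do rewrite big_ord_recr/=; apply: smooth_fun_mul.
Qed.

Lemma smooth_fun_cutoff (u : X -> R) : smooth_fun u -> smooth_fun (fun x => cutoff 0 (u x)).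
Proof.
move=> su c k; apply: (@Ck_comp _ _ _ _ setT (@cutoff R)) => //; first exact: cm_image_open.
  by move=> m x _; exact: cutoff_derive.
exact: su.
Qed.

Lemma smooth_fun_local (u : X -> R) : (forall x : X, exists (U : set X) v, [/\ nbhs x U, smooth_fun v & forall y, U y -> u y = v y]) ->
  smooth_fun u.
Proof.
move=> H c k; apply: Ck_local => _ [x cx <-].
have [U [v [nU sv uv]]] := H x.
have /(nbhs_chart _ cx)[d d0 dP] := nU; have [r r0 rP] := chart_ball cx.
pose e := Num.min d r; have e0 : 0 < e by rewrite lt_min d0.
exists (rball (chart c x) e); first exact: rball_center.
apply: (@Ck_ext _ _ (rball (chart c x) e) _ k (v \o chart_inv c)); first exact: rball_open.
  move=> z; rewrite /rball/= lt_min => /andP[zd /rP[zD zc]]; rewrite uv//.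
  by apply: dP; rewrite ?zc.
apply: Ck_subset (sv c k) => z; rewrite /rball/= lt_min => /andP[_ /rP[zD zc]].
by exists (chart_inv c z).
Qed.

(* The functions [w0 i] and [w1 i] being given by [orbit_average] on a countable cover, the sum of the
   [w1 j x * \prod_(i < j) cutoff 0 (j%:R * w0 i x)] is locally finite. *)
Lemma equivariant_function (x0 : X) : exists u : X -> R,
  [/\ smooth_fun u, forall x, 0 < u x & forall (a : simG g) x, u (fwd a x) = (fac a)^-1 * u x].
Proof.
have [w0 w0P] := choice orbit_average; have [w1 wP] := choice w0P.
have nU p : nbhs p [set x | 0 < w0 p x].
  have [s0 _ _ _ [_ pos]] := wP p.
  have cw := @smooth_fun_continuous _ _ _ _ s0 p.
  have /cvgrPdist_le/(_ _ (divr_gt0 pos (ltr0n R 2))) := cw; apply: filterS => y /=.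
  by rewrite ler_distlC => /andP[h _]; lra.
have [P PE] := lindelof x0 nU.
pose A j x : R := w1 (P j) x * \prod_(i < j) cutoff 0 (j%:R * w0 (P i) x).
have sA j : smooth_fun (A j).
  apply: smooth_fun_mul; first by have [_ s1 _ _ _] := wP (P j).
  apply: (smooth_fun_prod (F := fun i x => cutoff 0 (j%:R * w0 (P i) x))) => i.
  apply: smooth_fun_cutoff; apply: smooth_fun_mul; first exact: smooth_fun_cst.
  by have [s0 _ _ _ _] := wP (P i).
have A0 j x : 0 <= A j x.
  have [_ _ _ /(_ x)[_ h] _] := wP (P j).
  by rewrite mulr_ge0// prodr_ge0// => i _; exact: cutoff_ge0.
have Ae j (a : simG g) x : A j (fwd a x) = (fac a)^-1 * A j x.
  rewrite /A; have [_ _ /(_ a x)[_ ->] _ _] := wP (P j); rewrite -mulrA; congr (_ * (_ * _)).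
  by apply: eq_bigr => i _; have [_ _ /(_ a x)[-> _] _ _] := wP (P i).
have loc (x : X) : exists N, exists2 U, nbhs x U & forall y j, U y -> (N <= j)%N -> A j y = 0.
  have [i ix] := PE x; pose e := w0 (P i) x / 2; have e0 : 0 < e by rewrite divr_gt0.
  have [s0 _ _ _ _] := wP (P i); have cw := @smooth_fun_continuous _ _ _ _ s0 x.
  have nV : nbhs x [set y | e <= w0 (P i) y].
    have /cvgrPdist_le/(_ _ e0) := cw; apply: filterS => y /=.
    by rewrite ler_distlC => /andP[h _]; rewrite /e in h *; lra.
  (* Near [x] the value of [w0 (P i)] is at least [e]; for [j] beyond [i] and [M] the cutoff at
     [j%:R * w0 (P i)] vanishes, and with it the product. *)
  have [M eM] : exists M : nat, 1 <= M%:R * e.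
    exists (Num.bound e^-1); rewrite -ler_pdivrMr// div1r ltW// archi_boundP// invr_ge0 ltW//.
  exists (maxn i.+1 M); exists [set y | e <= w0 (P i) y] => // y j ey; rewrite geq_max => /andP[ij Mj].
  rewrite /A (bigD1 (Ordinal ij))//= cutoff_eq0 ?mul0r ?mulr0//.
  rewrite (le_trans eM)// ler_pM ?ler0n ?(ltW e0)// ler_nat//.
have [N NP] := choice loc.
pose u x := \sum_(j < N x) A j x.
have stab x M M' : (M <= M')%N -> (forall j, (M <= j)%N -> A j x = 0) -> \sum_(j < M') A j x = \sum_(j < M) A j x.
  move=> MM H; rewrite -(big_mkord xpredT (fun j => A j x)) -(big_mkord xpredT (fun j => A j x)).
  rewrite (big_cat_nat (leq0n M) MM)//=.
  have -> : \sum_(M <= j < M') A j x = 0.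
    by rewrite big_nat_cond big1// => j /andP[/andP[/H]].
  by rewrite addr0.
have uE x M : (forall j, (M <= j)%N -> A j x = 0) -> u x = \sum_(j < M) A j x.
  move=> H; have [U nU' UP] := NP x; have Ux : U x by exact: nbhs_singleton nU'.
  have H' j : (N x <= j)%N -> A j x = 0 by exact: UP.
  rewrite /u; have [le|/ltnW le] := leqP M (N x); first exact: stab.
  by apply/esym; exact: stab.
exists u; split.
- apply: smooth_fun_local => x; have [U nU' UP] := NP x.
  exists U, (fun y => \sum_(j < N x) A j y); split=> //; first exact: smooth_fun_sum.
  by move=> y Uy; apply: uE => j; exact: UP.
(* For the least [j] with [0 < w0 (P j) x], all the cutoffs in the product are taken at 0. *)
- move=> x; have ex : exists j, 0 < w0 (P j) x by exact: PE.
  have [j jx jmin] := ex_minnP ex.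
  have Aj : 0 < A j x.
    have [_ _ _ _ [iff _]] := wP (P j).
    rewrite mulr_gt0//; first exact/iff.
    rewrite prodr_gt0// => i _; apply: cutoff_gt0.
    have [_ _ _ /(_ x)[h _] _] := wP (P i).
    have [|le] := ltP 0 (w0 (P i) x); first by move=> /jmin; rewrite leqNgt ltn_ord.
    by rewrite (_ : w0 (P i) x = 0) ?mulr0 ?ltr01//; apply/eqP; rewrite eq_le le h.
  have [U nU' UP] := NP x; have Ux : U x by exact: nbhs_singleton nU'.
  have jN : (j < N x)%N.
    by rewrite ltnNge; apply/negP => /(UP x j Ux) Z; rewrite Z ltxx in Aj.
  rewrite /u (bigD1 (Ordinal jN))//= ltr_wpDr// sumr_ge0//.
- move=> a x; have [U nU' UP] := NP (fwd a x); have Ux : U (fwd a x) by exact: nbhs_singleton nU'.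
  have H j : (N (fwd a x) <= j)%N -> A j x = 0.
    move=> /(UP _ j Ux); rewrite Ae => /eqP; rewrite mulf_eq0 invr_eq0 gt_eqF ?fac_gt0//=.
    by move/eqP.
  rewrite (uE x _ H) /u mulr_sumr; apply: eq_bigr => j _.
  exact: Ae.
Qed.

End orbit_average.

(** * The invariant Hermitian metric *)

Section invariant_metric.
Context {R : realType} {n : nat} {X : complexManifold R n} (g : hermitianMetric X).

Lemma scaled_metric (v : X -> R) : smooth_fun v -> (forall x, 0 < v x) ->
  exists h : hermitianMetric X, forall c x a b, h c x a b = v x * g c x a b.
Proof.
move=> sv v0; unshelve eexists.
  apply: (@HermitianMetric R n X (fun c x a b => v x * g c x a b)).
  - by move=> c d x cx dx a b; rewrite (hm_compat g cx dx).
  - by move=> c x cx t a b w; rewrite hm_linear//; ring.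
  - by move=> c x cx a b; rewrite hm_sym.
  - by move=> c x cx a a0; rewrite mulr_gt0// hm_pos.
  - by move=> c x cx a b; rewrite hm_J.
  - move=> c a b k; apply: Ck_mul; [exact: cm_image_open|exact: sv|exact: hm_smooth].
by [].
Qed.

Lemma iso_conf : Iso g `<=` Conf g.
Proof.
move=> a [ba pa]; split=> //; exists (fun=> 1); split=> //.
exact: smooth_fun_cst.
Qed.

Hypothesis n1 : (1 < n)%N.
Hypothesis kg : kaehler g.
Hypothesis cX : connected [set: X].

Lemma invariant_metric (u : X -> R) : smooth_fun u -> (forall x, 0 < u x) ->
  (forall (a : simG g) x, u (fwd a x) = (fac a)^-1 * u x) ->
  exists h : hermitianMetric X, conformal_to h g /\ Conf g = Iso h.
Proof.
move=> su u0 ue; have v0 x : 0 < u x ^+ 2 by rewrite exprn_gt0.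
have sv : smooth_fun (fun x => u x ^+ 2) by exact: (smooth_fun_mul su su).
have [h hE] := scaled_metric sv v0; exists h; split.
  by exists (fun x => u x ^+ 2); split.
apply/seteqP; split=> [f cf|f [bf /pullback_vD pf]].
  have [a <-] := conf_sim n1 kg cX cf; have [ba _] := sim_conf a; split=> //.
  apply/pullback_vD => c d x cx dx v w; have /pullback_vD H := @fwd_pullback _ _ _ _ a.
  by rewrite !hE H// ue; field; rewrite gt_eqF// fac_gt0.
have [hf _] := bf; split=> //.
pose w x := u x ^+ 2 / u (f x) ^+ 2.
have w0 x : 0 < w x by rewrite divr_gt0.
have pw : pullback_eq f g w g.
  apply/pullback_vD => c d x cx dx a b; have := pf c d x cx dx a b; rewrite !hE mul1r => E.
  by rewrite /w mulrAC -E mulrAC mulfV ?mul1r// gt_eqF.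
have cv : continuous (fun x => u x ^+ 2) by exact: smooth_fun_continuous.
have cw : continuous w.
  have [cf _] := hf => x; apply: (@continuousM R X (fun x => u x ^+ 2) (fun x => (u (f x) ^+ 2)^-1) x).
    exact: cv.
  apply: (@continuousV R X (fun x => u (f x) ^+ 2) x); first by rewrite gt_eqF.
  exact: (continuous_comp (cf x) (cv (f x))).
exists w; split=> //.
(* Smoothness of [w] is obtained from local constancy, which avoids the composite of [u] with [f] in
   charts. *)
apply: smooth_fun_local => x.
have [U nU UP] := factor_locally_constant n1 hf kg kg cw pw x.
by exists U, (fun=> w x); split=> //; exact: smooth_fun_cst.
Qed.

Lemma bounded_radius_case x0 r0 : ~ rc g x0 r0 ->
  exists h : hermitianMetric X, conformal_to h g /\ Conf g = Iso h.
Proof.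
(* Any ball of sufficiently large radius contains the given one. *)
move=> nrc0; have nrc x : exists r, ~ rc g x r.
  have [s xs] := dle_finite g x x0 cX; exists (s + r0) => /(rc_move xs).
  exact: nrc0.
have [u [su u0 ue]] := equivariant_function (ltnW n1) cX nrc x0.
exact: invariant_metric su u0 ue.
Qed.

End invariant_metric.

(** * Limits and inverses of holomorphic maps *)

Section sequences.
Context {R : realType}.

Definition ncvg (W : normedModType R[i]) (u : nat -> W) (l : W) := forall e : R, 0 < e ->
  exists N, forall k, (N <= k)%N -> rnorm (u k - l) <= e.

Lemma ncvg_uniq (W : normedModType R[i]) (u : nat -> W) l l' : ncvg u l -> ncvg u l' -> l = l'.
Proof.
move=> ul ul'; apply/eqP; rewrite -subr_eq0; apply/eqP/rnorm_eq0/eqP.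
rewrite eq_le rnorm_ge0 andbT; apply/ler_addgt0Pr => e e0; rewrite add0r.
have e20 : 0 < e / 2 by rewrite divr_gt0.
have [N NP] := ul _ e20; have [N' N'P] := ul' _ e20.
rewrite (le_trans (rnormB_le _ (u (maxn N N')) _))// (splitr e) lerD//.
  by rewrite rnormB NP// leq_maxl.
by rewrite N'P// leq_maxr.
Qed.

Lemma ncvg_le (W : normedModType R[i]) (u : nat -> W) l a (M : R) : ncvg u l ->
  (exists N, forall k, (N <= k)%N -> rnorm (u k - a) <= M) -> rnorm (l - a) <= M.
Proof.
move=> ul [N NP]; apply/ler_addgt0Pr => e e0; have [N' N'P] := ul _ e0.
rewrite (le_trans (rnormB_le _ (u (maxn N N')) _))// addrC lerD//.
  by rewrite NP// leq_maxl.
by rewrite rnormB N'P// leq_maxr.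
Qed.

Lemma ncvgD (W : normedModType R[i]) (u v : nat -> W) l m : ncvg u l -> ncvg v m ->
  ncvg (fun k => u k + v k) (l + m).
Proof.
move=> ul vm e e0; have e20 : 0 < e / 2 by rewrite divr_gt0.
have [N NP] := ul _ e20; have [N' N'P] := vm _ e20.
exists (maxn N N') => k; rewrite geq_max => /andP[/NP h1 /N'P h2].
by rewrite opprD addrACA (le_trans (rnormD _ _))// (splitr e) lerD.
Qed.

Lemma ncvgZ (W : normedModType R[i]) (u : nat -> W) l (a : R[i]) : ncvg u l ->
  ncvg (fun k => a *: u k) (a *: l).
Proof.
move=> ul e e0; have a1 : 0 < 1 + rnorm (a : R[i]^o) by rewrite ltr_pwDl// rnorm_ge0.
have [N NP] := ul _ (divr_gt0 e0 a1); exists N => k /NP H.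
rewrite -scalerBr rnormZ (le_trans (ler_wpM2l (rnorm_ge0 _) H))// mulrCA ler_piMr ?(ltW e0)//.
by rewrite ler_pdivrMr// mul1r lerDr.
Qed.

Lemma ncvg_coord n (u : nat -> Cn R n) l : ncvg u l <->
  forall j, ncvg (fun k => u k j 0 : R[i]^o) (l j 0).
Proof.
split=> [ul j e /ul[N NP]|ul e e0].
  exists N => k /NP; apply: le_trans.
  by have := coord_le_rnorm (u k - l) j; rewrite !mxE.
have [N NP] := choice (fun j => ul j e e0).
exists (\max_j N j) => k Nk; apply: rnorm_le_coord; first exact: ltW.
move=> j; rewrite !mxE; apply: NP; exact: leq_trans (leq_bigmax j) Nk.
Qed.

Lemma real_geometric_limit (u : nat -> R) (C q : R) : 0 <= q < 1 ->
  (forall k, `|u k.+1 - u k| <= C * q ^+ k) ->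
  exists l, forall e : R, 0 < e -> exists N, forall k, (N <= k)%N -> `|u k - l| <= e.
Proof.
move=> /andP[q0 q1] uC.
have C0 : 0 <= C by have := le_trans (normr_ge0 _) (uC 0%N); rewrite expr0 mulr1.
have q1' : 0 < 1 - q by rewrite subr_gt0.
have step k m : `|u (k + m)%N - u k| <= C * q ^+ k * (1 - q ^+ m) / (1 - q).
  elim: m => [|m IH]; first by rewrite addn0 subrr normr0 expr0 subrr mulr0 mul0r.
  have -> : u (k + m.+1)%N - u k = (u (k + m)%N.+1 - u (k + m)%N) + (u (k + m)%N - u k) by rewrite addnS; ring.
  rewrite (le_trans (ler_normD _ _))// (le_trans (lerD (uC _) IH))//.
  rewrite le_eqVlt; apply/orP; left; apply/eqP; rewrite exprD exprSr; field.
  by rewrite gt_eqF.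
have qn (e : R) : 0 < e -> exists N, forall k, (N <= k)%N -> C * q ^+ k / (1 - q) <= e.
  move=> e0; have aq : `|q| < 1 by rewrite ger0_norm.
  have C1 : 0 < C + 1 by rewrite ltr_wpDl.
  have [|N NP] := eps_cvgn (cvg_expr aq) (e := e * (1 - q) / (C + 1)); first by rewrite divr_gt0// mulr_gt0.
  exists N => k /NP; rewrite sub0r normrN ger0_norm ?exprn_ge0// => H.
  rewrite ler_pdivrMr// (le_trans (_ : _ <= (C + 1) * q ^+ k))//.
    by rewrite ler_wpM2r ?exprn_ge0// lerDl.
  by rewrite mulrC -ler_pdivlMr.
have tail k m : (k <= m)%N -> `|u m - u k| <= C * q ^+ k / (1 - q).
  move=> km; rewrite -(subnKC km) (le_trans (step k _))// ler_pM2r ?invr_gt0//.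
  by rewrite ler_piMr ?mulr_ge0 ?exprn_ge0// lerBlDr lerDl exprn_ge0.
have cu : cvgn u.
  apply/cauchy_cvgP/cauchy_exP => e e0; have [N NP] := qn (e / 2) (divr_gt0 e0 (ltr0n R 2)).
  exists (u N); exists N => // k /= Nk; rewrite /ball/= distrC.
  rewrite (le_lt_trans (tail _ _ Nk))// (le_lt_trans (NP _ (leqnn _)))//.
  by rewrite ltr_pdivrMr// mulr_natr mulr2n ltrDl.
exists (limn u) => e e0; have [N NP] := eps_cvgn cu e0.
by exists N => k /NP; rewrite distrC.
Qed.

Lemma geometric_limit n (u : nat -> Cn R n) (C q : R) k0 : 0 <= q < 1 ->
  (forall k, (k0 <= k)%N -> rnorm (u k.+1 - u k) <= C * q ^+ k) -> exists l, ncvg u l.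
Proof.
move=> q01 uC; have /andP[q0 q1] := q01.
have coord (f : R[i]^o -> R) j : (forall x y, f (x - y) = f x - f y) -> (forall x, `|f x| <= rnorm x) ->
    exists l, forall e : R, 0 < e -> exists N, forall k, (N <= k)%N -> `|f (u k j 0) - l| <= e.
  move=> fB fle.
  have step k : `|f (u (k.+1 + k0)%N j 0) - f (u (k + k0)%N j 0)| <= C * q ^+ k0 * q ^+ k.
    rewrite -fB (le_trans (fle _))// -mulrA -exprD [(k0 + k)%N]addnC.
    rewrite (le_trans _ (uC _ (leq_addl _ _)))// addSn.
    by have := coord_le_rnorm (u (k + k0).+1 - u (k + k0)%N) j; rewrite !mxE.
  have [l lP] := @real_geometric_limit (fun k => f (u (k + k0)%N j 0)) (C * q ^+ k0) q q01 step.
  exists l => e /lP[N NP]; exists (N + k0)%N => k Nk.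
  have kk : (k0 <= k)%N by exact: leq_trans (leq_addl _ _) Nk.
  by have := NP (k - k0)%N; rewrite subnK//; apply; rewrite leq_subRL// addnC.
have [lr rP] := choice (fun j => coord (@complex.Re R) j (fun x y => raddfB _ x y) (@Re_le_rnorm R)).
have [li iP] := choice (fun j => coord (@complex.Im R) j (fun x y => raddfB _ x y) (@Im_le_rnorm R)).
exists (\col_j (lr j +i* li j)); apply/ncvg_coord => j e e0.
have e20 : 0 < e / 2 by rewrite divr_gt0.
have [N NP] := rP j _ e20; have [N' N'P] := iP j _ e20.
exists (maxn N N') => k; rewrite geq_max mxE => /andP[/NP h1 /N'P h2].
by rewrite (le_trans (rnorm_ReIm _))// !raddfB/= (splitr e) lerD.
Qed.

End sequences.

(** * Weierstrass limits and local inverses *)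

Section holomorphic_limits.
Context {R : realType} {n : nat}.
Local Notation V := (Cn R n).
Local Notation C := (R[i]^o).

(** Weierstrass's theorem. The common Lipschitz constant dominates the circle averages of the Cauchy
    formula, hence the derivatives converge; the Taylor estimates, uniform in [k], then pass to the
    limit. *)
Lemma lhol_limit (f_ : nat -> V -> C) (f : V -> C) z0 (rho L : R) :
  (forall k, lhol z0 rho L (f_ k)) ->
  (forall z, rball z0 rho z -> ncvg (fun k => f_ k z) (f z)) ->
  lhol z0 rho L f /\ forall z v, rball z0 rho z -> ncvg (fun k => cD (f_ k) z v) (cD f z v).
Proof.
move=> hf cf.
have D z v : rball z0 rho z -> exists l : C, ncvg (fun k => cD (f_ k) z v) l.
  move=> zr; have [-> | v0] := eqVneq v 0.
    exists 0 => e e0; exists 0%N => k _; have [lD _] := lhol_cder (hf k) zr.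
    by rewrite (lin0 lD) subrr rnorm0 ltW.
  have vp : 0 < rnorm v by exact: rnorm_gt0.
  pose r := (rho - rnorm (z - z0)) / (2 * rnorm v).
  have r0 : 0 < r by rewrite divr_gt0 ?subr_gt0// mulr_gt0.
  have rv : r * rnorm v = (rho - rnorm (z - z0)) / 2 by rewrite /r; field; rewrite gt_eqF.
  have zrv : rnorm (z - z0) + r * rnorm v < rho.
    by rewrite rv; move: zr; rewrite /rball/=; lra.
  have inB t : rball z0 rho (z + (r%:C * expi t) *: v).
    rewrite /rball/= addrAC (le_lt_trans (rnormD _ _))// rnormZ rnormM rnorm_real.
    by rewrite rnorm_expi mulr1 gtr0_norm.
  (* Discarding the first [N] terms bounds the values at [z], and with them all values on the
     circle. *)
  have [N NP] := cf z zr 1 ltr01.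
  pose p_ k t := f_ (k + N)%N (z + (r%:C * expi t) *: v) * expi (- t) : C.
  pose p t := f (z + (r%:C * expi t) *: v) * expi (- t) : C.
  have L0 : 0 <= L * rnorm v := le_trans (rnorm_ge0 _) (lhol_dbound v (hf 0%N) zr).
  have bM k t : rnorm (p_ k t) <= L * rnorm v * r + (1 + rnorm (f z)).
    rewrite /p_ rnormM rnorm_expi mulr1 -[f_ _ _](subrK (f_ (k + N)%N z)).
    rewrite (le_trans (rnormD _ _))// lerD//.
      rewrite (le_trans ((hf _).2 _ _ (inB t) zr))// addrAC subrr add0r rnormZ rnormM rnorm_real rnorm_expi mulr1.
      by rewrite gtr0_norm// -mulrA [rnorm v * r]mulrC.
    by rewrite -[f_ (k + N)%N z](subrK (f z)) (le_trans (rnormD _ _))// lerD2r NP// leq_addl.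
  have bp k : cbm (p_ k) by exact: lhol_cbm (hf (k + N)%N) r0 zrv.
  have pp t (e : R) : 0 < e -> exists N', forall k, (N' <= k)%N -> rnorm (p_ k t - p t) <= e.
    move=> e0; have [N' N'P] := cf _ (inB t) e e0; exists N' => k Nk.
    rewrite /p_ /p -mulrBl rnormM rnorm_expi mulr1; apply: N'P; exact: leq_trans (leq_addr _ _).
  have [_ cv] := @cavg_dct R p_ p (L * rnorm v * r + (1 + rnorm (f z))) bp bM pp.
  exists ((r^-1)%:C * cavg p) => e e0.
  have [N' N'P] := cv (e * r) (mulr_gt0 e0 r0); exists (N' + N)%N => k Nk.
  have kN : (N <= k)%N by exact: leq_trans (leq_addl _ _) Nk.
  have := N'P (k - N)%N; rewrite leq_subRL// addnC => /(_ Nk).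
  have -> : cavg (p_ (k - N)%N) = r%:C * cD (f_ k) z v.
    by rewrite -(lhol_T (hf k) r0 zrv) /p_ subnK.
  have rr : (r^-1)%:C * r%:C = 1 :> R[i] by rewrite -rmorphM/= mulVf ?gt_eqF.
  have -> : r%:C * cD (f_ k) z v - cavg p = r%:C * (cD (f_ k) z v - (r^-1)%:C * cavg p).
    have gen (x y p' q' : R[i]) : x * y = 1 -> y * p' - q' = y * (p' - x * q').
      by move=> xy; rewrite mulrBr mulrA [y * x]mulrC xy mul1r.
    exact: gen rr.
  by rewrite rnormM rnorm_real gtr0_norm// mulrC ler_pM2r.
have key z : rball z0 rho z -> exists2 Lz : V -> C, cder f z Lz & forall v, ncvg (fun k => cD (f_ k) z v) (Lz v).
  move=> zr; have [Lz LzP] := choice (fun v => D z v zr); exists Lz => //.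
  have lL : linear Lz.
    move=> a u v; have H1 := ncvgD (ncvgZ a (LzP u)) (LzP v).
    apply: (ncvg_uniq (LzP _)); move=> e /H1[N NP]; exists N => k /NP.
    by have [lD _] := lhol_cder (hf k) zr; rewrite lD.
  split=> // e e0.
  pose rho' := (rho + rnorm (z - z0)) / 2.
  have rr : rho' < rho by rewrite /rho'; move: zr; rewrite /rball/=; lra.
  have zr' : rball z0 rho' z by rewrite /rball/= /rho'; move: zr; rewrite /rball/=; lra.
  pose K := `|dlip rho rho' L| *+ 2 + 1; have K0 : 0 < K by rewrite ltr_wpDl// mulrn_wge0.
  exists (Num.min (rho' - rnorm (z - z0)) (e / K)).
    by rewrite lt_min subr_gt0 zr' divr_gt0.
  move=> h; rewrite lt_min => /andP[h1 h2].
  have zhr : rball z0 rho' (z + h).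
    by rewrite /rball/= addrAC addrC (le_lt_trans (rnormD _ _))// -ltrBrDr.
  have zhr' : rball z0 rho (z + h) by exact: lt_trans rr.
  have U := ncvgD (ncvgD (cf _ zhr') (ncvgZ (-1) (cf _ zr))) (ncvgZ (-1) (LzP h)).
  rewrite !scaleN1r in U; rewrite -[X in rnorm X]subr0.
  apply: (ncvg_le U); exists 0%N => k _; rewrite !scaleN1r subr0.
  rewrite (le_trans (lhol_taylor (hf k) rr zr' zhr))// expr2 mulrA -mulrnAl ler_wpM2r ?rnorm_ge0//.
  rewrite -mulrnAl (le_trans (_ : _ <= K * rnorm h))//.
    rewrite ler_wpM2r ?rnorm_ge0// /K (le_trans (_ : _ <= `|dlip rho rho' L| *+ 2)) ?lerDl//.
    by rewrite lerMn2r// ler_norm orbT.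
  by rewrite mulrC -ler_pdivlMr// ltW.
split; last by move=> z v /key[Lz /cder_cD -> ].
split=> [z /key[Lz /cder_differentiable[]]//|z z' zr zr'].
have U := ncvgD (cf _ zr) (ncvgZ (-1) (cf _ zr')); rewrite !scaleN1r in U.
rewrite -[X in rnorm X]subr0; apply: (ncvg_le U); exists 0%N => k _.
by rewrite scaleN1r subr0; exact: (hf k).2.
Qed.

Lemma lin_matrix (L : V -> V) : linear L -> exists M : 'M[R[i]]_n, forall v, L v = M *m v.
Proof.
move=> lL; exists (\matrix_(i, j) L (delta_mx j 0) i 0) => v.
have {1}-> : v = \sum_i v i 0 *: (delta_mx i 0 : V).
  by rewrite {1}[v]matrix_sum_delta; apply: eq_bigr => i _; rewrite big_ord1.
rewrite (lin_sum lL); apply/colP => i; rewrite summxE !mxE; apply: eq_bigr => j _.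
by rewrite (linZ lL) !mxE mulrC.
Qed.

Lemma mulmx_lin (M : 'M[R[i]]_n) : linear (fun v : V => M *m v : V).
Proof. by move=> a u v; rewrite mulmxDr -scalemxAr. Qed.

Lemma inverse_cder (F G : V -> V) z0 (S : 'M[R[i]]_n) : S \in unitmx ->
  cder F z0 (fun v => S *m v) -> G (F z0) = z0 ->
  (exists2 r : R, 0 < r & forall w, rnorm (w - F z0) < r -> F (G w) = w) ->
  (forall e : R, 0 < e -> exists2 d : R, 0 < d & forall w, rnorm (w - F z0) < d -> rnorm (G w - z0) < e) ->
  cder G (F z0) (fun v => invmx S *m v).
Proof.
move=> Su [_ dF] Gz [r r0 FG] cG; split; first exact: mulmx_lin.
move=> e e0; have [k k0 kP] := lin_bounded (mulmx_lin (invmx S)).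
(* The first bound gives [rnorm x <= 2 * k * rnorm h], the second turns this into an error of at
   most [e * rnorm h]. *)
pose e1 := Num.min (1 / (2 * k)) (e / (2 * k ^+ 2)).
have e10 : 0 < e1 by rewrite lt_min !divr_gt0// mulr_gt0// exprn_gt0.
have [d1 d10 d1P] := dF _ e10; have [d2 d20 d2P] := cG _ d10.
exists (Num.min r d2); first by rewrite lt_min r0.
move=> h; rewrite lt_min => /andP[hr hd].
have wh : F z0 + h - F z0 = h by rewrite addrAC subrr add0r.
have := FG (F z0 + h); rewrite wh => /(_ hr) FGw.
have := d2P (F z0 + h); rewrite wh => /(_ hd) Gd.
have := d1P _ Gd; rewrite subrKC FGw wh Gz => H.
set x := G (F z0 + h) - z0 in H Gd *.
have H2 : rnorm (invmx S *m h - x) <= k * (e1 * rnorm x).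
  rewrite (le_trans _ (ler_wpM2l (ltW k0) H))// (le_trans _ (kP _))//.
  by rewrite mulmxBr mulKmx.
have x2 : rnorm x <= 2 * k * rnorm h.
  have h1 : rnorm x <= rnorm (invmx S *m h) + rnorm (invmx S *m h - x).
    by rewrite -{1}(subKr (invmx S *m h) x) (le_trans (rnormD _ _))// rnormN.
  have h2 : k * (e1 * rnorm x) <= rnorm x / 2.
    rewrite (le_trans (_ : _ <= k * (1 / (2 * k) * rnorm x)))//.
      by rewrite ler_wpM2l ?(ltW k0)// ler_wpM2r ?rnorm_ge0// ge_min lexx.
    by rewrite le_eqVlt; apply/orP; left; apply/eqP; field; rewrite gt_eqF.
  by have h3 := kP h; move: H2 h1 h2 h3; lra.
rewrite rnormB (le_trans H2)// (le_trans (_ : _ <= k * (e1 * (2 * k * rnorm h))))//.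
  by rewrite ler_wpM2l ?(ltW k0)// ler_wpM2l ?(ltW e10).
rewrite (le_trans (_ : _ <= k * (e / (2 * k ^+ 2) * (2 * k * rnorm h))))//.
  by rewrite ler_wpM2l ?(ltW k0)// ler_wpM2r ?mulr_ge0 ?rnorm_ge0 ?(ltW k0)// ge_min lexx orbT.
by rewrite le_eqVlt; apply/orP; left; apply/eqP; field; rewrite gt_eqF.
Qed.

(** Newton's iteration with the derivative frozen at [a]: the map [E z = z - S^-1 (T z)] has a
    derivative of norm at most [1 / 8] near [a], so it is a contraction. *)
Lemma local_inverse (T : V -> V) a (delta K : R) (S : 'M[R[i]]_n) : 0 < delta -> vlhol a delta K T ->
  S \in unitmx -> cder T a (fun v => S *m v) ->
  exists d C eta : R, [/\ 0 < d, d <= delta, 0 < C, 0 < eta &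
    (forall z z', rball a d z -> rball a d z' -> rnorm (z - z') <= C * rnorm (T z - T z')) /\
    (forall w, rnorm (w - T a) < eta -> exists2 z, rball a d z & T z = w)].
Proof.
move=> d0 hT Su dT; have [k k0 kP] := lin_bounded (mulmx_lin (invmx S)).
have dd : delta / 2 < delta by rewrite ltr_pdivrMr// mulr_natr mulr2n ltrDl.
pose Q := `|dlip delta (delta / 2) K|.
(* The derivative of [E] vanishes at [a], and that of [T] varies by at most [Q * d] in operator
   norm; thus the former is at most [k * Q * d <= 1 / 8]. *)
pose d := Num.min (delta / 2) (1 / (8 * k * (Q + 1))).
have Q0 : 0 <= Q by exact: normr_ge0.
have dpos : 0 < d by rewrite lt_min !divr_gt0// !mulr_gt0// ltr_wpDl.
have d2 : d <= delta / 2 by rewrite ge_min lexx.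
have dde : d < delta by exact: le_lt_trans dd.
have k20 : 0 < 2 * k by exact: mulr_gt0.
have eta0 : 0 < d / (4 * k) by apply: divr_gt0 => //; exact: mulr_gt0.
have sub z : rball a d z -> rball a delta z by move=> /lt_trans; apply.
have sub2 z : rball a d z -> rball a (delta / 2) z by move=> /lt_le_trans; apply.
have aS v : vD T a v = S *m v by rewrite (cder_vD dT).
pose E z := z - invmx S *m T z.
have dE z : rball a d z -> cder E z (fun v => v - invmx S *m vD T z v).
  move=> zr; have [lD DP] := vlhol_cder hT (sub _ zr); split.
    by move=> c u v; rewrite lD mulmxDr -scalemxAr scalerBr opprD addrACA.
  move=> e e0; have [r r0 rP] := DP _ (divr_gt0 e0 k0); exists r => // h /rP H.
  have -> : E (z + h) - E z - (h - invmx S *m vD T z h) = - (invmx S *m (T (z + h) - T z - vD T z h)).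
    rewrite /E !mulmxBr.
    move: (invmx S *m T (z + h)) (invmx S *m T z) (invmx S *m vD T z h) => p q w.
    by apply/colP => j; rewrite !mxE; ring.
  rewrite rnormN (le_trans (kP _))// (le_trans (ler_wpM2l (ltW k0) H))// mulrA.
  by rewrite mulrCA mulfV ?gt_eqF// mulr1.
have bE z v : rball a d z -> rnorm (vD E z v) <= 1 / 8 * rnorm v.
  move=> zr; rewrite (cder_vD (dE z zr)).
  have -> : v - invmx S *m vD T z v = invmx S *m (vD T a v - vD T z v).
    by rewrite aS mulmxBr mulKmx.
  rewrite (le_trans (kP _))//.
  have h1 : rnorm (vD T a v - vD T z v) <= Q * rnorm v * d.
    apply: rnorm_le_coord; first by rewrite !mulr_ge0 ?rnorm_ge0// ltW.
    move=> j; have -> : (vD T a v - vD T z v) j 0 = vD T a v j 0 - vD T z v j 0 by rewrite !mxE.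
    have -> : vD T a v j 0 - vD T z v j 0 = cD (fun y => T y j 0 : R[i]^o) a v - cD (fun y => T y j 0 : R[i]^o) z v.
      congr (_ - _); first exact: (vlhol_coord v j hT (rball_center a d0)).
      exact: (vlhol_coord v j hT (sub z zr)).
    have ar : rball a (delta / 2) a by apply: rball_center; rewrite divr_gt0.
    rewrite (le_trans (lhol_Dlip v (hT j) dd ar (sub2 _ zr)))//.
    apply: (@le_trans _ _ (Q * rnorm v * rnorm (a - z))).
      by rewrite ler_wpM2r ?rnorm_ge0// ler_wpM2r ?rnorm_ge0// ler_norm.
    rewrite ler_wpM2l; [by []|by rewrite mulr_ge0 ?rnorm_ge0|by rewrite rnormB ltW].
  rewrite (le_trans (ler_wpM2l (ltW k0) h1))//.
  rewrite (le_trans (_ : _ <= k * ((Q + 1) * rnorm v * (1 / (8 * k * (Q + 1))))))//.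
    rewrite ler_wpM2l ?(ltW k0)// ler_pM ?mulr_ge0 ?rnorm_ge0 ?(ltW dpos)//.
      by rewrite ler_wpM2r ?rnorm_ge0// lerDl.
    by rewrite ge_min lexx orbT.
  rewrite le_eqVlt; apply/orP; left; apply/eqP; field.
  by rewrite !gt_eqF// ltr_wpDl.
have hE : vlhol a d (1 / 8 *+ 2) E.
  apply: vlhol_of_bound; last exact: bE.
  by move=> z zr; have /cder_differentiable[] := dE z zr.
have lE z z' : rball a d z -> rball a d z' -> rnorm (E z - E z') <= 1 / 4 * rnorm (z - z').
  move=> zr zr'; have := vlhol_lip _ hE zr zr'.
  by rewrite (_ : 1 / 8 *+ 2 = 1 / 4); [apply|rewrite -mulr_natr; field].
have zE z z' : z - z' = invmx S *m (T z - T z') + (E z - E z').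
  rewrite /E mulmxBr; move: (invmx S *m T z) (invmx S *m T z') => p q.
  by apply/colP => j; rewrite !mxE; ring.
exists d, (2 * k), (d / (4 * k)); split; [exact: dpos|exact: ltW|exact: k20|exact: eta0|].
split=> [z z' zr zr'|w wr].
  have h1 : rnorm (z - z') <= rnorm (invmx S *m (T z - T z')) + rnorm (E z - E z').
    by rewrite {1}zE rnormD.
  by have := lE _ _ zr zr'; have := kP (T z - T z'); have := mulr_ge0 (ltW k0) (rnorm_ge0 (T z - T z')); lra.
pose s := fix s k := if k is k'.+1 then s k' + invmx S *m (w - T (s k')) else a.
pose q0 := rnorm (invmx S *m (w - T a)).
have q0d : q0 < d / 4.
  rewrite (le_lt_trans (kP _))// mulrC -ltr_pdivlMr// (lt_le_trans wr)//.
  by rewrite le_eqVlt; apply/orP; left; apply/eqP; field; rewrite gt_eqF.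
have q00 : 0 <= q0 by exact: rnorm_ge0.
pose h : R := 1 / 2.
have h0 j : 0 <= h ^+ j by rewrite exprn_ge0// divr_ge0.
have h1 j : h ^+ j <= 1 by rewrite exprn_ile1 ?divr_ge0// ler_pdivrMr// mul1r ler1n.
have sP j : rnorm (s j - a) <= 2 * q0 * (1 - h ^+ j) /\ rnorm (s j.+1 - s j) <= h ^+ j * q0.
  elim: j => [|j [IH1 IH2]].
    by rewrite /= expr0 !subrr mulr0 rnorm0 mul1r [a + _ - a]addrAC subrr add0r; split.
  have near : 2 * q0 < d by move: q0d; lra.
  have in_ : rnorm (s j - a) <= 2 * q0 * (1 - h ^+ j) -> rball a d (s j).
    move=> H; rewrite /rball/= (le_lt_trans H)// (le_lt_trans _ near)//.
    by rewrite ler_piMr ?mulr_ge0// lerBlDr lerDl.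
  have IH1' : rnorm (s j.+1 - a) <= 2 * q0 * (1 - h ^+ j.+1).
    rewrite (le_trans (rnormB_le _ (s j) _))// (le_trans (lerD IH2 IH1))// exprS.
    by rewrite le_eqVlt; apply/orP; left; apply/eqP; move: (h ^+ j) => y; rewrite /h; field.
  split=> //.
  have r1 : rball a d (s j) by exact: in_.
  have r2 : rball a d (s j.+1).
    rewrite /rball/= (le_lt_trans IH1')// (le_lt_trans _ near)//.
    by rewrite ler_piMr ?mulr_ge0// lerBlDr lerDl.
  have -> : s j.+2 - s j.+1 = E (s j.+1) - E (s j).
    have e2 : s j.+2 = s j.+1 + invmx S *m (w - T (s j.+1)) by [].
    have e3 : s j.+1 - s j = invmx S *m w - invmx S *m T (s j).
      by rewrite /= addrAC subrr add0r mulmxBr.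
    have e4 : E (s j.+1) - E (s j) = (s j.+1 - s j) - invmx S *m T (s j.+1) + invmx S *m T (s j).
      rewrite /E; move: (invmx S *m T _) (invmx S *m T _) => p q.
      by apply/colP => l; rewrite !mxE; ring.
    rewrite e4 e3 e2 addrAC subrr add0r mulmxBr.
    move: (invmx S *m T _) (invmx S *m T _) => p q.
    by apply/colP => l; rewrite !mxE; ring.
  rewrite (le_trans (lE _ _ r2 r1))// exprS.
  move: IH2; have := mulr_ge0 (h0 j) q00; rewrite -[h * _ * q0]mulrA; move: (h ^+ j * q0) => y.
  by clear; rewrite /h => ? ?; lra.
have [z zP] : exists z, ncvg s z.
  apply: (@geometric_limit R n s q0 h 0%N); first by rewrite /h divr_ge0//= ltr_pdivrMr// mul1r ltr1n.
  by move=> j _; have [_] := sP j; rewrite mulrC.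
have near : 2 * q0 < d by move: q0d; lra.
have sa j : rnorm (s j - a) <= 2 * q0.
  by have [H _] := sP j; rewrite (le_trans H)// ler_piMr ?mulr_ge0// lerBlDr lerDl.
have zr : rball a d z.
  rewrite /rball/= (le_lt_trans _ near)//; apply: (ncvg_le zP); exists 0%N => j _; exact: sa.
exists z => //; apply/eqP; rewrite -subr_eq0; apply/eqP.
have K0 : 0 <= `|K| by [].
have hT' : vlhol a delta `|K| T.
  move=> j; have [h2 h3] := hT j; split=> [|x y xr yr]; first exact: h2.
  exact: (le_trans (h3 _ _ xr yr) (ler_wpM2r (rnorm_ge0 _) (ler_norm K))).
have U : ncvg (fun j => T (s j) - w) (T z - w).
  move=> e e0; have K1 : 0 < `|K| + 1 by rewrite ltr_wpDl.
  have [N NP] := zP _ (divr_gt0 e0 K1); exists N => j /NP H.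
  rewrite opprB addrA subrK (le_trans (vlhol_lip K0 hT' _ (sub _ zr)))//.
    by apply: sub; rewrite /rball/= (le_lt_trans (sa j)).
  rewrite (le_trans (ler_wpM2l K0 H))// mulrCA ler_piMr ?(ltW e0)// ler_pdivrMr// mul1r lerDl//.
(* The residual [T (s j) - w] is the image under [- S] of the step [s j.+1 - s j], which tends to
   0. *)
have Z : ncvg (fun j => T (s j) - w) 0.
  have [kS kS0 kSP] := lin_bounded (mulmx_lin S).
  move=> e e0; have k10 : 0 < kS * 2 by rewrite mulr_gt0.
  have [N NP] := zP _ (divr_gt0 e0 k10); exists N => j Nj; rewrite subr0.
  have -> : T (s j) - w = - (S *m (s j.+1 - s j)).
    by rewrite /= addrAC subrr add0r mulKVmx// opprB.
  rewrite rnormN (le_trans (kSP _))// (le_trans (_ : _ <= kS * (e / (kS * 2) + e / (kS * 2))))//.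
    rewrite ler_wpM2l ?(ltW kS0)// (le_trans (rnormB_le _ z _))// lerD//.
      by apply: NP; exact: leq_trans (leqnSn _).
    by rewrite rnormB NP.
  by rewrite le_eqVlt; apply/orP; left; apply/eqP; field; rewrite gt_eqF.
exact: ncvg_uniq U Z.
Qed.

End holomorphic_limits.

(** * Linearization of a contraction *)

Section contraction.
Context {R : realType} {n : nat} {X : complexManifold R n} (g : hermitianMetric X).
Context (al : simG g).
Hypothesis cX : connected [set: X].
Hypothesis lam1 : fac al < 1.
Local Notation V := (Cn R n).
Local Notation lam := (fac al).

Fixpoint pw k : simG g := if k is k'.+1 then sim_mul al (pw k') else sim_one g.

Lemma fac_pw k : fac (pw k) = lam ^+ k.
Proof.
elim: k => [|k IH]; first by rewrite expr0.
by rewrite exprS -IH.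
Qed.

Lemma pwS k x : fwd (pw k.+1) x = fwd al (fwd (pw k) x). Proof. by []. Qed.

Lemma pwSr k x : fwd (pw k.+1) x = fwd (pw k) (fwd al x).
Proof. by elim: k => // k IH; rewrite pwS IH. Qed.

Lemma dle_eq x y : (forall e : R, 0 < e -> dle g x y e) -> x = y.
Proof.
move=> xy; have [c cx] := cm_cover x; have [r [m [r0 m0 H]]] := dle_lower g cx.
have key (e : R) : 0 < e -> dom c y /\ rnorm (chart c y - chart c x) <= e.
  move=> e0; pose s := Num.min (m * e) (m * r / 2).
  have mr : 0 < m * r by rewrite mulr_gt0.
  have s0 : 0 < s by rewrite lt_min mulr_gt0//= divr_gt0.
  have sr : s < m * r by rewrite gt_min; apply/orP; right; rewrite ltr_pdivrMr// mulr_natr mulr2n ltrDl.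
  have [|cy ym] := H x y s cx _ sr (xy s s0); first by rewrite subrr rnorm0.
  by split=> //; rewrite -(ler_pM2l m0) (le_trans ym)// ge_min lexx.
have [cy _] := key 1 ltr01.
have E : chart c y - chart c x = 0.
  apply: rnorm_eq0; apply/eqP; rewrite eq_le rnorm_ge0 andbT; apply/ler_addgt0Pr => e /key[_].
  by rewrite add0r.
by rewrite -(cm_chartK cx) -(cm_chartK cy); move/eqP: E; rewrite subr_eq0 => /eqP ->.
Qed.

Lemma lam_small (C : R) (e : R) : 0 < e -> exists N, forall k, (N <= k)%N -> lam ^+ k * C <= e.
Proof.
move=> e0; have l0 := fac_gt0 al; have C1 : 0 < `|C| + 1 by rewrite ltr_wpDl.
have al1 : `|lam| < 1 by rewrite gtr0_norm.
have [N NP] := eps_cvgn (cvg_expr al1) (divr_gt0 e0 C1); exists N => k /NP.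
rewrite sub0r normrN normrX gtr0_norm// ler_pdivlMr// => H.
rewrite (le_trans _ H)// ler_wpM2l ?exprn_ge0 ?(ltW l0)// (le_trans (ler_norm C))// lerDl//.
Qed.

(** Banach's argument with compactness in place of completeness: the orbit of [x0] stays in a ball
    of radius [D / (1 - lam)], and consecutive points approach each other, so that a cluster point
    is fixed. *)
Lemma fixed_point (x0 : X) : (forall x r, rc g x r) -> exists p, fwd al p = p.
Proof.
move=> arc; have l0 := fac_gt0 al; have [D xD] := dle_finite g x0 (fwd al x0) cX.
have D0 := dle_ge0 xD.
have l1 : 0 < 1 - lam by rewrite subr_gt0.
have st k : dle g (fwd (pw k) x0) (fwd (pw k.+1) x0) (lam ^+ k * D).
  by rewrite pwSr -fac_pw; exact: sim_dle.
have far k : dle g x0 (fwd (pw k) x0) (D * (1 - lam ^+ k) / (1 - lam)).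
  elim: k => [|k IH]; first by rewrite expr0 subrr mulr0 mul0r; exact: dle_refl.
  apply: dle_le (dle_trans IH (st k)).
  by rewrite le_eqVlt; apply/orP; left; apply/eqP; rewrite exprS; field; rewrite gt_eqF.
have [K cK KP] := arc x0 (D / (1 - lam)).
have Kk k : K (fwd (pw k) x0).
  apply: KP; apply: dle_le (far k); rewrite ler_pM2r ?invr_gt0// ler_piMr//.
  by rewrite lerBlDr lerDl exprn_ge0// ltW.
have [p pP] : exists p : X, forall U : set X, nbhs p U -> forall N, exists2 k, (N <= k)%N & U (fwd (pw k) x0).
  apply: contrapT => nP.
  have [N NP] : exists N, forall k, (N <= k)%N -> ~ K (fwd (pw k) x0); last by exact: (NP N (leqnn _) (Kk N)).
  apply: (@compact_induction _ K (fun A => exists N, forall k, (N <= k)%N -> ~ A (fwd (pw k) x0)) cK).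
  - by move=> A B AB [N NP]; exists N => k /NP nB /AB.
  - by exists 0%N => k _ [].
  - move=> A B [N NP] [M MP]; exists (maxn N M) => k; rewrite geq_max => /andP[/NP nA /MP nB] [|].
      exact: nA.
    exact: nB.
  - move=> y _; apply: contrapT => nU; apply: nP; exists y => U nU' N.
    apply: contrapT => nk; apply: nU; exists U => //; exists N => k Nk Uk.
    by apply: nk; exists k.
exists p; apply/esym; apply: dle_eq => e e0.
have e30 : 0 < e / 3 by rewrite divr_gt0.
have [N NP] := lam_small D e30.
have nU : nbhs p [set y | dle g p y (e / 3)] by apply/(nbhs_dle g); exists (e / 3).
have [k Nk pk] := pP _ nU N.
have H1 := dle_le (NP k Nk) (st k).
have H2 := sim_dle al (dle_sym pk).
have := dle_trans (dle_trans pk H1) H2; apply: dle_le.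
have : lam * (e / 3) <= e / 3 by rewrite ler_piMl// ltW.
by move: e30; lra.
Qed.

Context (p : X) (c : cm_index X).
Hypothesis alp : fwd al p = p.
Hypothesis cp : dom c p.
Local Notation a := (chart c p).

Lemma pw_fix k : fwd (pw k) p = p.
Proof. by elim: k => // k IH; rewrite pwS IH. Qed.

Lemma dle_pw x r k : dle g p x r -> dle g p (fwd (pw k) x) (lam ^+ k * r).
Proof. by move=> /(sim_dle (pw k)); rewrite pw_fix fac_pw. Qed.

Lemma pw_chart : exists r m : R, [/\ 0 < r, 0 < m & forall x s k, dle g p x s -> lam ^+ k * s < m * r ->
  dom c (fwd (pw k) x) /\ m * rnorm (chart c (fwd (pw k) x) - a) <= lam ^+ k * s].
Proof.
have [r [m [r0 m0 H]]] := dle_lower g cp; exists r, m; split=> // x s k ps sr.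
by apply: (H p _ _ cp _ sr (dle_pw k ps)); rewrite subrr rnorm0.
Qed.

(** The differential of [al] at its fixed point, in coordinates for which the
    metric at [p] is the standard one. *)
Definition linearization (S B : 'M[R[i]]_n) := [/\ S \in unitmx, B \in unitmx,
  forall v w, flat_form (S *m v) (S *m w) = g c p v w,
  forall v w, flat_form (B *m v) (B *m w) = lam ^+ 2 * flat_form v w &
  forall v, S *m vD (local_rep (fwd al) c c) a v = B *m (S *m v)].

Lemma flat_eq0 (v : V) : flat_form v v = 0 -> v = 0.
Proof.
have [_ _ pos _] := @flat_form_hermitian R n; move=> v0.
by apply/eqP; apply: contrapT => /negP/pos; rewrite v0 ltxx.
Qed.

Lemma flat_sub (u u' w w' : V) :
  flat_form u w - flat_form u' w' = flat_form (u - u') w + flat_form u' (w - w').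
Proof.
have fB (b t v : V) : flat_form (b - t) v = flat_form b v - flat_form t v.
  by rewrite (hfDl (@flat_form_hermitian R n)) (hfNl (@flat_form_hermitian R n)).
have E : flat_form u' (w - w') = flat_form u' w - flat_form u' w'.
  by rewrite (hfC (@flat_form_hermitian R n)) fB !(hfC (@flat_form_hermitian R n) _ u').
by rewrite fB E addrA subrK.
Qed.

Lemma linearization_exists : exists S B, linearization S B.
Proof.
have [S Su SE] := hermitian_form_diag (chart_hermitian g cp).
have cp' : dom c (fwd al p) by rewrite alp.
have [lA _] := holomorphic_cder (@fwd_hol _ _ _ _ al) cp cp'.
have [M ME] := lin_matrix lA.
pose B := S *m M *m invmx S.
have BE v : B *m (S *m v) = S *m vD (local_rep (fwd al) c c) a v.
  by rewrite ME /B -!mulmxA mulKmx.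
have Bf v w : flat_form (B *m v) (B *m w) = lam ^+ 2 * flat_form v w.
  have /pullback_vD/(_ c c p cp cp') H := @fwd_pullback _ _ _ _ al.
  rewrite -(mulKVmx Su v) -(mulKVmx Su w) !BE !SE.
  by rewrite alp in H; exact: H.
have Bu : B \in unitmx.
  (* [B] multiplies a definite form by [lam ^+ 2], hence has no kernel, whereas the columns of
     [cokermx B] belong to it. *)
  rewrite -row_full_unit -cokermx_eq0; apply/eqP/matrixP => i j.
  have : B *m col j (cokermx B) = 0 by rewrite colE mulmxA mulmx_coker mul0mx.
  set w := col j _ => Bw; have := Bf w w; rewrite Bw.
  have -> : flat_form (0 : V) 0 = 0 by exact: hf0l (@flat_form_hermitian R n) 0.
  move/esym/eqP; rewrite mulf_eq0 expf_eq0/= gt_eqF ?fac_gt0//= => /eqP/flat_eq0 w0.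
  by have := congr1 (fun m : V => m i 0) w0; rewrite !mxE.
by exists S, B; split=> // v; rewrite BE.
Qed.

Section linearized.
Context (S B : 'M[R[i]]_n).
Hypothesis lin : linearization S B.

(* [B^-k] *)
Definition ib k (v : V) : V := iter k (fun w => invmx B *m w) v.

Lemma ib_lin k : linear (ib k).
Proof.
elim: k => [|k IH] b u v //=.
by rewrite /ib/= -/(ib k _) -/(ib k _) -/(ib k _) IH mulmxDr -scalemxAr.
Qed.

Lemma ib_flat k v w : lam ^+ k ^+ 2 * flat_form (ib k v) (ib k w) = flat_form v w.
Proof.
have [_ Bu _ Bf _] := lin.
elim: k => [|k IH]; first by rewrite expr0 expr1n mul1r.
rewrite -IH [lam ^+ k.+1]exprSr exprMn -mulrA; congr (_ * _).
by have := Bf (ib k.+1 v) (ib k.+1 w); rewrite /ib/= !mulKVmx.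
Qed.

Lemma ib_mul k v : ib k (B *m v) = B *m ib k v.
Proof.
have [_ Bu _ _ _] := lin.
elim: k => // k IH; rewrite /ib/= -/(ib k _) -/(ib k _) IH mulKmx// mulKVmx//.
Qed.

Lemma ibS k v : B *m ib k.+1 v = ib k v.
Proof. by have [_ Bu _ _ _] := lin; rewrite /ib/= mulKVmx. Qed.

(** [ib k] multiplies the Euclidean norm by [lam ^- k]; [C] compares that norm with the maximum norm
    [rnorm]. *)
Lemma ib_bound : exists2 C : R, 0 < C & forall k v, lam ^+ k * rnorm (ib k v) <= C * rnorm v.
Proof.
have [m [M [m0 M0 mM]]] := @chart_norm_equiv R n (Cn_manifold R n) (Cn_flat R n) tt 0 I.
have l0 k : 0 < lam ^+ k by rewrite exprn_gt0// fac_gt0.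
exists (M / m) => [|k v]; first by rewrite divr_gt0.
have /andP[h1 _] := mM (ib k v); have /andP[_ h2] := mM v.
rewrite mulrAC ler_pdivlMr// (le_trans _ h2)//.
have -> : hnorm (Cn_flat R n tt 0) v = lam ^+ k * hnorm (Cn_flat R n tt 0) (ib k v).
  rewrite /hnorm -[Cn_flat R n tt 0 v v]/(flat_form v v) -(ib_flat k) sqrtrM ?sqr_ge0// sqrtr_sqr.
  by rewrite gtr0_norm.
by rewrite -mulrA ler_pM2l// mulrC.
Qed.

Definition psi x : V := S *m (chart c x - a).

(** In the coordinates [psi], [B] is the differential of [al] at [p], so that the left-hand side is
    a Taylor remainder. *)
Lemma psi_quadratic : exists r C : R, [/\ 0 < r, 0 < C & forall x, dom c x -> rnorm (chart c x - a) < r ->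
  rnorm (psi (fwd al x) - B *m psi x) <= C * rnorm (chart c x - a) ^+ 2].
Proof.
have [_ _ _ _ BS] := lin.
have cp' : dom c (fwd al p) by rewrite alp.
have cl : {for p, continuous (fun _ : X => lam ^+ 2)} by exact: cst_continuous.
have [r [K [r0 K0 hF rP]]] := pullback_bound (@fwd_hol _ _ _ _ al) (@fwd_pullback _ _ _ _ al) cl cp cp'.
have [kS kS0 kSP] := lin_bounded (mulmx_lin S).
have r2 : r / 2 < r by rewrite ltr_pdivrMr// mulr_natr mulr2n ltrDl.
pose Q := `|dlip r (r / 2) K| *+ 2; have Q0 : 0 <= Q by rewrite mulrn_wge0.
exists (r / 2), (kS * (Q + 1)); split=> [||x cx xr]; [by rewrite divr_gt0|by rewrite mulr_gt0// ltr_wpDl|].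
pose F := local_rep (fwd al) c c; pose h := chart c x - a.
have ah : a + h = chart c x by rewrite /h addrC subrK.
have Fx : F (chart c x) = chart c (fwd al x) by rewrite /F /local_rep/= cm_chartK.
have Fa : F a = a by rewrite /F /local_rep/= cm_chartK// alp.
have -> : psi (fwd al x) - B *m psi x = S *m (F (a + h) - F a - vD F a h).
  by rewrite ah Fx Fa /psi -BS -mulmxBr.
rewrite (le_trans (kSP _))// -mulrA ler_wpM2l ?(ltW kS0)//.
apply: (@le_trans _ _ (Q * rnorm h ^+ 2)); last by rewrite ler_wpM2r ?sqr_ge0// lerDl.
apply: rnorm_le_coord; first by rewrite mulr_ge0 ?sqr_ge0.
move=> j; have -> : (F (a + h) - F a - vD F a h) j 0 = F (a + h) j 0 - F a j 0 - vD F a h j 0 by rewrite !mxE.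
have ar : rball a r a by exact: rball_center.
have ar2 : rball a (r / 2) a by apply: rball_center; rewrite divr_gt0.
have ahr : rball a (r / 2) (a + h) by rewrite /rball/= ah; exact: xr.
have -> : vD F a h j 0 = cD (fun y => F y j 0 : R[i]^o) a h by exact: vlhol_coord hF ar.
rewrite (le_trans (lhol_taylor (hF j) r2 ar2 ahr))// /Q -mulrnAl ler_wpM2r ?sqr_ge0//.
by rewrite lerMn2r ler_norm orbT.
Qed.

Definition approx k x := ib k (psi (fwd (pw k) x)).

(** The error of the linearization at [al^k x] is of order [lam ^+ (2 * k)], and [ib k.+1] expands
    it by [lam ^- k.+1]: the increments decrease like [lam ^+ k]. *)
Lemma approx_cvg x : exists l, ncvg (approx^~ x) l.
Proof.
have l0 := fac_gt0 al.
have [D pD] := dle_finite g p x cX; have D0 := dle_ge0 pD.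
have [r1 [m [r10 m0 ch]]] := pw_chart.
have [r2 [C [r20 C0 qu]]] := psi_quadratic.
have [Cb Cb0 bd] := ib_bound.
pose e := Num.min (m * r1 / 2) (m * r2 / 2).
have e0 : 0 < e by rewrite lt_min !divr_gt0 ?mulr_gt0.
have [N NP] := lam_small D e0.
pose K := Cb * (C * (D / m) ^+ 2) / lam.
apply: (@geometric_limit R n (approx^~ x) K lam N); first by rewrite (ltW l0).
move=> k /NP H.
have h1 : lam ^+ k * D < m * r1.
  rewrite (le_lt_trans H)// gt_min; apply/orP; left; by rewrite ltr_pdivrMr// mulr_natr mulr2n ltrDl mulr_gt0.
have h2 : lam ^+ k * D < m * r2.
  rewrite (le_lt_trans H)// gt_min; apply/orP; right; by rewrite ltr_pdivrMr// mulr_natr mulr2n ltrDl mulr_gt0.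
have [cy ym] := ch x D k pD h1.
set y := fwd (pw k) x in cy ym *.
have yr : rnorm (chart c y - a) < r2 by rewrite -(ltr_pM2l m0) (le_lt_trans ym).
have -> : approx k.+1 x - approx k x = ib k.+1 (psi (fwd al y) - B *m psi y).
  rewrite (linB (ib_lin _)) ib_mul ibS.
  by [].
have lk : 0 < lam ^+ k.+1 by rewrite exprn_gt0.
rewrite -(ler_pM2l lk) (le_trans (bd _ _))// (le_trans (ler_wpM2l (ltW Cb0) (qu y cy yr)))//.
have -> : lam ^+ k.+1 * (K * lam ^+ k) = Cb * (C * (lam ^+ k * D / m) ^+ 2).
  by rewrite /K exprS; field; rewrite !gt_eqF.
rewrite ler_wpM2l ?(ltW Cb0)// ler_wpM2l ?(ltW C0)// ler_sqr ?nnegrE ?rnorm_ge0//.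
  by rewrite ler_pdivlMr// mulrC.
by rewrite divr_ge0 ?mulr_ge0 ?exprn_ge0// ltW.
Qed.

Context (Phi : X -> V).
Hypothesis Phi_cvg : forall x, ncvg (approx^~ x) (Phi x).

Lemma ncvg_mulmx (M : 'M[R[i]]_n) (u : nat -> V) l : ncvg u l -> ncvg (fun k => M *m u k) (M *m l).
Proof.
move=> ul e e0; have [k k0 kP] := lin_bounded (mulmx_lin M).
have [N NP] := ul _ (divr_gt0 e0 k0); exists N => j /NP H.
by rewrite -mulmxBr (le_trans (kP _))// mulrC -ler_pdivlMr.
Qed.

Lemma Phi_al x : Phi (fwd al x) = B *m Phi x.
Proof.
apply: (ncvg_uniq (Phi_cvg (fwd al x))).
have H : ncvg (fun k => approx k.+1 x) (Phi x).
  by move=> e /(Phi_cvg x)[N NP]; exists N => k Nk; apply: NP; exact: leq_trans (leqnSn _).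
move=> e /(ncvg_mulmx B H)[N NP]; exists N => k /NP.
by rewrite /approx ibS -pwSr.
Qed.

Lemma Phi_pw k x : Phi x = ib k (Phi (fwd (pw k) x)).
Proof.
elim: k => // k IH; rewrite pwS Phi_al ib_mul ibS.
exact: IH.
Qed.

Lemma Phi_p : Phi p = 0.
Proof.
apply: (ncvg_uniq (Phi_cvg p)) => e e0; exists 0%N => k _.
rewrite /approx pw_fix /psi subrr mulmx0.
have -> : ib k 0 = 0 by exact: lin0 (ib_lin k).
by rewrite subrr rnorm0 ltW.
Qed.

Let T z := Phi (chart_inv c z).

Let T_k k z := approx k (chart_inv c z).

Lemma cder_affine (F : V -> V) (L' : V -> V) z L b : linear L' -> cder F z L ->
  cder (fun y => L' (F y - b)) z (fun v => L' (L v)).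
Proof.
move=> lL' dF.
have dL : cder (fun y => L' (y - b)) (F z) L'.
  split=> // e e0; exists 1 => // h _.
  rewrite -!(linB lL'); have -> : F z + h - b - (F z - b) - h = 0.
    by apply/colP => j; rewrite !mxE; ring.
  by rewrite (lin0 lL') rnorm0 mulr_ge0 ?rnorm_ge0 ?ltW.
exact: cder_comp dF dL.
Qed.

(** A ball on which all iterates of [al] stay in a good region of the chart. *)
Lemma iterates_chart : exists d m M : R, [/\ 0 < d, 0 < m, 0 < M &
  forall z, rball a d z -> [/\ dom c (chart_inv c z), chart c (chart_inv c z) = z &
    (forall v, hnorm (g c (chart_inv c z)) v <= M * rnorm v) /\ forall k,
    [/\ dom c (fwd (pw k) (chart_inv c z)),
      rnorm (chart c (fwd (pw k) (chart_inv c z)) - a) <= lam ^+ k * M &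
      forall v, m * rnorm v <= hnorm (g c (fwd (pw k) (chart_inv c z))) v]]].
Proof.
have l0 := fac_gt0 al.
have [r1 [m1 [M1 [r10 m10 M10 [inv bd]]]]] := chart_norm_bounds g cp.
have [r2 [m2 [r20 m20 ch]]] := pw_chart.
have [r3 [M3 [r30 M30 up]]] := dle_upper g cp.
pose d := Num.min (Num.min r1 r3) (Num.min (m2 * r2 / M3) (m2 * r1 / M3)).
have d0 : 0 < d by rewrite !lt_min r10 r30 !divr_gt0 ?mulr_gt0.
exists d, m1, (M1 + M3 * d / m2); split=> //.
  by rewrite addr_gt0// divr_gt0// mulr_gt0.
move=> z; rewrite /rball/= => zd; have := zd; rewrite !lt_min => /andP[/andP[z1 z3] /andP[z4 z5]].
have [zD zc] := inv z z1.
have D : dle g p (chart_inv c z) (M3 * rnorm (z - a)).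
  have := up _ _ cp zD; rewrite zc subrr rnorm0 => /(_ r30 z3); rewrite rnormB.
  by [].
have P0 : 0 <= M3 * d / m2 by rewrite divr_ge0 ?mulr_ge0// ltW.
split=> //; split=> [v|k].
  have := bd _ zD; rewrite zc => /(_ z1 v)/andP[_ h]; rewrite (le_trans h)// ler_wpM2r ?rnorm_ge0//.
  by rewrite lerDl.
have lk : lam ^+ k <= 1 by rewrite exprn_ile1 ?(ltW l0)// ltW.
have lk0 : 0 <= lam ^+ k by rewrite exprn_ge0// ltW.
have small (r : R) : rnorm (z - a) < m2 * r / M3 -> lam ^+ k * (M3 * rnorm (z - a)) < m2 * r.
  rewrite ltr_pdivlMr// mulrC => H; apply: le_lt_trans H.
  by rewrite ler_piMl// mulr_ge0 ?rnorm_ge0// ltW.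
have [kD km] := ch _ _ k D (small _ z4).
split=> //.
  rewrite -(ler_pM2l m20) (le_trans km)//.
  have -> : m2 * (lam ^+ k * (M1 + M3 * d / m2)) = lam ^+ k * (m2 * M1 + M3 * d) by field; rewrite gt_eqF.
  have h1 : M3 * rnorm (z - a) <= M3 * d by rewrite ler_wpM2l ?(ltW M30)// ltW.
  rewrite ler_wpM2l// (le_trans h1)//.
  by rewrite lerDr mulr_ge0// ltW.
move=> v; have rr : rnorm (chart c (fwd (pw k) (chart_inv c z)) - a) < r1.
  by rewrite -(ltr_pM2l m20) (le_lt_trans km)// small.
by have /andP[] := bd _ kD rr v.
Qed.

(** [fwd (pw k)] contracts by [lam ^+ k] and [ib k] expands by as much, so that the maps [T_k] have
    a common Lipschitz constant and [lhol_limit] applies. *)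
Lemma local_isometry : exists d L : R, [/\ 0 < d, 0 < L, vlhol a d L T, (forall v, vD T a v = S *m v) &
  forall z, rball a d z -> [/\ dom c (chart_inv c z), chart c (chart_inv c z) = z &
    forall v w, flat_form (vD T z v) (vD T z w) = g c (chart_inv c z) v w]].
Proof.
have l0 := fac_gt0 al; have [Su Bu Sg Bf BS] := lin.
have [d [m [M [d0 m0 M0 ch]]]] := iterates_chart.
have [kS kS0 kSP] := lin_bounded (mulmx_lin S).
have [Cb Cb0 bd] := ib_bound.
have dT k z : rball a d z -> cder (T_k k) z (fun v => ib k (S *m vD (local_rep (fwd (pw k)) c c) z v)).
  move=> /ch[zD zc [_ /(_ k)[kD _ _]]].
  have := holomorphic_cder (@fwd_hol _ _ _ _ (pw k)) zD kD; rewrite zc => dF.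
  have lL : linear (fun v => ib k (S *m v)) by move=> b u v; rewrite mulmx_lin ib_lin.
  exact: (cder_affine a lL dF).
have wk k z v : rball a d z -> rnorm (vD (local_rep (fwd (pw k)) c c) z v) <= lam ^+ k * (M / m) * rnorm v.
  move=> /ch[zD zc [zM /(_ k)[kD _ km]]].
  have /pullback_vD/(_ c c _ zD kD v v) := @fwd_pullback _ _ _ _ (pw k); rewrite zc fac_pw => E.
  have := km (vD (local_rep (fwd (pw k)) c c) z v); rewrite /hnorm E sqrtrM ?sqr_ge0// sqrtr_sqr.
  rewrite ger0_norm ?exprn_ge0 ?(ltW l0)// => H.
  rewrite -(ler_pM2l m0) (le_trans H)//.
  have -> : m * (lam ^+ k * (M / m) * rnorm v) = lam ^+ k * (M * rnorm v) by field; rewrite gt_eqF.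
  by rewrite ler_wpM2l ?exprn_ge0 ?(ltW l0)//; exact: zM.
pose L := Cb * (kS * (M / m)); have L0 : 0 < L by rewrite !mulr_gt0// invr_gt0.
have bT k z v : rball a d z -> rnorm (vD (T_k k) z v) <= L * rnorm v.
  move=> zr; rewrite (cder_vD (dT k z zr)).
  have lk : 0 < lam ^+ k by rewrite exprn_gt0.
  rewrite -(ler_pM2l lk) (le_trans (bd _ _))// /L -mulrA mulrCA ler_wpM2l ?(ltW Cb0)//.
  rewrite (le_trans (kSP _))// -mulrA mulrCA ler_wpM2l ?(ltW kS0)// mulrA.
  exact: wk.
have hT k : vlhol a d (L *+ 2) (T_k k).
  apply: vlhol_of_bound; last exact: bT.
  by move=> z /(dT k z)/cder_differentiable[].
have lim j : lhol a d (L *+ 2) (fun z => T z j 0 : R[i]^o) /\ forall z v, rball a d z ->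
    ncvg (fun k => cD (fun z => T_k k z j 0 : R[i]^o) z v) (cD (fun z => T z j 0 : R[i]^o) z v).
  apply: (@lhol_limit R n (fun k z => T_k k z j 0)) => [k|z zr]; first exact: hT.
  by have /ncvg_coord := Phi_cvg (chart_inv c z); apply.
have hTl : vlhol a d (L *+ 2) T by move=> j; have [] := lim j.
have DT z v : rball a d z -> ncvg (fun k => vD (T_k k) z v) (vD T z v).
  move=> zr; apply/ncvg_coord => j e e0; have [_ H] := lim j.
  have [N NP] := H z v zr e e0; exists N => k /NP.
  have E1 : vD T z v j 0 = cD (fun y => T y j 0 : R[i]^o) z v := vlhol_coord v j hTl zr.
  have E2 : vD (T_k k) z v j 0 = cD (fun y => T_k k y j 0 : R[i]^o) z v := vlhol_coord v j (hT k) zr.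
  have E3 : rnorm (vD (T_k k) z v j 0 - vD T z v j 0) =
    rnorm (cD (fun y => T_k k y j 0 : R[i]^o) z v - cD (fun y => T y j 0 : R[i]^o) z v) :=
    congr2 (fun s t => rnorm (s - t)) E2 E1.
  exact: (fun h => eq_ind_r (fun t => t <= e) h E3).
have ar : rball a d a by exact: rball_center.
exists d, (L *+ 2); split=> //.
- by rewrite pmulrn_rgt0.
- move=> v; apply: (ncvg_uniq (DT a v ar)) => e e0; exists 0%N => k _.
  (* At the fixed point every [T_k] has the differential [S]: the powers of [B] and of its inverse
     cancel. *)
  rewrite (cder_vD (dT k a ar)) (_ : ib k _ = S *m v) ?subrr ?rnorm0 ?ltW//.
  elim: k v => [|k IH] v.
    by rewrite /= (cder_vD (cder_local_id cp)).
  have [_ _ [_ /(_ k)[kD _ _]]] := ch _ ar; rewrite cm_chartK// in kD.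
  have kD' : dom c (fwd al (fwd (pw k) p)) by rewrite pw_fix alp.
  have -> : vD (local_rep (fwd (pw k.+1)) c c) a v = vD (local_rep (fwd al) c c) a (vD (local_rep (fwd (pw k)) c c) a v).
    have := @vD_local_comp R n X X X (fwd (pw k)) (fwd al) c c c p v (@fwd_hol _ _ _ _ (pw k)) (@fwd_hol _ _ _ _ al) cp kD kD'.
    by rewrite pw_fix.
  by rewrite BS ib_mul ibS IH.
- move=> z zr; have [zD zc [zM zk]] := ch z zr; split=> // v w.
  have [r0 [Mf [r00 Mf0 Mf_]]] := metric_CS (@openT V) (conj (fun z (_ : setT z) => @flat_form_hermitian R n) (fun v w => @smooth_cst R n setT (flat_form v w))) (I : setT (0 : V)).
  have {r0 r00 Mf_}Mf1 (u u' : V) : `|flat_form u u'| <= Mf * (rnorm u * rnorm u').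
    by have [|_] := Mf_ 0; rewrite ?subrr ?rnorm0//; apply.
  apply/eqP; rewrite -subr_eq0; apply/eqP/normr0_eq0/eqP; rewrite eq_le normr_ge0 andbT.
  apply/ler_addgt0Pr => e e0; rewrite add0r.
  pose Lv := L * rnorm v; pose Lw := L * rnorm w.
  have Lv0 : 0 <= Lv by rewrite mulr_ge0 ?rnorm_ge0// ltW.
  have Lw0 : 0 <= Lw by rewrite mulr_ge0 ?rnorm_ge0// ltW.
  (* convergence of [flat_form (D T_k v) (D T_k w)], and its value up to the variation of the metric *)
  pose A1 := Mf * (Lv + 1 + Lw) + 1; have A10 : 0 < A1 by rewrite ltr_wpDl// mulr_ge0 ?(ltW Mf0)// !addr_ge0.
  pose t1 := Num.min 1 (e / 2 / A1); have t10 : 0 < t1 by rewrite lt_min ltr01 !divr_gt0.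
  have [N1 N1P] := DT z v zr t1 t10; have [N2 N2P] := DT z w zr t1 t10.
  have Ic : (chart c @` dom c) a by exists p.
  pose A2 := (M / m * rnorm v) * (M / m * rnorm w) + 1.
  have A20 : 0 < A2 by rewrite ltr_wpDl// !mulr_ge0 ?rnorm_ge0 ?invr_ge0 ?(ltW M0) ?(ltW m0).
  have t20 : 0 < e / 2 / A2 by rewrite !divr_gt0.
  have [r3 r30 r3P] := metric_continuous (@cm_image_open _ _ X c) (metric_on_chart g c) Ic t20.
  have [N3 N3P] := lam_small M (divr_gt0 r30 (ltr0n R 2)).
  pose k := maxn N1 (maxn N2 N3).
  have k1 := N1P k (leq_maxl _ _).
  have k2 : rnorm (vD (T_k k) z w - vD T z w) <= t1 by apply: N2P; rewrite /k !leq_max leqnn orbT.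
  have k3 : lam ^+ k * M <= r3 / 2 by apply: N3P; rewrite /k !leq_max leqnn !orbT.
  have [kD kM _] := zk k.
  have b1 : rnorm (vD (T_k k) z v) <= Lv by exact: bT.
  have b2 : rnorm (vD T z w) <= Lw + 1.
    have b3 : rnorm (vD (T_k k) z w) <= Lw by exact: bT.
    rewrite -[vD T z w](subrK (vD (T_k k) z w)) (le_trans (rnormD _ _))// addrC lerD//.
    by rewrite rnormB (le_trans k2)// ge_min lexx.
  have F1 : `|flat_form (vD T z v) (vD T z w) - flat_form (vD (T_k k) z v) (vD (T_k k) z w)| <= e / 2.
    have -> : flat_form (vD T z v) (vD T z w) - flat_form (vD (T_k k) z v) (vD (T_k k) z w) =
      flat_form (vD T z v - vD (T_k k) z v) (vD T z w) + flat_form (vD (T_k k) z v) (vD T z w - vD (T_k k) z w).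
      exact: flat_sub.
    rewrite (le_trans (ler_normD _ _))// (le_trans (lerD (Mf1 _ _) (Mf1 _ _)))//.
    rewrite -mulrDr (rnormB (vD T z v)) (rnormB (vD T z w)).
    apply: (@le_trans _ _ (Mf * (t1 * (Lw + 1) + Lv * t1))).
      by rewrite ler_wpM2l ?(ltW Mf0)// lerD// ler_pM ?rnorm_ge0.
    have -> : Mf * (t1 * (Lw + 1) + Lv * t1) = Mf * (Lv + 1 + Lw) * t1 by ring.
    rewrite (le_trans (_ : _ <= A1 * t1))//; first by rewrite ler_wpM2r ?(ltW t10)// lerDl.
    by rewrite mulrC -ler_pdivlMr// ge_min lexx orbT.
  set vk := vD (local_rep (fwd (pw k)) c c) z v; set wk' := vD (local_rep (fwd (pw k)) c c) z w.
  have lk : 0 < lam ^+ k by rewrite exprn_gt0.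
  have lk2 : 0 < lam ^+ k ^+ 2 by rewrite exprn_gt0.
  (* After multiplication by [lam ^+ k ^+ 2], the first term is [g] at [p] and the second is [g] at
     the image of the point under [fwd (pw k)], both on the vectors [vk] and [wk']; continuity of
     the metric compares them. *)
  have F2 : `|flat_form (vD (T_k k) z v) (vD (T_k k) z w) - g c (chart_inv c z) v w| <= e / 2.
    have E1 : lam ^+ k ^+ 2 * flat_form (vD (T_k k) z v) (vD (T_k k) z w) = g c p vk wk'.
      by rewrite !(cder_vD (dT k z zr)) ib_flat Sg.
    have /pullback_vD/(_ c c _ zD kD v w) := @fwd_pullback _ _ _ _ (pw k); rewrite zc fac_pw => E2.
    rewrite -(ler_pM2l lk2) -[X in X * `|_|](gtr0_norm lk2) -normrM mulrBr E1 -E2.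
    have [|_ H] := r3P (chart c (fwd (pw k) (chart_inv c z))).
      by rewrite (le_lt_trans kM)// (le_lt_trans k3)// ltr_pdivrMr// mulr_natr mulr2n ltrDl.
    rewrite !cm_chartK// in H; rewrite distrC (le_trans (H _ _))//.
    apply: (@le_trans _ _ (e / 2 / A2 * ((lam ^+ k * (M / m) * rnorm v) * (lam ^+ k * (M / m) * rnorm w)))).
      by rewrite ler_wpM2l ?(ltW t20)// ler_pM ?rnorm_ge0//; exact: wk.
    have -> : e / 2 / A2 * ((lam ^+ k * (M / m) * rnorm v) * (lam ^+ k * (M / m) * rnorm w)) =
       lam ^+ k ^+ 2 * (e / 2 * (((M / m * rnorm v) * (M / m * rnorm w)) / A2)).
      by field; rewrite !gt_eqF.
    rewrite ler_wpM2l ?(ltW lk2)// ler_piMr ?divr_ge0 ?(ltW e0)// ler_pdivrMr// mul1r /A2 lerDl//.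
  apply: (le_trans (ler_distD (flat_form (vD (T_k k) z v) (vD (T_k k) z w)) _ _)).
  exact: (eq_ind_r (fun t => _ <= t) (lerD F1 F2) (splitr e)).
Qed.

Lemma local_surjective : exists d C eta L : R, [/\ 0 < d, 0 < C, 0 < eta, 0 < L &
  [/\ vlhol a d L T,
   (forall z, rball a d z -> [/\ dom c (chart_inv c z), chart c (chart_inv c z) = z &
     forall v w, flat_form (vD T z v) (vD T z w) = g c (chart_inv c z) v w]),
   (forall z z', rball a d z -> rball a d z' -> rnorm (z - z') <= C * rnorm (T z - T z')) &
   (forall w, rnorm w < eta -> exists2 z, rball a d z & T z = w)]].
Proof.
have [d [L [d0 L0 hT DT iT]]] := local_isometry.
have [Su _ _ _ _] := lin.
have ar : rball a d a by exact: rball_center.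
have cT : cder T a (fun v => S *m v).
  have := vlhol_cder hT ar; congr (cder _ _ _); apply/funext; exact: DT.
have [d' [C [eta [d'0 dd C0 eta0 [inj sur]]]]] := local_inverse d0 hT Su cT.
have sub z : rball a d' z -> rball a d z by move=> /lt_le_trans; apply.
have Ta : T a = 0 by rewrite /T cm_chartK// Phi_p.
exists d', C, eta, L; split; [exact: d'0|exact: C0|exact: eta0|exact: L0|split].
- move=> j; have := hT j; case=> h1 h2; split=> [z /sub|z z' /sub zr /sub zr']; [exact: h1|exact: h2].
- by move=> z /sub/iT.
- exact: inj.
- by move=> w; rewrite -[w in rnorm w](subr0 w) -Ta; exact: sur.
Qed.

Lemma pw_near x (d : R) : 0 < d ->
  exists k, dom c (fwd (pw k) x) /\ rball a d (chart c (fwd (pw k) x)).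
Proof.
move=> d0; have [D pD] := dle_finite g p x cX.
have [r [m [r0 m0 ch]]] := pw_chart.
pose e := Num.min (m * r / 2) (m * d / 2).
have mr : 0 < m * r by rewrite mulr_gt0.
have md : 0 < m * d by rewrite mulr_gt0.
have e0 : 0 < e by rewrite lt_min !divr_gt0.
have [N NP] := lam_small D e0; exists N; have H := NP N (leqnn _).
have h1 : lam ^+ N * D < m * r.
  rewrite (le_lt_trans H)// gt_min; apply/orP; left; by rewrite ltr_pdivrMr// mulr_natr mulr2n ltrDl.
have [kD km] := ch x D N pD h1; split=> //.
rewrite /rball/= -(ltr_pM2l m0) (le_lt_trans km)// (le_lt_trans H)// gt_min; apply/orP; right.
by rewrite ltr_pdivrMr// mulr_natr mulr2n ltrDl.
Qed.

Lemma ib_inj k : injective (ib k).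
Proof.
move=> v w E; apply/eqP; rewrite -subr_eq0; apply/eqP/flat_eq0.
by rewrite -(ib_flat k) (linB (ib_lin k)) E subrr (hf0l (@flat_form_hermitian R n)) mulr0.
Qed.

Lemma pwK k w : ib k (iter k (mulmx B) w) = w.
Proof.
have [_ Bu _ _ _] := lin.
by elim: k w => // k IH w; rewrite [iter k.+1 _ w]/= ib_mul ibS IH.
Qed.

Lemma iter_small (w : V) (eta : R) : 0 < eta -> exists N, rnorm (iter N (mulmx B) w) < eta.
Proof.
have l0 := fac_gt0 al; move=> eta0.
have [m [M [m0 M0 mM]]] := @chart_norm_equiv R n (Cn_manifold R n) (Cn_flat R n) tt 0 I.
have e0 : 0 < m * eta / 2 by rewrite divr_gt0 ?mulr_gt0.
have [N NP] := lam_small (M * rnorm w) e0; have H := NP N (leqnn _).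
exists N; set y := iter N (mulmx B) w.
have /andP[h1 _] := mM y; have /andP[_ h2] := mM w.
rewrite -(ltr_pM2l m0) (le_lt_trans h1)//.
have l1 : 0 < lam ^+ N by rewrite exprn_gt0.
have -> : hnorm (Cn_flat R n tt 0) y = lam ^+ N * hnorm (Cn_flat R n tt 0) w.
  rewrite /hnorm -[Cn_flat R n tt 0 y y]/(flat_form y y) -(ib_flat N) pwK sqrtrM ?sqr_ge0// sqrtr_sqr.
  by rewrite gtr0_norm.
rewrite (le_lt_trans (ler_wpM2l (ltW l1) h2))// (le_lt_trans H)//.
by rewrite ltr_pdivrMr// mulr_natr mulr2n ltrDl mulr_gt0.
Qed.

(** The relation [Phi_pw] carries the local statements at [p] to the whole of [X] and C^n: a power
    of [al] brings any two points into the ball where [T] is injective, and a power of [B] brings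
    any target near 0. *)
Lemma Phi_bijective : exists Psi : V -> X, cancel Phi Psi /\ cancel Psi Phi.
Proof.
have l0 := fac_gt0 al.
have [d [C [eta [L [d0 C0 eta0 L0 [hT iT injT surT]]]]]] := local_surjective.
have inj : injective Phi.
  move=> x x' E.
  have [d1 d1P] : exists D : R, dle g p x D /\ dle g p x' D.
    have [D D1] := dle_finite g p x cX; have [D' D2] := dle_finite g p x' cX.
    by exists (Num.max D D'); split; [apply: dle_le D1|apply: dle_le D2]; rewrite le_max lexx ?orbT.
  have [H1 H2] := d1P.
  have [r [m [r0 m0 ch]]] := pw_chart.
  pose e := Num.min (m * r / 2) (m * d / 2).
  have mr : 0 < m * r by rewrite mulr_gt0.
  have md : 0 < m * d by rewrite mulr_gt0.
  have e0 : 0 < e by rewrite lt_min !divr_gt0.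
  have [N NP] := lam_small d1 e0; have H := NP N (leqnn _).
  have h1 : lam ^+ N * d1 < m * r.
    rewrite (le_lt_trans H)// gt_min; apply/orP; left; by rewrite ltr_pdivrMr// mulr_natr mulr2n ltrDl.
  have h2 : lam ^+ N * d1 < m * d.
    rewrite (le_lt_trans H)// gt_min; apply/orP; right; by rewrite ltr_pdivrMr// mulr_natr mulr2n ltrDl.
  have [k1 m1] := ch x d1 N H1 h1; have [k2 m2] := ch x' d1 N H2 h1.
  have b1 : rball a d (chart c (fwd (pw N) x)).
    by rewrite /rball/= -(ltr_pM2l m0) (le_lt_trans m1).
  have b2 : rball a d (chart c (fwd (pw N) x')).
    by rewrite /rball/= -(ltr_pM2l m0) (le_lt_trans m2).
  have E' : Phi (fwd (pw N) x) = Phi (fwd (pw N) x').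
    by apply: (@ib_inj N); rewrite -!Phi_pw.
  have := injT _ _ b1 b2; rewrite /T !cm_chartK// E' subrr rnorm0 mulr0 => le0.
  have /rnorm_eq0/eqP : rnorm (chart c (fwd (pw N) x) - chart c (fwd (pw N) x')) = 0.
    by apply/eqP; rewrite eq_le rnorm_ge0 le0.
  rewrite subr_eq0 => /eqP E2.
  by apply: (can_inj (@fwdK _ _ _ _ (pw N))); rewrite -(cm_chartK k1) -(cm_chartK k2) E2.
have sur w : exists x, Phi x = w.
  have [N ye] := iter_small w eta0; pose y := iter N (mulmx B) w.
  have [z zr Tz] := surT y ye.
  exists (bwd (pw N) (chart_inv c z)); rewrite (Phi_pw N) bwdK.
  by rewrite -[Phi _]/(T z) Tz pwK.
have [Psi PsiP] := choice sur; exists Psi; split=> x; last exact: PsiP.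
by apply: inj; rewrite PsiP.
Qed.

Local Notation F := (Phi : X -> Cn_manifold R n).

(** By [Phi_pw], the differential at [x] is computed from that of [T] at a point moved into the good
    ball; the scalings of the metric by [fwd (pw k)] and [ib k] cancel. *)
Lemma Phi_cder e x : dom e x -> exists M : 'M[R[i]]_n, [/\ M \in unitmx,
  cder (local_rep F e tt) (chart e x) (fun v => M *m v) &
  forall v w, flat_form (M *m v) (M *m w) = g e x v w].
Proof.
move=> ex; have [d [C [eta [L [d0 C0 eta0 L0 [hT iT _ _]]]]]] := local_surjective.
have [k [ky kr]] := pw_near x d0; pose y := fwd (pw k) x.
have H1 := holomorphic_cder (@fwd_hol _ _ _ _ (pw k)) ex ky.
have H2 : cder (local_rep F c tt) (chart c y) (vD T (chart c y)) by exact: vlhol_cder hT kr.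
have [cf _] := @fwd_hol _ _ _ _ (pw k).
have H3 := cder_affine 0 (ib_lin k) (@cder_local_comp R n X X (Cn_manifold R n) (fwd (pw k)) F e c tt x _ _ ex ky (cf x) H1 H2).
have E : (fun z => ib k (local_rep (F \o fwd (pw k)) e tt z - 0)) = local_rep F e tt.
  by apply/funext => z; rewrite subr0 /local_rep/= -Phi_pw.
rewrite E in H3; have [lL _] := H3; have [M ME] := lin_matrix lL.
have fM v w : flat_form (M *m v) (M *m w) = g e x v w.
  rewrite -!ME; have l0 : lam ^+ k ^+ 2 != 0 by rewrite !expf_neq0 ?gt_eqF ?fac_gt0.
  apply: (mulfI l0); rewrite ib_flat.
  have [_ _ ->] := iT _ kr; rewrite !cm_chartK//.
  have /pullback_vD/(_ e c x ex ky v w) := @fwd_pullback _ _ _ _ (pw k).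
  by rewrite fac_pw.
exists M; split=> //; last by move: H3; congr (cder _ _ _); apply/funext.
rewrite -row_full_unit -cokermx_eq0; apply/eqP/matrixP => i j.
have : M *m col j (cokermx M) = 0 by rewrite colE mulmxA mulmx_coker mul0mx.
set w := col j _ => Mw; have := fM w w; rewrite Mw.
have -> : flat_form (0 : V) 0 = 0 by exact: hf0l (@flat_form_hermitian R n) 0.
have [_ _ pos _] := chart_hermitian g ex.
move=> H; have [w0|/pos] := eqVneq w 0; last by rewrite -H ltxx.
by have := congr1 (fun m : V => m i 0) w0; rewrite !mxE.
Qed.

Lemma Phi_continuous : continuous F.
Proof.
move=> x; have [e ex] := cm_cover x.
have [M [_ /cder_differentiable[/differentiable_continuous cM _] _]] := Phi_cder ex.
move=> A /= nA; have {nA}nA : nbhs (local_rep F e tt (chart e x)) A.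
  by rewrite /local_rep/= cm_chartK.
have /nbhs_rnormP[r r0 rP] := cM _ nA.
apply/(nbhs_chart _ ex); exists r => // y ey /rP.
by rewrite /= /local_rep/= cm_chartK.
Qed.

Lemma Phi_holomorphic : holomorphic F.
Proof.
split; first exact: Phi_continuous.
by move=> e [] x ex _; have [M [_ /cder_differentiable[]]] := Phi_cder ex.
Qed.

Lemma Phi_pullback : pullback_eq F (Cn_flat R n) (fun=> 1) g.
Proof.
apply/pullback_vD => e [] x ex _ v w; have [M [_ H fM]] := Phi_cder ex.
by rewrite mul1r -fM (cder_vD H).
Qed.

Context (Psi : V -> X).
Hypothesis PhiK : cancel Phi Psi.
Hypothesis PsiK : cancel Psi Phi.

Lemma Psi_pw k w : Psi w = bwd (pw k) (Psi (iter k (mulmx B) w)).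
Proof. by rewrite -{1}[w](pwK k) -[bwd _ _]PhiK (Phi_pw k) bwdK PsiK pwK. Qed.

Lemma Psi_continuous : continuous (Psi : Cn_manifold R n -> X).
Proof.
move=> w0; have [d [C [eta [L [d0 C0 eta0 L0 [hT iT injT surT]]]]]] := local_surjective.
have [N yN] := iter_small w0 eta0.
have near_small w : rnorm w < eta -> exists2 z, rball a d z & [/\ T z = w, dom c (Psi w) & chart c (Psi w) = z].
  move=> /surT[z zr Tz]; exists z => //; have [zD zc _] := iT _ zr.
  have -> : Psi w = chart_inv c z by rewrite -Tz /T PhiK.
  by [].
set w1 := iter N _ _ in yN.
(* Near [w1] the Lipschitz bound for the inverse of [T] gives continuity; [Psi_pw] carries it to
   [w0]. *)
have c1 : {for w1, continuous (Psi : V -> X)}.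
  have [z1 z1r [Tz1 w1D w1c]] := near_small w1 yN.
  move=> A /(nbhs_chart _ w1D)[r r0 rP]; apply/nbhs_rnormP.
  exists (Num.min (eta - rnorm w1) (r / C)); first by rewrite lt_min subr_gt0 yN divr_gt0.
  move=> w; rewrite lt_min => /andP[h1 h2].
  have [|z zr [Tz wD wc]] := near_small w.
    by rewrite -[w](subrK w1) (le_lt_trans (rnormD _ _))// -ltrBrDr.
  apply: rP => //; rewrite wc w1c (le_lt_trans (injT _ _ zr z1r))// Tz Tz1 mulrC -ltr_pdivlMr//.
pose BN (w : V) : V := iter N (mulmx B) w.
have c2 : continuous BN.
  apply: lin_continuous; rewrite /BN; elim: (N) => // j IH b u v.
  by rewrite /= IH mulmxDr -scalemxAr.
have [c3 _] := @bwd_hol _ _ _ _ (pw N).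
rewrite (_ : Psi = bwd (pw N) \o (Psi \o BN)); last by apply/funext => w; exact: Psi_pw.
apply: continuous_comp; last exact: c3.
by apply: continuous_comp; [exact: c2|exact: c1].
Qed.

Lemma Psi_holomorphic : holomorphic (Psi : Cn_manifold R n -> X).
Proof.
split; first exact: Psi_continuous.
move=> [] e w _ ew; have [M [Mu H _]] := Phi_cder ew.
have E : local_rep F e tt (chart e (Psi w)) = w by rewrite /local_rep/= cm_chartK.
have := @inverse_cder R n (local_rep F e tt) (local_rep (Psi : Cn_manifold R n -> X) tt e) (chart e (Psi w)) M Mu H.
rewrite E => H2.
have key (r : R) : 0 < r -> exists2 d : R, 0 < d & forall w', rnorm (w' - w) < d ->
    dom e (Psi w') /\ rnorm (chart e (Psi w') - chart e (Psi w)) < r.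
  move=> r0; have : nbhs (Psi w) [set y | dom e y /\ rnorm (chart e y - chart e (Psi w)) < r].
    by apply/(nbhs_chart _ ew); exists r.
  by move=> /Psi_continuous/nbhs_rnormP.
have H3 : cder (local_rep (Psi : Cn_manifold R n -> X) tt e) w (fun v => invmx M *m v).
  apply: H2 => //.
    have [d d0 dP] := key 1 ltr01; exists d => // w' /dP[w'D _].
    by rewrite /local_rep/= cm_chartK.
  by move=> r /key[d d0 dP]; exists d => // w' /dP[].
by have /cder_differentiable[] := H3.
Qed.

Lemma Phi_isometry : holo_isometry g (Cn_flat R n) F.
Proof.
split; last exact: Phi_pullback.
split; first exact: Phi_holomorphic.
exists (Psi : Cn_manifold R n -> X); split; [exact: PhiK|exact: PsiK|exact: Psi_holomorphic].
Qed.

End linearized.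
End contraction.

Lemma contraction_flat {R : realType} {n : nat} {X : complexManifold R n} (g : hermitianMetric X)
    (al : simG g) (x0 : X) : connected [set: X] -> fac al < 1 -> (forall x r, rc g x r) ->
  exists Phi : X -> Cn_manifold R n, holo_isometry g (Cn_flat R n) Phi.
Proof.
move=> cX l1 arc; have [p alp] := fixed_point cX l1 x0 arc.
have [c cp] := cm_cover p.
have [S [B lin]] := linearization_exists alp cp.
have [Phi PhiP] := choice (approx_cvg cX l1 alp cp lin).
have [Psi [PhiK PsiK]] := Phi_bijective cX l1 alp cp lin PhiP.
exists Phi; exact: (Phi_isometry cX l1 alp cp lin PhiP PhiK PsiK).
Qed.

(** * Similarities of C^n *)

Section flat_space.
Context {R : realType} {n : nat}.
Local Notation V := (Cn R n).
Local Notation CnM := (Cn_manifold R n).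

Definition adj (M : 'M[R[i]]_n) : 'M[R[i]]_n := map_mx Num.conj (M^T).

Lemma flat_adj (M : 'M[R[i]]_n) (v w : V) : flat_form (M *m v) w = flat_form v (adj M *m w).
Proof.
rewrite /flat_form; congr (complex.Re _).
under eq_bigr do rewrite !mxE mulr_suml.
rewrite exchange_big/=; apply: eq_bigr => k _.
rewrite !mxE rmorph_sum mulr_sumr; apply: eq_bigr => j _.
by rewrite !mxE rmorphM/= conjcK mulrCA mulrA.
Qed.

Lemma flat_nondeg (u : V) : (forall v, flat_form v u = 0) -> u = 0.
Proof. by move=> /(_ u)/flat_eq0. Qed.

Lemma unitarymx_flat (U : 'M[R[i]]_n) :
  U \is unitarymx <-> forall v w : V, flat_form (U *m v) (U *m w) = flat_form v w.
Proof.
split=> [/unitarymxP/mulmx1C UU v w|UU].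
  by rewrite flat_adj mulmxA -[adj U *m U]/(map_mx Num.conj (U^T) *m U) UU mul1mx.
apply/unitarymxP/mulmx1C/matrixP => i j.
have E (w : V) : adj U *m (U *m w) = w.
  apply/eqP; rewrite -subr_eq0; apply/eqP/flat_nondeg => v.
  rewrite (hfC (@flat_form_hermitian R n)) (hfDl (@flat_form_hermitian R n)) (hfNl (@flat_form_hermitian R n)).
  by rewrite !(hfC (@flat_form_hermitian R n) _ v) -flat_adj UU subrr.
have cE (A : 'M[R[i]]_n) : A *m col j 1%:M = col j A by rewrite !colE mul1mx.
have colij (A : 'M[R[i]]_n) : (col j A) i 0 = A i j by rewrite mxE.
have : (col j (adj U *m U)) i 0 = (col j (1%:M : 'M[R[i]]_n)) i 0 by rewrite -(cE (adj U *m U)) -mulmxA E.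
by move=> h; exact: (etrans (esym (colij _)) (etrans h (colij _))).
Qed.

Lemma cder_affine_map (M : 'M[R[i]]_n) (b z : V) : cder (fun y : V => M *m y + b) z (fun v => M *m v).
Proof.
split; first exact: mulmx_lin.
move=> e e0; exists 1 => // h _.
have -> : M *m (z + h) + b - (M *m z + b) - M *m h = 0.
  by rewrite mulmxDr; move: (M *m z) (M *m h) => u w; apply/colP => j; rewrite !mxE; ring.
by rewrite rnorm0 mulr_ge0 ?rnorm_ge0 ?ltW.
Qed.

(** Liouville's theorem: the differential is bounded on the whole of C^n, and its Lipschitz constant
    on a fixed ball tends to 0 as the radius of the larger ball grows. *)
Lemma flat_cder (f : V -> V) (s : R) : 0 < s -> holomorphic (f : CnM -> CnM) ->
  pullback_eq (f : CnM -> CnM) (Cn_flat R n) (fun=> s ^+ 2) (Cn_flat R n) ->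
  exists M b, forall z, f z = M *m z + b.
Proof.
move=> s0 hf /pullback_vD pf.
have dfz z : cder f z (vD f z) := @holomorphic_cder R n CnM CnM f tt tt z hf I I.
have fE z v w : flat_form (vD f z v) (vD f z w) = s ^+ 2 * flat_form v w := pf tt tt z I I v w.
have [m [M [m0 M0 mM]]] := @chart_norm_equiv R n CnM (Cn_flat R n) tt 0 I.
pose K := s * M / m; have K0 : 0 < K by rewrite !mulr_gt0// invr_gt0.
have bd z v : rnorm (vD f z v) <= K * rnorm v.
  have /andP[h1 _] := mM (vD f z v); have /andP[_ h2] := mM v.
  have E : hnorm (Cn_flat R n tt 0) (vD f z v) = s * hnorm (Cn_flat R n tt 0) v.
    rewrite /hnorm -[Cn_flat R n tt 0 (vD f z v) (vD f z v)]/(flat_form (vD f z v) (vD f z v)) fE sqrtrM ?sqr_ge0//.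
    by rewrite sqrtr_sqr gtr0_norm.
  by rewrite /K mulrAC ler_pdivlMr// mulrC (le_trans h1)// E -mulrA ler_wpM2l// ltW.
pose L := K *+ 2.
have hv r : vlhol (0 : V) r L f.
  apply: vlhol_of_bound => [z _|z v _]; last exact: bd.
  by have /cder_differentiable[] := dfz z.
have L0 : 0 < L by rewrite pmulrn_rgt0.
have Dcst z v : vD f z v = vD f 0 v.
  apply/colP => j; apply/eqP; rewrite -subr_eq0; apply/eqP/rnorm_eq0/eqP.
  rewrite eq_le rnorm_ge0 andbT; apply/ler_addgt0Pr => e e0; rewrite add0r.
  (* Chosen so that the bound [4 * L / (r - r') * rnorm v * rnorm z] is at most [e]. *)
  pose r' := rnorm z + 1; pose r := r' + 4 * L * rnorm v * rnorm z / e + 1.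
  have P0 : 0 <= 4 * L * rnorm v * rnorm z / e by rewrite divr_ge0 ?(ltW e0)// !mulr_ge0 ?rnorm_ge0 ?ltW.
  have rr : r' < r by rewrite /r -addrA ltrDl ltr_wpDl.
  have zr' : rball (0 : V) r' z by rewrite /rball/= subr0 ltrDl.
  have or' : rball (0 : V) r' 0 by rewrite /rball/= subr0 rnorm0 ltr_wpDl// rnorm_ge0.
  have E1 : vD f z v j 0 = cD (fun y => f y j 0 : R[i]^o) z v := vlhol_coord v j (hv r) (lt_trans zr' rr).
  have E2 : vD f 0 v j 0 = cD (fun y => f y j 0 : R[i]^o) 0 v := vlhol_coord v j (hv r) (lt_trans or' rr).
  have E3 : rnorm (vD f z v j 0 - vD f 0 v j 0) = rnorm (cD (fun y => f y j 0 : R[i]^o) z v -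
    cD (fun y => f y j 0 : R[i]^o) 0 v) := congr2 (fun s t => rnorm (s - t)) E1 E2.
  apply: (eq_ind_r (fun t => t <= e) _ E3).
  apply: (le_trans (lhol_Dlip v (hv r j) rr zr' or')); rewrite subr0 /dlip.
  have d0 : 0 < r - r' by rewrite subr_gt0.
  rewrite -mulrA mulrAC ler_pdivrMr// mulrA.
  have -> : e * (r - r') = 4 * L * rnorm v * rnorm z + e by rewrite /r; field; rewrite gt_eqF.
  by rewrite lerDl ltW.
have [l0 _] := dfz 0; have [A AE] := lin_matrix l0.
exists A, (f 0) => z.
(* [f] minus its linear part has differential 0, hence Lipschitz constant 0. *)
pose F (y : V) : V := f y - A *m y.
have dF y : cder F y (fun=> 0).
  split; first by move=> b u v; rewrite scaler0 addr0.
  move=> e e0; have [_ /(_ e e0)[d d0 dP]] := dfz y; exists d => // h /dP.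
  have -> : F (y + h) - F y - 0 = f (y + h) - f y - vD f y h; last by [].
  rewrite Dcst AE /F mulmxDr; move: (A *m y) (A *m h) (f _) (f _) => p q p' q'.
  by apply/colP => j; rewrite !mxE; ring.
have hF : vlhol (0 : V) (rnorm z + 1) (0 *+ 2) F.
  apply: vlhol_of_bound => [y _|y v _]; first by have /cder_differentiable[] := dF y.
  by rewrite (cder_vD (dF y)) rnorm0 mul0r.
have zr : rball (0 : V) (rnorm z + 1) z by rewrite /rball/= subr0 ltrDl.
have or : rball (0 : V) (rnorm z + 1) 0 by rewrite /rball/= subr0 rnorm0 ltr_wpDl// rnorm_ge0.
have := vlhol_lip _ hF zr or; rewrite mul0rn mul0r => /(_ (lexx _)) le0.
have /rnorm_eq0/eqP : rnorm (F z - F 0) = 0 by apply/eqP; rewrite eq_le rnorm_ge0 le0.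
rewrite subr_eq0 /F mulmx0 subr0 subr_eq addrC => /eqP ->.
by [].
Qed.

Lemma flat_similarity (f : V -> V) (s : R) : 0 < s -> holomorphic (f : CnM -> CnM) ->
  pullback_eq (f : CnM -> CnM) (Cn_flat R n) (fun=> s ^+ 2) (Cn_flat R n) ->
  exists U b, U \is unitarymx /\ forall z, f z = sdp_act (@linUR R n) (b, (U, s)) z.
Proof.
move=> s0 hf pf; have [M [b fE]] := flat_cder s0 hf pf.
have sC : s%:C != 0 :> R[i] by rewrite eq_complex/= negb_and gt_eqF.
exists (s%:C^-1 *: M), b; split=> [|z]; last first.
  by rewrite /sdp_act/= /linUR/= -scalemxAl scalerA mulfV// scale1r fE.
apply/unitarymx_flat => v w.
have /pullback_vD/(_ tt tt 0 I I v w) := pf.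
have -> : local_rep (f : CnM -> CnM) tt tt = fun z : V => M *m z + b by apply/funext => z; exact: fE.
rewrite (cder_vD (cder_affine_map M b _)) => E.
have sV : s%:C^-1 = (s^-1)%:C :> R[i] by rewrite -fmorphV.
rewrite -!scalemxAl sV (hfZl (@flat_form_hermitian R n)) (hfZr (@flat_form_hermitian R n)) mulrA.
have {}E : flat_form (M *m v) (M *m w) = s ^+ 2 * flat_form v w by exact: E.
by rewrite E; field; rewrite gt_eqF.
Qed.

Lemma sdp_act_similarity (U : 'M[R[i]]_n) (b : V) (s : R) : U \is unitarymx -> 0 < s ->
  holomorphic (sdp_act (@linUR R n) (b, (U, s)) : CnM -> CnM) /\
  pullback_eq (sdp_act (@linUR R n) (b, (U, s)) : CnM -> CnM) (Cn_flat R n) (fun=> s ^+ 2) (Cn_flat R n).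
Proof.
move=> /unitarymx_flat Uf s0.
have E : sdp_act (@linUR R n) (b, (U, s)) = fun z => (s%:C *: U) *m z + b.
  by apply/funext => z; rewrite /sdp_act/= /linUR/= scalemxAl.
have dA (z : V) := cder_differentiable (cder_affine_map (s%:C *: U) b z).
rewrite E; split.
  split=> [z|[] [] z _ _]; last by have [] := dA z.
  by have [/differentiable_continuous] := dA z.
apply/pullback_vD => -[] [] z _ _ v w.
pose A (z : V) : V := (s%:C *: U) *m z + b.
change (flat_form (vD A z v) (vD A z w) = s ^+ 2 * flat_form v w).
rewrite (cder_vD (cder_affine_map (s%:C *: U) b _)).
rewrite -!scalemxAl.
by rewrite (hfZl (@flat_form_hermitian R n)) (hfZr (@flat_form_hermitian R n)) Uf mulrA.
Qed.

Lemma sdp_actM (x y : V * ('M[R[i]]_n * R)) z :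
  sdp_act (@linUR R n) (CnUR_mul x y) z = sdp_act (@linUR R n) x (sdp_act (@linUR R n) y z).
Proof.
case: x y => [b [U s]] [b' [U' s']]; rewrite /sdp_act/= /linUR/=.
rewrite mulmxDr scalerDr -scalemxAr scalerA mulmxA rmorphM/= -addrA; congr (_ + _).
by rewrite addrC.
Qed.

Lemma sdp_actK (U : 'M[R[i]]_n) (b : V) (s : R) : U \is unitarymx -> 0 < s ->
  exists b', [/\ adj U \is unitarymx, cancel (sdp_act (@linUR R n) (b, (U, s))) (sdp_act (@linUR R n) (b', (adj U, s^-1)))
   & cancel (sdp_act (@linUR R n) (b', (adj U, s^-1))) (sdp_act (@linUR R n) (b, (U, s)))].
Proof.
move=> Uu s0; exists (- ((s^-1)%:C *: (adj U *m b))).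
have U1 : U *m adj U = 1%:M by exact/unitarymxP.
have U2 : adj U *m U = 1%:M by exact: mulmx1C.
have sC : (s^-1)%:C * s%:C = 1 :> R[i] by rewrite -rmorphM/= mulVf// gt_eqF.
have sC' : s%:C * (s^-1)%:C = 1 :> R[i] by rewrite mulrC.
split.
- by rewrite trmxC_unitary.
- move=> z; rewrite /sdp_act/= /linUR/= mulmxDr -scalemxAr mulmxA U2 mul1mx scalerDr scalerA sC scale1r.
  by rewrite addrK.
- move=> z; rewrite /sdp_act/= /linUR/= mulmxDr mulmxN -!scalemxAr !mulmxA U1 !mul1mx scalerDr scalerN !scalerA sC' !scale1r.
  by rewrite subrK.
Qed.

(** The value at 0 gives [b]. As [U] is unitary, the length of the image of one nonzero vector,
    which exists for [0 < n], gives [s]; then [U] is determined. *)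
Lemma sdp_act_inj (x y : V * ('M[R[i]]_n * R)) : (0 < n)%N -> CnUR x -> CnUR y ->
  sdp_act (@linUR R n) x = sdp_act (@linUR R n) y -> x = y.
Proof.
case: x y => [b [U s]] [b' [U' s']] n0 [/= Uu s0] [/= Uu' s0'] E.
have bE : b = b'.
  have := congr1 (fun f => f 0) E; rewrite /sdp_act/= /linUR/= !mulmx0 !scaler0 !add0r.
  by [].
have UE (z : V) : s%:C *: (U *m z) = s'%:C *: (U' *m z).
  by have := congr1 (fun f => f z) E; rewrite /sdp_act/= /linUR/= bE => /addIr.
have sE : s = s'.
  pose v : V := const_mx 1.
  have v0 : v != 0.
    apply/eqP => /(congr1 (fun m : V => m (Ordinal n0) 0)); rewrite !mxE => /eqP.
    by rewrite oner_eq0.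
  have [_ _ /(_ v v0) vp _] := @flat_form_hermitian R n.
  have := congr2 (@flat_form R n) (UE v) (UE v).
  rewrite !(hfZl (@flat_form_hermitian R n)) !(hfZr (@flat_form_hermitian R n)).
  have -> := (unitarymx_flat U).1 Uu v v; have -> := (unitarymx_flat U').1 Uu' v v.
  rewrite !mulrA -!expr2 => /(mulIf (negbT (gt_eqF vp)))/eqP.
  by rewrite eqrXn2 ?ltW// => /eqP.
have sC : s'%:C != 0 :> R[i] by rewrite eq_complex/= negb_and gt_eqF.
rewrite bE sE; congr (_, (_, _)); apply/matrixP => i j.
have := UE (col j 1%:M); rewrite sE => /(scalerI sC) /(congr1 (fun m : V => m i 0)).
by rewrite !colE !mulmxA !mulmx1 -!colE !mxE.
Qed.

End flat_space.

(** * The groups of a manifold isometric to C^n *)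

Section flat_case.
Context {R : realType} {n : nat} {X : complexManifold R n} (g : hermitianMetric X).
Local Notation V := (Cn R n).
Local Notation CnM := (Cn_manifold R n).
Context (Phi : X -> CnM) (Psi : CnM -> X).
Hypothesis iso_Phi : holo_isometry g (Cn_flat R n) Phi.
Hypothesis PhiK : cancel Phi Psi.
Hypothesis PsiK : cancel Psi Phi.

Lemma hol_Phi : holomorphic Phi.
Proof. by have [[]] := iso_Phi. Qed.

(** The given inverse coincides with the holomorphic one contained in [biholomorphic]. *)
Lemma hol_Psi : holomorphic Psi.
Proof.
have [[_ [f' [fK f'K hf']]] _] := iso_Phi.
rewrite (_ : Psi = f') //; apply/funext => w.
by rewrite -[LHS]fK PsiK.
Qed.

Lemma pull_Psi : pullback_eq Psi g (fun=> 1) (Cn_flat R n).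
Proof.
have [_ pP] := iso_Phi.
have := pullback_inv hol_Phi hol_Psi PsiK (fun=> ltr01) pP.
by under [X in pullback_eq _ _ X _]funext do rewrite invr1.
Qed.

Lemma conj_hol (A : V -> V) : holomorphic (A : CnM -> CnM) -> holomorphic (Psi \o A \o Phi).
Proof. by move=> hA; exact: holomorphic_comp hol_Phi (holomorphic_comp hA hol_Psi). Qed.

Lemma conj_pullback (A : V -> V) s : holomorphic (A : CnM -> CnM) ->
  pullback_eq (A : CnM -> CnM) (Cn_flat R n) (fun=> s) (Cn_flat R n) ->
  pullback_eq (Psi \o A \o Phi) g (fun=> s) g.
Proof.
move=> hA pA; have [_ pP] := iso_Phi.
have H1 := pullback_comp hA hol_Psi pA pull_Psi.
have := pullback_comp hol_Phi (holomorphic_comp hA hol_Psi) pP H1.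
by congr (pullback_eq _ _ _ _); apply/funext => x; rewrite mul1r mulr1.
Qed.

Lemma sdp_similarity (b : V) (U : 'M[R[i]]_n) (s : R) : U \is unitarymx -> 0 < s ->
  biholomorphic (Psi \o sdp_act (@linUR R n) (b, (U, s)) \o Phi) /\
  pullback_eq (Psi \o sdp_act (@linUR R n) (b, (U, s)) \o Phi) g (fun=> s ^+ 2) g.
Proof.
move=> Uu s0; have [hA pA] := sdp_act_similarity b Uu s0.
split; last exact: conj_pullback.
split; first exact: conj_hol.
have [b' [Uu' AK A'K]] := sdp_actK b Uu s0.
have [hA' _] : _ /\ _ := sdp_act_similarity b' Uu' (etrans (invr_gt0 s) s0).
exists (Psi \o sdp_act (@linUR R n) (b', (adj U, s^-1)) \o Phi); split; last exact: conj_hol.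
  by move=> x; rewrite /= PsiK AK.
by move=> x; rewrite /= PsiK A'K.
Qed.

Lemma similarity_sdp (f : X -> X) (s : R) : 0 < s -> holomorphic f ->
  pullback_eq f g (fun=> s ^+ 2) g ->
  exists U b, U \is unitarymx /\ Psi \o sdp_act (@linUR R n) (b, (U, s)) \o Phi = f.
Proof.
move=> s0 hf pf; have [_ pP] := iso_Phi.
have hfP := holomorphic_comp hf hol_Phi.
have hB : holomorphic (Phi \o f \o Psi) := holomorphic_comp hol_Psi hfP.
have := pullback_comp hol_Psi hfP pull_Psi (pullback_comp hf hol_Phi pf pP).
have -> : (fun x : CnM => 1 * s ^+ 2 * 1) = fun=> s ^+ 2 by apply/funext => x; rewrite mul1r mulr1.
move=> /(flat_similarity s0 hB)[U [b [Uu E]]]; exists U, b; split=> //.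
by apply/funext => x; rewrite /= -E /= !PhiK.
Qed.

Lemma group_iso_conf : (1 < n)%N -> connected [set: X] -> kaehler g ->
  group_iso (@CnUR R n) (@CnUR_mul R n) (Conf g) (fun s => Psi \o sdp_act (@linUR R n) s \o Phi).
Proof.
move=> n1 cX kg; split; last first.
  by move=> s t _ _; apply/funext => x; rewrite /= PsiK sdp_actM.
split.
- move=> [b [U s]] [/= Uu s0]; have [h1 h2] := sdp_similarity b Uu s0; split=> //.
  exists (fun=> s ^+ 2); split=> // [|x]; first exact: smooth_fun_cst.
  by rewrite exprn_gt0.
- move=> s t; rewrite !inE => Gs Gt E; apply: (sdp_act_inj (ltnW n1) Gs Gt).
  apply/funext => z; have := congr1 (fun f => Phi (f (Psi z))) E.
  by rewrite /= !PsiK.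
- move=> f /(conf_sim n1 kg cX)[a <-].
  have [U [b [Uu E]]] := similarity_sdp (fac_gt0 a) (@fwd_hol _ _ _ _ a) (@fwd_pullback _ _ _ _ a).
  by exists (b, (U, fac a)) => //; split=> //; exact: fac_gt0.
Qed.

Lemma linU_linUR (s : V * 'M[R[i]]_n) : sdp_act (@linU R n) s = sdp_act (@linUR R n) (s.1, (s.2, 1)).
Proof. by apply/funext => z; rewrite /sdp_act/= /linUR/= scale1r. Qed.

Lemma group_iso_iso : (0 < n)%N ->
  group_iso (@CnU R n) (@CnU_mul R n) (Iso g) (fun s => Psi \o sdp_act (@linU R n) s \o Phi).
Proof.
move=> n0; split; last first.
  move=> s t _ _; rewrite !linU_linUR; apply/funext => x /=; rewrite PsiK -sdp_actM.
  by rewrite /CnUR_mul/sdp_mul/= mulr1 /linUR/= scale1r.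
split.
- move=> [b U] /= Uu; have [h1] := sdp_similarity b Uu ltr01.
  by rewrite expr1n linU_linUR => h2; split.
- move=> [b U] [b' U'] /set_mem Uu /set_mem Uu' E.
  have : sdp_act (@linUR R n) (b, (U, 1)) = sdp_act (@linUR R n) (b', (U', 1)).
    rewrite !linU_linUR in E; apply/funext => z; have := congr1 (fun f => Phi (f (Psi z))) E.
    by rewrite /= !PsiK.
  have k1 : CnUR (b, (U, 1 : R)) by split; [exact: Uu|exact: ltr01].
  have k2 : CnUR (b', (U', 1 : R)) by split; [exact: Uu'|exact: ltr01].
  by move=> h; have [-> ->] := sdp_act_inj n0 k1 k2 h.
- move=> f [[hf _] pf]; have pf' : pullback_eq f g (fun=> 1 ^+ 2) g by rewrite expr1n.
  have [U [b [Uu E]]] := similarity_sdp ltr01 hf pf'.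
  by exists (b, U) => //; rewrite linU_linUR.
Qed.

End flat_case.

Theorem theorem3 (R : realType) (n : nat) (hn : (4 <= 2 * n)%N)
    (X : complexManifold R n) (g : hermitianMetric X)
    (Xconnected : connected [set: X]) (gkaehler : kaehler g) :
  (exists h : hermitianMetric X, conformal_to h g /\ Conf g = Iso h)
  \/
  ((exists Phi : X -> Cn_manifold R n, holo_isometry g (Cn_flat R n) Phi) /\
   forall (Phi : X -> Cn_manifold R n) (Psi : Cn_manifold R n -> X),
     holo_isometry g (Cn_flat R n) Phi -> cancel Phi Psi -> cancel Psi Phi ->
     group_iso (@CnU R n) (@CnU_mul R n) (Iso g)
       (fun s => Psi \o sdp_act (@linU R n) s \o Phi) /\
     group_iso (@CnUR R n) (@CnUR_mul R n) (Conf g)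
       (fun s => Psi \o sdp_act (@linUR R n) s \o Phi)).
Proof.
have n1 : (1 < n)%N by rewrite -(leq_pmul2l (isT : (0 < 2)%N)).
have [CI|CI] := pselect (Conf g `<=` Iso g).
  left; exists g; split; last by apply/seteqP; split; [exact: CI|exact: iso_conf].
  exists (fun=> 1); split=> //; first exact: smooth_fun_cst.
  by move=> c x cx v w; rewrite mul1r.
(* A conformal map that is not an isometry has a factor different from 1; it or its inverse is a
   contraction. A point [x0] comes with it, since on the empty manifold every conformal map is an
   isometry. *)
have [al [x0 al1]] : exists (al : simG g) (x0 : X), fac al < 1.
  apply: contrapT => nal; apply: CI => f cf; have [a af] := conf_sim n1 gkaehler Xconnected cf.
  have fa1 (x : X) : fac a = 1.
    apply/eqP; rewrite eq_le; apply/andP; split; rewrite leNgt; apply/negP => a1; apply: nal.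
      by exists (sim_inv a), x; rewrite /fac/= invf_lt1// fac_gt0.
    by exists a, x.
  split; first by case: cf.
  move=> c d x cx dx v w; rewrite -af in dx *; rewrite mul1r.
  have := @fwd_pullback _ _ _ _ a c d x cx dx v w.
  by rewrite (fa1 x) expr1n mul1r.
have [arc|/existsNP[x /existsNP[r nrc]]] := pselect (forall x r, rc g x r).
  right; split; first exact: contraction_flat x0 Xconnected al1 arc.
  by move=> Phi Psi iP PK KP; split; [apply: group_iso_iso => //; exact: ltnW|exact: group_iso_conf].
by left; have [h [h1 h2]] := bounded_radius_case n1 gkaehler Xconnected nrc; exists h.
Qed.
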